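(* Let $n\ge 2$. There is a constant $c=c(n)>0$, depending only on $n$ (in particular independent of $\Omega$, $R$, $\rho$), such that the following holds. Let $\Omega\subset\mathbb R^n$ be a domain of diameter $R$ that is star-shaped with respect to a ball $B_\rho$ of radius $\rho$. Then there exist positive constants $C^A$ and $C^B$ with $$ C^A \le c\,\frac{R}{\rho^2}\left[1+\left(\frac{|\Omega|}{|B_\rho|}\right)^{\frac{n-2}{2(n-1)}}\left(\log\frac{|\Omega|}{|B_\rho|}\right)^{\frac{n}{2(n-1)}}\right], \qquad C^B\le c\,\frac{R}{\rho}, $$ such that for every $f\in H^1_0(\Omega)\cap L^2_0(\Omega)$ there exists $\mathbf u\in[H^2_0(\Omega)]^n$ satisfying $$ \nabla\cdot\mathbf u=f,\qquad |\mathbf u|_{2,\Omega}\le C^A\,\|f\|_{0,\Omega}+C^B\,|f|_{1,\Omega}. $$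
   Context: $\Omega$ is star-shaped with respect to the ball $B_\rho$ if for every $x\in\Omega$ and $y\in B_\rho$ the segment joining $x$ and $y$ lies in $\Omega$ (so $B_\rho\subset\Omega$). $|\Omega|$, $|B_\rho|$ denote Lebesgue measures. $\|\cdot\|_{0,\Omega}$ is the $L^2(\Omega)$ norm; $|\cdot|_{s,\Omega}$ is the Sobolev $H^s(\Omega)$ seminorm, i.e. the $L^2(\Omega)$ norm of all derivatives of order $s$ (also for vector fields). $H^s_0(\Omega)$ is the closure of $\mathcal C_0^\infty(\Omega)$ (smooth functions with compact support in $\Omega$) in the $H^s(\Omega)$ norm. $L^2_0(\Omega)$ is the space of functions in $L^2(\Omega)$ with zero average over $\Omega$. *)

(* Defs.v *)
From HB Require Import structures.
From mathcomp Require Import all_boot all_order all_algebra.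
From mathcomp Require Import all_classical all_reals all_analysis.
Import Order.TTheory GRing.Theory Num.Theory.
Import numFieldNormedType.Exports.

Set Implicit Arguments.
Unset Strict Implicit.
Unset Printing Implicit Defensive.

Local Open Scope classical_set_scope.
Local Open Scope ring_scope.

(* The sigma-algebra on R^n generated by the coordinate projections, i.e. the
   Borel sigma-algebra. *)
Section measurable_rV.
Variables (R : realType) (n : nat).

Let coors : 'I_n -> 'rV[R]_n -> measurableTypeR R := fun i x => x ord0 i.

Let rV_set0 : g_sigma_preimage coors set0.
Proof. exact: sigma_algebra0. Qed.

Let rV_setC A : g_sigma_preimage coors A -> g_sigma_preimage coors (~` A).
Proof. exact: sigma_algebraC. Qed.

Let rV_bigcup (F : (set 'rV[R]_n)^nat) :
  (forall i, g_sigma_preimage coors (F i)) ->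
  g_sigma_preimage coors (\bigcup_i (F i)).
Proof. exact: sigma_algebra_bigcup. Qed.

HB.instance Definition _ := @isMeasurable.Build default_measure_display
  'rV[R]_n (g_sigma_preimage coors) rV_set0 rV_setC rV_bigcup.

End measurable_rV.

Section measurable_rV_lemmas.
Variable R : realType.

Lemma measurable_coord n (i : 'I_n) :
  measurable_fun [set: 'rV[R]_n] (fun x => x ord0 i : measurableTypeR R).
Proof.
move=> _ Y mY; rewrite setTI; apply: sub_sigma_algebra => /=.
rewrite -bigcup_seq/=; exists i => /=; first by rewrite mem_index_enum.
by exists Y => //; rewrite setTI.
Qed.

Lemma measurable_fun_coordP d (T : measurableType d) n (f : T -> 'rV[R]_n) :
  (forall i, measurable_fun [set: T]
     (fun t => f t ord0 i : measurableTypeR R)) ->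
  measurable_fun [set: T] f.
Proof.
move=> mf _ A mA; rewrite setTI.
have : preimage_set_system setT f measurable `<=` (@measurable _ T).
  rewrite /measurable/= -g_sigma_preimage_comp.
  apply: smallest_sub; first exact: sigma_algebra_measurable.
  rewrite -bigcup_seq; apply: bigcup_sub => i _ B [C mC <-].
  exact: mf.
by apply; exists A => //; rewrite setTI.
Qed.

Definition consV n (p : measurableTypeR R * 'rV[R]_n) : 'rV[R]_n.+1 :=
  row_mx (const_mx p.1 : 'rV[R]_1) p.2.

Definition unconsV n (x : 'rV[R]_n.+1) : measurableTypeR R * 'rV[R]_n :=
  (x ord0 ord0, \row_j x ord0 (lift ord0 j)).

Lemma consVK n : cancel (@consV n) (@unconsV n).
Proof.
case=> a x; rewrite /consV /unconsV/=; congr pair.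
  rewrite (_ : ord0 = lshift n (ord0 : 'I_1)); last exact/val_inj.
  by rewrite (@row_mxEl _ 1 1 n) mxE.
apply/rowP => j; rewrite mxE.
rewrite (_ : lift ord0 j = rshift 1 j); last exact/val_inj.
by rewrite (@row_mxEr _ 1 1 n).
Qed.

Lemma measurable_consV n : measurable_fun setT (@consV n).
Proof.
apply: measurable_fun_coordP => i.
have [j ->|j ->] := split_ordP (i : 'I_(1 + n)).
  rewrite (_ : (fun _ => _) = fst); first exact: measurable_fst.
  by apply/funext => p; rewrite /consV (@row_mxEl _ 1 1 n) mxE.
rewrite (_ : (fun _ => _) = (fun x : 'rV[R]_n => x ord0 j) \o snd).
  apply: (measurableT_comp (measurable_coord j)); exact: measurable_snd.
by apply/funext => p; rewrite /consV (@row_mxEr _ 1 1 n).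
Qed.

Lemma measurable_unconsV n : measurable_fun setT (@unconsV n).
Proof.
apply/measurable_fun_pair; first exact: measurable_coord.
apply: measurable_fun_coordP => i.
by under eq_fun do rewrite mxE; exact: measurable_coord.
Qed.

End measurable_rV_lemmas.

Section lebesgue_cons.
Variables (R : realType) (n : nat).
Variable mu : {sigma_finite_measure set 'rV[R]_n -> \bar R}.

Definition lebesgue_cons : set 'rV[R]_n.+1 -> \bar R :=
  pushforward (lebesgue_measure \x mu)%E (@consV R n).

Let lebesgue_cons0 : lebesgue_cons set0 = 0%E.
Proof. by rewrite /lebesgue_cons /pushforward preimage_set0 measure0. Qed.

Let lebesgue_cons_ge0 A : (0 <= lebesgue_cons A)%E.
Proof. exact: (measure_ge0 (lebesgue_measure \x mu)%E). Qed.

Let lebesgue_cons_sigma_additive : semi_sigma_additive lebesgue_cons.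
Proof.
move=> F mF tF mUF.
have mcons A : measurable A -> measurable (@consV R n @^-1` A).
  by move=> mA; rewrite -[X in measurable X]setTI; exact: measurable_consV.
rewrite /lebesgue_cons /pushforward preimage_bigcup.
apply: measure_semi_sigma_additive.
- by move=> k; exact: mcons.
- apply/trivIsetP => /= i j _ _ ij; rewrite -preimage_setI.
  by move/trivIsetP : tF => /(_ _ _ _ _ ij) ->//; rewrite preimage_set0.
- by rewrite -preimage_bigcup; exact: mcons.
Qed.

HB.instance Definition _ := isMeasure.Build _ _ _ lebesgue_cons
  lebesgue_cons0 lebesgue_cons_ge0 lebesgue_cons_sigma_additive.

Let lebesgue_cons_sigma_finite : sigma_finite setT lebesgue_cons.
Proof.
have /sigma_finiteP[F [TF ndF Foo]] := sigma_finiteT (@lebesgue_measure R).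
have /sigma_finiteP[G [TG ndG Goo]] := sigma_finiteT mu.
exists (fun k => @unconsV R n @^-1` (F k `*` G k)).
  rewrite -preimage_bigcup -[LHS](preimage_setT (@unconsV R n)).
  congr (_ @^-1` _); rewrite -setXTT TF TG predeqE => -[x y]; split.
    move=> [/= [k _ Fkx] [l _ Gly]]; exists (maxn k l) => //; split.
    - by move: x Fkx; exact/subsetPset/ndF/leq_maxl.
    - by move: y Gly; exact/subsetPset/ndG/leq_maxr.
  by move=> [k _ []/= ? ?]; split; exists k.
move=> k; have [mF Fk] := Foo k; have [mG Gk] := Goo k; split.
  rewrite -[X in measurable X]setTI; apply: measurable_unconsV => //.
  exact: measurableX.
rewrite /lebesgue_cons /pushforward -comp_preimage.
rewrite (_ : _ \o _ = id); last by apply/funext => p /=; rewrite consVK.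
by rewrite product_measure1E// lte_mul_pinfty// ge0_fin_numE.
Qed.

HB.instance Definition _ := Measure_isSigmaFinite.Build _ _ _ lebesgue_cons
  lebesgue_cons_sigma_finite.

End lebesgue_cons.

(* Lebesgue measure on R^n, the n-fold product of that of R. *)
Fixpoint lebesgueV (R : realType) (n : nat) :
    {sigma_finite_measure set 'rV[R]_n -> \bar R} :=
  match n with
  | 0 => \d_ (0 : 'rV[R]_0)
  | n'.+1 => lebesgue_cons (lebesgueV R n')
  end.

Section euclidean_geometry.
Variables (R : realType) (n : nat).
Implicit Types (A Omega B : set 'rV[R]_n) (x y a : 'rV[R]_n).

(* The library norm on 'rV[R]_n is the sup norm; it induces the usual topology,
   but metric quantities (balls, diameters) have to use the Euclidean norm. *)
Definition enorm x : R := Num.sqrt (\sum_(i < n) x ord0 i ^+ 2).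

Definition eball a (r : R) : set 'rV[R]_n := [set x | enorm (x - a) < r].

Definition ediam A : \bar R :=
  ereal_sup [set (enorm (x - y))%:E | x in A & y in A].

Definition vol A : R := fine (lebesgueV R n A).

Definition domain Omega : Prop := [/\ open Omega, connected Omega & Omega !=set0].

Definition star_shaped Omega B : Prop :=
  forall x y, Omega x -> B y ->
  forall t : R, 0 <= t <= 1 -> Omega ((1 - t) *: x + t *: y).

End euclidean_geometry.

(* Elements of L^2(Omega) and of the Sobolev spaces are represented by functions
   on the whole of R^n of which only the values in Omega matter. *)
Section sobolev.
Variables (R : realType) (n : nat).
Local Notation V := 'rV[R]_n.
Local Notation mu := (lebesgueV R n).
Implicit Types (Omega : set V) (f g phi : V -> R) (u : V -> V).

Definition partial (i : 'I_n) f : V -> R := 'D_(delta_mx ord0 i) f.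

Definition smooth f : Prop :=
  forall s : seq 'I_n, let g := foldr partial f s in
  continuous g /\ forall i x, derivable g x (delta_mx ord0 i).

Definition test_function Omega phi : Prop :=
  let supp := closure [set x | phi x != 0] in
  [/\ smooth phi, compact supp & supp `<=` Omega].

Definition mdeg (alpha : 'I_n -> nat) : nat := (\sum_(i < n) alpha i)%N.

Definition mpartial (alpha : 'I_n -> nat) f : V -> R :=
  foldr (fun i g => iter (alpha i) (partial i) g) f (enum 'I_n).

Definition in_L2 Omega f : Prop := (f \_ Omega) \in Lfun mu 2%:E.

Definition L2norm Omega f : R := fine ('N[mu]_2%:E [EFin \o (f \_ Omega)])%E.

Definition in_L20 Omega f : Prop :=
  in_L2 Omega f /\ \int[mu]_(x in Omega) f x = 0.

(* g is an L^2 weak partial derivative of order alpha of f in Omega *)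
Definition is_wpartial Omega (alpha : 'I_n -> nat) f g : Prop :=
  in_L2 Omega g /\
  forall phi, test_function Omega phi ->
    \int[mu]_(x in Omega) (f x * mpartial alpha phi x) =
    (-1) ^+ mdeg alpha * \int[mu]_(x in Omega) (g x * phi x).

(* Chosen representative; weak derivatives are unique up to null sets. *)
Definition wpartial Omega (alpha : 'I_n -> nat) f : V -> R :=
  xget (cst 0) [set g | is_wpartial Omega alpha f g].

Definition in_H (s : nat) Omega f : Prop :=
  in_L2 Omega f /\
  forall alpha, (mdeg alpha <= s)%N -> exists g, is_wpartial Omega alpha f g.

(* A multi-index of order s has entries at most s, whence the index type. *)
Definition Hseminorm (s : nat) Omega f : R :=
  Num.sqrt (\sum_(alpha : {ffun 'I_n -> 'I_s.+1} |
                   mdeg (fun i => alpha i) == s)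
              L2norm Omega (wpartial Omega (fun i => alpha i) f) ^+ 2).

Definition Hnorm (s : nat) Omega f : R :=
  Num.sqrt (\sum_(k < s.+1) Hseminorm k Omega f ^+ 2).

Definition in_H0 (s : nat) Omega f : Prop :=
  in_H s Omega f /\
  forall e : R, 0 < e ->
    exists2 phi, test_function Omega phi & Hnorm s Omega (f \- phi) < e.

Definition component u (i : 'I_n) : V -> R := fun x => u x ord0 i.

Definition in_H0V (s : nat) Omega u : Prop :=
  forall i, in_H0 s Omega (component u i).

Definition HseminormV (s : nat) Omega u : R :=
  Num.sqrt (\sum_(i < n) Hseminorm s Omega (component u i) ^+ 2).

Definition wdiv Omega u : V -> R := fun x =>
  \sum_(i < n) wpartial Omega (fun j => nat_of_bool (j == i)) (component u i) x.

End sobolev.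

(* Main.v *)
(* Let w be a smooth kernel of integral 1 supported in the ball, which we centre at the origin.
   With E_m[a,b](x) = \int_0^1 (1+t)^m \int a(z) b((1+t)x - tz) dz dt, Bogovskii's solution of
   div u = f reads
     u_i = E_(n-2)[x_i w, f] - E_(n-2)[w, x_i f] + E_(n-2)[f, x_i w] - E_(n-2)[x_i f, w],
   and d_j E_m[a,b] = E_(m+1)[a, d_j b]. In the divergence the integrand in t is an exact derivative,
   whence div u = f - w \int f; and u lives in the convex hull of the ball and the support of f.

   In the second derivatives of u both derivatives may fall on w in the last two terms. Young's
   inequality bounds the contribution of t ~ 2^-l by the smaller of t^(-n/2) times an L^1 norm of the
   kernel and |Omega|^(1/2) times its L^2 norm; balancing the two at 2^(l(n-1)) ~ |Omega|/|B_rho| gives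
   the power and the logarithm. The first two terms take one derivative on f and the other one produces
   a singular integral E_n[a, d_k g] with a a dilate of a convolution of two bumps; it is bounded on L^2
   without Fourier analysis, by telescoping over dyadic scales and a square function estimate which
   follows from almost orthogonality (T T^* ).

   For f in H^1_0 of mean zero, approximate by test functions, restore the mean with a multiple of w, and
   solve. The second derivatives of the solutions are Cauchy, hence so are the lower ones by Poincare's
   inequality, and completeness of L^2 gives u. *)
Require Import Defs.
From mathcomp Require Import all_boot all_order all_algebra.
From mathcomp Require Import all_classical all_reals all_analysis.
From mathcomp Require Import measurable_realfun.
From mathcomp Require Import ring lra.
Import Order.TTheory GRing.Theory Num.Theory.
Import numFieldNormedType.Exports.

Set Implicit Arguments.
Unset Strict Implicit.
Unset Printing Implicit Defensive.

Local Open Scope classical_set_scope.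
Local Open Scope ring_scope.

(** * Lebesgue measure on row vectors *)

(** Bogovskii's integral runs over segments joining a point [y] of the support of [f] to a point [z]
    of the ball, and is singular at [y]. Each segment is cut at its midpoint and each half is
    parametrised from its own end: [x = (y + t *: z) / (1 + t)], or the same with [y] and [z]
    exchanged, for [t] in ]0, 1]. Both halves become instances of one operator [E], critical at
    [t = 0], where [x] reaches the support of the second argument. Near [f] this gives a singular
    integral; near the ball the second argument is smooth and small [t] costs only a function of the
    volume ratio. The kernel is the dilate by [rho] of a profile depending on [n] alone, and
    dilating the first argument of a convolution [cv t] replaces [t] by [rho * t]; so the constants
    are those of the profile. It is a convolution of two bumps because telescoping needs two
    factors: one is differenced, the other carries a derivative. [wpartial] is an arbitrary choice
    among weak derivatives, so each norm in the conclusion must be shown independent of that choice;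
    this is the purpose of the separation by test functions. *)

Section rV_borel.
Variables (R : realType) (n : nat).
Implicit Types (x y c : 'rV[R]_n) (A : set 'rV[R]_n).

Lemma rV_coord_le x i : `|x ord0 i| <= `|x|.
Proof.
rewrite [leRHS]/Num.norm /= mx_normrE; apply: (le_bigmax _ (fun ij => `|x ij.1 ij.2|) (ord0, i)).
Qed.

Lemma rV_norm_le x (r : R) : 0 <= r -> (forall i, `|x ord0 i| <= r) -> `|x| <= r.
Proof.
move=> r0 xr; rewrite [leLHS]/Num.norm /= mx_normrE; apply/bigmax_leP; split => // -[i j] _ /=.
by rewrite (ord1 i).
Qed.

Lemma rV_norm_lt x (r : R) : 0 < r -> (forall i, `|x ord0 i| < r) -> `|x| < r.
Proof.
move=> r0 xr; rewrite [ltLHS]/Num.norm /= mx_normrE; apply/bigmax_ltP; split => // -[i j] _ /=.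
by rewrite (ord1 i).
Qed.

Definition cube c (r : R) : set 'rV[R]_n := [set x | forall i, `|x ord0 i - c ord0 i| < r].

Lemma measurable_cube c r : measurable (cube c r).
Proof.
rewrite (_ : cube c r = \bigcap_(i in [set: 'I_n]) [set x | `|x ord0 i - c ord0 i| < r]); last first.
  by apply/seteqP; split => x /= xc; [move=> i _; exact: xc|move=> i; exact: xc].
apply: fin_bigcap_measurable => // i _.
suff -> : (fun x : 'rV[R]_n => [set x | `|x ord0 i - c ord0 i| < r] x) =
    (fun x => x ord0 i : measurableTypeR R) @^-1` (ball (c ord0 i) r).
  rewrite -[X in measurable X]setTI; apply: measurable_coord => //; exact: measurable_ball.
by apply/seteqP; split => x /=; rewrite /ball/= distrC.
Qed.

Lemma nbhs_cube x A : nbhs x A -> exists2 r : R, 0 < r & cube x r `<=` A.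
Proof.
move=> /nbhs_ballP[r /= r0 rA]; exists r => // y xy; apply: rA.
rewrite -ball_normE /=; apply: rV_norm_lt => // i; rewrite !mxE distrC; exact: xy.
Qed.

Lemma rat_cube x (r : R) : 0 < r ->
  exists (c : 'rV[rat]_n) (k : nat), cube (map_mx ratr c) k.+1%:R^-1 x /\
    cube (map_mx ratr c) k.+1%:R^-1 `<=` cube x r.
Proof.
move=> r0; have [k kr] : exists k : nat, k.+1%:R^-1 < r / 2.
  have [k] := ltr_add_invr (divr_gt0 r0 (ltr0n _ 2)); rewrite add0r => kr.
  by exists k.
have k0 : (0 : R) < k.+1%:R^-1 by rewrite invr_gt0.
set e := k.+1%:R^-1 in kr k0.
have /choice[c cE] : forall i, exists q : rat, `|x ord0 i - ratr q| < e.
  move=> i; have : x ord0 i - e < x ord0 i + e by lra.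
  by move=> /rat_in_itvoo[q]; rewrite in_itv/= => /andP[q1 q2]; exists q; rewrite ltr_norml; lra.
exists (\row_i c i), k; split => [i|y yc i]; rewrite ?mxE //.
have := cE i; have := yc i; rewrite !mxE -/e => h1 h2.
have -> : y ord0 i - x ord0 i = (y ord0 i - ratr (c i)) - (x ord0 i - ratr (c i)) by ring.
by apply: (le_lt_trans (ler_normB _ _)); move: h1 h2; lra.
Qed.

(** Centres are rational and radii are of the form [1 / (k + 1)], so the union is countable: hence
    open sets belong to the sigma-algebra of the coordinates. The same cubes are enumerated again to
    build cutoffs of an arbitrary open set. *)
Lemma open_bigcup_cube A : open A ->
  A = \bigcup_(k in [set k : 'rV[rat]_n * nat | cube (map_mx ratr k.1) k.2.+1%:R^-1 `<=` A])
        cube (map_mx ratr k.1) k.2.+1%:R^-1.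
Proof.
move=> oA; apply/seteqP; split => [x Ax|x [k kA]]; last exact: kA.
have [r r0 rA] := nbhs_cube (open_nbhs_nbhs (conj oA Ax)).
have [c [k [cx ckr]]] := rat_cube x r0.
by exists (c, k) => //= y yc; exact/rA/ckr.
Qed.

Lemma measurable_rV_open A : open A -> measurable A.
Proof.
move=> oA; rewrite (open_bigcup_cube oA).
rewrite bigcup_mkcond; apply: countable_bigcupT_measurable => [|k]; first exact: countableP.
by case: ifP => _; [exact: measurable_cube|exact: measurable0].
Qed.

Lemma measurable_rV_continuous (f : 'rV[R]_n -> R) : continuous f ->
  measurable_fun setT (f : 'rV[R]_n -> measurableTypeR R).
Proof.
move=> /continuousP cf.
apply: (measurability _ (RGenOpens.measurableE R)).
move=> _ [_ [a [b ->] <-]]; rewrite setTI; apply: measurable_rV_open; apply: cf.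
exact: interval_open.
Qed.

End rV_borel.

Section affine1.
Variable R : realType.
Local Notation lam := (@lebesgue_measure R).
Variables (c b : R).
Hypothesis c0 : c != 0.
Let phi : measurableTypeR R -> measurableTypeR R := fun x => c * x + b.

Let mphi : measurable_fun setT phi.
Proof.
apply: continuous_measurable_fun => x.
by apply: cvgD; [apply: cvgM; [exact: cvg_cst|exact: cvg_id]|exact: cvg_cst].
Qed.

Let pfm := measure_function_pushforward__canonical__measure_function_Measure lam mphi.

Let phi_itv (X : set R) : ocitv X -> lam X = mscale (NngNum (normr_ge0 c)) pfm X.
Proof.
move=> [[x y]] /= xy <-; rewrite /mscale /pushforward/=.
have [cp|cn|/eqP] := ltgtP 0 c; last by rewrite eq_sym (negbTE c0).
  rewrite (_ : pushforward lam phi _ = lam `](x - b) / c, (y - b) / c]%classic); last first.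
    congr (lam _).
    apply/seteqP; split => z /=; rewrite /phi !in_itv/= ltr_pdivrMr// ler_pdivlMr//; lra.
  rewrite !lebesgue_measure_itv /= !lte_fin ltr_pM2r ?invr_gt0// ltrD2r gtr0_norm//.
  case: ifPn => _; last by rewrite mule0.
  by rewrite -EFinB -EFinD; congr EFin; field.
rewrite (_ : pushforward lam phi _ = lam `[(y - b) / c, (x - b) / c[%classic); last first.
  congr (lam _).
  apply/seteqP; split => z /=; rewrite /phi !in_itv/= ltr_ndivlMr// ler_ndivrMr//; lra.
rewrite !lebesgue_measure_itv /= !lte_fin ltr_nM2r ?invr_lt0// ltrD2r ltr0_norm//.
case: ifPn => _; last by rewrite mule0.
by rewrite -EFinB -EFinD; congr EFin; field.
Qed.

(** [|c|] times the image of Lebesgue measure under [phi] agrees with Lebesgue measure on half-open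
    intervals, hence everywhere. For negative [c] the preimage is closed on the other side, which
    does not change its length. *)
Lemma ge0_integral_affine1 (f : measurableTypeR R -> \bar R) :
  measurable_fun setT f -> (forall x, (0 <= f x)%E) ->
  (\int[lam]_x f x = `|c|%:E * \int[lam]_x f (c * x + b)%R)%E.
Proof.
move=> mf f0.
rewrite (@eq_measure_integral _ _ _ _ (mscale (NngNum (normr_ge0 c)) pfm)); last first.
  by move=> A mA _; apply: lebesgue_measure_unique => // X; exact: phi_itv.
rewrite ge0_integral_mscale//; congr (_ * _)%E.
by rewrite (ge0_integral_pushforward mphi).
Qed.
End affine1.

Section integral_cons.
Variables (R : realType) (n : nat).
Local Notation lam := (@lebesgue_measure R).

Lemma ge0_integral_lebesgueVS (f : 'rV[R]_n.+1 -> \bar R) :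
  measurable_fun setT f -> (forall x, (0 <= f x)%E) ->
  (\int[lebesgueV R n.+1]_x f x = \int[lam]_t \int[lebesgueV R n]_x f (consV (t, x)))%E.
Proof.
move=> mf f0.
pose pfm := measure_function_pushforward__canonical__measure_function_Measure
  (lam \x lebesgueV R n)%E (@measurable_consV R n).
rewrite (@eq_measure_integral _ _ _ _ pfm); last by [].
rewrite (ge0_integral_pushforward (@measurable_consV R n))// preimage_setT.
rewrite fubini_tonelli1//.
  by apply: measurableT_comp => //; exact: measurable_consV.
by move=> x; exact: f0.
Qed.

Lemma unconsVK : cancel (@unconsV R n) (@consV R n).
Proof.
move=> x; rewrite /consV /unconsV/=; apply/rowP => i.
have [j ->|j ->] := split_ordP (i : 'I_(1 + n)).
  rewrite (_ : 0 = ord0)// (@row_mxEl _ 1 1 n) mxE; congr (x _ _).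
  by apply/val_inj => /=; rewrite (ord1 j).
by rewrite (_ : 0 = ord0)// (@row_mxEr _ 1 1 n) mxE; congr (x _ _); exact/val_inj.
Qed.

Lemma consV_ord0 (t : R) (x : 'rV[R]_n) : consV (t, x) ord0 ord0 = t :> R.
Proof. by have := consVK (t, x) => -[]. Qed.

Lemma consV_lift (t : R) (x : 'rV[R]_n) j : consV (t, x) ord0 (lift ord0 j) = x ord0 j :> R.
Proof. by have /(congr1 snd)/rowP/(_ j) := @consVK R n (t, x); rewrite !mxE. Qed.

Lemma lebesgueVS_setX (A : set R) (B : set 'rV[R]_n) :
  measurable (A : set (measurableTypeR R)) -> measurable B ->
  lebesgueV R n.+1 ((@unconsV R n) @^-1` (A `*` B)) = (lam A * lebesgueV R n B)%E.
Proof.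
move=> mA mB; rewrite /= /lebesgue_cons /pushforward -comp_preimage.
rewrite (_ : _ \o _ = id); last by apply/funext => p /=; rewrite consVK.
by rewrite product_measure1E.
Qed.

End integral_cons.

Section affineV.
Variable R : realType.

Lemma measurable_affine n (c : R) (b : 'rV[R]_n) :
  measurable_fun setT (fun x : 'rV[R]_n => c *: x + b).
Proof.
apply: measurable_fun_coordP => i.
apply: (@eq_measurable_fun _ _ _ _ _ (fun x : 'rV[R]_n => c * x ord0 i + b ord0 i)).
  by move=> x _; rewrite !mxE.
apply: measurable_funD => //; apply: measurable_funM => //; exact: measurable_coord.
Qed.

(** A homothety followed by a translation acts on each coordinate separately, so Tonelli and an
    induction on [n] do the work of a determinant. *)
Lemma ge0_integral_affine n (c : R) (b : 'rV[R]_n) (f : 'rV[R]_n -> \bar R) :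
  c != 0 -> measurable_fun setT f -> (forall x, (0 <= f x)%E) ->
  (\int[lebesgueV R n]_x f x = (`|c| ^+ n)%:E * \int[lebesgueV R n]_x f (c *: x + b)%R)%E.
Proof.
move=> c0; elim: n b f => [|n IH] b f mf f0.
  rewrite expr0 mul1e; apply: eq_integral => x _; congr f.
  by apply/rowP; case.
have mfc : measurable_fun setT (fun x : 'rV[R]_n.+1 => f (c *: x + b)).
  by apply: measurableT_comp => //; exact: measurable_affine.
rewrite !ge0_integral_lebesgueVS//.
pose b0 := b ord0 ord0; pose b1 := \row_j b ord0 (lift ord0 j) : 'rV[R]_n.
have consE t x : c *: consV (t, x) + b = consV (c * t + b0, c *: x + b1).
  apply: (can_inj (@unconsVK R n)); rewrite consVK /unconsV; congr pair.
    by rewrite mxE mxE consV_ord0.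
  by apply/rowP => j; rewrite [LHS]mxE mxE mxE consV_lift !mxE.
have mcons : measurable_fun setT (fun p => f (consV p)).
  by apply: measurableT_comp => //; exact: measurable_consV.
have mF := @measurable_fun_fubini_tonelli_F _ _ _ _ R (lebesgueV R n) (f \o @consV R n)
  mcons (fun x => f0 _).
pose F t := (\int[lebesgueV R n]_x f (consV (t, x)))%E.
pose G t := (\int[lebesgueV R n]_x f (c *: consV (t, x) + b)%R)%E.
have mG : measurable_fun setT (G : measurableTypeR R -> \bar R).
  apply: (@measurable_fun_fubini_tonelli_F _ _ _ _ R (lebesgueV R n) (fun p => f (c *: consV p + b)) _ (fun x => f0 _)).
  exact: measurableT_comp mfc (@measurable_consV R n).
have FG t : F (c * t + b0) = ((`|c| ^+ n)%:E * G t)%E.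
  rewrite /F (IH b1 (fun x => f (consV (c * t + b0, x))))//.
    by rewrite /G; congr (_ * _)%E; apply: eq_integral => x _; rewrite consE.
  exact: (measurableT_comp mcons (measurable_pair1 (c * t + b0))).
transitivity (`|c|%:E * \int[lebesgue_measure]_t F (c * t + b0)%R)%E.
  have F0 t : (0 <= F t)%E by exact: integral_ge0.
  exact: (@ge0_integral_affine1 R c b0 c0 F mF F0).
rewrite exprS EFinM -muleA; congr (_ * _)%E.
under eq_integral do rewrite FG.
rewrite ge0_integralZl//; first by move=> t _; exact: integral_ge0.
Qed.

Lemma lebesgueV_cube01 n : lebesgueV R n (cube 0 1) = (2 ^+ n)%:E.
Proof.
elim: n => [|n IH].
  rewrite /= diracE expr0 mem_set// => i; by case: i.
have -> : cube (0 : 'rV[R]_n.+1) 1 = (@unconsV R n) @^-1` (ball (0 : R) 1 `*` cube 0 1).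
  apply/seteqP; split => x /=; rewrite /cube /=.
    move=> h; split; first by have := h ord0; rewrite mxE /ball/= distrC.
    by move=> i; rewrite !mxE; have := h (lift ord0 i); rewrite !mxE.
  case=> h0 h1 i; case: (unliftP ord0 i) => [j|] ->.
    by have := h1 j; rewrite !mxE.
  by move: h0; rewrite /ball/= distrC mxE.
rewrite lebesgueVS_setX; [|exact: measurable_ball|exact: measurable_cube].
by rewrite IH lebesgue_measure_ball// -EFinM exprS mulr2n.
Qed.

Lemma lebesgueV_affine n (c : R) (b : 'rV[R]_n) (A : set 'rV[R]_n) :
  c != 0 -> measurable A ->
  lebesgueV R n A = ((`|c| ^+ n)%:E * lebesgueV R n [set x | A (c *: x + b)%R])%E.
Proof.
move=> c0 mA; have mA' : measurable [set x | A (c *: x + b)].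
  rewrite -[X in measurable X]setTI; exact: measurable_affine.
rewrite -[in LHS](setIT A) -[X in (_ * _ X)%E]setIT -!integral_indic//.
rewrite (@ge0_integral_affine _ c b)//.
by apply/measurable_EFinP; exact: measurable_indic.
Qed.

Lemma lebesgueV_cube n (c : 'rV[R]_n) (r : R) : 0 < r -> lebesgueV R n (cube c r) = ((2 * r) ^+ n)%:E.
Proof.
move=> r0; rewrite (@lebesgueV_affine _ r c) ?gt_eqF//; last exact: measurable_cube.
rewrite (_ : mkset _ = cube 0 1); last first.
  apply/seteqP; split => x h i; have := h i.
    by rewrite !mxE addrK normrM gtr0_norm// subr0 -[ltRHS]mulr1 ltr_pM2l.
  by rewrite !mxE addrK normrM gtr0_norm// subr0 -[X in _ -> _ < X]mulr1 ltr_pM2l.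
by rewrite lebesgueV_cube01 gtr0_norm// -EFinM exprMn mulrC.
Qed.

Lemma lebesgueV_bounded n (A : set 'rV[R]_n) (M : R) : measurable A ->
  (forall x, A x -> `|x| < M) -> (lebesgueV R n A < +oo)%E.
Proof.
move=> mA AM; have [M0|M0] := ltP 0 M; last first.
  rewrite (_ : A = set0) ?measure0 ?ltry//; apply/seteqP; split => x //= /AM.
  by rewrite ltNge (le_trans M0).
apply: (@le_lt_trans _ _ (lebesgueV R n (cube 0 M))).
  apply: le_measure; rewrite ?inE//; first exact: measurable_cube.
  by move=> x /AM xM i; rewrite mxE subr0; exact: le_lt_trans (rV_coord_le _ _) xM.
by rewrite lebesgueV_cube// ltry.
Qed.

End affineV.

(** Common source of the Cauchy-Schwarz inequalities below: for integrals, for integrals with a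
    weight, and for weighted finite sums. *)
Lemma discriminant_le (R : realFieldType) (a b c : R) :
  0 <= c -> (forall t, 0 <= a + 2 * t * b + t ^+ 2 * c) -> b ^+ 2 <= a * c.
Proof.
rewrite le_eqVlt => /predU1P[<- h|c0 h].
  rewrite mulr0; have [->|b0] := eqVneq b 0; first by rewrite expr0n.
  (* For this [t] the affine function [a + 2 * t * b] takes the value [-1]. *)
  have := h (- (a + 1) / (2 * b)); have -> : 2 * (- (a + 1) / (2 * b)) * b = - (a + 1) by field.
  by rewrite mulr0; lra.
have := h (- b / c).
have -> : a + 2 * (- b / c) * b + (- b / c) ^+ 2 * c = (a * c - b ^+ 2) / c by field; rewrite gt_eqF.
by rewrite pmulr_lge0 ?invr_gt0// subr_ge0.
Qed.

(** * Real-valued integrals *)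

Section Rint.
Context d (T : measurableType d) (R : realType) (mu : {measure set T -> \bar R}).
Implicit Types f g : T -> R.

Definition rint f := mu.-integrable [set: T] (EFin \o f).

Lemma rint_measurable f : rint f -> measurable_fun setT f.
Proof. by move=> /integrableP[/measurable_EFinP]. Qed.

Lemma rintD f g : rint f -> rint g -> rint (fun x => f x + g x).
Proof. by move=> hf hg; apply: eq_integrable (integrableD measurableT hf hg). Qed.

Lemma rintZ k f : rint f -> rint (fun x => k * f x).
Proof. by move=> hf; apply: eq_integrable (integrableZl measurableT k hf). Qed.

Lemma rintN f : rint f -> rint (fun x => - f x).
Proof. by move=> /(rintZ (-1)); apply: eq_integrable => // x _ /=; rewrite mulN1r. Qed.

Lemma rintB f g : rint f -> rint g -> rint (fun x => f x - g x).
Proof. by move=> hf hg; apply: rintD => //; exact: rintN. Qed.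

Lemma rint_norm f : rint f -> rint (fun x => `|f x|).
Proof. by move=> hf; have := integrable_abse hf; apply: eq_integrable. Qed.

Lemma rint_le f g : measurable_fun setT f -> (forall x, `|f x| <= g x) -> rint g -> rint f.
Proof.
move=> mf fg; apply: le_integrable => //; first exact/measurable_EFinP.
by move=> x _ /=; rewrite lee_fin (le_trans (fg x))// ler_norm.
Qed.

Lemma RintD f g : rint f -> rint g ->
  \int[mu]_x (f x + g x) = \int[mu]_x f x + \int[mu]_x g x.
Proof. by move=> hf hg; rewrite RintegralD. Qed.

Lemma RintB f g : rint f -> rint g ->
  \int[mu]_x (f x - g x) = \int[mu]_x f x - \int[mu]_x g x.
Proof. by move=> hf hg; rewrite RintegralB. Qed.

Lemma RintZ k f : rint f -> \int[mu]_x (k * f x) = k * \int[mu]_x f x.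
Proof. by move=> hf; rewrite RintegralZl. Qed.

Lemma Rintegral_zero : \int[mu]_x (0 : R) = 0.
Proof. by rewrite /Rintegral integral0_eq. Qed.

Lemma RintN f : rint f -> \int[mu]_x (- f x) = - \int[mu]_x f x.
Proof.
by move=> hf; rewrite -mulN1r -RintZ//; apply: eq_Rintegral => x _; rewrite mulN1r.
Qed.

Lemma Rint_le f g : rint f -> rint g -> (forall x, f x <= g x) ->
  \int[mu]_x f x <= \int[mu]_x g x.
Proof. by move=> hf hg fg; apply: le_Rintegral => // x _; exact: fg. Qed.

Lemma Rint_ge0 f : (forall x, 0 <= f x) -> 0 <= \int[mu]_x f x.
Proof. by move=> f0; apply: Rintegral_ge0 => x _; exact: f0. Qed.

Lemma Rint_norm f : rint f -> `|\int[mu]_x f x| <= \int[mu]_x `|f x|.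
Proof. by move=> hf; exact: le_normr_Rintegral. Qed.

Lemma rint_sum (I : Type) (s : seq I) (F : I -> T -> R) : (forall i, rint (F i)) ->
  rint (fun x => \sum_(i <- s) F i x).
Proof.
move=> hF; elim: s => [|i s IH].
  have := integrable0 mu [set: T]; apply: eq_integrable => // x _.
  by rewrite /= big_nil.
by apply: eq_integrable (rintD (hF i) IH) => // x _; rewrite /= big_cons.
Qed.

Lemma Rint_sum (I : Type) (s : seq I) (F : I -> T -> R) : (forall i, rint (F i)) ->
  \int[mu]_x (\sum_(i <- s) F i x) = \sum_(i <- s) \int[mu]_x F i x.
Proof.
move=> hF; elim: s => [|i s IH].
  by rewrite big_nil -[RHS]Rintegral_zero; apply: eq_Rintegral => x _; rewrite big_nil.
rewrite big_cons -IH -RintD//; last exact: rint_sum.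
by apply: eq_Rintegral => x _; rewrite big_cons.
Qed.

Lemma rint_bounded f (A : set T) (C : R) : measurable A -> (mu A < +oo)%E ->
  measurable_fun setT f -> (forall x, `|f x| <= C) -> (forall x, ~ A x -> f x = 0) -> rint f.
Proof.
move=> mA Afin mf fC f0.
have : mu.-integrable A (EFin \o f).
  apply: measurable_bounded_integrable => //; first exact: measurable_funS mf.
  by exists C; split; [exact: num_real|move=> M CM x _ /=; exact: le_trans (fC x) (ltW CM)].
move=> /(integrable_mkcond _ mA); apply: eq_integrable => // x _ /=.
rewrite /patch; case: ifPn => // /negP h; rewrite f0 // => Ax; apply: h; exact: mem_set.
Qed.

Lemma Rint_bounded_le f (A : set T) (C : R) : measurable A -> (mu A < +oo)%E ->
  measurable_fun setT f -> (forall x, `|f x| <= C) -> (forall x, ~ A x -> f x = 0) ->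
  \int[mu]_x `|f x| <= C * fine (mu A).
Proof.
move=> mA Afin mf fC f0.
rewrite -(Rintegral_cst mu mA) [leRHS]Rintegral_mkcond.
have rf : rint f by exact: rint_bounded fC f0.
have mcA : measurable_fun setT (cst C \_ A) by apply/(measurable_restrictT _ _).1 => //; exact: measurable_cst.
apply: Rint_le.
- exact: rint_norm.
- apply: (rint_bounded mA Afin mcA (C := `|C|)).
    by move=> x; rewrite /patch; case: ifP; rewrite ?normr0.
  by move=> x Ax; rewrite /patch memNset.
- move=> x; rewrite /patch; case: ifPn => [_|/negP h]; first exact: fC.
  by rewrite f0 ?normr0// => Ax; apply: h; exact: mem_set.
Qed.

Lemma Rint_CS f g : rint (fun x => f x ^+ 2) -> rint (fun x => g x ^+ 2) ->
  rint (fun x => f x * g x) ->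
  (\int[mu]_x (f x * g x)) ^+ 2 <= (\int[mu]_x (f x ^+ 2)) * (\int[mu]_x (g x ^+ 2)).
Proof.
move=> f2 g2 fg; apply: discriminant_le => [|t]; first by apply: Rint_ge0 => x; exact: sqr_ge0.
rewrite -!RintZ// -!RintD//; last 3 first.
- by apply: rintD => //; exact: rintZ.
- exact: rintZ.
- exact: rintZ.
apply: Rint_ge0 => x; rewrite [leRHS](_ : _ = (f x + t * g x) ^+ 2) ?sqr_ge0//; ring.
Qed.

(** The weighted form behind both versions of Young's inequality: the weight is one factor of the
    convolution, and only the other factor gets squared. *)
Lemma Rint_CSw w h : (forall x, 0 <= w x) -> rint w -> rint (fun x => w x * h x) ->
  rint (fun x => w x * h x ^+ 2) ->
  (\int[mu]_x (w x * h x)) ^+ 2 <= (\int[mu]_x w x) * (\int[mu]_x (w x * h x ^+ 2)).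
Proof.
move=> w0 rw rwh rwhh; apply: discriminant_le => [|t].
  by apply: Rint_ge0 => x; rewrite mulr_ge0// sqr_ge0.
rewrite -!RintZ// -!RintD//; last 3 first.
- by apply: rintD => //; exact: rintZ.
- exact: rintZ.
- exact: rintZ.
apply: Rint_ge0 => x; rewrite [leRHS](_ : _ = w x * (1 + t * h x) ^+ 2); last by ring.
by rewrite mulr_ge0// sqr_ge0.
Qed.

End Rint.

(** * Fubini for bounded functions supported in a product of sets of finite measure *)

Section Rfubini.
Context d1 d2 (T1 : measurableType d1) (T2 : measurableType d2) (R : realType).
Variables (m1 : {sigma_finite_measure set T1 -> \bar R}) (m2 : {sigma_finite_measure set T2 -> \bar R}).
Variables (f : T1 * T2 -> R) (A1 : set T1) (A2 : set T2) (C : R).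
Hypotheses (mA1 : measurable A1) (mA2 : measurable A2).
Hypotheses (A1fin : (m1 A1 < +oo)%E) (A2fin : (m2 A2 < +oo)%E).
Hypotheses (mf : measurable_fun setT f) (fC : forall z, `|f z| <= C).
Hypothesis f0 : forall x y, ~ (A1 x /\ A2 y) -> f (x, y) = 0.

Lemma rint_prod : rint (m1 \x m2)%E f.
Proof.
apply: (@rint_bounded _ _ _ _ _ (A1 `*` A2) C) => //.
- exact: measurableX.
- apply: (@le_lt_trans _ _ (m1 A1 * m2 A2)%E); first by rewrite -product_measure1E.
  by rewrite lte_mul_pinfty// ge0_fin_numE.
- by move=> [x y] /= xy; exact: f0.
Qed.

Lemma rint_fst x : rint m2 (fun y => f (x, y)).
Proof.
apply: (@rint_bounded _ _ _ _ _ A2 C) => //; first exact: measurableT_comp mf (measurable_pair1 x).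
by move=> y Ay; apply: f0 => -[].
Qed.

Lemma rint_snd y : rint m1 (fun x => f (x, y)).
Proof.
apply: (@rint_bounded _ _ _ _ _ A1 C) => //; first exact: measurableT_comp mf (measurable_pair2 y).
by move=> x Ax; apply: f0 => -[].
Qed.

Let EF x : (\int[m2]_y (f (x, y))%:E = (\int[m2]_y f (x, y))%:E)%E.
Proof. by rewrite /Rintegral fineK//; exact/integrable_fin_num/rint_fst. Qed.

Let EG y : (\int[m1]_x (f (x, y))%:E = (\int[m1]_x f (x, y))%:E)%E.
Proof. by rewrite /Rintegral fineK//; exact/integrable_fin_num/rint_snd. Qed.

Lemma rint_fubini1 : rint m1 (fun x => \int[m2]_y f (x, y)).
Proof.
have := integrable_fubini_F rint_prod.
by apply: eq_integrable => // x _; exact: EF.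
Qed.

Lemma rint_fubini2 : rint m2 (fun y => \int[m1]_x f (x, y)).
Proof.
apply: (@rint_bounded _ _ _ _ _ A2 (C * fine (m1 A1))) => //.
- apply/measurable_EFinP; have := measurable_fubini_G rint_prod.
  by apply: eq_measurable_fun => y _; exact: EG.
- move=> y; apply: (le_trans (Rint_norm (rint_snd y))).
  apply: Rint_bounded_le => //; first exact: measurableT_comp mf (measurable_pair2 y).
  by move=> x Ax; apply: f0 => -[].
- move=> y Ay; rewrite -(Rintegral_zero m1); apply: eq_Rintegral => x _; apply: f0 => -[]//.
Qed.

Lemma Rfubini : \int[m1]_x \int[m2]_y f (x, y) = \int[m2]_y \int[m1]_x f (x, y).
Proof.
rewrite {1}/Rintegral [in RHS]/Rintegral; congr fine.
under eq_integral do rewrite -EF; under [RHS]eq_integral do rewrite -EG.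
exact: (Fubini rint_prod).
Qed.

Lemma Rfubini_prod : \int[(m1 \x m2)%E]_z f z = \int[m1]_x \int[m2]_y f (x, y).
Proof.
rewrite {1}/Rintegral [in RHS]/Rintegral; congr fine.
under [RHS]eq_integral do rewrite -EF.
by rewrite (integral12_prod_meas1 rint_prod).
Qed.

End Rfubini.

Section cfun.
Variables (T : topologicalType) (R : realType).
Implicit Types f g : T -> R.

Lemma cfD f g : continuous f -> continuous g -> continuous (fun x => f x + g x).
Proof. by move=> cf cg x; apply: (@cvgD _ _ _ _ _ f g); [exact: cf|exact: cg]. Qed.

Lemma cfM f g : continuous f -> continuous g -> continuous (fun x => f x * g x).
Proof. by move=> cf cg x; apply: (@cvgM _ _ _ _ f g); [exact: cf|exact: cg]. Qed.

Lemma cfZ (k : R) f : continuous f -> continuous (fun x => k * f x).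
Proof. by move=> cf; apply: cfM => // x; exact: cvg_cst. Qed.

Lemma cf_norm f : continuous f -> continuous (fun x => `|f x|).
Proof. by move=> cf x; apply: (@cvg_norm _ _ _ _ _ f); exact: cf. Qed.

Lemma cf_sum (J : Type) (s : seq J) (F : J -> T -> R) : (forall i, continuous (F i)) ->
  continuous (fun x => \sum_(i <- s) F i x).
Proof.
move=> hF; elim: s => [|i s IH].
  by under eq_fun do rewrite big_nil; move=> x; exact: cvg_cst.
by under eq_fun do rewrite big_cons; exact: cfD.
Qed.

End cfun.

(** * Continuous functions of bounded support on row vectors *)

Section Vint.
Variables (R : realType) (n : nat).
Local Notation V := 'rV[R]_n.
Local Notation mu := (lebesgueV R n).
Implicit Types (f g : V -> R) (x y z : V).

Lemma rint_affine (c : R) (b : V) f : c != 0 -> rint mu f -> rint mu (fun x => f (c *: x + b)).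
Proof.
move=> c0 /integrableP[mf foo]; apply/integrableP; split.
  exact: measurableT_comp mf (measurable_affine c b).
move: foo; rewrite (@ge0_integral_affine _ _ c b)//; last exact: measurableT_comp.
move=> h; rewrite -(@lte_pmul2l _ (`|c| ^+ n)%:E)//; last first.
  by rewrite lte_fin exprn_gt0// normr_gt0.
by rewrite gt0_muley// lte_fin exprn_gt0// normr_gt0.
Qed.

Lemma Rint_affine (c : R) (b : V) f : c != 0 -> rint mu f ->
  \int[mu]_x f x = `|c| ^+ n * \int[mu]_x f (c *: x + b).
Proof.
move=> c0; have pos g : rint mu g -> (forall x, 0 <= g x) ->
    \int[mu]_x g x = `|c| ^+ n * \int[mu]_x g (c *: x + b).
  move=> hg g0; have mg := measurable_int _ hg; have hg' := rint_affine b c0 hg.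
  rewrite {1}/Rintegral (@ge0_integral_affine _ _ c b)//.
  by rewrite fineM//; exact/(integrable_fin_num measurableT hg').
move=> hf; have mf := rint_measurable hf.
have rp : rint mu (fun x => Num.max (f x) 0).
  apply: (rint_le _ _ (rint_norm hf)); first exact: measurable_maxr.
  by move=> x; case: (leP (f x) 0) => h; rewrite ?normr0.
have rn : rint mu (fun x => Num.max (- f x) 0).
  apply: (rint_le _ _ (rint_norm hf)); first by apply: measurable_maxr => //; exact: measurableT_comp.
  by move=> x; case: (leP (- f x) 0) => h; rewrite ?normr0 ?normrN.
have fE x : f x = Num.max (f x) 0 - Num.max (- f x) 0.
  by case: (leP (f x) 0) => h; case: (leP (- f x) 0) => h'; lra.
have le0 (r : R) : 0 <= Num.max r 0 by rewrite le_max lexx orbT.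
under eq_Rintegral do rewrite fE; under [in RHS]eq_Rintegral do rewrite fE.
rewrite !RintB//; [|exact: (rint_affine b c0 rp)|exact: (rint_affine b c0 rn)].
by rewrite mulrBr (pos _ rp)// (pos _ rn).
Qed.

Lemma measurable_nball (M : R) : measurable [set x : V | `|x| < M].
Proof.
apply: measurable_rV_open; rewrite (_ : mkset _ = ball (0 : V) M); last first.
  by apply/seteqP; split => x; rewrite -ball_normE /= sub0r normrN.
exact: ball_open.
Qed.

Lemma nball_fin (M : R) : (mu [set x : V | (`|x| < M)%R] < +oo)%E.
Proof. by apply: (@lebesgueV_bounded _ _ _ M) => //; exact: measurable_nball. Qed.

Definition bsupp f := exists M : R, forall x, M <= `|x| -> f x = 0.

Definition Cc f := continuous f /\ bsupp f.

Lemma Cc_measurable f : Cc f -> measurable_fun setT f.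
Proof. by case=> cf _; exact: measurable_rV_continuous. Qed.

Lemma Cc_bounded f : Cc f -> exists2 C : R, 0 <= C & forall x, `|f x| <= C.
Proof.
move=> [cf [M fM]].
have cK : compact [set x : V | `|x| <= `|M|].
  apply: bounded_closed_compact.
    by exists `|M|; split => [|N MN x /= /le_trans]; [exact: num_real|apply; exact: ltW].
  rewrite (_ : mkset _ = (fun x : V => `|x|) @^-1` [set r | r <= `|M|])//.
  by apply: closed_comp => [x _|]; [exact: norm_continuous|exact: closed_le].
have K0 : [set x : V | `|x| <= `|M|] !=set0 by exists 0; rewrite /= normr0.
have [x _ hx] := compact_EVT_max K0 cK (continuous_subspaceT (cf_norm cf)).
exists `|f x| => // y; have [yM|yM] := leP `|y| `|M|; first by apply: hx; rewrite inE.
by rewrite fM ?normr0// (le_trans (ler_norm _))// ltW.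
Qed.

Lemma Cc_supp f : Cc f -> exists2 M : R, 0 < M & forall x, M <= `|x| -> f x = 0.
Proof.
move=> [_ [M fM]]; exists (`|M| + 1) => [|x hx]; first by rewrite ltr_wpDl.
by apply: fM; apply: le_trans hx; rewrite (le_trans (ler_norm M))// lerDl.
Qed.

Lemma Cc_rint f : Cc f -> rint mu f.
Proof.
move=> hf; have [C _ fC] := Cc_bounded hf; have [M _ fM] := Cc_supp hf.
apply: (rint_bounded (measurable_nball M) (nball_fin M) (Cc_measurable hf) fC) => x /= /negP.
by rewrite -leNgt; exact: fM.
Qed.

Lemma CcD f g : Cc f -> Cc g -> Cc (fun x => f x + g x).
Proof.
move=> [cf [M fM]] [cg [N gN]]; split; first exact: cfD.
by exists (Num.max M N) => x; rewrite ge_max => /andP[h1 h2]; rewrite fM// gN// addr0.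
Qed.

Lemma CcMl f g : Cc f -> continuous g -> Cc (fun x => f x * g x).
Proof.
move=> [cf [M fM]] cg; split; first exact: cfM.
by exists M => x h; rewrite fM// mul0r.
Qed.

Lemma CcM f g : Cc f -> Cc g -> Cc (fun x => f x * g x).
Proof. by move=> hf [cg _]; exact: CcMl. Qed.

Lemma CcZ (k : R) f : Cc f -> Cc (fun x => k * f x).
Proof.
by move=> [cf [M fM]]; split; [exact: cfZ|exists M => x h; rewrite fM// mulr0].
Qed.

Lemma CcN f : Cc f -> Cc (fun x => - f x).
Proof. by move=> /(CcZ (-1)); under eq_fun do rewrite mulN1r. Qed.

Lemma CcB f g : Cc f -> Cc g -> Cc (fun x => f x - g x).
Proof. by move=> hf hg; apply: CcD => //; exact: CcN. Qed.

Lemma Cc_abs f : Cc f -> Cc (fun x => `|f x|).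
Proof.
by move=> [cf [M fM]]; split; [exact: cf_norm|exists M => x h; rewrite fM// normr0].
Qed.

Lemma Cc0 : Cc (fun=> 0).
Proof. by split; [exact: cst_continuous|exists 0]. Qed.

Lemma Cc_sum (J : Type) (s : seq J) (F : J -> V -> R) : (forall i, Cc (F i)) ->
  Cc (fun x => \sum_(i <- s) F i x).
Proof.
move=> hF; elim: s => [|i s IH].
  by under eq_fun do rewrite big_nil; exact: Cc0.
by under eq_fun do rewrite big_cons; exact: CcD.
Qed.

Lemma continuous_affine (c : R) (b : V) : continuous (fun x : V => c *: x + b).
Proof. move=> x; have h1 := @scaler_continuous _ V c x; have h2 := @cst_continuous V V b x.
have h3 := @continuousD R V V _ _ _ h1 h2. exact: h3.
Qed.

Lemma Cc_affine (c : R) (b : V) f : c != 0 -> Cc f -> Cc (fun x => f (c *: x + b)).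
Proof.
move=> c0 [cf [M fM]]; split.
  by move=> x; apply: (continuous_comp (@continuous_affine c b x)); exact: cf.
exists ((M + `|b|) / `|c|) => x; rewrite ler_pdivrMr ?normr_gt0// => h; apply: fM.
have -> : c *: x + b = c *: x - - b by rewrite opprK.
apply: le_trans (lerB_dist _ _); rewrite normrN normrZ mulrC; lra.
Qed.

Lemma Cc_sqr f : Cc f -> Cc (fun x => f x ^+ 2).
Proof. by move=> hf; have := CcM hf hf; under eq_fun do rewrite -expr2. Qed.

Definition L1 f : R := \int[mu]_x `|f x|.
Definition nrm f : R := Num.sqrt (\int[mu]_x (f x ^+ 2)).

Lemma L1_ge0 f : 0 <= L1 f.
Proof. exact: Rint_ge0. Qed.

Lemma nrm_ge0 f : 0 <= nrm f.
Proof. exact: sqrtr_ge0. Qed.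

Lemma nrm_sqr f : nrm f ^+ 2 = \int[mu]_x (f x ^+ 2).
Proof. by rewrite sqr_sqrtr// Rint_ge0// => x; exact: sqr_ge0. Qed.

Lemma Cc_CS f g : Cc f -> Cc g -> `|\int[mu]_x (f x * g x)| <= nrm f * nrm g.
Proof.
move=> hf hg; rewrite -(@ler_pXn2r _ 2)// ?nnegrE ?mulr_ge0 ?nrm_ge0//.
rewrite exprMn !nrm_sqr real_normK ?num_real//.
by apply: Rint_CS; apply: Cc_rint; [exact: Cc_sqr|exact: Cc_sqr|exact: CcM].
Qed.

Lemma nrmZ k f : Cc f -> nrm (fun x => k * f x) = `|k| * nrm f.
Proof.
move=> hf; rewrite /nrm; under eq_Rintegral do rewrite exprMn.
rewrite RintZ; last exact/Cc_rint/Cc_sqr.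
by rewrite sqrtrM ?sqr_ge0// sqrtr_sqr.
Qed.

Lemma nrm_affine (c : R) (b : V) f : c != 0 -> Cc f ->
  nrm f ^+ 2 = `|c| ^+ n * nrm (fun x => f (c *: x + b)) ^+ 2.
Proof. by move=> c0 hf; rewrite !nrm_sqr (Rint_affine b c0)//; exact/Cc_rint/Cc_sqr. Qed.

Lemma nrmD f g : Cc f -> Cc g -> nrm (fun x => f x + g x) <= nrm f + nrm g.
Proof.
move=> hf hg; rewrite -(@ler_pXn2r _ 2)// ?nnegrE ?addr_ge0 ?nrm_ge0//.
rewrite nrm_sqr sqrrD !nrm_sqr.
have -> : \int[mu]_x ((f x + g x) ^+ 2) =
    \int[mu]_x (f x ^+ 2) + 2 * \int[mu]_x (f x * g x) + \int[mu]_x (g x ^+ 2).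
  rewrite -RintZ -?RintD; try (by apply/Cc_rint; do ?[exact: Cc_sqr | exact: CcM | apply: CcD | apply: CcZ]).
  by apply: eq_Rintegral => x _; ring.
have := Cc_CS hf hg; have := ler_norm (\int[mu]_x (f x * g x)); lra.
Qed.

End Vint.

(** * Smooth functions *)

Section deriveP.
Variables (R : realType) (V : normedModType R).
Implicit Types (f g : V -> R) (x v : V).

Lemma is_deriveI f x v (d : R) :
  (forall e : R, 0 < e -> exists2 del : R, 0 < del & forall h : R, h != 0 -> `|h| < del ->
     `|h^-1 * (f (h *: v + x) - f x) - d| <= e) -> is_derive x v f d.
Proof.
move=> H.
have cv : (fun h => h^-1 *: ((f \o shift x) (h *: v) - f x)) @ 0^' --> d.
  apply/cvgrPdist_le => e e0; have [del del0 hd] := H _ e0.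
  near=> h; rewrite distrC; apply: hd; first by near: h; exact: nbhs_dnbhs_neq.
  by near: h; exact: dnbhs0_lt.
by apply: DeriveDef; [apply/cvg_ex; exists d|exact/cvg_lim].
Unshelve. all: by end_near. Qed.

Lemma is_deriveE f x v (d : R) : is_derive x v f d ->
  (forall e : R, 0 < e -> exists2 del : R, 0 < del & forall h : R, h != 0 -> `|h| < del ->
     `|h^-1 * (f (h *: v + x) - f x) - d| <= e).
Proof.
move=> H e e0; have [df dE] := H; have : (fun h => h^-1 *: ((f \o shift x) (h *: v) - f x)) @ 0^' --> d.
  by rewrite -dE; exact: df.
move=> /cvgrPdist_le/(_ _ e0) [del /= del0 hd]; exists del => // h h0 hdel.
rewrite distrC; apply: hd => //=; by rewrite /ball/= sub0r normrN.
Qed.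

End deriveP.

Section derive_line.
Variables (R : realType) (V : normedModType R).
Implicit Types (f g : V -> R) (x v : V).

Lemma is_derive_affine f x c (r : R) v d :
  is_derive (r *: x + c) v f d -> is_derive x v (fun x => f (r *: x + c)) (r * d).
Proof.
move=> /is_deriveE H; apply: is_deriveI => e e0.
have [->|r0] := eqVneq r 0.
  by exists 1 => // h _ _; rewrite !scale0r subrr !mulr0 mul0r subrr normr0 ltW.
have r0' : 0 < `|r| by rewrite normr_gt0.
have [del del0 hd] := H (e / `|r|) (divr_gt0 e0 r0').
exists (del / `|r|); first by rewrite divr_gt0.
move=> h h0; rewrite ltr_pdivlMr ?normr_gt0// mulrC -normrM => hl.
have := hd (r * h) (mulf_neq0 r0 h0) hl; rewrite ler_pdivlMr ?normr_gt0// => hd1.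
apply: le_trans hd1; rewrite scalerDr scalerA -addrA -normrM.
by rewrite le_eqVlt; apply/orP; left; apply/eqP; congr (`|_|); field; rewrite r0 h0.
Qed.

Lemma is_derive_line f x v t d :
  is_derive (x + t *: v) v f d -> is_derive t (1 : R) (fun s => f (x + s *: v)) d.
Proof.
move=> /is_deriveE H; apply: (@is_deriveI R R^o) => e e0; have [del del0 hd] := H e e0.
exists del => // h h0 hl; have := hd h h0 hl; congr (_ <= _); congr (`|_|).
by congr (_ * (f _ - _) - _); rewrite scaler1 scalerDl addrCA.
Qed.

Lemma MVT_line f v : (forall x, derivable f x v) -> forall y s,
  exists2 xi, `|xi| <= `|s| & f (y + s *: v) - f y = s * 'D_v f (y + xi *: v).
Proof.
move=> df y s; pose g t := f (y + t *: v).
have dg t : is_derive t (1 : R) g ('D_v f (y + t *: v)).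
  exact/is_derive_line/derivableP.
have cg : continuous g by move=> t; apply/differentiable_continuous/derivable1_diffP; have [] := dg t.
have g0 : g 0 = f y by rewrite /g scale0r addr0.
rewrite -g0 -/(g s); have [s0|s0] := leP 0 s.
  have [xi] := @MVT_segment R g (fun t => 'D_v f (y + t *: v)) 0 s s0 (fun t _ => dg t)
    (continuous_subspaceT cg).
  rewrite in_itv/= => /andP[h1 h2] ->; exists xi; first by rewrite !ger0_norm.
  by rewrite subr0 mulrC.
have [xi] := @MVT_segment R g (fun t => 'D_v f (y + t *: v)) s 0 (ltW s0) (fun t _ => dg t)
    (continuous_subspaceT cg).
rewrite in_itv/= => /andP[h1 h2] E; exists xi; first by rewrite !ler0_norm ?lerN2// ltW.
by apply: oppr_inj; rewrite opprB E sub0r mulrN mulrC.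
Qed.

End derive_line.

Section Ck.
Variables (R : realType) (n : nat).
Local Notation V := 'rV[R]_n.
Implicit Types (f g : V -> R) (x v : V) (i : 'I_n).

Definition ei i : V := delta_mx ord0 i.

(** [smooth] quantifies over all words of partial derivatives at once; stratifying by the order
    gives something on which stability under products and changes of variables can be proved by
    induction. *)
Fixpoint Ck k f : Prop := continuous f /\
  if k is k'.+1 then forall i, (forall x, derivable f x (ei i)) /\ Ck k' (partial i f) else True.

Lemma Ck_continuous k f : Ck k f -> continuous f.
Proof. by case: k => [|k] []. Qed.

Lemma CkW k f : Ck k.+1 f -> Ck k f.
Proof.
elim: k f => [|k IH] f [cf hf]; first by split.
by split => // i; have [h1 h2] := hf i; split => //; exact: IH.
Qed.

Lemma smooth_Ck f : smooth f <-> forall k, Ck k f.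
Proof.
split=> [sf k|hf s].
  suff : forall s, Ck k (foldr (@partial R n) f s) by move=> /(_ [::]).
  elim: k => [|k IH] s; first by split => //; have [] := sf s.
  by have [cs ds] := sf s; split => // i; split => [x|]; [exact: ds|exact: (IH (i :: s))].
suff hs : forall k, Ck k (foldr (@partial R n) f s).
  by split; [exact: Ck_continuous (hs 0%N)|move=> i x; have [_ /(_ i)[h _]] := hs 1%N; exact: h].
elim: s => [|i s IH] k //=; by have [_ /(_ i)[]] := IH k.+1.
Qed.

Lemma partial_is_derive f g i : (forall x, is_derive x (ei i) f (g x)) ->
  (forall x, derivable f x (ei i)) /\ partial i f = g.
Proof.
by move=> h; split => [x|]; [have [] := h x|apply/funext => x; have [_ <-] := h x].
Qed.

Lemma Ck1_is_derive k f i x : Ck k.+1 f -> is_derive x (ei i) f (partial i f x).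
Proof. by move=> [_ /(_ i)[df _]]; exact: derivableP. Qed.

Lemma CkD k f g : Ck k f -> Ck k g -> Ck k (fun x => f x + g x).
Proof.
elim: k f g => [|k IH] f g hf hg; (split; first by apply: cfD; [case: hf|case: hg]) => // i.
have [|h1 ->] := @partial_is_derive (fun x => f x + g x) (fun x => partial i f x + partial i g x) i.
  by move=> x; have h1 := Ck1_is_derive i x hf; have h2 := Ck1_is_derive i x hg; exact: is_deriveD.
by split => //; apply: IH; [case: hf => _ /(_ i)[]|case: hg => _ /(_ i)[]].
Qed.

Lemma CkM k f g : Ck k f -> Ck k g -> Ck k (fun x => f x * g x).
Proof.
elim: k f g => [|k IH] f g hf hg; (split; first by apply: cfM; [case: hf|case: hg]) => // i.
have [|h1 ->] := @partial_is_derive (fun x => f x * g x) (fun x => f x * partial i g x + g x * partial i f x) i.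
  by move=> x; have h1 := Ck1_is_derive i x hf; have h2 := Ck1_is_derive i x hg; exact: is_deriveM.
have [_ /(_ i)[_ hfi]] := hf; have [_ /(_ i)[_ hgi]] := hg.
by split => //; apply: CkD; [exact: (IH _ _ (CkW hf) hgi)|exact: (IH _ _ (CkW hg) hfi)].
Qed.

Lemma Ck_cst k (c : R) : Ck k (fun=> c).
Proof.
elim: k c => [|k IH] c; (split; first exact: cst_continuous) => // i.
have [h1 h2] := @partial_is_derive (fun=> c) (fun=> 0) i (fun x => is_derive_cst c x (ei i)).
by split => //; rewrite h2.
Qed.

Lemma Ck_affine k f (r : R) c : Ck k f -> Ck k (fun x => f (r *: x + c)).
Proof.
elim: k f => [|k IH] f hf; (split; first by move=> x; apply: (continuous_comp (@continuous_affine R n r c x)); case: hf => + _; exact) => // i.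
have [|h1 ->] := @partial_is_derive (fun x => f (r *: x + c)) (fun x => r * partial i f (r *: x + c)) i.
  by move=> x; apply: is_derive_affine; exact: (Ck1_is_derive i _ hf).
by split => //; apply: CkM; [exact: Ck_cst|apply: IH; case: hf => _ /(_ i)[]].
Qed.

Lemma is_derive_coord j i x : is_derive x (ei i) (fun x : V => x ord0 j) (i == j)%:R.
Proof.
apply: is_deriveI => e e0; exists 1 => // h h0 _.
rewrite !mxE /= addrK eq_sym mulrA mulVf// mul1r subrr normr0; exact: ltW.
Qed.

Lemma Ck_coord k j : Ck k (fun x : V => x ord0 j).
Proof.
case: k => [|k]; (split; first exact: coord_continuous) => // i.
have [|h1 ->] := @partial_is_derive (fun x : V => x ord0 j) (fun=> (i == j)%:R) i.
  by move=> x; exact: is_derive_coord.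
by split => //; exact: Ck_cst.
Qed.

(** One coordinate is added to the direction at a time: the increment along [ei i] is, by the mean
    value theorem, [h * c] times the partial derivative at a nearby point, and continuity of that
    derivative brings it back to [x]. [K] is such that the nearby point lies within [|h| * K] of
    [x]. *)
Lemma is_derive_add_ei f x u i (c d : R) : Ck 1%N f -> is_derive x u f d ->
  is_derive x (u + c *: ei i) f (d + c * partial i f x).
Proof.
move=> hf /is_deriveE H; apply: is_deriveI => e e0.
have [cf /(_ i)[dfi [cfi _]]] := hf.
have c1 : 0 < `|c| + 1 by rewrite ltr_wpDl.
have e2 : 0 < e / 2 / (`|c| + 1) by rewrite !divr_gt0.
have /cvgrPdist_lt/(_ _ e2)/nbhs_ballP[d1 /= d10 h1] := cfi x.
have [d2 d20 h2] := H (e / 2) (divr_gt0 e0 (ltr0n _ 2)).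
pose K := `|u| + `|c *: ei i| + 1.
have K0 : 0 < K by rewrite ltr_wpDl// addr_ge0.
exists (Num.min d2 (d1 / K)); first by rewrite lt_min d20 divr_gt0.
move=> h h0; rewrite lt_min ltr_pdivlMr// => /andP[hd2 hd1].
have [xi xi1 xiE] := MVT_line dfi (h *: u + x) (h * c).
have -> : h^-1 * (f (h *: (u + c *: ei i) + x) - f x) - (d + c * partial i f x) =
   (h^-1 * (f (h *: u + x) - f x) - d) + c * (partial i f (h *: u + x + xi *: ei i) - partial i f x).
  rewrite scalerDr scalerA addrAC.
  have -> : f (h *: u + x + (h * c) *: ei i) = f (h *: u + x) + h * c * partial i f (h *: u + x + xi *: ei i).
    by rewrite /partial -xiE [RHS]addrC subrK.
  by field.
apply: le_trans (ler_normD _ _) _.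
have -> : e = e / 2 + e / 2 by field.
apply: lerD; first exact: h2.
rewrite normrM.
have : `|partial i f x - partial i f (h *: u + x + xi *: ei i)| < e / 2 / (`|c| + 1).
  apply: h1; rewrite -ball_normE /=.
  have -> : h *: u + x + xi *: ei i = x + (h *: u + xi *: ei i) by rewrite addrAC addrC.
  rewrite opprD addrA subrr sub0r normrN; apply: le_lt_trans (ler_normD _ _) _.
  apply: le_lt_trans hd1; rewrite !normrZ /K mulrDr mulr1 mulrDr -addrA lerD2l.
  rewrite (@le_trans _ _ (`|h * c| * `|ei i|))//; first by rewrite ler_wpM2r.
  by rewrite normrM normrZ mulrA lerDl.
rewrite distrC ltr_pdivlMr// => /ltW h3; apply: le_trans h3.
by rewrite mulrC ler_wpM2l// lerDl.
Qed.

Lemma C1_is_derive f x v : Ck 1%N f -> is_derive x v f (\sum_i v ord0 i * partial i f x).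
Proof.
move=> hf; rewrite {1}(row_sum_delta v).
suff : forall s : seq 'I_n, is_derive x (\sum_(i <- s) v ord0 i *: ei i) f (\sum_(i <- s) v ord0 i * partial i f x).
  by apply.
elim=> [|i s IH]; first by rewrite !big_nil; exact: is_derive0.
by rewrite !big_cons addrC [X in is_derive _ _ _ X]addrC; exact: is_derive_add_ei.
Qed.

End Ck.

Local Opaque smooth.

Section smooth_calculus.
Variables (R : realType) (n : nat).
Local Notation V := 'rV[R]_n.
Local Notation ei := (@ei R n).
Implicit Types (f g : V -> R) (x v : V) (i : 'I_n).

Lemma smooth_continuous f : smooth f -> continuous f.
Proof. by move=> /smooth_Ck/(_ 0%N)[]. Qed.

Lemma smooth_partial f i : smooth f -> smooth (partial i f).
Proof. by move=> /smooth_Ck h; apply/smooth_Ck => k; have [_ /(_ i)[]] := h k.+1. Qed.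

Lemma smooth_is_derive f i x : smooth f -> is_derive x (ei i) f (partial i f x).
Proof. by move=> /smooth_Ck/(_ 1%N)/Ck1_is_derive. Qed.

Lemma smoothD f g : smooth f -> smooth g -> smooth (fun x => f x + g x).
Proof. by move=> /smooth_Ck hf /smooth_Ck hg; apply/smooth_Ck => k; exact: CkD. Qed.

Lemma smoothM f g : smooth f -> smooth g -> smooth (fun x => f x * g x).
Proof. by move=> /smooth_Ck hf /smooth_Ck hg; apply/smooth_Ck => k; exact: CkM. Qed.

Lemma smooth_cst (c : R) : smooth (fun _ : V => c).
Proof. by apply/smooth_Ck => k; exact: Ck_cst. Qed.

Lemma smoothZ (c : R) f : smooth f -> smooth (fun x => c * f x).
Proof. by move=> hf; apply: smoothM; [exact: smooth_cst|exact: hf]. Qed.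

Lemma smoothB f g : smooth f -> smooth g -> smooth (fun x => f x - g x).
Proof.
move=> hf hg; have -> : (fun x => f x - g x) = (fun x => f x + -1 * g x).
  by apply/funext => x; rewrite mulN1r.
by apply: smoothD; [exact: hf|exact: smoothZ].
Qed.

Lemma smooth_affine f (r : R) c : smooth f -> smooth (fun x => f (r *: x + c)).
Proof. by move=> /smooth_Ck hf; apply/smooth_Ck => k; exact: Ck_affine. Qed.

Lemma smooth_coord i : smooth (fun x : V => x ord0 i).
Proof. by apply/smooth_Ck => k; exact: Ck_coord. Qed.

Lemma smooth_sum (J : Type) (s : seq J) (F : J -> V -> R) : (forall j, smooth (F j)) ->
  smooth (fun x => \sum_(i <- s) F i x).
Proof.
move=> hF; elim: s => [|i s IH].
  by rewrite (_ : (fun x => _) = fun=> 0); [exact: smooth_cst|apply/funext => x; rewrite big_nil].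
rewrite (_ : (fun x => _) = fun x => F i x + \sum_(j <- s) F j x); first exact: (smoothD (hF i) IH).
by apply/funext => x; rewrite big_cons.
Qed.

Lemma smooth_prod (J : Type) (s : seq J) (F : J -> V -> R) : (forall j, smooth (F j)) ->
  smooth (fun x => \prod_(i <- s) F i x).
Proof.
move=> hF; elim: s => [|i s IH].
  by rewrite (_ : (fun x => _) = fun=> 1); [exact: smooth_cst|apply/funext => x; rewrite big_nil].
rewrite (_ : (fun x => _) = fun x => F i x * \prod_(j <- s) F j x); first exact: (smoothM (hF i) IH).
by apply/funext => x; rewrite big_cons.
Qed.

Lemma partial_val f g i : (forall x, is_derive x (ei i) f (g x)) -> partial i f = g.
Proof. by move=> /partial_is_derive[]. Qed.

Lemma partialD f g i : smooth f -> smooth g ->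
  partial i (fun x => f x + g x) = fun x => partial i f x + partial i g x.
Proof.
move=> hf hg; apply: partial_val => x; have h1 := smooth_is_derive i x hf.
by have h2 := smooth_is_derive i x hg; exact: is_deriveD.
Qed.

Lemma partialM f g i : smooth f -> smooth g ->
  partial i (fun x => f x * g x) = fun x => f x * partial i g x + g x * partial i f x.
Proof.
move=> hf hg; apply: partial_val => x; have h1 := smooth_is_derive i x hf.
by have h2 := smooth_is_derive i x hg; exact: is_deriveM.
Qed.

Lemma partial_cst (c : R) i : partial i (fun _ : V => c) = fun=> 0.
Proof. by apply: partial_val => x; exact: is_derive_cst. Qed.

Lemma partialZ (c : R) f i : smooth f -> partial i (fun x => c * f x) = fun x => c * partial i f x.
Proof.
move=> hf; rewrite (partialM _ (smooth_cst c) hf).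
by apply/funext => x; rewrite partial_cst mulr0 addr0.
Qed.

Lemma partialB f g i : smooth f -> smooth g ->
  partial i (fun x => f x - g x) = fun x => partial i f x - partial i g x.
Proof.
move=> hf hg; have -> : (fun x => f x - g x) = (fun x => f x + -1 * g x).
  by apply/funext => x; rewrite mulN1r.
rewrite (partialD _ hf (smoothZ (-1) hg)).
by rewrite (partialZ _ _ hg); apply/funext => x; rewrite mulN1r.
Qed.

Lemma partial_affine f (r : R) c i : smooth f ->
  partial i (fun x => f (r *: x + c)) = fun x => r * partial i f (r *: x + c).
Proof. by move=> hf; apply: partial_val => x; apply: is_derive_affine; exact: smooth_is_derive. Qed.

Lemma partial_coord i j : partial i (fun x : V => x ord0 j) = fun=> (i == j)%:R.
Proof. by apply: partial_val => x; exact: is_derive_coord. Qed.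

Definition Ccoo f := smooth f /\ bsupp f.

Lemma Ccoo_Cc f : Ccoo f -> Cc f.
Proof. by case=> sf bf; split => //; exact: smooth_continuous. Qed.

Lemma CcooD f g : Ccoo f -> Ccoo g -> Ccoo (fun x => f x + g x).
Proof.
by move=> hf hg; split; [case: hf; case: hg => *; exact: smoothD|
  have [] := CcD (Ccoo_Cc hf) (Ccoo_Cc hg)].
Qed.

Lemma CcooMl f g : Ccoo f -> smooth g -> Ccoo (fun x => f x * g x).
Proof.
move=> [sf [M fM]] sg; split; first exact: smoothM.
by exists M => x h; rewrite fM// mul0r.
Qed.

Lemma CcooMr f g : smooth f -> Ccoo g -> Ccoo (fun x => f x * g x).
Proof. by move=> sf hg; under eq_fun do rewrite mulrC; exact: CcooMl. Qed.

Lemma CcooZ (c : R) f : Ccoo f -> Ccoo (fun x => c * f x).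
Proof. by move=> hf; apply: CcooMr; [exact: smooth_cst|exact: hf]. Qed.

Lemma CcooB f g : Ccoo f -> Ccoo g -> Ccoo (fun x => f x - g x).
Proof.
move=> hf hg; have -> : (fun x => f x - g x) = (fun x => f x + -1 * g x).
  by apply/funext => x; rewrite mulN1r.
by apply: CcooD; [exact: hf|exact: CcooZ].
Qed.

Lemma Ccoo_affine f (r : R) c : r != 0 -> Ccoo f -> Ccoo (fun x => f (r *: x + c)).
Proof.
move=> r0 hf; split; first by case: hf => *; exact: smooth_affine.
by have [] := Cc_affine c r0 (Ccoo_Cc hf).
Qed.

Lemma Ccoo_sum (J : Type) (s : seq J) (F : J -> V -> R) : (forall j, Ccoo (F j)) ->
  Ccoo (fun x => \sum_(i <- s) F i x).
Proof.
by move=> hF; split; [apply: smooth_sum => j; case: (hF j)|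
  have [] := Cc_sum s (fun j => Ccoo_Cc (hF j))].
Qed.

Lemma partial0_near f i x : (\forall y \near x, f y = 0) -> partial i f x = 0.
Proof.
move=> /nbhs_ballP[e /= e0 he]; suff : is_derive x (ei i) f 0 by case.
apply: is_deriveI => e1 e10; exists (e / (`|ei i : V| + 1)); first by rewrite divr_gt0// ltr_wpDl.
move=> h h0; rewrite ltr_pdivlMr ?ltr_wpDl// => hl.
rewrite (he x (ballxx x e0)) he ?subrr ?mulr0 ?subr0 ?normr0 ?ltW//.
rewrite -ball_normE /= opprD addrCA subrr addr0 normrN normrZ (le_lt_trans _ hl)//.
by rewrite ler_wpM2l// lerDl.
Qed.

Lemma Ccoo_partial f i : Ccoo f -> Ccoo (partial i f).
Proof.
move=> [sf [M fM]]; split; first exact: smooth_partial.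
exists (M + 1) => x hx; apply: partial0_near; apply/nbhs_ballP; exists 1 => //= y.
rewrite -ball_normE /= => xy; apply: fM; rewrite -(lerD2r 1) (le_trans hx)//.
have -> : x = y + (x - y) by rewrite addrC subrK.
by rewrite (le_trans (ler_normD _ _))// lerD2l ltW.
Qed.

Lemma smooth_C1_derive f x v : smooth f -> is_derive x v f (\sum_i v ord0 i * partial i f x).
Proof. by move=> /smooth_Ck/(_ 1%N); exact: C1_is_derive. Qed.

Lemma Ccoo_lipschitz f : Ccoo f -> exists2 L : R, 0 <= L & forall x y, `|f x - f y| <= L * `|x - y|.
Proof.
move=> hf; have /choice[C hC] : forall i, exists C : R, 0 <= C /\ forall x, `|partial i f x| <= C.
  by move=> i; have [C C0 hC] := Cc_bounded (Ccoo_Cc (Ccoo_partial i hf)); exists C.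
exists (\sum_i C i); first by apply: sumr_ge0 => i _; case: (hC i).
move=> x y; have df z : derivable f z (x - y) by have [] := smooth_C1_derive z (x - y) hf.1.
have [xi _] := MVT_line df y 1; rewrite scale1r [X in f X - _]addrC subrK mul1r => ->.
have [_ ->] := smooth_C1_derive (y + xi *: (x - y)) (x - y) hf.1.
rewrite mulr_suml; apply: le_trans (ler_norm_sum _ _ _) _; apply: ler_sum => i _.
by rewrite normrM mulrC ler_pM// ?rV_coord_le//; case: (hC i).
Qed.

Lemma norm_ei i : `|ei i : V| <= 1.
Proof. by apply: rV_norm_le => // j; rewrite !mxE; case: (_ && _); rewrite ?normr1 ?normr0. Qed.

(** Difference quotients of [f] have integral zero by translation invariance. They differ from the
    derivative by at most [L * h], with [L] a Lipschitz constant of the derivative, on a ball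
    containing all supports; the [+ 1] in its radius makes room for the translation by [h <= 1]. *)
Lemma Rint_partial0 f i : Ccoo f -> \int[lebesgueV R n]_x partial i f x = 0.
Proof.
move=> hf; have [L L0 hL] := Ccoo_lipschitz (Ccoo_partial i hf).
have [M M0 fM] := Cc_supp (Ccoo_Cc hf).
have hpf := Ccoo_Cc (Ccoo_partial i hf); have [M' M'0 fM'] := Cc_supp hpf.
pose N := Num.max (M + 1) M'.
set m := fine (lebesgueV R n [set x : V | `|x| < N]).
suff H : forall h : R, 0 < h -> h <= 1 -> `|\int[lebesgueV R n]_x partial i f x| <= L * m * h.
  apply/eqP; rewrite -normr_le0; apply/ler_addgt0Pl => e e0; rewrite addr0.
  have [Lm|Lm] := leP (L * m) e.
    by apply: le_trans (H 1 _ _) _; rewrite ?mulr1.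
  have Lm0 := lt_trans e0 Lm.
  apply: le_trans (H (e / (L * m)) _ _) _; first by rewrite divr_gt0.
    by rewrite ler_pdivrMr// mul1r ltW.
  by rewrite mulrC divfK// gt_eqF.
move=> h h0 h1.
have hfh : Cc (fun x => f (x + h *: ei i)).
  by have := Cc_affine (h *: ei i) (oner_neq0 R) (Ccoo_Cc hf); under eq_fun do rewrite scale1r.
have E0 : \int[lebesgueV R n]_x (h^-1 * (f (x + h *: ei i) - f x)) = 0.
  rewrite RintZ; last by apply: Cc_rint; apply: CcB => //; exact: Ccoo_Cc.
  rewrite RintB; [|exact: Cc_rint|exact/Cc_rint/Ccoo_Cc].
  rewrite [X in _ - X](Rint_affine (h *: ei i) (oner_neq0 R)); last exact/Cc_rint/Ccoo_Cc.
  rewrite normr1 expr1n mul1r; under [X in _ - X]eq_Rintegral do rewrite scale1r.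
  by rewrite subrr mulr0.
have hq : Cc (fun x => h^-1 * (f (x + h *: ei i) - f x)).
  by apply: CcZ; apply: CcB => //; exact: Ccoo_Cc.
rewrite -[X in `|X|]subr0 -E0 -RintB; [|exact: Cc_rint|exact: Cc_rint].
apply: le_trans (Rint_norm _ ) _; first by apply: Cc_rint; exact: CcB.
rewrite mulrAC; apply: Rint_bounded_le.
- exact: measurable_nball.
- exact: nball_fin.
- exact: (Cc_measurable (CcB hpf hq)).
- move=> x; have [xi xi1 ->] := MVT_line (fun z => (let: h := smooth_is_derive i z hf.1 in @ex_derive _ _ _ _ _ _ _ h)) x h.
  rewrite mulrA mulVf ?gt_eqF// mul1r; apply: le_trans (hL _ _) _.
  rewrite ler_wpM2l// opprD addrA subrr sub0r normrN normrZ -[leRHS]mulr1 ler_pM//.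
    by rewrite (le_trans xi1)// gtr0_norm.
  exact: norm_ei.
- move=> x /= /negP; rewrite -leNgt ge_max => /andP[x1 x2].
  have fx : f x = 0 by apply: fM; rewrite (le_trans _ x1)// lerDl.
  have -> : f (x + h *: ei i) = 0.
    apply: fM; rewrite -(lerD2r 1) (le_trans x1)//.
    rewrite -[X in `|X| <= _](addrK (h *: ei i)) (le_trans (ler_normB _ _))// lerD2l.
    by rewrite normrZ gtr0_norm// -[leRHS]mulr1 ler_pM// ?norm_ei// ltW.
  by rewrite fM'// fx subrr mulr0 subr0.
Qed.

Lemma IBP f g i : Ccoo f -> smooth g ->
  \int[lebesgueV R n]_x (partial i f x * g x) = - \int[lebesgueV R n]_x (f x * partial i g x).
Proof.
move=> hf sg; apply/eqP; rewrite -subr_eq0 opprK -RintD; last 2 first.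
- by apply: Cc_rint; apply: CcMl; [exact/Ccoo_Cc/Ccoo_partial|exact: smooth_continuous].
- by apply: Cc_rint; apply: CcMl; [exact/Ccoo_Cc|exact/smooth_continuous/smooth_partial].
rewrite -[X in _ == X](Rint_partial0 i (CcooMl hf sg)) (partialM i hf.1 sg); apply/eqP.
by apply: eq_Rintegral => x _; rewrite addrC mulrC [X in _ + X]mulrC addrC mulrC.
Qed.

End smooth_calculus.

Lemma lipschitz_continuous (R : realType) (V : normedModType R) (f : V -> R) (L : R) :
  0 <= L -> (forall x y, `|f x - f y| <= L * `|x - y|) -> continuous f.
Proof.
move=> L0 hL x; apply/cvgrPdist_le => e e0; apply/nbhs_ballP; exists (e / (L + 1)).
  by rewrite /= divr_gt0// ltr_wpDl.
move=> y; rewrite -ball_normE /= ltr_pdivlMr ?ltr_wpDl// => hl.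
apply: le_trans (hL x y) _; rewrite mulrC (le_trans _ (ltW hl))// ler_wpM2l//.
by rewrite lerDl.
Qed.

(** * Differentiation under the integral sign *)

Section parametric.
Context (R : realType) (n : nat) d (P : measurableType d) (m : {measure set P -> \bar R}).
Local Notation V := 'rV[R]_n.
Local Notation ei := (@ei R n).
Variables (r : P -> R) (c : P -> V) (rho : R).
Hypotheses (mr : measurable_fun setT r) (mc : measurable_fun setT c).
Hypothesis rho0 : 0 <= rho.

(** A common form for the convolutions [cv] (where [r = 1]) and the operators [E] (where
    [r = 1 + t]). Differentiating in [x] multiplies the weight by [r p] and differentiates [phi],
    which stays within the class; smoothness follows by induction. *)
Definition pint (w : P -> R) (phi : V -> R) (x : V) : R :=
  \int[m]_p (w p * phi (r p *: x + c p)).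

Lemma measurable_paff x : measurable_fun setT (fun p => r p *: x + c p).
Proof.
apply: measurable_fun_coordP => i.
apply: (@eq_measurable_fun _ _ _ _ _ (fun p => r p * x ord0 i + c p ord0 i)).
  by move=> p _; rewrite !mxE.
apply: measurable_funD; first by apply: measurable_funM.
exact: measurableT_comp (measurable_coord i) mc.
Qed.

Lemma rint_pint w phi x : rint m w -> Cc phi -> rint m (fun p => w p * phi (r p *: x + c p)).
Proof.
move=> rw hphi; have [C C0 hC] := Cc_bounded hphi.
apply: (rint_le _ _ (rintZ C (rint_norm rw))).
  apply: measurable_funM; first exact: rint_measurable rw.
  exact: measurableT_comp (Cc_measurable hphi) (measurable_paff x).
by move=> p; rewrite normrM mulrC ler_wpM2r.
Qed.

(** The scale [1 + t] is unbounded on the whole parameter space and is controlled only where the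
    weight does not vanish. *)
Definition pbound (w : P -> R) := rint m w /\ forall p, w p = 0 \/ `|r p| <= rho.

Lemma pboundM w : pbound w -> pbound (fun p => w p * r p).
Proof.
move=> [rw wr]; split.
  apply: (rint_le _ _ (rintZ rho (rint_norm rw))).
    by apply: measurable_funM => //; exact: rint_measurable rw.
  move=> p; have [->|h] := wr p; first by rewrite mul0r normr0 mulr0.
  by rewrite normrM mulrC ler_wpM2r.
by move=> p; have [->|] := wr p; [left; rewrite mul0r|right].
Qed.

Lemma pint_lipschitz w phi : pbound w -> Ccoo phi ->
  exists2 L : R, 0 <= L & forall x y, `|pint w phi x - pint w phi y| <= L * `|x - y|.
Proof.
move=> [rw wr] hphi; have [L L0 hL] := Ccoo_lipschitz hphi.
exists (L * rho * \int[m]_p `|w p|); first by rewrite !mulr_ge0// Rint_ge0.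
move=> x y; have hc := Ccoo_Cc hphi; rewrite /pint -RintB; [|exact: rint_pint..].
apply: le_trans (Rint_norm _) _; first by apply: rintB; exact: rint_pint.
rewrite mulrAC -RintZ; last exact: rint_norm.
apply: Rint_le; [by apply: rint_norm; apply: rintB; exact: rint_pint|exact/rintZ/rint_norm|].
move=> p; rewrite -mulrBr normrM; have [->|h] := wr p; first by rewrite normr0 mul0r mulr0.
rewrite mulrC ler_wpM2r//; apply: le_trans (hL _ _) _.
rewrite opprD addrACA subrr addr0 -scalerBr normrZ -!mulrA ler_wpM2l//.
by rewrite ler_wpM2r.
Qed.

Lemma pint_continuous w phi : pbound w -> Ccoo phi -> continuous (pint w phi).
Proof.
move=> hw hphi; have [L L0 hL] := pint_lipschitz hw hphi.
exact: lipschitz_continuous L0 hL.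
Qed.

(** The mean value theorem and the Lipschitz bound for [partial i phi] give the explicit error
    [|h| * K], so that no convergence theorem is called for. *)
Lemma pint_derive w phi i x : pbound w -> Ccoo phi ->
  is_derive x (ei i) (pint w phi) (pint (fun p => w p * r p) (partial i phi) x).
Proof.
move=> hw hphi; have [rw wr] := hw; have hpi := Ccoo_partial i hphi.
have [L L0 hL] := Ccoo_lipschitz hpi; have [rwr _] := pboundM hw.
pose K := L * rho ^+ 2 * \int[m]_p `|w p|.
have K0 : 0 <= K by rewrite !mulr_ge0// Rint_ge0.
apply: is_deriveI => e e0; exists (e / (K + 1)); first by rewrite divr_gt0// ltr_wpDl.
move=> h h0; rewrite ltr_pdivlMr ?ltr_wpDl// => hl.
have hc := Ccoo_Cc hphi; have hpc := Ccoo_Cc hpi.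
rewrite /pint -RintB; [|exact: rint_pint..].
have rI1 : rint m (fun p => h^-1 * (w p * phi (r p *: (h *: ei i + x) + c p) - w p * phi (r p *: x + c p))).
  by apply: rintZ; apply: rintB; exact: rint_pint.
rewrite -RintZ; last by apply: rintB; exact: rint_pint.
rewrite -RintB; [|by []|exact: rint_pint].
have rI2 := rintB rI1 (rint_pint x rwr hpc).
apply: le_trans (Rint_norm rI2) _.
apply: (@le_trans _ _ (\int[m]_p (L * rho ^+ 2 * `|h| * `|w p|))).
  apply: Rint_le; [exact: rint_norm|exact/rintZ/rint_norm|].
  move=> p; have [->|hr] := wr p; first by rewrite !mul0r subrr mulr0 subrr normr0 mulr0.
  have [xi xi1 E] := MVT_line (fun z => (let: h := smooth_is_derive i z hphi.1 in @ex_derive _ _ _ _ _ _ _ h)) (r p *: x + c p) (r p * h).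
  have -> : h^-1 * (w p * phi (r p *: (h *: ei i + x) + c p) - w p * phi (r p *: x + c p)) -
      w p * r p * partial i phi (r p *: x + c p) =
      w p * (r p * (partial i phi (r p *: x + c p + xi *: ei i) - partial i phi (r p *: x + c p))).
    have -> : r p *: (h *: ei i + x) + c p = r p *: x + c p + (r p * h) *: ei i.
      by rewrite scalerDr scalerA -addrA addrC.
    by rewrite -mulrBr E -/(partial i phi _); field.
  rewrite normrM mulrC ler_wpM2r// normrM.
  apply: (@le_trans _ _ (rho * (L * (rho * `|h|)))); last by rewrite le_eqVlt; apply/orP; left; apply/eqP; ring.
  rewrite ler_pM//; apply: le_trans (hL _ _) _; rewrite ler_wpM2l//.
  rewrite addrC addKr normrZ -[leRHS]mulr1 ler_pM//; last exact: norm_ei.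
  by rewrite (le_trans xi1)// normrM ler_wpM2r.
rewrite RintZ; last exact: rint_norm.
have -> : L * rho ^+ 2 * `|h| * \int[m]_p `|w p| = `|h| * K by rewrite /K; ring.
by apply: le_trans (ltW hl); rewrite ler_wpM2l// lerDl.
Qed.

Lemma pint_partial w phi i : pbound w -> Ccoo phi ->
  partial i (pint w phi) = pint (fun p => w p * r p) (partial i phi).
Proof. by move=> hw hphi; apply: partial_val => x; exact: pint_derive. Qed.

Lemma pint_smooth w phi : pbound w -> Ccoo phi -> smooth (pint w phi).
Proof.
move=> hw hphi; apply/smooth_Ck => k; elim: k w phi hw hphi => [|k IH] w phi hw hphi.
  by split; first exact: pint_continuous.
split; first exact: pint_continuous.
move=> i; rewrite pint_partial//; split => [x|].
  exact: (@ex_derive _ _ _ _ _ _ _ (pint_derive i x hw hphi)).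
by apply: IH; [exact: pboundM|exact: Ccoo_partial].
Qed.

End parametric.

(** * A smooth function flat at the origin *)

Section bump1.
Variable R : realType.
Implicit Types (p : {poly R}) (x : R).

(** A polynomial in [1 / x] is allowed as a factor so that the family is closed under
    differentiation: with [y = 1 / x] the derivative of [p(y) exp(-y)] is
    [y ^ 2 (p - p')(y) exp(-y)], which is [flat' p]. *)
Definition flat p x : R := if 0 < x then p.[x^-1] * expR (- x^-1) else 0.

Definition flat' p : {poly R} := 'X^2 * (p - p^`()).

Lemma poly_bound p : exists2 C : R, 0 <= C & forall y, 1 <= y -> `|p.[y]| <= C * y ^+ (size p).
Proof.
exists (\sum_(i < size p) `|p`_i|); first exact: sumr_ge0.
move=> y y1; rewrite horner_coef mulr_suml; apply: le_trans (ler_norm_sum _ _ _) _.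
apply: ler_sum => i _; rewrite normrM ler_wpM2l// normrX ger0_norm ?(le_trans ler01)//.
by rewrite ler_weXn2l// ltnW.
Qed.

(** The exponential dominates [y ^ k / k!] with [k = (size p).+2], two powers more than the
    polynomial can grow; the quadratic bound is what makes the derivative at the origin vanish. *)
Lemma flat_bound p : exists2 C : R, 0 <= C & forall x, 0 < x -> x <= 1 -> `|flat p x| <= C * x ^+ 2.
Proof.
have [C C0 hC] := poly_bound p; exists (C * (size p).+2`!%:R).
  by rewrite mulr_ge0.
move=> x x0 x1; rewrite /flat x0 normrM [`|expR _|]ger0_norm ?expR_ge0//.
have y1 : 1 <= x^-1 by rewrite invf_ge1.
have y0 : 0 < x^-1 by rewrite invr_gt0.
apply: (@le_trans _ _ (C * x^-1 ^+ size p * expR (- x^-1))).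
  by rewrite ler_wpM2r ?expR_ge0// hC.
rewrite -!mulrA ler_wpM2l// expRN.
have h := expR_ge1Dxn (size p).+1 (ltW y0).
have f0 : 0 < ((size p).+2`!%:R : R) by rewrite ltr0n fact_gt0.
have {}h : x^-1 ^+ (size p).+2 <= expR x^-1 * (size p).+2`!%:R.
  by rewrite -ler_pdivrMr// (le_trans _ h)// lerDr.
have -> : x ^+ 2 = (x^-1 ^+ 2)^-1 by rewrite exprVn invrK.
rewrite ler_pdivlMr ?exprn_gt0// mulrAC -exprD addn2.
by rewrite ler_pdivrMr ?expR_gt0// mulrC.
Qed.

Lemma flat_derive p x : is_derive x (1 : R) (flat p) (flat (flat' p) x).
Proof.
have [x0|x0|->] := ltgtP x 0.
- rewrite [flat _ x]/flat ltNge (ltW x0)/=.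
  apply: (@is_deriveI R R^o) => e e0; exists (- x); first by rewrite oppr_gt0.
  move=> h h0 hl; rewrite scaler1 /flat !ltNge (ltW x0)/=.
  have -> : h + x <= 0 by move: hl; rewrite ltr_norml => /andP[]; lra.
  by rewrite /= subrr mulr0 subrr normr0 ltW.
- pose D : R := p.[x^-1] * (expR (- x^-1) * (x^-1 ^+ 2)) + expR (- x^-1) * (p^`().[x^-1] * (- (x^-1 ^+ 2))).
  have -> : flat (flat' p) x = D.
    have key (a b E y : R) : y ^+ 2 * (a - b) * E = a * (E * y ^+ 2) + E * (b * (- (y ^+ 2))) by ring.
    by rewrite /flat x0 /flat' !hornerE; exact: key.
  have xn0 : x != 0 by rewrite gt_eqF.
  have dV : is_derive x (1 : R) (fun y : R => y^-1) (- (x^-1 ^+ 2)).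
    apply: is_derive_eq (is_deriveV (f := id) xn0 (is_derive_id x (1 : R))) _.
    by change (- x ^- 2 * 1 = - x^-1 ^+ 2); rewrite mulr1 exprVn.
  have d0 : is_derive x (1 : R) (fun y : R => - y^-1) (x^-1 ^+ 2).
    by apply: is_derive_eq (is_deriveN dV) _; rewrite opprK.
  have d1 : is_derive x (1 : R) (fun y : R => expR (- y^-1)) (expR (- x^-1) * (x^-1 ^+ 2)).
    exact: (@is_derive1_comp R (@expR R) (fun y : R => - y^-1) x _ _ (is_derive_expR (- x^-1)) d0).
  have d2 : is_derive x (1 : R) (fun y : R => p.[y^-1]) (p^`().[x^-1] * (- (x^-1 ^+ 2))).
    exact: (@is_derive1_comp R (horner p) (fun y : R => y^-1) x _ _ (is_derive_poly p x^-1) dV).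
  have /is_deriveE dM : is_derive x (1 : R) (fun y : R => p.[y^-1] * expR (- y^-1)) D.
    exact: (is_deriveM d2 d1).
  apply: (@is_deriveI R R^o) => e e0; have [del del0 hd] := dM e e0.
  exists (Num.min del x); first by rewrite lt_min del0.
  move=> h h0; rewrite lt_min => /andP[h1 h2]; have := hd h h0 h1.
  rewrite /flat x0; have -> // : 0 < h *: 1 + x.
  by rewrite scaler1; move: h2; rewrite ltr_norml => /andP[]; lra.
- have [C C0 hC] := flat_bound p.
  rewrite [flat (flat' p) 0]/flat ltxx.
  apply: (@is_deriveI R R^o) => e e0; exists (Num.min 1 (e / (C + 1))).
    by rewrite lt_min ltr01 divr_gt0// ltr_wpDl.
  move=> h h0; rewrite lt_min ltr_pdivlMr ?ltr_wpDl// => /andP[h1 h2].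
  rewrite scaler1 addr0 {2}/flat ltxx !subr0.
  have [hp|hp] := ltP 0 h; last by rewrite /flat ltNge hp/= mulr0 normr0 ltW.
  rewrite normrM normfV (gtr0_norm hp) ler_pdivrMl//.
  rewrite gtr0_norm// in h1 h2.
  apply: (le_trans (hC h hp (ltW h1))); rewrite expr2 mulrCA ler_wpM2l ?(ltW hp)//.
  by rewrite mulrC (le_trans _ (ltW h2))// ler_wpM2l ?(ltW hp)// lerDl.
Qed.

Lemma flat_continuous p : continuous (flat p).
Proof.
move=> x; apply/differentiable_continuous/derivable1_diffP.
by have [] := flat_derive p x.
Qed.

Lemma flat_smooth n (i : 'I_n) p (r c : R) : smooth (fun x : 'rV[R]_n => flat p (r * x ord0 i + c)).
Proof.
apply/smooth_Ck => k; elim: k p r c => [|k IH] p r c; (split; first (move=> x; apply: (@continuous_comp _ _ _ (fun x : 'rV[R]_n => r * x ord0 i + c)); [|exact: flat_continuous])).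
- by apply: cfD; [apply: cfZ; exact: coord_continuous|exact: cst_continuous].
- by [].
- by apply: cfD; [apply: cfZ; exact: coord_continuous|exact: cst_continuous].
move=> j.
have [|h1 ->] := @partial_is_derive _ _ (fun x : 'rV[R]_n => flat p (r * x ord0 i + c))
    (fun x : 'rV[R]_n => (r * (j == i)%:R) * flat (flat' p) (r * x ord0 i + c)) j.
  move=> x; apply: is_deriveI => e e0.
  pose s := r * (j == i)%:R.
  have /is_deriveE D := @is_derive_affine R R^o (flat p) 0 (r * x ord0 i + c) s 1 _ (flat_derive p _).
  have [del del0 hd] := D e e0; exists del => // h h0 hl.
  have : `|h^-1 * (flat p (s * (h * 1 + 0) + (r * x ord0 i + c)) - flat p (s * 0 + (r * x ord0 i + c))) -
    s * flat (flat' p) (s * 0 + (r * x ord0 i + c))| <= e := hd h h0 hl.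
  rewrite mulr0 add0r !mxE/=.
  rewrite (_ : s * (h * 1 + 0) + (r * x ord0 i + c) = r * (h * (i == j)%:R + x ord0 i) + c) //.
  by rewrite /s (eq_sym i); ring.
split => //; apply: CkM; first exact: Ck_cst.
exact: IH.
Qed.

End bump1.

Lemma sqr_le (R : realDomainType) (x y : R) : `|x| <= y -> x ^+ 2 <= y ^+ 2.
Proof.
move=> xy; rewrite -real_normK ?num_real// ler_pXn2r// ?nnegrE//.
exact: le_trans xy.
Qed.

(** * Convolution with dilates *)

Section conv.
Variables (R : realType) (n : nat).
Local Notation V := 'rV[R]_n.
Local Notation mu := (lebesgueV R n).
Local Notation ei := (@ei R n).
Implicit Types (a b f g h v : V -> R) (x y z w : V) (s t e : R).

Lemma measurable_lin2 (al be : R) (c : V) :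
  measurable_fun setT (fun p : V * V => al *: p.1 + be *: p.2 + c).
Proof.
apply: measurable_fun_coordP => i.
apply: (@eq_measurable_fun _ _ _ _ _ (fun p : V * V => al * p.1 ord0 i + be * p.2 ord0 i + c ord0 i)).
  by move=> p _; rewrite !mxE.
apply: measurable_funD => //; apply: measurable_funD; apply: measurable_funM => //.
  exact: measurableT_comp (measurable_coord i) measurable_fst.
exact: measurableT_comp (measurable_coord i) measurable_snd.
Qed.

(** The kernels for which the order of integration may be exchanged without further
    justification. *)
Definition tame (F : V * V -> R) := [/\ measurable_fun setT F, exists C : R, forall p, `|F p| <= C &
  exists M : R, forall x z, M <= `|x| \/ M <= `|z| -> F (x, z) = 0].

Let tame0 F M : (forall x z, M <= `|x| \/ M <= `|z| -> F (x, z) = 0 :> R) ->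
  forall x z : V, ~ ([set x : V | `|x| < M] x /\ [set x : V | `|x| < M] z) -> F (x, z) = 0.
Proof.
move=> FM x z /= xz; apply: FM.
have [|xM] := leP M `|x|; [by left|have [|zM] := leP M `|z|; [by right|]].
by exfalso; exact: xz.
Qed.

Lemma VFubini F : tame F -> \int[mu]_x \int[mu]_z F (x, z) = \int[mu]_z \int[mu]_x F (x, z).
Proof.
move=> [mF [C FC] [M FM]]; have mA := @measurable_nball R n M; have fA := @nball_fin R n M.
exact: (@Rfubini _ _ _ _ R mu mu F _ _ C mA mA fA fA mF FC (tame0 FM)).
Qed.

Lemma rint_tame1 F : tame F -> rint mu (fun x => \int[mu]_z F (x, z)).
Proof.
move=> [mF [C FC] [M FM]]; have mA := @measurable_nball R n M; have fA := @nball_fin R n M.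
exact: (@rint_fubini1 _ _ _ _ R mu mu F _ _ C mA mA fA fA mF FC (tame0 FM)).
Qed.

Lemma rint_tame_fst F x : tame F -> rint mu (fun z => F (x, z)).
Proof.
move=> [mF [C FC] [M FM]]; have mA := @measurable_nball R n M; have fA := @nball_fin R n M.
exact: (@rint_fst _ _ _ _ R mu F _ _ C mA fA mF FC (tame0 FM)).
Qed.

Lemma measurable_Cc2 b (al be : R) (c : V) : Cc b ->
  measurable_fun setT (fun p : V * V => b (al *: p.1 + be *: p.2 + c)).
Proof. by move=> hb; exact: measurableT_comp (Cc_measurable hb) (measurable_lin2 al be c). Qed.

(* The second argument of [b] can only be bounded away through [a] or [h]; the
   coefficient of the remaining variable must therefore be nonzero. *)
Lemma tame3 a b (al be : R) c : Cc a -> Cc b -> al != 0 ->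
  tame (fun p : V * V => a p.2 * b (al *: p.1 + be *: p.2 + c)).
Proof.
move=> ha hb al0; split.
- apply: measurable_funM; last exact: measurable_Cc2.
  exact: measurableT_comp (Cc_measurable ha) measurable_snd.
- have [A A0 hA] := Cc_bounded ha; have [B B0 hB] := Cc_bounded hb.
  by exists (A * B) => p; rewrite normrM ler_pM.
have [M M0 hM] := Cc_supp ha; have [N N0 hN] := Cc_supp hb.
pose K := (N + `|be| * M + `|c|) / `|al|.
have al1 : 0 < `|al| by rewrite normr_gt0.
have K0 : 0 <= K by rewrite divr_ge0// !addr_ge0// ?mulr_ge0// ltW.
exists (M + K) => x z /= H; have [zM|zM] := leP M `|z|; first by rewrite hM// mul0r.
rewrite [b _]hN ?mulr0//; case: H => H; last first.
  by exfalso; move: zM; rewrite ltNge (le_trans _ H)// lerDl.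
have {}H : N + `|be| * M + `|c| <= `|al *: x|.
  have : K <= `|x| by rewrite (le_trans _ H)// lerDr ltW.
  by rewrite /K ler_pdivrMr// normrZ [X in _ <= X]mulrC.
have -> : al *: x + be *: z + c = al *: x - (- (be *: z + c)) by rewrite opprK addrA.
apply: le_trans (lerB_dist _ _); rewrite lerBrDr normrN.
apply: le_trans H; rewrite -addrA lerD2l (le_trans (ler_normD _ _))// lerD2r normrZ.
by rewrite ler_wpM2l// ltW.
Qed.

Lemma tameM1 F h : tame F -> measurable_fun setT h -> (exists C : R, forall x, `|h x| <= C) ->
  tame (fun p : V * V => h p.1 * F p).
Proof.
move=> [mF [C FC] [M FM]] mh [B hB]; split.
- by apply: measurable_funM => //; exact: measurableT_comp mh measurable_fst.
- by exists (B * C) => p; rewrite normrM ler_pM.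
by exists M => x z H; rewrite /= FM// mulr0.
Qed.

Lemma tameM1_Cc F h : tame F -> Cc h -> tame (fun p : V * V => h p.1 * F p).
Proof.
move=> tF hh; apply: tameM1 => //; first exact: Cc_measurable.
by have [B B0 hB] := Cc_bounded hh; exists B.
Qed.

Lemma tame2 a b v (al be : R) c : Cc a -> Cc b -> Cc v ->
  tame (fun p : V * V => a p.2 * (b p.1 * v (al *: p.1 + be *: p.2 + c))).
Proof.
move=> ha hb hv; have [A A0 hA] := Cc_bounded ha; have [B B0 hB] := Cc_bounded hb.
have [D D0 hD] := Cc_bounded hv.
have [M M0 hM] := Cc_supp ha; have [N N0 hN] := Cc_supp hb; split.
- apply: measurable_funM; first exact: measurableT_comp (Cc_measurable ha) measurable_snd.
  apply: measurable_funM; last exact: measurable_Cc2.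
  exact: measurableT_comp (Cc_measurable hb) measurable_fst.
- by exists (A * (B * D)) => p; rewrite !normrM ler_pM// ler_pM.
exists (Num.max M N) => x z [] /=; rewrite ge_max => /andP[h1 h2].
  by rewrite (hN x)// mul0r mulr0.
by rewrite (hM z)// mul0r.
Qed.

(* Convolution of [b] with the dilate [z |-> t ^- n * a (t^-1 *: z)], written after rescaling so
   that [t = 0] and [t < 0] make sense. *)
Definition cv t a b x : R := \int[mu]_z (a z * b (x - t *: z)).

Lemma cvE t a b : cv t a b = pint mu (fun=> 1) (fun z => - (t *: z)) a b.
Proof. by apply/funext => x; apply: eq_Rintegral => z _; rewrite scale1r. Qed.

Let mc t : measurable_fun setT (fun z : V => - (t *: z)).
Proof.
have := measurable_affine (- t) (0 : V); under eq_fun do rewrite addr0 scaleNr; exact.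
Qed.

Let pb t a : Cc a -> pbound mu (fun=> 1) 1 a.
Proof. by move=> ha; split; [exact: Cc_rint|right; rewrite normr1]. Qed.

Let m1 : measurable_fun setT ((fun=> 1) : V -> R).
Proof. exact: measurable_cst. Qed.

Lemma cv_smooth t a b : Cc a -> Ccoo b -> smooth (cv t a b).
Proof. move=> ha hb; rewrite cvE; exact: (pint_smooth m1 (mc t) ler01 (pb t ha) hb). Qed.

Lemma cv_Ccoo t a b : Cc a -> Ccoo b -> Ccoo (cv t a b).
Proof.
move=> ha hb; split; first exact: cv_smooth.
have [M M0 hM] := Cc_supp ha; have [N N0 hN] := Cc_supp (Ccoo_Cc hb).
exists (N + `|t| * M) => x hx; rewrite /cv -(Rintegral_zero mu); apply: eq_Rintegral => z _.
have [zM|zM] := leP M `|z|; first by rewrite hM// mul0r.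
rewrite hN ?mulr0//; apply: le_trans (lerB_dist _ _); rewrite lerBrDr.
by apply: le_trans hx; rewrite lerD2l normrZ ler_wpM2l// ltW.
Qed.

Lemma Cc_sub t b x : Cc b -> t != 0 -> Cc (fun z => b (x - t *: z)).
Proof.
move=> hb t0; have := @Cc_affine R n (- t) x b; rewrite oppr_eq0 => /(_ t0 hb).
by under eq_fun do rewrite addrC scaleNr.
Qed.

Lemma rint_cv t a b x : Cc a -> Cc b -> rint mu (fun z => a z * b (x - t *: z)).
Proof.
move=> ha hb; have := rint_tame_fst x (tame3 (- t) 0 ha hb (oner_neq0 R)).
by apply: eq_integrable => // z _ /=; rewrite scale1r addr0 scaleNr.
Qed.

(** Integration by parts in [z], where [b (x - t *: z)] has derivative [- t] times that of [b]:
    moving a derivative onto a kernel at scale [t] costs [1 / t]. *)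
Lemma cv_ibp t a b i x : Ccoo a -> Ccoo b -> t * cv t a (partial i b) x = cv t (partial i a) b x.
Proof.
move=> ha hb; rewrite /cv.
have sb : smooth (fun z => b (- t *: z + x)) by apply: smooth_affine; case: hb.
have -> : \int[mu]_z (partial i a z * b (x - t *: z)) =
    \int[mu]_z (partial i a z * (fun z => b (- t *: z + x)) z).
  by apply: eq_Rintegral => z _; rewrite scaleNr addrC.
rewrite IBP// partial_affine; last by case: hb.
rewrite -RintZ; last by apply: rint_cv; [exact: Ccoo_Cc|exact/Ccoo_Cc/Ccoo_partial].
rewrite -RintN; last first.
  apply: Cc_rint; apply: CcMl; first exact: Ccoo_Cc.
  by apply: smooth_continuous; have := smooth_partial i sb; rewrite partial_affine; case: hb.
by apply: eq_Rintegral => z _; rewrite scaleNr [x - _]addrC; ring.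
Qed.

(** Taking the adjoint reflects the kernel, which is here a change of sign of the scale. *)
Lemma cv_adjoint t a g h : Cc a -> Cc g -> Cc h ->
  \int[mu]_x (cv t a g x * h x) = \int[mu]_x (g x * cv (- t) a h x).
Proof.
move=> ha hg hh.
have T1 := tameM1_Cc (tame3 (- t) 0 ha hg (oner_neq0 R)) hh.
have T2 := tameM1_Cc (tame3 t 0 ha hh (oner_neq0 R)) hg.
transitivity (\int[mu]_x \int[mu]_z (h x * (a z * g (1 *: x + - t *: z + 0)))).
  apply: eq_Rintegral => x _; rewrite mulrC /cv -RintZ; last exact: rint_cv.
  by apply: eq_Rintegral => z _; rewrite scale1r addr0 scaleNr.
rewrite (VFubini T1).
transitivity (\int[mu]_x \int[mu]_z (g x * (a z * h (1 *: x + t *: z + 0)))); last first.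
  apply: eq_Rintegral => x _; rewrite /cv -RintZ; last exact: rint_cv.
  by apply: eq_Rintegral => z _; rewrite scale1r addr0 scaleNr opprK.
rewrite (VFubini T2); apply: eq_Rintegral => z _ /=.
rewrite (Rint_affine (t *: z) (oner_neq0 R)).
  rewrite normr1 expr1n mul1r; apply: eq_Rintegral => x _.
  by rewrite !scale1r !addr0 scaleNr addrK mulrCA mulrA mulrC.
apply: Cc_rint; apply: CcM => //; apply: CcZ.
have := @Cc_sub 1 g; under [fun z => g _]eq_fun do rewrite addrAC.
have := Cc_affine (- t *: z) (oner_neq0 R) hg.
by under [X in _ -> _ -> Cc X]eq_fun do rewrite addr0.
Qed.

(** Two successive convolutions at scales [e * t] and [t] are a single one at scale [t], whose
    kernel depends only on the ratio [e]. For [e = 1] this factors the kernel of a singular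
    integral; for small [e] it measures how nearly orthogonal two scales are. *)
Lemma cv_assoc e t a b v x : Cc a -> Ccoo b -> Ccoo v ->
  cv (e * t) a (cv t b v) x = cv t (cv e a b) v x.
Proof.
move=> ha hb hv.
have hb' := Ccoo_Cc hb; have hv' := Ccoo_Cc hv.
have T : tame (fun p : V * V => v (x - t *: p.1) * (a p.2 * b (1 *: p.1 + - e *: p.2 + 0))).
  apply: (@tameM1 (fun p : V * V => a p.2 * b (1 *: p.1 + - e *: p.2 + 0)) (fun w => v (x - t *: w))).
  - exact: tame3 ha hb' (oner_neq0 R).
  - have := measurableT_comp (Cc_measurable hv') (measurable_affine (- t) x).
    by apply: eq_measurable_fun => w _ /=; rewrite scaleNr addrC.
  - by have [D D0 hD] := Cc_bounded hv'; exists D.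
transitivity (\int[mu]_z \int[mu]_w (v (x - t *: w) * (a z * b (1 *: w + - e *: z + 0)))).
  apply: eq_Rintegral => z _; rewrite {1}/cv.
  rewrite (Rint_affine (- e *: z) (oner_neq0 R)); last exact: rint_cv.
  rewrite normr1 expr1n mul1r -RintZ; last first.
    have := rint_affine (- e *: z) (oner_neq0 R) (rint_cv t (x - (e * t) *: z) hb' hv').
    by [].
  apply: eq_Rintegral => w _; rewrite !scale1r addr0 scaleNr scalerDr scalerN scalerA.
  have -> : x - (e * t) *: z - (t *: w - (t * e) *: z) = x - t *: w.
    by rewrite opprB addrA mulrC subrK.
  by rewrite mulrA mulrC.
rewrite -(VFubini T); apply: eq_Rintegral => w _ /=.
rewrite mulrC /cv RintZ; last exact: (rint_tame_fst w (tame3 (- e) 0 ha hb' (oner_neq0 R))).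
congr (_ * _); apply: eq_Rintegral => z _.
by rewrite scale1r addr0 scaleNr.
Qed.

Lemma cv_comm s t a b v x : Cc a -> Cc b -> Cc v ->
  cv s a (cv t b v) x = cv t b (cv s a v) x.
Proof.
move=> ha hb hv.
have T := tame2 (- t) (- s) x ha hb hv.
transitivity (\int[mu]_z \int[mu]_w (a z * (b w * v (- t *: w + - s *: z + x)))).
  apply: eq_Rintegral => z _; rewrite /cv -RintZ; last exact: rint_cv.
  by apply: eq_Rintegral => w _; rewrite !scaleNr addrC addrA addrAC.
rewrite -(VFubini T); apply: eq_Rintegral => w _ /=; rewrite /cv -RintZ; last exact: rint_cv.
by apply: eq_Rintegral => z _; rewrite mulrCA !scaleNr addrC addrA.
Qed.

Lemma L1_sub t b x : Cc b -> 0 < t -> \int[mu]_z `|b (x - t *: z)| = t ^- n * L1 b.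
Proof.
move=> hb t0; have tn0 : - t != 0 by rewrite oppr_eq0 gt_eqF.
rewrite /L1 [X in _ * X](Rint_affine x tn0); last exact/Cc_rint/Cc_abs.
rewrite normrN gtr0_norm// mulrA mulVf ?mul1r ?expf_neq0 ?gt_eqF//.
by apply: eq_Rintegral => z _; rewrite scaleNr addrC.
Qed.

Lemma young1 t a g : Cc a -> Ccoo g -> nrm (cv t a g) <= L1 a * nrm g.
Proof.
move=> ha hg; have hg' := Ccoo_Cc hg.
rewrite -(@ler_pXn2r _ 2)// ?nnegrE ?mulr_ge0 ?nrm_ge0 ?L1_ge0//.
have hcv := Ccoo_Cc (cv_Ccoo t ha hg).
have T : tame (fun p : V * V => `|a p.2| * (g (1 *: p.1 + - t *: p.2 + 0)) ^+ 2).
  exact: (tame3 (- t) 0 (Cc_abs ha) (Cc_sqr hg') (oner_neq0 R)).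
rewrite nrm_sqr exprMn; apply: (@le_trans _ _ (\int[mu]_x (L1 a * \int[mu]_z (`|a z| * g (1 *: x + - t *: z + 0) ^+ 2)))).
  apply: Rint_le; [exact/Cc_rint/Cc_sqr|exact/rintZ/(rint_tame1 T)|move=> x].
  have ra : rint mu (fun z => `|a z| * g (x - t *: z)) by exact: (rint_cv t x (Cc_abs ha) hg').
  have ra2 : rint mu (fun z => `|a z| * g (x - t *: z) ^+ 2) by exact: (rint_cv t x (Cc_abs ha) (Cc_sqr hg')).
  have ra1 : rint mu (fun z => `|a z| * `|g (x - t *: z)|) by exact: (rint_cv t x (Cc_abs ha) (Cc_abs hg')).
  apply: (@le_trans _ _ ((\int[mu]_z (`|a z| * `|g (x - t *: z)|)) ^+ 2)).
    apply: sqr_le; rewrite /cv (le_trans (Rint_norm (rint_cv t x ha hg')))//.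
    by rewrite le_eqVlt; apply/orP; left; apply/eqP/eq_Rintegral => z _; rewrite normrM.
  have ra2' : rint mu (fun z => `|a z| * `|g (x - t *: z)| ^+ 2).
    by apply: eq_integrable ra2 => // z _; rewrite /= real_normK ?num_real.
  have := Rint_CSw (fun z => normr_ge0 _) (Cc_rint (Cc_abs ha)) ra1 ra2'.
  move=> /le_trans; apply; rewrite le_eqVlt; apply/orP; left; apply/eqP; congr (_ * _).
  by apply: eq_Rintegral => z _; rewrite real_normK ?num_real// scale1r addr0 scaleNr.
rewrite RintZ; last exact: (rint_tame1 T).
rewrite (VFubini T) expr2 -mulrA ler_wpM2l ?L1_ge0//.
rewrite nrm_sqr mulrC -RintZ; last exact/Cc_rint/Cc_abs.
rewrite le_eqVlt; apply/orP; left; apply/eqP/eq_Rintegral => z _ /=.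
rewrite RintZ; last first.
  by apply: Cc_rint; under eq_fun do rewrite addr0; exact: (Cc_affine _ (oner_neq0 R) (Cc_sqr hg')).
rewrite mulrC [in RHS](Rint_affine (- t *: z) (oner_neq0 R)); last exact/Cc_rint/Cc_sqr.
by rewrite normr1 expr1n mul1r; congr (_ * _); apply: eq_Rintegral => x _; rewrite addr0.
Qed.

(** Young's inequality with the roles exchanged: the weight is now [z |-> g (x - t *: z)], of L1
    norm [t ^- n * L1 g]. Against [young1], which is uniform in [t], it puts the L2 norm on [a] at
    the price of a power of [t]; the two are balanced later. *)
Lemma young2 t a g : 0 < t -> Cc a -> Ccoo g ->
  nrm (cv t a g) ^+ 2 <= t ^- n * L1 g ^+ 2 * nrm a ^+ 2.
Proof.
move=> t0 ha hg; have hg' := Ccoo_Cc hg.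
have hcv := Ccoo_Cc (cv_Ccoo t ha hg).
have T : tame (fun p : V * V => (a p.2) ^+ 2 * `|g (1 *: p.1 + - t *: p.2 + 0)|).
  exact: (tame3 (- t) 0 (Cc_sqr ha) (Cc_abs hg') (oner_neq0 R)).
rewrite nrm_sqr; apply: (@le_trans _ _ (\int[mu]_x (t ^- n * L1 g * \int[mu]_z (a z ^+ 2 * `|g (1 *: x + - t *: z + 0)|)))).
  apply: Rint_le; [exact/Cc_rint/Cc_sqr|exact/rintZ/(rint_tame1 T)|move=> x].
  have ra1 : rint mu (fun z => `|g (x - t *: z)| * `|a z|).
    by have := rint_cv t x (Cc_abs ha) (Cc_abs hg'); apply: eq_integrable => // z _ /=; rewrite mulrC.
  have ra2 : rint mu (fun z => `|g (x - t *: z)| * `|a z| ^+ 2).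
    have := rint_cv t x (Cc_sqr ha) (Cc_abs hg'); apply: eq_integrable => // z _ /=.
    by rewrite mulrC real_normK ?num_real.
  have rg : rint mu (fun z => `|g (x - t *: z)|).
    by apply: Cc_rint; apply: Cc_abs; apply: Cc_sub => //; rewrite gt_eqF.
  apply: (@le_trans _ _ ((\int[mu]_z (`|g (x - t *: z)| * `|a z|)) ^+ 2)).
    apply: sqr_le; rewrite /cv (le_trans (Rint_norm (rint_cv t x ha hg')))//.
    by rewrite le_eqVlt; apply/orP; left; apply/eqP/eq_Rintegral => z _; rewrite normrM mulrC.
  have := @Rint_CSw _ _ _ mu (fun z => `|g (x - t *: z)|) (fun z => `|a z|) (fun z => normr_ge0 _) rg ra1 ra2.
  rewrite (L1_sub x hg' t0) => /le_trans; apply.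
  rewrite le_eqVlt; apply/orP; left; apply/eqP; congr (_ * _); apply: eq_Rintegral => z _.
  by rewrite mulrC real_normK ?num_real// scale1r addr0 scaleNr.
rewrite RintZ; last exact: (rint_tame1 T).
rewrite (VFubini T) expr2 -!mulrA ler_wpM2l ?invr_ge0 ?exprn_ge0 ?(ltW t0)// ler_wpM2l ?L1_ge0//.
rewrite nrm_sqr -RintZ; last exact/Cc_rint/Cc_sqr.
rewrite le_eqVlt; apply/orP; left; apply/eqP/eq_Rintegral => z _ /=.
rewrite RintZ; last first.
  apply: Cc_rint; apply: Cc_abs; under eq_fun do rewrite addr0.
  exact: (Cc_affine _ (oner_neq0 R) hg').
rewrite mulrC /L1 [in RHS](Rint_affine (- t *: z) (oner_neq0 R)); last exact/Cc_rint/Cc_abs.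
by rewrite normr1 expr1n mul1r; congr (_ * _); apply: eq_Rintegral => x _; rewrite addr0.
Qed.

End conv.

(** * Square functions and the bilinear estimate *)

Section geom.
Variable R : realFieldType.
Local Notation hf := (2^-1 : R).

Lemma geom_half N : \sum_(l < N) hf ^+ l <= 2.
Proof.
suff -> : \sum_(l < N) hf ^+ l = 2 - 2 * hf ^+ N by rewrite gerBl mulr_ge0// exprn_ge0.
elim: N => [|N IH]; first by rewrite big_ord0 expr0; lra.
by rewrite big_ord_recr /= IH exprS; field.
Qed.

(** This is [2 ^ (- |m - p|)]: one of the two truncated differences is always zero. *)
Definition hw (p m : nat) : R := hf ^+ (m - p) * hf ^+ (p - m).

Lemma hwC p m : hw p m = hw m p. Proof. by rewrite /hw mulrC. Qed.

Lemma hw_ge0 p m : 0 <= hw p m. Proof. by rewrite mulr_ge0// exprn_ge0. Qed.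

Lemma hwE p m : (p <= m)%N -> hw p m = hf ^+ (m - p).
Proof. by move=> pm; rewrite /hw; move/eqP: pm => ->; rewrite mulr1. Qed.

Lemma sum_hw p N : \sum_(m < N) hw p m <= 3.
Proof.
(* A form that passes through the induction: the terms below [p] add up to less than [1], those from
   [p] on to less than [2]. *)
suff : \sum_(m < N) hw p m <= if (N <= p)%N then hf ^+ (p - N) else 3 - 2 * hf ^+ (N - p).
  case: ifP => _ /le_trans; apply; last by rewrite gerBl mulr_ge0// exprn_ge0.
  have : hf ^+ (p - N) <= 1 by rewrite exprn_ile1//; lra.
  lra.
elim: N => [|N IH]; first by rewrite big_ord0 leq0n exprn_ge0.
rewrite big_ord_recr/=; apply: (le_trans (lerD IH (lexx _))).
have [Np|pN] := ltnP N p.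
  rewrite (ltnW Np) hwC hwE ?(ltnW Np)// -(subnSK Np) exprS.
  by rewrite le_eqVlt; apply/orP; left; apply/eqP; field.
rewrite hwE//; case: ltngtP pN => // [pN _|<- _].
  rewrite (subSn (ltnW pN)) exprS.
  by rewrite le_eqVlt; apply/orP; left; apply/eqP; field.
rewrite subnn subSnn expr0 expr1; lra.
Qed.

Lemma sum_CS (I : Type) (s : seq I) (w x y : I -> R) : (forall i, 0 <= w i) ->
  (\sum_(i <- s) w i * (x i * y i)) ^+ 2 <=
  (\sum_(i <- s) w i * x i ^+ 2) * (\sum_(i <- s) w i * y i ^+ 2).
Proof.
move=> w0; apply: discriminant_le => [|t].
  by apply: sumr_ge0 => i _; rewrite mulr_ge0// sqr_ge0.
rewrite mulr_sumr mulr_sumr -!big_split/=; apply: sumr_ge0 => i _.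
rewrite [leRHS](_ : _ = w i * (x i + t * y i) ^+ 2); last by ring.
by rewrite mulr_ge0// sqr_ge0.
Qed.

End geom.

Section square_function.
Variables (R : realType) (n : nat).
Local Notation V := 'rV[R]_n.
Local Notation mu := (lebesgueV R n).
Local Notation hf := (2^-1 : R).
Implicit Types (a b f g h v k : V -> R) (x y z w : V) (s t e : R).

Lemma Rint_mulC a b : \int[mu]_x (a x * b x) = \int[mu]_x (b x * a x).
Proof. by apply: eq_Rintegral => x _; rewrite mulrC. Qed.

Definition mean0 k := \int[mu]_x k x = 0.

(** Since [k] has mean zero, the constant [k x] may be subtracted under the integral; the Lipschitz
    bound then gains a factor [e]. The result lives in the ball of radius [M + M] as long as
    [e <= 1]. *)
Lemma L1_cv_mean0 k : Ccoo k -> mean0 k ->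
  exists2 C : R, 0 <= C & forall e, 0 <= e -> e <= 1 -> L1 (cv (- e) k k) <= C * e.
Proof.
move=> hk k0; have hk' := Ccoo_Cc hk; have [L L0 hL] := Ccoo_lipschitz hk.
have [M M0 hM] := Cc_supp hk'.
set m := fine (mu [set x : V | (`|x| < M + M)%R]).
exists (L * M * L1 k * m); first by rewrite !mulr_ge0 ?L1_ge0 ?fine_ge0 ?(ltW M0).
move=> e e0 e1; rewrite -mulrA [m * e]mulrC mulrA.
apply: Rint_bounded_le.
- exact: measurable_nball.
- exact: nball_fin.
- exact: (Cc_measurable (Ccoo_Cc (cv_Ccoo _ hk' hk))).
- move=> x; have -> : cv (- e) k k x = \int[mu]_z (k z * (k (x - - e *: z) - k x)).
    transitivity (\int[mu]_z (k z * k (x - - e *: z) - k x * k z)).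
      rewrite RintB; [|exact: rint_cv|exact/Cc_rint/CcZ].
      by rewrite RintZ; [rewrite k0 mulr0 subr0|exact: Cc_rint].
    by apply: eq_Rintegral => z _; rewrite mulrBr; congr (_ - _); rewrite mulrC.
  have r1 : rint mu (fun z => k z * (k (x - - e *: z) - k x)).
    have := rintB (rint_cv (- e) x hk' hk') (Cc_rint (CcZ (k x) hk')).
    by apply: eq_integrable => // z _ /=; rewrite mulrBr [k x * _]mulrC.
  apply: le_trans (Rint_norm r1) _.
  apply: (@le_trans _ _ (\int[mu]_z (L * M * e * `|k z|))).
    apply: Rint_le; [exact: rint_norm|exact/rintZ/Cc_rint/Cc_abs|move=> z].
    have [zM|zM] := leP M `|z|; first by rewrite hM// mul0r normr0 mulr0.
    rewrite normrM mulrC ler_wpM2r//; apply: le_trans (hL _ _) _.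
    rewrite scaleNr opprK addrC addKr normrZ (ger0_norm e0) -!mulrA ler_wpM2l//.
    by rewrite mulrC ler_wpM2r// ltW.
  rewrite RintZ; last exact/Cc_rint/Cc_abs.
  by rewrite -!mulrA; do 2 (rewrite ler_wpM2l ?(ltW M0)//); rewrite mulrC.
- move=> x /= /negP; rewrite -leNgt => hx; rewrite /cv -(Rintegral_zero mu).
  apply: eq_Rintegral => z _; have [zM|zM] := leP M `|z|; first by rewrite hM// mul0r.
  rewrite (hM (_ - _)) ?mulr0//; apply: le_trans (lerB_dist _ _); rewrite lerBrDr.
  apply: le_trans hx; rewrite lerD2l scaleNr normrN normrZ (ger0_norm e0).
  by rewrite -[leRHS]mul1r ler_pM// ltW.
Qed.

Local Opaque cv nrm L1.

(** By adjunction and associativity the pairing is that of [a] with a convolution of [b] by the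
    kernel [cv (- (s / t)) k k], whose L1 norm is of order [s / t]. *)
Lemma cv_almost_orth k : Ccoo k -> mean0 k ->
  exists2 C : R, 0 <= C & forall s t a b, 0 < s -> s <= t -> Ccoo a -> Ccoo b ->
  `|\int[mu]_x (cv (- s) k a x * cv (- t) k b x)| <= C * (s / t) * (nrm a * nrm b).
Proof.
move=> hk k0; have hk' := Ccoo_Cc hk; have [C C0 hC] := L1_cv_mean0 hk k0.
exists C => // s t a b s0 st ha hb.
have t0 : 0 < t by exact: lt_le_trans st.
have hcb := cv_Ccoo (- t) hk' hb.
rewrite cv_adjoint//; [|exact: Ccoo_Cc..].
rewrite opprK.
have -> : \int[mu]_x (a x * cv s k (cv (- t) k b) x) =
    \int[mu]_x (a x * cv (- t) (cv (- (s / t)) k k) b x).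
  apply: eq_Rintegral => x _; rewrite -(cv_assoc (- (s / t)) (- t) x hk' hk hb).
  by rewrite mulrNN divfK// gt_eqF.
have hkk := cv_Ccoo (- (s / t)) hk' hk.
apply: (le_trans (Cc_CS (Ccoo_Cc ha) (Ccoo_Cc (cv_Ccoo _ (Ccoo_Cc hkk) hb)))).
rewrite mulrCA ler_wpM2l ?nrm_ge0//.
apply: le_trans (young1 _ (Ccoo_Cc hkk) hb) _; rewrite ler_wpM2r ?nrm_ge0//.
by apply: hC; rewrite ?divr_ge0 ?(ltW s0) ?(ltW t0)// ler_pdivrMr// mul1r.
Qed.

(** To be read with [Y p] the adjoint of an operator applied to its own value at [g], and [b p] the
    norm of that value. If [S] is the sum and [y] the sum of the [Y p], then [S <= nrm g * nrm y],
    while almost orthogonality and [2 u v <= u ^ 2 + v ^ 2] give [nrm y ^+ 2 <= 3 * K * S]; one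
    factor [S] cancels. The [3] bounds the rows of [hw]. *)
Lemma TTstar (N : nat) (Y : nat -> V -> R) (b : nat -> R) (K : R) g :
  Ccoo g -> (forall p, Ccoo (Y p)) -> (forall p, 0 <= b p) -> 0 <= K ->
  (forall p, \int[mu]_x (g x * Y p x) = b p ^+ 2) ->
  (forall p m, \int[mu]_x (Y p x * Y m x) <= K * hw R p m * (b p * b m)) ->
  \sum_(p < N) b p ^+ 2 <= 3 * K * nrm g ^+ 2.
Proof.
move=> hg hY b0 K0 gY pair.
set S := \sum_(p < N) _; have S0 : 0 <= S by apply: sumr_ge0 => p _; exact: sqr_ge0.
pose y x := \sum_(p < N) Y p x; have hy : Ccoo y by exact: Ccoo_sum.
have SE : S = \int[mu]_x (g x * y x).
  rewrite /y; under eq_Rintegral do rewrite mulr_sumr.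
  rewrite Rint_sum; last by move=> p; apply: Cc_rint; apply: CcM; exact: Ccoo_Cc.
  by apply: eq_bigr => p _; rewrite gY.
have yS : nrm y ^+ 2 <= 3 * K * S.
  rewrite nrm_sqr.
  have -> : \int[mu]_x (y x ^+ 2) = \sum_(p < N) \sum_(m < N) \int[mu]_x (Y p x * Y m x).
    transitivity (\int[mu]_x \sum_(p < N) \sum_(m < N) Y p x * Y m x).
      apply: eq_Rintegral => x _; rewrite /y expr2 mulr_suml; apply: eq_bigr => p _.
      by rewrite mulr_sumr.
    have rI p m : rint mu (fun x => Y p x * Y m x) by apply: Cc_rint; apply: CcM; exact: Ccoo_Cc.
    rewrite Rint_sum; last by move=> p; apply: rint_sum => m; exact: rI.
    by apply: eq_bigr => p _; rewrite Rint_sum.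
  apply: (@le_trans _ _ (\sum_(p < N) \sum_(m < N) (K / 2 * (hw R p m * b p ^+ 2) + K / 2 * (hw R m p * b m ^+ 2)))).
    apply: ler_sum => p _; apply: ler_sum => m _; apply: le_trans (pair p m) _.
    rewrite [hw R m p]hwC -subr_ge0.
    have key (q u v : R) : K / 2 * (q * u ^+ 2) + K / 2 * (q * v ^+ 2) - K * q * (u * v) =
      K / 2 * (q * (u - v) ^+ 2) by field.
    by rewrite key mulr_ge0 ?divr_ge0// mulr_ge0 ?hw_ge0// sqr_ge0.
  have H : \sum_(p < N) \sum_(m < N) K / 2 * (hw R p m * b p ^+ 2) <= 3 * (K / 2) * S.
    rewrite mulr_sumr; apply: ler_sum => p _.
    have D0 : 0 <= K / 2 by rewrite divr_ge0.
    move: (K / 2) D0 => D D0; rewrite -mulr_sumr -mulr_suml [3 * D]mulrC -mulrA ler_wpM2l// ler_wpM2r ?sqr_ge0//.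
    exact: sum_hw.
  under eq_bigr do rewrite big_split/=.
  rewrite big_split/= [X in _ + X]exchange_big/=.
  have key (u : R) : 3 * K * u = 3 * (K / 2) * u + 3 * (K / 2) * u by field.
  by rewrite key; exact: lerD.
have : S ^+ 2 <= 3 * K * nrm g ^+ 2 * S.
  have : S <= nrm g * nrm y.
    by rewrite SE (le_trans (ler_norm _))// Cc_CS//; exact: Ccoo_Cc.
  move=> h1; apply: (@le_trans _ _ (nrm g ^+ 2 * nrm y ^+ 2)).
    by rewrite -exprMn sqr_le// ger0_norm.
  have key (u v : R) : 3 * K * u * v = u * (3 * K * v) by ring.
  by rewrite key ler_wpM2l ?sqr_ge0.
have [->|S1] := eqVneq S 0; first by move=> _; apply: mulr_ge0; [exact: mulr_ge0|exact: sqr_ge0].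
by rewrite expr2 ler_pM2r// lt_def S1.
Qed.

(* The factor [2] is room for scales that are dyadic only up to a factor in [1/2, 1]. *)
Lemma square_function k : Ccoo k -> mean0 k ->
  exists2 C : R, 0 <= C & forall (N : nat) (sg : nat -> R) g, Ccoo g -> (forall p, 0 < sg p) ->
  (forall p m, (p <= m)%N -> sg m <= 2 * hf ^+ (m - p) * sg p) ->
  \sum_(p < N) nrm (cv (sg p) k g) ^+ 2 <= C * nrm g ^+ 2.
Proof.
move=> hk k0; have hk' := Ccoo_Cc hk; have [C C0 hC] := cv_almost_orth hk k0.
exists (3 * (2 * C)); first by rewrite !mulr_ge0.
move=> N sg g hg sg0 hsg.
have hX p : Ccoo (cv (sg p) k g) by exact: cv_Ccoo.
apply: (@TTstar N (fun p => cv (- sg p) k (cv (sg p) k g)) (fun p => nrm (cv (sg p) k g)) _ g hg).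
- by move=> p; exact: cv_Ccoo.
- by move=> p; exact: nrm_ge0.
- by rewrite mulr_ge0.
- move=> p; rewrite -cv_adjoint//; [|exact: Ccoo_Cc..].
  by rewrite nrm_sqr; apply: eq_Rintegral => x _; rewrite expr2.
have mr (u v : R) : 0 < u -> u <= v -> u / v <= v / u.
  move=> u0 uv; have v0 := lt_le_trans u0 uv.
  by rewrite (@le_trans _ _ 1)// ?ler_pdivrMr ?mul1r// ler_pdivlMr ?mul1r.
have H p m : `|\int[mu]_x (cv (- sg p) k (cv (sg p) k g) x * cv (- sg m) k (cv (sg m) k g) x)| <=
    C * Num.min (sg p / sg m) (sg m / sg p) * (nrm (cv (sg p) k g) * nrm (cv (sg m) k g)).
  have [le|le] := leP (sg p) (sg m).
    by rewrite min_l; [exact: hC|exact: mr].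
  rewrite min_r; last by apply: mr => //; exact: ltW.
  rewrite (Rint_mulC (cv (- sg p) k (cv (sg p) k g))) (mulrC (nrm (cv (sg p) k g))).
  exact: (hC _ _ _ _ (sg0 m) (ltW le) (hX m) (hX p)).
move=> p m; apply: le_trans (ler_norm _) _; apply: le_trans (H p m) _.
rewrite ler_wpM2r ?mulr_ge0 ?nrm_ge0// [2 * C]mulrC -mulrA ler_wpM2l//.
have [pm|/ltnW mp] := leqP p m.
  rewrite hwE// (@le_trans _ _ (sg m / sg p)) ?ge_min ?lexx ?orbT//.
  by rewrite ler_pdivrMr// hsg.
rewrite hwC hwE// (@le_trans _ _ (sg p / sg m)) ?ge_min ?lexx//.
by rewrite ler_pdivrMr// hsg.
Qed.

End square_function.

(** * Telescoping over dyadic scales *)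

Section bilinear.
Variables (R : realType) (n : nat).
Local Notation V := 'rV[R]_n.
Local Notation mu := (lebesgueV R n).
Local Notation hf := (2^-1 : R).
Implicit Types (a b f g h v k A B : V -> R) (x y z w : V) (s t e : R).

(** The difference of [a] and its dilate of equal integral: it has mean zero, and convolution with
    it is the difference of the convolutions with [a] at scales [t] and [2 * t]. *)
Definition kap a : V -> R := fun z => a z - 2 ^- n * a (2^-1 *: z + 0).

Lemma Ccoo_kap a : Ccoo a -> Ccoo (kap a).
Proof.
move=> ha; apply: CcooB => //; apply: CcooZ; exact: Ccoo_affine.
Qed.

Let h20 : (2^-1 : R) != 0. Proof. by rewrite invr_eq0. Qed.

Lemma mean0_kap a : Cc a -> mean0 (kap a).
Proof.
move=> ha; rewrite /mean0 /kap RintB; [|exact: Cc_rint|exact/Cc_rint/CcZ/Cc_affine].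
rewrite RintZ; last exact/Cc_rint/Cc_affine.
rewrite (Rint_affine 0 h20 (Cc_rint ha)) normfV ger0_norm// exprVn.
by rewrite subrr.
Qed.

Lemma cv_kap t a f x : Cc a -> Cc f -> cv t (kap a) f x = cv t a f x - cv (2 * t) a f x.
Proof.
move=> ha hf; rewrite /cv /kap.
transitivity (\int[mu]_z (a z * f (x - t *: z) - (2 ^- n * a (2^-1 *: z + 0)) * f (x - t *: z))).
  by apply: eq_Rintegral => z _; rewrite mulrBl.
have h : Cc (fun z => 2 ^- n * a (2^-1 *: z + 0)) by exact/CcZ/Cc_affine.
rewrite RintB; [|exact: rint_cv|exact: (rint_cv t x h hf)].
congr (_ - _); rewrite (Rint_affine 0 (_ : (2 : R) != 0))//; last exact: (rint_cv t x h hf).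
rewrite -RintZ; last first.
  exact: (rint_affine 0 (_ : (2 : R) != 0) (rint_cv t x h hf)).
apply: eq_Rintegral => z _; rewrite !addr0 !scalerA mulVf// scale1r ger0_norm// mulrA mulrA.
by rewrite mulfV ?expf_neq0// mul1r [t * 2]mulrC.
Qed.

Lemma Ccoo_refl a : Ccoo a -> Ccoo (fun z => a (-1 *: z + 0)).
Proof. by move=> ha; apply: Ccoo_affine => //; rewrite oppr_eq0 oner_eq0. Qed.

Lemma mean0_refl a : Cc a -> mean0 a -> mean0 (fun z => a (-1 *: z + 0)).
Proof.
move=> ha; rewrite /mean0 => <-.
rewrite [RHS](Rint_affine 0 (_ : (-1 : R) != 0)) ?oppr_eq0 ?oner_eq0//; last exact: Cc_rint.
by rewrite normrN normr1 expr1n mul1r.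
Qed.

Lemma cv_refl t a f x : Cc a -> Cc f -> cv (- t) a f x = cv t (fun z => a (-1 *: z + 0)) f x.
Proof.
move=> ha hf; rewrite /cv (Rint_affine 0 (_ : (-1 : R) != 0)) ?oppr_eq0 ?oner_eq0//; last exact: rint_cv.
rewrite normrN normr1 expr1n mul1r; apply: eq_Rintegral => z _.
by rewrite addr0 scalerA mulrN1 opprK.
Qed.

Lemma cv_dil t r a f y : cv t a (fun x => f (r *: x + 0)) y = cv (r * t) a f (r *: y + 0).
Proof. by apply: eq_Rintegral => z _; rewrite !addr0 scalerBr scalerA. Qed.

Lemma nrm_dil r f : hf <= r -> Cc f -> nrm (fun x => f (r *: x + 0)) ^+ 2 <= 2 ^+ n * nrm f ^+ 2.
Proof.
move=> r1 hcf; have r0 : 0 < r by apply: lt_le_trans r1; rewrite invr_gt0.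
have rn0 : r != 0 by rewrite gt_eqF.
rewrite (nrm_affine 0 rn0 hcf) mulrA -[leLHS]mul1r ler_wpM2r ?sqr_ge0//.
rewrite gtr0_norm// -exprMn exprn_ege1//.
by rewrite -(ler_pM2l (_ : 0 < hf)) ?invr_gt0// mulr1 mulrA mulVf// mul1r.
Qed.

Local Opaque cv nrm L1.

(** [K + 1] stands in for the square root of [K]. *)
Lemma le_of_sqr (X K G : R) : 0 <= K -> 0 <= G -> X ^+ 2 <= K * G ^+ 2 -> X <= (K + 1) * G.
Proof.
move=> K0 G0 h; have KG : 0 <= (K + 1) * G by rewrite mulr_ge0// addr_ge0.
apply: le_trans (ler_norm _) _; rewrite -(@ler_pXn2r _ 2)// ?nnegrE// real_normK ?num_real//.
apply: le_trans h _; rewrite exprMn ler_wpM2r ?sqr_ge0//.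
have : 0 <= K ^+ 2 by exact: sqr_ge0.
have -> : (K + 1) ^+ 2 = K ^+ 2 + 2 * K + 1 by ring.
lra.
Qed.

(** The dilation of [h] depends on the level [p + q] while the scales depend on [p]. The convolution
    with [A] passes to [h] by adjunction, where the dilation merely changes its scale;
    Cauchy-Schwarz with the weights [2 ^ -q] then separates a square function of [g] from one of
    [h]. *)
Lemma pairing_sum A B : Ccoo A -> Ccoo B -> mean0 A -> mean0 B ->
  exists2 C : R, 0 <= C & forall (N : nat) (t s rho : nat -> R) g h,
  Ccoo g -> Ccoo h ->
  (forall p, 0 < t p) -> (forall p, 0 < s p) ->
  (forall p m, (p <= m)%N -> t m = hf ^+ (m - p) * t p) ->
  (forall p m, (p <= m)%N -> s m = hf ^+ (m - p) * s p) ->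
  (forall l, hf <= rho l <= 1) ->
  \sum_(p < N) \sum_(q < N) hf ^+ q *
    `|\int[mu]_x (cv (t p) A (cv (s p) B g) x * h (rho (p + q)%N *: x + 0))| <= C * (nrm g * nrm h).
Proof.
move=> hA hB A0 B0; have [CB CB0 HB] := square_function hB B0.
have [CA CA0 HA] := square_function (Ccoo_refl hA) (mean0_refl (Ccoo_Cc hA) A0).
pose D := (2 * CB) * (2 * (2 ^+ n * CA)).
have D0 : 0 <= D by rewrite !mulr_ge0// exprn_ge0.
exists (D + 1); first by rewrite addr_ge0.
move=> N t s rho g h hg hh t0 s0 tE sE hrho.
have rho0 l : 0 < rho l by have /andP[h1 _] := hrho l; apply: lt_le_trans h1; rewrite invr_gt0.
have rhon l : rho l != 0 by rewrite gt_eqF.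
pose x p := nrm (cv (s p) B g).
pose y p q := nrm (cv (rho (p + q)%N * t p) (fun z => A (-1 *: z + 0)) h).
have hhr l : Ccoo (fun x => h (rho l *: x + 0)) by exact: Ccoo_affine.
have y' p q : nrm (cv (- t p) A (fun x => h (rho (p + q)%N *: x + 0))) ^+ 2 <= 2 ^+ n * y p q ^+ 2.
  have -> : cv (- t p) A (fun x => h (rho (p + q)%N *: x + 0)) =
    fun z => cv (rho (p + q)%N * t p) (fun z => A (-1 *: z + 0)) h (rho (p + q)%N *: z + 0).
    apply/funext => z; rewrite cv_dil mulrN cv_refl//; exact: Ccoo_Cc.
  apply: nrm_dil; first by have /andP[] := hrho (p + q)%N.
  by apply: Ccoo_Cc; apply: cv_Ccoo => //; exact/Ccoo_Cc/Ccoo_refl.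
have term p q : `|\int[mu]_x (cv (t p) A (cv (s p) B g) x * h (rho (p + q)%N *: x + 0))| <=
    x p * nrm (cv (- t p) A (fun x => h (rho (p + q)%N *: x + 0))).
  have hc : Ccoo (cv (s p) B g) by apply: cv_Ccoo => //; exact: Ccoo_Cc.
  rewrite (cv_adjoint (t p) (Ccoo_Cc hA) (Ccoo_Cc hc) (Ccoo_Cc (hhr _))).
  apply: Cc_CS; first exact: Ccoo_Cc.
  by apply: Ccoo_Cc; apply: cv_Ccoo => //; exact: Ccoo_Cc.
set S := (X in X <= _).
apply: (@le_trans _ _ (\sum_(pq : 'I_N * 'I_N) hf ^+ pq.2 * (x pq.1 *
   nrm (cv (- t pq.1) A (fun x => h (rho (pq.1 + pq.2)%N *: x + 0)))))).
  rewrite -(pair_bigA _ (fun p q : 'I_N => hf ^+ q * (x p * nrm (cv (- t p) A (fun x => h (rho (p + q)%N *: x + 0))))))/=.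
  apply: ler_sum => p _; apply: ler_sum => q _.
  by rewrite ler_wpM2l ?exprn_ge0.
apply: le_of_sqr => //; first by rewrite mulr_ge0 ?nrm_ge0.
apply: le_trans (sum_CS _ _ _ _) _; first by move=> i; rewrite exprn_ge0.
rewrite exprMn.
have key (u v w z : R) : u * v * (w * z) = (u * w) * (v * z) by ring.
rewrite /D (key (2 * CB)); apply: ler_pM.
- by apply: sumr_ge0 => i _; apply: mulr_ge0; [exact: exprn_ge0|exact: sqr_ge0].
- by apply: sumr_ge0 => i _; apply: mulr_ge0; [exact: exprn_ge0|exact: sqr_ge0].
- rewrite -(pair_bigA _ (fun p q : 'I_N => hf ^+ q * x p ^+ 2))/= exchange_big/=.
  under eq_bigr do rewrite -mulr_sumr.
  rewrite -mulr_suml -mulrA ler_pM ?geom_half//.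
  + by apply: sumr_ge0 => i _; rewrite exprn_ge0.
  + by apply: sumr_ge0 => i _; rewrite sqr_ge0.
  apply: HB => // p m pm; rewrite (sE p m pm) ler_wpM2r ?(ltW (s0 p))//.
  by rewrite -[leLHS]mul1r ler_wpM2r ?exprn_ge0// ler1n.
- apply: (@le_trans _ _ (\sum_(q < N) hf ^+ q * (2 ^+ n * CA * nrm h ^+ 2))).
    rewrite -(pair_bigA _ (fun p q : 'I_N => hf ^+ q * nrm (cv (- t p) A (fun x => h (rho (p + q)%N *: x + 0))) ^+ 2))/=.
    rewrite exchange_big/=; apply: ler_sum => q _; rewrite -mulr_sumr ler_wpM2l ?exprn_ge0//.
    apply: (@le_trans _ _ (\sum_(p < N) 2 ^+ n * y p q ^+ 2)); first by apply: ler_sum => p _.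
    rewrite -mulr_sumr -mulrA ler_wpM2l ?exprn_ge0//.
    (* For fixed [q] these scales decay dyadically up to the ratio of two values of [rho], which is
       at most [2]. *)
    apply: (HA N (fun p => rho (p + q)%N * t p)) => // [p|p m pm]; first by rewrite mulr_gt0.
    rewrite (tE p m pm); have /andP[r1 r2] := hrho (p + q)%N; have /andP[r3 r4] := hrho (m + q)%N.
    have key2 (u v w z : R) : u * v * (w * z) = (u * w) * (v * z) by ring.
    have u0 : 0 <= hf ^+ (m - p) * t p by rewrite mulr_ge0 ?exprn_ge0 ?(ltW (t0 p)).
    rewrite key2 ler_wpM2r//.
    apply: le_trans r4 _; rewrite -(ler_pM2l (_ : 0 < hf)) ?invr_gt0// mulr1 mulrA mulVf//.
    by rewrite mul1r.
  rewrite -mulr_suml -[leRHS]mulrA; apply: ler_wpM2r; last exact: geom_half.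
  by apply: mulr_ge0; [apply: mulr_ge0 => //; exact: exprn_ge0|exact: sqr_ge0].
Qed.

Lemma cvZr t (c : R) a f x : Cc a -> Cc f -> cv t a (fun y => c * f y) x = c * cv t a f x.
Proof.
move=> ha hcf; rewrite -[RHS]RintZ; last exact: rint_cv.
by apply: eq_Rintegral => z _; rewrite mulrCA.
Qed.

Lemma cvBr t a f g x : Cc a -> Cc f -> Cc g ->
  cv t a (fun y => f y - g y) x = cv t a f x - cv t a g x.
Proof.
move=> ha hcf hg; rewrite -[RHS]RintB; [|exact: rint_cv|exact: rint_cv].
by apply: eq_Rintegral => z _; rewrite mulrBr.
Qed.

Lemma sum_triangle_eq (F : nat -> nat -> R) N :
  \sum_(l < N) \sum_(p < l) F p (l - p.+1)%N = \sum_(p < N) \sum_(q < N - p.+1) F p q.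
Proof.
elim: N => [|N IH]; first by rewrite !big_ord0.
rewrite big_ord_recr/= IH [RHS]big_ord_recr/= subnn big_ord0 addr0 -big_split/=.
apply: eq_bigr => p _; rewrite subSS.
have -> : (N - p = (N - p.+1).+1)%N by rewrite -subSn.
by rewrite big_ord_recr.
Qed.

Lemma sum_triangle_le (F : nat -> nat -> R) N : (forall p q, 0 <= F p q) ->
  \sum_(l < N) \sum_(p < l) F p (l - p.+1)%N <= \sum_(p < N) \sum_(q < N) F p q.
Proof.
move=> F0; rewrite sum_triangle_eq; apply: ler_sum => p _.
rewrite (big_ord_widen N (F p)) ?leq_subr// big_mkcond/=.
by apply: ler_sum => q _; case: ifP.
Qed.

Local Opaque kap.

(** Write the difference of products as [(A_t - A_2t) B_t + A_2t (B_t - B_2t)] and integrate by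
    parts in the undifferenced factor. In the second term that factor has scale [2 * t], whence
    [2^-1]. *)
Lemma telescope_diff t i a b g x : Ccoo a -> Ccoo b -> Ccoo g ->
  t * (cv t a (cv t b (partial i g)) x - cv (2 * t) a (cv (2 * t) b (partial i g)) x) =
  cv t (kap a) (cv t (partial i b) g) x + 2^-1 * cv t (kap b) (cv (2 * t) (partial i a) g) x.
Proof.
move=> ha hb hg; have hG := Ccoo_partial i hg.
have [[[ca cb] cg] cG] := (Ccoo_Cc ha, Ccoo_Cc hb, Ccoo_Cc hg, Ccoo_Cc hG).
have cvC s f v : Cc f -> Ccoo v -> Cc (cv s f v) by move=> h1 h2; exact/Ccoo_Cc/cv_Ccoo.
have cka := Ccoo_Cc (Ccoo_kap ha); have ckb := Ccoo_Cc (Ccoo_kap hb).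
have -> : cv t (partial i b) g = fun y => t * cv t b (partial i g) y.
  by apply/funext => y; rewrite cv_ibp.
have -> : cv (2 * t) (partial i a) g = fun y => 2 * t * cv (2 * t) a (partial i g) y.
  by apply/funext => y; rewrite cv_ibp.
rewrite !cvZr//; try exact: cvC.
rewrite (cv_comm t (2 * t) x ckb ca cG) (cv_kap t x ca (cvC _ _ _ cb hG)).
have -> : cv t (kap b) (partial i g) = fun y => cv t b (partial i g) y - cv (2 * t) b (partial i g) y.
  by apply/funext => y; rewrite cv_kap.
rewrite cvBr//; try exact: cvC.
have key (c u v w : R) : c * (u - w) = c * (u - v) + 2^-1 * (2 * c * (v - w)) by field.
exact: key.
Qed.

Lemma Rint_combine c (X Y P Q H : V -> R) : Cc X -> Cc Y -> Cc P -> Cc Q -> Cc H ->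
  (forall x, c * (X x - Y x) = P x + 2^-1 * Q x) ->
  c * (\int[mu]_x (X x * H x) - \int[mu]_x (Y x * H x)) =
  \int[mu]_x (P x * H x) + 2^-1 * \int[mu]_x (Q x * H x).
Proof.
move=> cX cY cP cQ cH E.
have rXH := Cc_rint (CcM cX cH); have rYH := Cc_rint (CcM cY cH).
have rPH := Cc_rint (CcM cP cH); have rQH := Cc_rint (CcM cQ cH).
rewrite -RintB// -RintZ; last exact: rintB.
rewrite -(RintZ _ rQH) -RintD//; last exact: rintZ.
by apply: eq_Rintegral => x _; rewrite -mulrBl [LHS]mulrA E mulrDl -mulrA.
Qed.

(** In [I p l] the first index is the scale of the kernels and the second the level of the dilation,
    frozen while the first telescopes from [0] to [l]. The factor [t l] in front equals
    [2 ^ -(l - p - 1)] times [t p.+1], so with [q = l - p - 1] the increments come with the summable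
    weights [2 ^ -q]. *)
Lemma dyadic_telescope N (t : nat -> R) (I P1 P2 : nat -> nat -> R) (Z B1 B2 : R) :
  (forall p m, (p <= m)%N -> t m = hf ^+ (m - p) * t p) ->
  (forall p l, t p.+1 * (I p.+1 l - I p l) = P1 p l + 2^-1 * P2 p l) ->
  0 <= Z -> (forall l, `|t 0%N * I 0%N l| <= Z) ->
  \sum_(p < N) \sum_(q < N) hf ^+ q * `|P1 p (p + q).+1| <= B1 ->
  \sum_(p < N) \sum_(q < N) hf ^+ q * `|P2 p (p + q).+1| <= B2 ->
  `|\sum_(l < N) t l * I l l| <= 2 * Z + (B1 + B2).
Proof.
move=> tE dI Z0 zero H1 H2.
have tele l : I l l = I 0%N l + \sum_(p < l) (I p.+1 l - I p l).
  rewrite -(big_mkord xpredT (fun p => I p.+1 l - I p l)) telescope_sumr//.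
  by rewrite addrC subrK.
have step l : t l * I l l = hf ^+ l * (t 0%N * I 0%N l) +
   \sum_(p < l) hf ^+ (l - p.+1) * (P1 p l + 2^-1 * P2 p l).
  rewrite tele mulrDr; congr (_ + _); first by rewrite (tE 0%N l)// subn0 mulrA.
  rewrite mulr_sumr; apply: eq_bigr => p _.
  by rewrite -dI mulrA -(tE _ _ (ltn_ord p)).
apply: le_trans (ler_norm_sum _ _ _) _.
apply: (@le_trans _ _ (\sum_(l < N) hf ^+ l * Z
   + (\sum_(l < N) \sum_(p < l) hf ^+ (l - p.+1) * `|P1 p (p + (l - p.+1)).+1| +
      \sum_(l < N) \sum_(p < l) hf ^+ (l - p.+1) * `|P2 p (p + (l - p.+1)).+1|))).
  rewrite -!big_split/=; apply: ler_sum => l _; rewrite step.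
  apply: le_trans (ler_normD _ _) _; apply: lerD.
    by rewrite normrM ger0_norm ?exprn_ge0// ler_wpM2l ?exprn_ge0.
  rewrite -big_split/=; apply: le_trans (ler_norm_sum _ _ _) _; apply: ler_sum => p _.
  have -> : (p + (l - p.+1)).+1 = l :> nat by rewrite -addSn subnKC.
  rewrite normrM ger0_norm ?exprn_ge0// -mulrDr ler_wpM2l ?exprn_ge0//.
  apply: le_trans (ler_normD _ _) _; rewrite lerD2l normrM ger0_norm//.
  by have := normr_ge0 (P2 p l); move: `|_| => u u0; lra.
apply: lerD; first by rewrite -mulr_suml ler_wpM2r ?geom_half.
apply: lerD.
  apply: le_trans (sum_triangle_le (F := fun p q => hf ^+ q * `|P1 p (p + q).+1|) N _) H1.
  by move=> p q; rewrite mulr_ge0 ?exprn_ge0.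
apply: le_trans (sum_triangle_le (F := fun p q => hf ^+ q * `|P2 p (p + q).+1|) N _) H2.
by move=> p q; rewrite mulr_ge0 ?exprn_ge0.
Qed.

(* With [a_t] the dilate at scale [t] of [a = al * be], telescope [a_(t l)] from [a_(t 0)]. In
   [a_s - a_(2 s)] only one of the two factors is differenced and the derivative of [g] is put on the
   other: both have mean zero, and Cauchy-Schwarz leads to a product of two square functions. *)
Theorem bilinear_bound al be i : Ccoo al -> Ccoo be ->
  exists2 C : R, 0 <= C & forall (N : nat) (t r : nat -> R) g h,
  Ccoo g -> Ccoo h -> (forall p, 0 < t p) ->
  (forall p m, (p <= m)%N -> t m = hf ^+ (m - p) * t p) ->
  (forall l, 1 <= r l <= 2) ->
  `|\sum_(l < N) t l * (r l ^+ n * \int[mu]_x (cv (t l) (cv 1 al be) (partial i g) (r l *: x + 0) * h x))|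
    <= C * (nrm g * nrm h).
Proof.
move=> ha hb; have [ca cb] := (Ccoo_Cc ha, Ccoo_Cc hb).
have hda := Ccoo_partial i ha; have hdb := Ccoo_partial i hb.
have [C1 C10 H1] := pairing_sum (Ccoo_kap ha) hdb (mean0_kap ca) (Rint_partial0 i hb).
have [C2 C20 H2] := pairing_sum (Ccoo_kap hb) hda (mean0_kap cb) (Rint_partial0 i ha).
pose K := 2 * (L1 al * L1 (partial i be) * (2 ^+ n + 1)).
have K0 : 0 <= K by rewrite !mulr_ge0 ?L1_ge0// addr_ge0// exprn_ge0.
exists (K + (C1 + C2)); first by rewrite !addr_ge0.
move=> N t r g h hg hh t0 tE hr.
have hG := Ccoo_partial i hg; have [[cg cG] ch] := (Ccoo_Cc hg, Ccoo_Cc hG, Ccoo_Cc hh).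
pose rho l := (r l)^-1.
have r0 l : 0 < r l by have /andP[h1 _] := hr l; exact: lt_le_trans h1.
have hrho l : hf <= rho l <= 1.
  have /andP[h1 h2] := hr l; rewrite /rho invf_le1// h1 andbT.
  by rewrite lef_pV2// posrE.
have rho0 l : rho l != 0 by rewrite invr_eq0 gt_eqF.
pose H l x := h (rho l *: x + 0).
have hH l : Ccoo (H l) by exact: Ccoo_affine.
pose X p := cv (t p) al (cv (t p) be (partial i g)).
have cX p : Ccoo (X p) by apply: cv_Ccoo => //; exact: cv_Ccoo.
pose I p l := \int[mu]_x (X p x * H l x).
(* The factor [r l ^+ n] is the Jacobian that moves the dilation from the convolution onto [h]. *)
have E l : r l ^+ n * \int[mu]_x (cv (t l) (cv 1 al be) (partial i g) (r l *: x + 0) * h x) = I l l.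
  have rn : r l != 0 by rewrite gt_eqF.
  rewrite /I (Rint_affine 0 rn (Cc_rint (CcM (Ccoo_Cc (cX l)) (Ccoo_Cc (hH l))))) (gtr0_norm (r0 l)).
  congr (_ * _); apply: eq_Rintegral => x _; rewrite /H !addr0 scalerA mulVf// scale1r.
  by rewrite /X -(cv_assoc 1 (t l) (r l *: x) ca hb hG) mul1r.
rewrite (eq_bigr (fun l : 'I_N => t l * I l l)); last by move=> l _; rewrite E.
pose P1 p l := \int[mu]_x (cv (t p.+1) (kap al) (cv (t p.+1) (partial i be) g) x * H l x).
pose P2 p l := \int[mu]_x (cv (t p.+1) (kap be) (cv (2 * t p.+1) (partial i al) g) x * H l x).
have tS p : t p = 2 * t p.+1 by rewrite (tE p p.+1 (leqnSn p)) subSnn expr1 mulrA mulfV// mul1r.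
have dI p l : t p.+1 * (I p.+1 l - I p l) = P1 p l + 2^-1 * P2 p l.
  have cP1 : Cc (cv (t p.+1) (kap al) (cv (t p.+1) (partial i be) g)).
    apply/Ccoo_Cc/cv_Ccoo; [exact/Ccoo_Cc/Ccoo_kap|apply: cv_Ccoo => //; exact: Ccoo_Cc].
  have cP2 : Cc (cv (t p.+1) (kap be) (cv (2 * t p.+1) (partial i al) g)).
    apply/Ccoo_Cc/cv_Ccoo; [exact/Ccoo_Cc/Ccoo_kap|apply: cv_Ccoo => //; exact: Ccoo_Cc].
  rewrite /I /P1 /P2; apply: (Rint_combine (Ccoo_Cc (cX _)) (Ccoo_Cc (cX _)) cP1 cP2 (Ccoo_Cc (hH l))) => x.
  by rewrite /X (tS p); exact: telescope_diff.
have zero l : `|t 0%N * I 0%N l| <= L1 al * L1 (partial i be) * (2 ^+ n + 1) * (nrm g * nrm h).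
  have cY : Ccoo (cv (t 0%N) (partial i be) g) by apply: cv_Ccoo => //; exact: Ccoo_Cc.
  have -> : t 0%N * I 0%N l = \int[mu]_x (cv (t 0%N) al (cv (t 0%N) (partial i be) g) x * H l x).
    rewrite -RintZ; last exact: Cc_rint (CcM (Ccoo_Cc (cX 0%N)) (Ccoo_Cc (hH l))).
    apply: eq_Rintegral => x _; rewrite mulrA; congr (_ * _).
    rewrite (_ : cv (t 0%N) (partial i be) g = fun y => t 0%N * cv (t 0%N) be (partial i g) y).
      by rewrite cvZr//; exact/Ccoo_Cc/cv_Ccoo.
    by apply/funext => y; rewrite cv_ibp.
  apply: (le_trans (Cc_CS _ _)); [exact/Ccoo_Cc/cv_Ccoo|exact: Ccoo_Cc|].
  have y1 := young1 (t 0%N) ca cY; have y2 := young1 (t 0%N) (Ccoo_Cc hdb) hg.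
  have /andP[hr1 _] := hrho l.
  have y3 := le_of_sqr (exprn_ge0 n (ler0n R 2)) (nrm_ge0 h) (nrm_dil hr1 ch).
  have key (u v w z k : R) : u * v * w * (z * k) = (u * (v * z)) * (w * k) by ring.
  rewrite key; apply: ler_pM; rewrite ?nrm_ge0//; apply: le_trans y1 _.
  by rewrite ler_wpM2l ?L1_ge0.
have -> : (K + (C1 + C2)) * (nrm g * nrm h) =
  2 * (L1 al * L1 (partial i be) * (2 ^+ n + 1) * (nrm g * nrm h)) +
  (C1 * (nrm g * nrm h) + C2 * (nrm g * nrm h)) by rewrite /K !mulrDl -!mulrA.
apply: (dyadic_telescope tE dI _ zero).
- by rewrite !mulr_ge0 ?L1_ge0 ?nrm_ge0// addr_ge0// exprn_ge0.
- have tS' p m : (p <= m)%N -> t m.+1 = hf ^+ (m - p) * t p.+1 by move=> pm; rewrite (tE p.+1 m.+1).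
  exact: (H1 N (fun p => t p.+1) (fun p => t p.+1) (fun l => rho l.+1) g h hg hh
    (fun p => t0 p.+1) (fun p => t0 p.+1) tS' tS' (fun l => hrho l.+1)).
- have tS' p m : (p <= m)%N -> t m.+1 = hf ^+ (m - p) * t p.+1 by move=> pm; rewrite (tE p.+1 m.+1).
  have tS2 p m : (p <= m)%N -> 2 * t m.+1 = hf ^+ (m - p) * (2 * t p.+1).
    by move=> pm; rewrite (tE p.+1 m.+1)// subSS mulrCA.
  have t2 p : 0 < 2 * t p.+1 by rewrite mulr_gt0.
  exact: (H2 N (fun p => t p.+1) (fun p => 2 * t p.+1) (fun l => rho l.+1) g h hg hh
    (fun p => t0 p.+1) t2 tS' tS2 (fun l => hrho l.+1)).
Qed.

End bilinear.

Lemma Rint_affine1 (R : realType) (c : R) (f : R -> R) : c != 0 ->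
  rint (@lebesgue_measure R) f ->
  rint (@lebesgue_measure R) (fun x => f (c * x)) /\
  \int[lebesgue_measure]_x f x = `|c| * \int[lebesgue_measure]_x f (c * x).
Proof.
move=> c0; pose lam := @lebesgue_measure R.
have mc : measurable_fun [set: measurableTypeR R] (fun x : measurableTypeR R => (c * x : measurableTypeR R)).
  exact: measurable_funM.
have c1 : (0 < `|c|%:E)%E by rewrite lte_fin normr_gt0.
have rint_c g : rint lam g -> rint lam (fun x => g (c * x)).
  move=> /integrableP[mg goo]; apply/integrableP; split; first exact: measurableT_comp mg mc.
  move: goo; have := @ge0_integral_affine1 R c 0 c0 (fun x => `|(EFin \o g) x|)%E.
  under [in RHS]eq_integral do rewrite addr0.
  move=> ->//; last exact: measurableT_comp.
  by move=> h; rewrite -(@lte_pmul2l _ `|c|%:E)// gt0_muley.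
have pos g : rint lam g -> (forall x, 0 <= g x) ->
    \int[lam]_x g x = `|c| * \int[lam]_x g (c * x).
  move=> hg g0; have mg := measurable_int _ hg; have hg' := rint_c _ hg.
  have := @ge0_integral_affine1 R c 0 c0 (EFin \o g).
  under [in RHS]eq_integral do rewrite addr0.
  rewrite {1}/Rintegral => ->//.
  by rewrite fineM//; exact/(integrable_fin_num measurableT hg').
move=> hf; split; first exact: rint_c.
have mf := rint_measurable hf.
have rp : rint lam (fun x => Num.max (f x) 0).
  apply: (rint_le _ _ (rint_norm hf)); first exact: measurable_maxr.
  by move=> x; case: (leP (f x) 0) => h; rewrite ?normr0.
have rn : rint lam (fun x => Num.max (- f x) 0).
  apply: (rint_le _ _ (rint_norm hf)); first by apply: measurable_maxr => //; exact: measurableT_comp.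
  by move=> x; case: (leP (- f x) 0) => h; rewrite ?normr0 ?normrN.
have fE x : f x = Num.max (f x) 0 - Num.max (- f x) 0.
  by case: (leP (f x) 0) => h; case: (leP (- f x) 0) => h'; lra.
have le0 (r : R) : 0 <= Num.max r 0 by rewrite le_max lexx orbT.
under eq_Rintegral do rewrite fE; under [in RHS]eq_Rintegral do rewrite fE.
rewrite !RintB//; [|exact: (rint_c _ rp)|exact: (rint_c _ rn)].
by rewrite mulrBr (pos _ rp)// (pos _ rn).
Qed.

(** * Bogovskii's operator *)

Section dyadic.
Variable R : realType.
Local Notation lam := (@lebesgue_measure R).
Local Notation hf := (2^-1 : R).
Implicit Types Phi : R -> R.

Definition I01 (t : R) : R := ((0 < t) && (t <= 1))%:R.
Definition Ihf (t : R) : R := ((hf < t) && (t <= 1))%:R.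

Lemma I01_cases t : I01 t = 0 \/ I01 t = 1 /\ 0 < t <= 1.
Proof. by rewrite /I01; case: (_ && _); [right|left]. Qed.

Lemma measurable_I01 : measurable_fun [set: measurableTypeR R] (I01 : measurableTypeR R -> R).
Proof.
rewrite (_ : I01 = \1_`]0, 1]); first exact: measurable_indic.
by apply/funext => t; rewrite indicE /I01 mem_setE in_itv.
Qed.

Lemma measurable_Ihf : measurable_fun [set: measurableTypeR R] (Ihf : measurableTypeR R -> R).
Proof.
rewrite (_ : Ihf = \1_`]hf, 1]); first exact: measurable_indic.
by apply/funext => t; rewrite indicE /Ihf mem_setE in_itv.
Qed.

Lemma Rint_I01 Phi : rint lam (fun t => I01 t * Phi t) ->
  \int[lam]_t (I01 t * Phi t) = \int[lam]_(t in `[0, 1]) Phi t.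
Proof.
move=> h; rewrite -Rintegral_itv_obnd_cbnd; last first.
  apply/integrable_mkcond => //; apply: eq_integrable h => // t _.
  by rewrite /= /patch mem_setE in_itv /I01; case: ifP; rewrite ?mul1r ?mul0r.
rewrite [RHS]Rintegral_mkcond; apply: eq_Rintegral => t _.
by rewrite /patch mem_setE in_itv /I01; case: ifP; rewrite ?mul1r ?mul0r.
Qed.

Lemma rint_I01 : rint lam I01.
Proof.
apply: (@rint_bounded _ (measurableTypeR R) R lam I01 (`[0%R, 1%R]%classic : set (measurableTypeR R)) 1) => //.
- have h : (lebesgue_measure (`[0%R, 1%R]%classic : set R) < +oo)%E.
    by rewrite lebesgue_measure_itv /= lte_fin ltr01 sube0 ltry.
  exact: h.
- exact: measurable_I01.
- by move=> t; rewrite /I01; case: (_ && _); rewrite ?normr0 ?normr1.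
- move=> t /=; rewrite in_itv/= => h; rewrite /I01; case: (boolP (_ && _)) => // /andP[t0 t1].
  by exfalso; apply: h; rewrite ltW.
Qed.

Lemma Rint_I01_1 : \int[lam]_t (I01 t) = 1.
Proof.
transitivity (\int[lam]_t (I01 t * 1)); first by apply: eq_Rintegral => t _; rewrite mulr1.
rewrite Rint_I01; last by apply: eq_integrable rint_I01 => // t _ /=; rewrite mulr1.
rewrite Rintegral_cst//= lebesgue_measure_itv /= lte_fin ltr01 /=.
by rewrite subr0 mulr1.
Qed.

Lemma rint_Ihf Phi : rint lam (fun t => I01 t * Phi t) -> rint lam (fun t => Ihf t * Phi t).
Proof.
move=> h; have mE : (fun t => Ihf t * Phi t) = (fun t => Ihf t * (I01 t * Phi t)).
  apply/funext => t; rewrite /Ihf /I01; case: (ltP hf t) => h1; last by rewrite !mul0r.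
  have -> : 0 < t by apply: lt_trans h1; rewrite invr_gt0.
  by rewrite andTb; case: (t <= 1); rewrite ?mul0r ?mul1r.
rewrite mE; apply: (rint_le _ _ (rint_norm h)).
  by apply: measurable_funM; [exact: measurable_Ihf|exact: rint_measurable h].
move=> t; rewrite normrM ler_piMl// /Ihf; by case: (_ && _); rewrite ?normr0 ?normr1.
Qed.

Lemma rint_half Phi : rint lam (fun t => I01 t * Phi t) ->
  rint lam (fun t => I01 t * Phi (hf * t)) /\
  \int[lam]_t (I01 t * Phi t) =
    \int[lam]_t (Ihf t * Phi t) + hf * \int[lam]_t (I01 t * Phi (hf * t)).
Proof.
move=> h; have h2 : hf != 0 by [].
have rh := rint_Ihf h.
have I2 t : I01 (2 * t) * Phi t = I01 t * Phi t - Ihf t * Phi t.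
  rewrite -mulrBl; congr (_ * _); rewrite /I01 /Ihf pmulr_rgt0//.
  have -> : (2 * t <= 1) = (t <= hf) by rewrite -ler_pdivlMl// mulr1.
  by case: (ltP 0 t) => h1; case: (leP t hf) => h3; case: (leP t 1) => h4 //=;
    rewrite ?subrr ?subr0//; lra.
have r2 : rint lam (fun t => I01 (2 * t) * Phi t).
  by rewrite (_ : (fun t => _) = (fun t => I01 t * Phi t - Ihf t * Phi t)); [exact: rintB|apply/funext].
have [r3 E] := Rint_affine1 h2 r2; split.
  by apply: eq_integrable r3 => // t _ /=; rewrite mulrA mulfV// mul1r.
have -> : \int[lam]_t (I01 t * Phi t) = \int[lam]_t (Ihf t * Phi t + I01 (2 * t) * Phi t).
  by apply: eq_Rintegral => t _; rewrite I2 addrC subrK.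
rewrite RintD// E ger0_norm//; congr (_ + _ * _); apply: eq_Rintegral => t _.
by rewrite mulrA mulfV// mul1r.
Qed.

Lemma rint_dyadic Phi N : rint lam (fun t => I01 t * Phi t) ->
  rint lam (fun t => I01 t * Phi (hf ^+ N * t)).
Proof.
move=> h; elim: N => [|N IH].
  by apply: eq_integrable h => // t _ /=; rewrite expr0 mul1r.
have [r _] := rint_half IH; apply: eq_integrable r => // t _ /=.
by rewrite exprSr mulrA.
Qed.

(** All dyadic intervals are folded onto ]1/2, 1]: for each fixed [t] there the integrand is a sum
    over the exactly dyadic scales [2 ^ -l * t], as the discrete estimates require. A remainder is
    kept because those estimates concern finite sums. *)
Lemma Rint_dyadic Phi N : rint lam (fun t => I01 t * Phi t) ->
  \int[lam]_t (I01 t * Phi t) =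
  \int[lam]_t (Ihf t * \sum_(l < N) hf ^+ l * Phi (hf ^+ l * t)) +
  hf ^+ N * \int[lam]_t (I01 t * Phi (hf ^+ N * t)).
Proof.
move=> h; elim: N => [|N IH].
  rewrite expr0 mul1r [X in X + _](_ : _ = 0) ?add0r.
    by apply: eq_Rintegral => t _; rewrite mul1r.
  by rewrite -[RHS](Rintegral_zero lam); apply: eq_Rintegral => t _; rewrite big_ord0 mulr0.
have rl l : rint lam (fun t => Ihf t * (hf ^+ l * Phi (hf ^+ l * t))).
  by apply: eq_integrable (rintZ (hf ^+ l) (rint_Ihf (rint_dyadic l h))) => // t _ /=; rewrite mulrCA.
rewrite IH; have [_ ->] := rint_half (rint_dyadic N h).
rewrite mulrDr addrA -RintZ; last exact/rint_Ihf/rint_dyadic.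
rewrite -RintD; last 2 first.
- have := rint_sum (index_enum 'I_N) (fun l : 'I_N => rl l); apply: eq_integrable => // t _ /=.
  by rewrite mulr_sumr.
- exact/rintZ/rint_Ihf/rint_dyadic.
congr (_ + _).
  by apply: eq_Rintegral => t _; rewrite big_ord_recr/= mulrDr; congr (_ + _); rewrite mulrCA.
rewrite mulrA -exprSr; congr (_ * _); apply: eq_Rintegral => t _.
by rewrite mulrA -exprSr.
Qed.

Lemma dyadic_bound Phi N (S M : R) : rint lam (fun t => I01 t * Phi t) ->
  0 <= S -> 0 <= M ->
  (forall th, hf < th <= 1 -> `|\sum_(l < N) hf ^+ l * Phi (hf ^+ l * th)| <= S) ->
  (forall t, 0 < t <= 1 -> `|Phi t| <= M) ->
  `|\int[lam]_t (I01 t * Phi t)| <= S + hf ^+ N * M.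
Proof.
move=> h S0 M0 hS hM; rewrite (Rint_dyadic N h); apply: le_trans (ler_normD _ _) _.
have bnd Psi K : 0 <= K -> rint lam Psi -> (forall t, `|Psi t| <= K * I01 t) -> `|\int[lam]_t Psi t| <= K.
  move=> K0 rP hP; apply: le_trans (Rint_norm rP) _; rewrite -[leRHS]mulr1 -Rint_I01_1 -RintZ; last exact: rint_I01.
  by apply: Rint_le => //; [exact: rint_norm|exact/rintZ/rint_I01].
apply: lerD.
  apply: bnd => //.
    have rl l : rint lam (fun t => Ihf t * (hf ^+ l * Phi (hf ^+ l * t))).
      by apply: eq_integrable (rintZ (hf ^+ l) (rint_Ihf (rint_dyadic l h))) => // t _ /=; rewrite mulrCA.
    have := rint_sum (index_enum 'I_N) (fun l : 'I_N => rl l); apply: eq_integrable => // t _ /=.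
    by rewrite mulr_sumr.
  move=> t; rewrite /Ihf; have [h1|h1] := ltP hf t; last by rewrite mul0r normr0 mulr_ge0 /I01.
  have t0 : 0 < t by apply: lt_trans h1; rewrite invr_gt0.
  rewrite /I01 t0 !andTb; have [t1|t1] := leP t 1; last by rewrite mul0r normr0 mulr0.
  by rewrite mul1r mulr1; apply: hS; rewrite h1.
rewrite normrM ger0_norm ?exprn_ge0// ler_wpM2l ?exprn_ge0//.
apply: bnd => //; first exact: rint_dyadic.
move=> t; have [->|[-> /andP[t0 t1]]] := I01_cases t; first by rewrite mul0r normr0 mulr0.
rewrite mul1r mulr1; apply: hM; rewrite mulr_gt0 ?exprn_gt0//=.
rewrite -[leRHS]mulr1; apply: ler_pM => //; rewrite ?exprn_ge0 ?(ltW t0)//.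
by rewrite exprn_ile1// invf_le1// ler1n.
Qed.

End dyadic.

(** Tonelli yields measurability for nonnegative integrands; adding [C] times the indicator of [A]
    makes [F] nonnegative and shifts the integral by a constant. *)
Lemma measurable_fun_Rint d1 d2 (T1 : measurableType d1) (T2 : measurableType d2)
  (R : realType) (m2 : {sigma_finite_measure set T2 -> \bar R})
  (F : T1 * T2 -> R) (A : set T2) (C : R) :
  measurable A -> (m2 A < +oo)%E ->
  measurable_fun setT F -> (forall q, `|F q| <= C) ->
  (forall p z, ~ A z -> F (p, z) = 0) ->
  measurable_fun setT (fun p => \int[m2]_z F (p, z)).
Proof.
move=> mA Afin mF FC F0.
pose G (q : T1 * T2) : R := F q + C * \1_A q.2.
have mI : measurable_fun setT (fun q : T1 * T2 => C * \1_A q.2 : R).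
  by apply: measurable_funM => //; exact: measurableT_comp measurable_snd.
have mG : measurable_fun setT G by exact: measurable_funD.
have G0 q : 0 <= G q.
  rewrite /G indicE; have [/set_mem Aq|/negP Aq] := boolP (q.2 \in A).
    by rewrite mulr1; have := FC q; rewrite ler_norml => /andP[h _]; lra.
  rewrite mulr0 addr0; move: Aq; case: q => p z /= Aq; rewrite F0// => Az; apply: Aq; exact: mem_set.
have rI : rint m2 (fun z => C * \1_A z : R).
  apply: rintZ; apply: (rint_bounded mA Afin (C := 1)) => //.
    by move=> z; rewrite indicE; case: (_ \in _); rewrite ?normr0 ?normr1.
  by move=> z Az; rewrite indicE memNset.
have rF p : rint m2 (fun z => F (p, z)).
  apply: (rint_bounded mA Afin _ (fun z => FC (p, z)) (F0 p)).
  exact: measurableT_comp mF (pair1_measurable p).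
have E p : \int[m2]_z F (p, z) = \int[m2]_z G (p, z) - \int[m2]_z (C * \1_A z).
  by rewrite -RintB//; [apply: eq_Rintegral => z _; rewrite /G addrK|exact: rintD].
apply: (@eq_measurable_fun _ _ _ _ _ (fun p => \int[m2]_z G (p, z) - \int[m2]_z (C * \1_A z))).
  by move=> p _; rewrite E.
apply: measurable_funB => //; apply: measurableT_comp => //.
have := @measurable_fun_fubini_tonelli_F _ _ T1 T2 R m2 (EFin \o G).
apply; first exact/measurable_EFinP.
by move=> q; rewrite lee_fin.
Qed.

(** * The operators [E] and their divergence identity *)

Section Eop.
Variables (R : realType) (n : nat).
Local Notation V := 'rV[R]_n.
Local Notation mu := (lebesgueV R n).
Local Notation lam := (@lebesgue_measure R).
Local Notation RM := (measurableTypeR R).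
Local Notation ei := (@ei R n).
Implicit Types (a b f g h : V -> R) (x y z : V) (t : R).

Lemma measurable_comb d (P : measurableType d) (r s : P -> R) (x z : P -> V) :
  measurable_fun setT r -> measurable_fun setT s ->
  measurable_fun setT x -> measurable_fun setT z ->
  measurable_fun setT (fun p => r p *: x p + s p *: z p).
Proof.
move=> mr ms mx mz; apply: measurable_fun_coordP => i.
apply: (@eq_measurable_fun _ _ _ _ _ (fun p => r p * x p ord0 i + s p * z p ord0 i)).
  by move=> p _; rewrite !mxE.
by apply: measurable_funD; apply: measurable_funM => //; exact: measurableT_comp (measurable_coord i) _.
Qed.

Definition W (m : nat) t : R := I01 t * (1 + t) ^+ m.

Lemma measurable_W m : measurable_fun [set: RM] (W m : RM -> R).
Proof.
apply: measurable_funM; first exact: measurable_I01.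
by apply: measurable_funX; apply: measurable_funD.
Qed.

Lemma W_ge0 m t : 0 <= W m t.
Proof.
rewrite /W; have [->|[-> /andP[t0 _]]] := I01_cases t; first by rewrite mul0r.
by rewrite mul1r exprn_ge0// addr_ge0// ltW.
Qed.

Lemma W_le m t : W m t <= 2 ^+ m.
Proof.
rewrite /W; have [->|[-> /andP[t0 t1]]] := I01_cases t; first by rewrite mul0r exprn_ge0.
by rewrite mul1r lerXn2r ?nnegrE ?addr_ge0 ?(ltW t0)//; lra.
Qed.

Lemma W0 m t : ~ `[0, 1]%classic t -> W m t = 0.
Proof.
rewrite /= in_itv/= /W => h; have [->|[_ /andP[t0 t1]]] := I01_cases t; first by rewrite mul0r.
by exfalso; apply: h; rewrite ltW.
Qed.

Let A01 : set RM := `[0%R, 1%R]%classic.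

Let mA01 : measurable A01.
Proof. exact: measurable_itv. Qed.

Let A01_fin : (lam A01 < +oo)%E.
Proof.
have h : (lebesgue_measure (`[0%R, 1%R]%classic : set R) < +oo)%E.
  by rewrite lebesgue_measure_itv /= lte_fin ltr01 sube0 ltry.
exact: h.
Qed.

(* The points where [E m a b] is nonzero are the [(y + t *: z) / (1 + t)] with [0 < t <= 1],
   [a z != 0] and [b y != 0]: the half of the segment nearer to the support of [b]. *)
Definition E m a b x : R := \int[lam]_t (W m t * cv t a b ((1 + t) *: x)).

Lemma rint_tz (F : RM * V -> R) (M C : R) : measurable_fun setT F -> (forall p, `|F p| <= C) ->
  (forall t z, I01 t = 0 \/ M <= `|z| -> F (t, z) = 0) ->
  [/\ rint (lam \x mu)%E F, \int[(lam \x mu)%E]_p F p = \int[lam]_t \int[mu]_z F (t, z),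
      \int[lam]_t \int[mu]_z F (t, z) = \int[mu]_z \int[lam]_t F (t, z),
      rint lam (fun t => \int[mu]_z F (t, z)) & rint mu (fun z => \int[lam]_t F (t, z))].
Proof.
move=> mF FC F0.
have h0 (t : RM) (z : V) : ~ (A01 t /\ [set z : V | `|z| < M] z) -> F (t, z) = 0.
  move=> /= h; apply: F0; have [|[_ /andP[t0 t1]]] := I01_cases t; first by left.
  right; rewrite leNgt; apply/negP => zM; apply: h; split => //.
  by rewrite /A01 /= in_itv/= t1 ltW.
have mB := measurable_nball (n := n) M; have finB := nball_fin n M.
split.
- exact: (rint_prod mA01 mB A01_fin finB mF FC h0).
- exact: (Rfubini_prod mA01 mB A01_fin finB mF FC h0).
- exact: (Rfubini mA01 mB A01_fin finB mF FC h0).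
- exact: (rint_fubini1 mA01 mB A01_fin finB mF FC h0).
- exact: (rint_fubini2 mA01 mB A01_fin finB mF FC h0).
Qed.

(** With [Er] and [Ec] below, the data that express [E] as a parametric integral over the pairs
    [(t, z)]. *)
Definition Ew m a (p : RM * V) : R := W m p.1 * a p.2.
Definition Er (p : RM * V) : R := 1 + p.1.
Definition Ec (p : RM * V) : V := - (p.1 *: p.2).

Lemma measurable_Er : measurable_fun setT Er.
Proof. exact: measurable_funD. Qed.

Lemma measurable_Ec : measurable_fun setT Ec.
Proof.
apply: measurable_fun_coordP => i.
apply: (@eq_measurable_fun _ _ _ _ _ (fun p : RM * V => - (p.1 * p.2 ord0 i))).
  by move=> p _; rewrite !mxE.
apply: measurableT_comp => //; apply: measurable_funM => //.
exact: measurableT_comp (measurable_coord i) measurable_snd.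
Qed.

Lemma measurable_Ew m a : Cc a -> measurable_fun setT (Ew m a).
Proof.
move=> ha; apply: measurable_funM; first exact: measurableT_comp (measurable_W m) measurable_fst.
exact: measurableT_comp (Cc_measurable ha) measurable_snd.
Qed.

Lemma Ew_bound m a : Cc a -> exists2 C : R, 0 <= C & forall p, `|Ew m a p| <= C.
Proof.
move=> ha; have [C C0 hC] := Cc_bounded ha; exists (2 ^+ m * C); first by rewrite mulr_ge0 ?exprn_ge0.
by move=> p; rewrite normrM ger0_norm ?W_ge0// ler_pM ?W_ge0// W_le.
Qed.

Lemma Ew_supp m a : Cc a -> exists M : R, forall t z, I01 t = 0 \/ M <= `|z| -> Ew m a (t, z) = 0.
Proof.
move=> ha; have [M M0 hM] := Cc_supp ha; exists M => t z [t0|zM]; rewrite /Ew /=.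
  by rewrite /W t0 !mul0r.
by rewrite hM ?mulr0.
Qed.

Lemma Ew_pbound m a : Cc a -> pbound (lam \x mu)%E Er 2 (Ew m a).
Proof.
move=> ha; have [M hM] := Ew_supp m ha; have [C C0 hC] := Ew_bound m ha; split.
  by have [] := rint_tz (measurable_Ew m ha) hC hM.
move=> [t z]; rewrite /Ew /W /Er/=; have [->|[_ /andP[t0 t1]]] := I01_cases t.
  by left; rewrite !mul0r.
by right; rewrite ger0_norm ?addr_ge0 ?(ltW t0)//; lra.
Qed.

Let Ebody m a b x : Cc a -> Cc b ->
  [/\ rint (lam \x mu)%E (fun p => Ew m a p * b (Er p *: x + Ec p)),
   \int[(lam \x mu)%E]_p (Ew m a p * b (Er p *: x + Ec p)) =
      \int[lam]_t \int[mu]_z (Ew m a (t, z) * b (Er (t, z) *: x + Ec (t, z))),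
   \int[lam]_t \int[mu]_z (Ew m a (t, z) * b (Er (t, z) *: x + Ec (t, z))) =
      \int[mu]_z \int[lam]_t (Ew m a (t, z) * b (Er (t, z) *: x + Ec (t, z))),
   rint lam (fun t => \int[mu]_z (Ew m a (t, z) * b (Er (t, z) *: x + Ec (t, z)))) &
   rint mu (fun z => \int[lam]_t (Ew m a (t, z) * b (Er (t, z) *: x + Ec (t, z))))].
Proof.
move=> ha hb; have [M hM] := Ew_supp m ha; have [C C0 hC] := Ew_bound m ha.
have [D D0 hD] := Cc_bounded hb.
apply: (@rint_tz (fun p => Ew m a p * b (Er p *: x + Ec p)) M (C * D)).
- apply: measurable_funM; first exact: measurable_Ew.
  exact: measurableT_comp (Cc_measurable hb) (measurable_paff measurable_Er measurable_Ec x).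
- by move=> p; rewrite normrM ler_pM.
- by move=> t z h; rewrite hM// mul0r.
Qed.

Lemma E_pint m a b : Cc a -> Cc b -> E m a b = pint (lam \x mu)%E Er Ec (Ew m a) b.
Proof.
move=> ha hb; apply/funext => x; have [_ e _ _ _] := Ebody m x ha hb; rewrite /pint e.
apply: eq_Rintegral => t _; rewrite /cv -RintZ; last exact: rint_cv.
by apply: eq_Rintegral => z _; rewrite /Ew /Er /Ec /= mulrA.
Qed.

Lemma E_smooth m a b : Cc a -> Ccoo b -> smooth (E m a b).
Proof.
move=> ha hb; rewrite (E_pint m ha (Ccoo_Cc hb)).
apply: (pint_smooth measurable_Er measurable_Ec (ler0n R 2)) => //; exact: Ew_pbound.
Qed.

Lemma E_partial m a b i : Cc a -> Ccoo b -> partial i (E m a b) = E m.+1 a (partial i b).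
Proof.
move=> ha hb; rewrite (E_pint m ha (Ccoo_Cc hb)) (E_pint m.+1 ha (Ccoo_Cc (Ccoo_partial i hb))).
rewrite (pint_partial measurable_Er measurable_Ec (ler0n R 2) i (Ew_pbound m ha) hb).
congr (pint _ _ _ _ _); apply/funext => p; rewrite /Ew /W /Er exprSr.
by rewrite mulrAC !mulrA.
Qed.

Lemma E_supp m a b x : (forall t z, 0 < t <= 1 -> a z = 0 \/ b ((1 + t) *: x - t *: z) = 0) -> E m a b x = 0.
Proof.
move=> h; rewrite /E -(Rintegral_zero lam); apply: eq_Rintegral => t _.
rewrite /W; have [->|[_ t1]] := I01_cases t; first by rewrite !mul0r.
rewrite [X in _ * X](_ : _ = 0) ?mulr0// /cv -(Rintegral_zero mu); apply: eq_Rintegral => z _.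
by have [->|->] := h t z t1; rewrite ?mul0r ?mulr0.
Qed.

Let rint_Wb m b x z : Cc b -> rint lam (fun t => W m t * b ((1 + t) *: x - t *: z)).
Proof.
move=> hb; have [D D0 hD] := Cc_bounded hb.
apply: (@rint_bounded _ RM R lam _ A01 (2 ^+ m * D)).
- exact: mA01.
- exact: A01_fin.
- apply: measurable_funM; first exact: measurable_W.
  apply: (measurableT_comp (Cc_measurable hb)).
  apply: (@eq_measurable_fun _ _ _ _ _ (fun t : RM => (1 + t) *: x + (- t) *: z)).
    by move=> t _; rewrite scaleNr.
  by apply: measurable_comb => //; (exact: measurable_funD || exact: measurableT_comp).
- by move=> t; rewrite normrM ger0_norm ?W_ge0// ler_pM ?W_ge0// W_le.
- by move=> t h; rewrite W0// mul0r.
Qed.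

Lemma E_swap m a b x : Cc a -> Cc b ->
  rint mu (fun z => a z * \int[lam]_t (W m t * b ((1 + t) *: x - t *: z))) /\
  E m a b x = \int[mu]_z (a z * \int[lam]_t (W m t * b ((1 + t) *: x - t *: z))).
Proof.
move=> ha hb; have [_ e e2 _ r] := Ebody m x ha hb.
have e3 z : \int[lam]_t (Ew m a (t, z) * b (Er (t, z) *: x + Ec (t, z))) =
    a z * \int[lam]_t (W m t * b ((1 + t) *: x - t *: z)).
  rewrite -RintZ; last exact: rint_Wb.
  by apply: eq_Rintegral => t _; rewrite /Ew /Er /Ec /= mulrA [a z * _]mulrC.
split; first by apply: eq_integrable r => // z _ /=; rewrite e3.
by rewrite (E_pint m ha hb) /pint e e2; apply: eq_Rintegral => z _; rewrite e3.
Qed.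

Lemma rint_E m a b x : Cc a -> Cc b -> rint lam (fun t => W m t * cv t a b ((1 + t) *: x)).
Proof.
move=> ha hb; have [_ _ _ + _] := Ebody m x ha hb; apply: eq_integrable => // t _ /=; congr EFin.
rewrite /cv -RintZ; last exact: rint_cv.
by apply: eq_Rintegral => z _; rewrite /Ew /Er /Ec /= mulrA.
Qed.

Lemma E_pairing m a b h : Cc a -> Ccoo b -> Cc h ->
  rint lam (fun t => W m t * \int[mu]_x (cv t a b ((1 + t) *: x) * h x)) /\
  \int[mu]_x (E m a b x * h x) =
  \int[lam]_t (W m t * \int[mu]_x (cv t a b ((1 + t) *: x) * h x)).
Proof.
move=> ha hbs hh; have hb := Ccoo_Cc hbs.
have [Ca Ca0 hCa] := Cc_bounded ha; have [Cb Cb0 hCb] := Cc_bounded hb; have [Ch Ch0 hCh] := Cc_bounded hh.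
have [Ma Ma0 hMa] := Cc_supp ha; have [Mh Mh0 hMh] := Cc_supp hh.
pose F (q : (RM * V) * V) : R := W m q.1.1 * h q.1.2 * (a q.2 * b ((1 + q.1.1) *: q.1.2 - q.1.1 *: q.2)).
have mF : measurable_fun setT F.
  have m1 : measurable_fun setT (fun q : (RM * V) * V => q.1.1) by exact: measurableT_comp measurable_fst measurable_fst.
  have m2 : measurable_fun setT (fun q : (RM * V) * V => q.1.2) by exact: measurableT_comp measurable_snd measurable_fst.
  apply: measurable_funM; apply: measurable_funM.
  - exact: measurableT_comp (measurable_W m) m1.
  - exact: measurableT_comp (Cc_measurable hh) m2.
  - exact: measurableT_comp (Cc_measurable ha) measurable_snd.
  - apply: (measurableT_comp (Cc_measurable hb)).
    apply: (@eq_measurable_fun _ _ _ _ _ (fun q : (RM * V) * V => (1 + q.1.1) *: q.1.2 + (- q.1.1) *: q.2)).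
      by move=> q _; rewrite scaleNr.
    by apply: measurable_comb => //; (exact: measurable_funD || exact: measurableT_comp).
have FC q : `|F q| <= 2 ^+ m * Ch * (Ca * Cb).
  rewrite /F normrM; apply: ler_pM => //; rewrite normrM; apply: ler_pM => //.
  by rewrite ger0_norm ?W_ge0 ?W_le.
have F0 (p : RM * V) (z : V) : ~ [set z : V | `|z| < Ma] z -> F (p, z) = 0.
  by move=> /= /negP; rewrite -leNgt => zM; rewrite /F /= hMa// mul0r mulr0.
(* Joint measurability of the convolution in [t] and [x] is obtained by integrating [z] out of a
   kernel in three variables; what remains is bounded, of bounded support, and ready for Fubini. *)
have E1 := measurable_fun_Rint (measurable_nball Ma) (nball_fin n Ma) mF FC F0.
pose G (p : RM * V) : R := W m p.1 * (cv p.1 a b ((1 + p.1) *: p.2) * h p.2).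
have GE p : \int[mu]_z F (p, z) = G p.
  rewrite /G /cv mulrA mulrAC -[in RHS]RintZ; last exact: rint_cv.
  by apply: eq_Rintegral.
have mG : measurable_fun setT G.
  by apply: (@eq_measurable_fun _ _ _ _ _ (fun p => \int[mu]_z F (p, z))) => [p _|]; [exact: GE|exact: E1].
pose K := 2 ^+ m * (Ca * Cb * fine (mu [set z : V | (`|z| < Ma)%R]) * Ch).
have GC p : `|G p| <= K.
  rewrite /G normrM ger0_norm ?W_ge0//; apply: ler_pM; rewrite ?W_ge0 ?W_le//.
  rewrite normrM; apply: ler_pM => //; apply: le_trans (Rint_norm (rint_cv _ _ ha hb)) _.
  apply: Rint_bounded_le.
  - exact: measurable_nball.
  - exact: nball_fin.
  - exact: rint_measurable (rint_cv _ _ ha hb).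
  - by move=> z; rewrite normrM ler_pM.
  - by move=> z /= /negP; rewrite -leNgt => hz; rewrite hMa// mul0r.
have G0 (t : RM) (x : V) : ~ (A01 t /\ [set x : V | `|x| < Mh] x) -> G (t, x) = 0.
  move=> hp; rewrite /G /=; have [xa|xa] := leP Mh `|x|; first by rewrite hMh// !mulr0.
  by rewrite W0 ?mul0r// => pt; apply: hp; split.
have Gi t : \int[mu]_x G (t, x) = W m t * \int[mu]_x (cv t a b ((1 + t) *: x) * h x).
  rewrite /G /=; have [I0|[_ /andP[t0 _]]] := I01_cases t.
    transitivity (\int[mu]_x (0 : R)); first by apply: eq_Rintegral => x _; rewrite /W I0 !mul0r.
    by rewrite Rintegral_zero /W I0 !mul0r.
  have t1 : 1 + t != 0 by rewrite gt_eqF// addr_gt0.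
  have := Cc_rint (CcM (Cc_affine 0 t1 (Ccoo_Cc (cv_Ccoo t ha hbs))) hh).
  by under eq_fun do rewrite addr0; move=> h1; exact: RintZ.
split.
  have := rint_fubini1 mA01 (measurable_nball Mh) A01_fin (nball_fin n Mh) mG GC G0.
  by apply: eq_integrable => // t _ /=; rewrite Gi.
have := Rfubini mA01 (measurable_nball Mh) A01_fin (nball_fin n Mh) mG GC G0.
under eq_Rintegral do rewrite Gi; move=> ->; apply: eq_Rintegral => x _.
rewrite /E mulrC -RintZ; last exact: rint_E.
by apply: eq_Rintegral => t _; rewrite /G /= mulrCA [h x * _]mulrC.
Qed.

Lemma FTC_I01 (F F' : R -> R) : (forall t, is_derive t (1 : R) F (F' t)) -> continuous F' ->
  rint lam (fun t => I01 t * F' t) ->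
  \int[lam]_t (I01 t * F' t) = F 1 - F 0.
Proof.
move=> dF cF' rF; rewrite Rint_I01//.
have cF t : {for t, continuous F}.
  by apply: differentiable_continuous; apply/derivable1_diffP; have [] := dF t.
rewrite /Rintegral (@continuous_FTC2 _ F' F 0 1)//.
- exact: continuous_subspaceT.
- split.
  + by move=> t _; have [] := dF t.
  + exact/cvg_at_right_filter/cF.
  + exact/cvg_at_left_filter/cF.
- by move=> t _; rewrite derive1E; have [_ ->] := dF t.
Qed.

Lemma E_swapB m a b b' (c : V -> R) x : Cc a -> Cc (fun z => c z * a z) -> Cc b -> Cc b' ->
  rint mu (fun z => a z * \int[lam]_t (W m t * (b ((1 + t) *: x - t *: z) - c z * b' ((1 + t) *: x - t *: z)))) /\
  E m a b x - E m (fun z => c z * a z) b' x =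
  \int[mu]_z (a z * \int[lam]_t (W m t * (b ((1 + t) *: x - t *: z) - c z * b' ((1 + t) *: x - t *: z)))).
Proof.
move=> ha ha' hb hb'; have [r1 e1] := E_swap m x ha hb; have [r2 e2] := E_swap m x ha' hb'.
have e z : a z * \int[lam]_t (W m t * (b ((1 + t) *: x - t *: z) - c z * b' ((1 + t) *: x - t *: z))) =
    a z * \int[lam]_t (W m t * b ((1 + t) *: x - t *: z)) -
    c z * a z * \int[lam]_t (W m t * b' ((1 + t) *: x - t *: z)).
  have s1 := rint_Wb m x z hb; have s2 := rint_Wb m x z hb'.
  rewrite [c z * a z]mulrC -[X in _ - X]mulrA -mulrBr; congr (_ * _).
  rewrite -(RintZ (c z) s2) -(RintB s1 (rintZ (c z) s2)).
  by apply: eq_Rintegral => t _; rewrite mulrBr; congr (_ - _); rewrite mulrCA.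
split; first by apply: eq_integrable (rintB r1 r2) => // z _ /=; rewrite e.
by rewrite e1 e2 -(RintB r1 r2); apply: eq_Rintegral => z _; rewrite e.
Qed.

(** Let [y = x + t (x - z)], so that [y - z = (1 + t) (x - z)]. The sum over [i] of the two
    integrands is [n b(y) + (1 + t) (x - z) . grad b(y)]; multiplied by [(1 + t) ^ (n - 1)] it is
    the derivative in [t] of [(1 + t) ^ n b(y)], which is evaluated at [0] and [1]. *)
Lemma E_div m a b x : n = m.+1 -> Cc a -> Ccoo b ->
  \sum_i (E m a (partial i (fun y => y ord0 i * b y)) x - E m (fun y => y ord0 i * a y) (partial i b) x) =
  \int[mu]_z (a z * (2 ^+ n * b (2 *: x - z) - b x)).
Proof.
move=> nm ha hb; have cb := Ccoo_Cc hb.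
have hmb i : Ccoo (fun y => y ord0 i * b y) by apply: CcooMr => //; exact: smooth_coord.
have hma i : Cc (fun y => y ord0 i * a y).
  by under eq_fun do rewrite mulrC; apply: CcMl => //; exact: coord_continuous.
have P i := E_swapB m x ha (hma i) (Ccoo_Cc (Ccoo_partial i (hmb i))) (Ccoo_Cc (Ccoo_partial i hb)).
rewrite (eq_bigr _ (fun i _ => (P i).2)) -(Rint_sum _ (fun i => (P i).1)).
apply: eq_Rintegral => z _; rewrite -mulr_sumr; congr (_ * _).
have r i : rint lam (fun t => W m t * (partial i (fun y => y ord0 i * b y) ((1 + t) *: x - t *: z) -
    z ord0 i * partial i b ((1 + t) *: x - t *: z))).
  have := rintB (rint_Wb m x z (Ccoo_Cc (Ccoo_partial i (hmb i))))
    (rintZ (z ord0 i) (rint_Wb m x z (Ccoo_Cc (Ccoo_partial i hb)))).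
  by apply: eq_integrable => // t _ /=; rewrite mulrBr; congr (_ - _)%:E; rewrite mulrCA.
rewrite -(Rint_sum _ r).
pose y t := x + t *: (x - z).
have yE t : (1 + t) *: x - t *: z = y t by rewrite /y scalerDl scale1r scalerBr addrA.
pose F (t : R) := (1 + t) ^+ n * b (y t).
pose S (t : R) := \sum_i (x - z) ord0 i * partial i b (y t).
pose F' (t : R) := n%:R * (1 + t) ^+ m * b (y t) + (1 + t) ^+ n * S t.
have dF t : is_derive t (1 : R) F (F' t).
  have d1 : is_derive t (1 : R) (fun t => b (y t)) (S t).
    by apply: (@is_derive_line _ _ b x (x - z)); exact: smooth_C1_derive hb.1.
  have d2 : is_derive t (1 : R) (fun t : R => (1 + t) ^+ n) (n%:R * (1 + t) ^+ m).
    have d3 : is_derive t (1 : R) (fun t : R => 1 + t) 1.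
      by have := is_deriveD (is_derive_cst (1 : R) t 1) (is_derive_id t 1); rewrite add0r.
    rewrite nm (_ : (fun t : R => (1 + t) ^+ m.+1) = (fun t : R => 1 + t) ^+ m.+1); last first.
      by apply/funext => u; rewrite exprfctE.
    by apply: (is_derive_eq (is_deriveX m.+1 d3)); rewrite /GRing.scale/= mulr1.
  apply: (is_derive_eq (is_deriveM d2 d1)); rewrite /F' addrC; congr (_ + _).
  by rewrite /GRing.scale/= mulrC.
have cbi g : smooth g -> continuous (fun t => g (y t)).
  move=> sg t; have := is_derive_line (f := g) (x := x) (v := x - z) (smooth_C1_derive (y t) (x - z) sg).
  by move=> [d _]; apply: differentiable_continuous; exact/derivable1_diffP.
have cX k : continuous (fun t : R => (1 + t) ^+ k).
  have c1 : continuous (fun t : R => 1 + t) by apply: cfD => t; [exact: cst_continuous|exact: cvg_id].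
  elim: k => [|k IH]; first by under eq_fun do rewrite expr0; exact: cst_continuous.
  by under eq_fun do rewrite exprS; exact: cfM.
have cF' : continuous F'.
  apply: cfD; apply: cfM.
  - apply: cfZ; exact: cX.
  - exact: cbi hb.1.
  - exact: cX.
  - by apply: cf_sum => i; apply: cfZ; exact: cbi (smooth_partial i hb.1).
have E' t : \sum_i W m t * (partial i (fun y => y ord0 i * b y) ((1 + t) *: x - t *: z) -
    z ord0 i * partial i b ((1 + t) *: x - t *: z)) = I01 t * F' t.
  have e1 : (1 + t) ^+ n = (1 + t) ^+ m * (1 + t) by rewrite nm exprSr.
  have e2 : \sum_i (partial i (fun y => y ord0 i * b y) (y t) - z ord0 i * partial i b (y t)) =
      n%:R * b (y t) + (1 + t) * S t.
    transitivity (\sum_i (b (y t) + (1 + t) * ((x - z) ord0 i * partial i b (y t)))).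
      apply: eq_bigr => i _; rewrite (partialM i (smooth_coord R i) hb.1) partial_coord eqxx.
      by rewrite /y !mxE /=; ring.
    by rewrite big_split/= sumr_const card_ord -mulr_sumr mulr_natl.
  rewrite -mulr_sumr yE e2 /W /F' e1; move: (S t) (b (y t)) => u v; ring.
transitivity (\int[lam]_t (I01 t * F' t)); first by apply: eq_Rintegral => t _; rewrite E'.
rewrite (FTC_I01 dF cF'); last first.
  by apply: eq_integrable (rint_sum (index_enum 'I_n) r) => // t _ /=; rewrite E'.
rewrite /F /y scale1r scale0r !addr0 expr1n mul1r; congr (_ * b _ - _).
by rewrite scaler_nat addrA.
Qed.

End Eop.

(** * Bounds for [E] by duality and dilation *)

Section chart_bounds.
Variables (R : realType) (n : nat).
Local Notation V := 'rV[R]_n.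
Local Notation mu := (lebesgueV R n).
Local Notation lam := (@lebesgue_measure R).
Local Notation hf := (2^-1 : R).
Implicit Types (a b f g h : V -> R) (x y z : V) (t rho : R).

(** Normalised to preserve the integral and the L1 norm, so that as first argument of a convolution
    it only multiplies the scale by [rho]. *)
Definition dil (rho : R) a x : R := rho ^- n * a (rho^-1 *: x + 0).

Lemma Ccoo_dil rho a : 0 < rho -> Ccoo a -> Ccoo (dil rho a).
Proof.
by move=> r0 ha; apply: CcooZ; apply: Ccoo_affine => //; rewrite invr_eq0 gt_eqF.
Qed.

Lemma Cc_dil rho a : 0 < rho -> Cc a -> Cc (dil rho a).
Proof.
by move=> r0 ha; apply: CcZ; apply: Cc_affine => //; rewrite invr_eq0 gt_eqF.
Qed.

Lemma cv_dil_l rho t a b x : 0 < rho -> Cc a -> Cc b -> cv t (dil rho a) b x = cv (rho * t) a b x.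
Proof.
move=> r0 ha hb; have rn : rho != 0 by rewrite gt_eqF.
rewrite {1}/cv (Rint_affine 0 rn); last exact: rint_cv (Cc_dil r0 ha) hb.
rewrite gtr0_norm// -(RintZ _ (rint_affine 0 rn (rint_cv t x (Cc_dil r0 ha) hb))).
apply: eq_Rintegral => z _; rewrite /dil !addr0 !scalerA mulVf// scale1r !mulrA.
by rewrite mulfV ?expf_neq0// mul1r [t * rho]mulrC.
Qed.

Lemma partial_dil rho a i : Ccoo a -> partial i (dil rho a) = fun x => rho^-1 * dil rho (partial i a) x.
Proof.
move=> [sa _]; rewrite /dil (partialZ _ _ (smooth_affine rho^-1 0 sa)) (partial_affine _ _ _ sa).
by apply/funext => x; rewrite mulrCA.
Qed.

Lemma L1_dil rho a : 0 < rho -> Cc a -> L1 (dil rho a) = L1 a.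
Proof.
move=> r0 ha; have rn : rho^-1 != 0 by rewrite invr_eq0 gt_eqF.
rewrite [RHS](Rint_affine 0 rn (Cc_rint (Cc_abs ha))) -(RintZ _ (rint_affine 0 rn (Cc_rint (Cc_abs ha)))).
apply: eq_Rintegral => x _; rewrite /dil normrM; congr (_ * _).
by rewrite ger0_norm ?invr_ge0 ?exprn_ge0 ?(ltW r0)// gtr0_norm ?invr_gt0// exprVn.
Qed.

Lemma nrm_dil_sqr rho a : 0 < rho -> Cc a -> nrm (dil rho a) ^+ 2 = rho ^- n * nrm a ^+ 2.
Proof.
move=> r0 ha; have rn : rho^-1 != 0 by rewrite invr_eq0 gt_eqF.
rewrite /dil nrmZ; last exact: Cc_affine.
rewrite exprMn (nrm_affine 0 rn ha) [in RHS]mulrA real_normK ?num_real//; congr (_ * _).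
by rewrite expr2 gtr0_norm ?invr_gt0// exprVn.
Qed.

Lemma nrm_dil_le r f : 1 <= r -> Cc f -> nrm (fun x => f (r *: x + 0)) <= nrm f.
Proof.
move=> r1 hf; have r0 : 0 < r by exact: lt_le_trans r1.
have rn0 : r != 0 by rewrite gt_eqF.
rewrite -(@ler_pXn2r _ 2)// ?nnegrE ?nrm_ge0//.
rewrite (nrm_affine 0 rn0 hf) -[leLHS]mul1r ler_wpM2r ?sqr_ge0//.
by rewrite gtr0_norm// exprn_ege1.
Qed.

Lemma E_Ccoo m a b : Cc a -> Ccoo b -> Ccoo (E m a b).
Proof.
move=> ha hb; split; first exact: E_smooth.
have [M M0 hM] := Cc_supp ha; have [N N0 hN] := Cc_supp (Ccoo_Cc hb).
exists (M + N) => x hx; apply: E_supp => t z /andP[t0 t1].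
have [zM|zM] := leP M `|z|; first by left; exact: hM.
right; apply: hN; apply: le_trans (lerB_dist _ _).
rewrite !normrZ !ger0_norm ?addr_ge0 ?(ltW t0)// lerBrDr.
apply: (@le_trans _ _ (N + M)).
  by rewrite lerD2l -[leRHS]mul1r ler_pM// ?(ltW t0)// ltW.
by rewrite addrC (le_trans hx)// -[leLHS]mul1r ler_wpM2r// lerDl ltW.
Qed.

Local Opaque cv nrm L1.

Lemma le_of_sqr_mul (X Y : R) : 0 <= X -> 0 <= Y -> X ^+ 2 <= Y * X -> X <= Y.
Proof.
move=> X0 Y0; have [->//|Xn] := eqVneq X 0.
by rewrite expr2 ler_pM2r// lt0r Xn.
Qed.

(** Duality, the test function being [E n a b] itself, one factor of whose norm cancels at the end.
    The exponent is [n] since two differentiations of [E n.-2] lead there, and [(1 + t) ^ n] is just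
    the Jacobian of [x |-> (1 + t) x]. The tail beyond level [N] is either sent to zero or kept as
    the cheap end of the balance. *)
Lemma E_dyadic a b (N : nat) (S M : R) : Cc a -> Ccoo b -> 0 <= S -> 0 <= M ->
  (forall h th, Ccoo h -> hf < th <= 1 ->
     `|\sum_(l < N) hf ^+ l * ((1 + hf ^+ l * th) ^+ n *
        \int[mu]_x (cv (hf ^+ l * th) a b ((1 + hf ^+ l * th) *: x + 0) * h x))| <= S * nrm h) ->
  (forall t, 0 < t <= 1 -> nrm (cv t a b) <= M) ->
  nrm (E n a b) <= S + hf ^+ N * (2 ^+ n * M).
Proof.
move=> ha hb S0 M0 hS hM; have hE := E_Ccoo n ha hb; have cE := Ccoo_Cc hE.
apply: le_of_sqr_mul; first exact: nrm_ge0.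
  by rewrite addr_ge0// !mulr_ge0// exprn_ge0.
have [rE EE] := E_pairing n ha hb cE.
have -> : nrm (E n a b) ^+ 2 = \int[mu]_x (E n a b x * E n a b x).
  by rewrite nrm_sqr; apply: eq_Rintegral => x _; rewrite expr2.
pose Phi t := (1 + t) ^+ n * \int[mu]_x (cv t a b ((1 + t) *: x + 0) * E n a b x).
have WP t : W n t * \int[mu]_x (cv t a b ((1 + t) *: x) * E n a b x) = I01 t * Phi t.
  have e : \int[mu]_x (cv t a b ((1 + t) *: x) * E n a b x) = \int[mu]_x (cv t a b ((1 + t) *: x + 0) * E n a b x).
    by apply: eq_Rintegral => x _; rewrite addr0.
  by rewrite e /Phi /W; move: (\int[mu]_x _) => u; rewrite mulrA.
rewrite EE; have -> : \int[lam]_t (W n t * \int[mu]_x (cv t a b ((1 + t) *: x) * E n a b x)) =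
    \int[lam]_t (I01 t * Phi t) by apply: eq_Rintegral => t _; exact: WP.
have rP : rint lam (fun t => I01 t * Phi t).
  by apply: eq_integrable rE => // t _ /=; rewrite WP.
apply: le_trans (ler_norm _) _; rewrite mulrDl -[(_ ^+ N * _) * _]mulrA.
apply: (dyadic_bound rP).
- by rewrite mulr_ge0 ?nrm_ge0.
- by rewrite !mulr_ge0 ?nrm_ge0 ?exprn_ge0.
- by move=> th hth; apply: hS.
move=> t /andP[t0 t1]; rewrite /Phi normrM ger0_norm ?exprn_ge0 ?addr_ge0 ?(ltW t0)//.
rewrite -mulrA; apply: ler_pM => //; first by rewrite exprn_ge0 ?addr_ge0 ?(ltW t0).
  by rewrite lerXn2r ?nnegrE ?addr_ge0 ?(ltW t0)//; lra.
have hc := cv_Ccoo t ha hb; have t2 : 1 + t != 0 by rewrite gt_eqF// addr_gt0.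
apply: le_trans (Cc_CS (Cc_affine 0 t2 (Ccoo_Cc hc)) cE) _.
rewrite ler_wpM2r ?nrm_ge0//; apply: le_trans (nrm_dil_le _ (Ccoo_Cc hc)) _.
  by rewrite lerDl ltW.
by apply: hM; rewrite t0.
Qed.

Lemma le_geom_limit (X S M : R) : 0 <= M -> (forall N, X <= S + hf ^+ N * M) -> X <= S.
Proof.
move=> M0 H; apply/ler_addgt0Pr => e e0.
have [N hN] : exists N, hf ^+ N * M <= e.
  pose N := (Num.trunc (M / e)).+1; exists N.
  have hN : M / e < N%:R by exact: truncnS_gt.
  have h2 : M / e < 2 ^+ N.
    by apply: lt_trans hN _; rewrite -natrX ltr_nat ltn_expl.
  rewrite exprVn -[leLHS]mulrC ler_pdivrMr ?exprn_gt0// -ler_pdivrMl// mulrC; exact: ltW.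
by apply: le_trans (H N) _; rewrite lerD2l.
Qed.

(* Paired with itself, [E] is an integral over [t] of terms whose dyadic sums are controlled by
   [bilinear_bound]. *)
Theorem E_singular_bound al be i : Ccoo al -> Ccoo be ->
  exists2 C : R, 0 <= C & forall rho g, 0 < rho -> Ccoo g ->
    nrm (E n (dil rho (cv 1 al be)) (partial i g)) <= C / rho * nrm g.
Proof.
move=> hal hbe; have [C C0 HC] := bilinear_bound i hal hbe.
exists (2 * C); first by rewrite mulr_ge0.
move=> rho g r0 hg; set a := cv 1 al be.
have ha : Ccoo a by apply: cv_Ccoo => //; exact: Ccoo_Cc.
have hG := Ccoo_partial i hg; have cG := Ccoo_Cc hG.
have hda := Ccoo_dil r0 ha; have cda := Ccoo_Cc hda.
pose M := L1 (dil rho a) * nrm (partial i g).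
apply: (@le_geom_limit _ _ (2 ^+ n * M)).
  by rewrite !mulr_ge0 ?exprn_ge0 ?L1_ge0 ?nrm_ge0.
move=> N; apply: (E_dyadic cda hG).
- by rewrite !mulr_ge0 ?invr_ge0 ?nrm_ge0// ltW.
- by rewrite mulr_ge0 ?L1_ge0 ?nrm_ge0.
- move=> h th hh /andP[th0 th1].
  have thp : 0 < th by apply: lt_trans th0; rewrite invr_gt0.
  have HH := HC N (fun l => rho * (hf ^+ l * th)) (fun l => 1 + hf ^+ l * th) g h hg hh.
  have {}HH : `|\sum_(l < N) rho * (hf ^+ l * th) * ((1 + hf ^+ l * th) ^+ n *
      \int[mu]_x (cv (rho * (hf ^+ l * th)) a (partial i g) ((1 + hf ^+ l * th) *: x + 0) * h x))|
      <= C * (nrm g * nrm h).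
    apply: HH.
    + by move=> p; rewrite !mulr_gt0// exprn_gt0 ?invr_gt0.
    + move=> p m pm; rewrite -[in LHS](subnK pm) exprD.
      by move: (hf ^+ (m - p)) (hf ^+ p) => u v; ring.
    + move=> l; have h1 : 0 <= hf ^+ l * th by rewrite mulr_ge0 ?exprn_ge0// ltW.
      have h2 : hf ^+ l * th <= 1.
        by rewrite -[leRHS]mulr1 ler_pM ?exprn_ge0 ?(ltW thp)// exprn_ile1// invf_le1// ler1n.
      by apply/andP; split; lra.
  have rth : 0 < rho * th by rewrite mulr_gt0.
  (* The bilinear estimate has the weights [rho * 2 ^ -l * th] in place of [2 ^ -l]; dividing by
     [rho * th], which exceeds [rho / 2], produces the constant [2 * C / rho]. *)
  rewrite -(ler_pM2l rth); apply: le_trans (_ : C * (nrm g * nrm h) <= _); last first.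
    rewrite (_ : rho * th * (2 * C / rho * nrm g * nrm h) = (2 * th) * (C * (nrm g * nrm h))); last first.
      have key (r u v c k : R) : r != 0 -> r * u * (2 * c / r * v * k) = (2 * u) * (c * (v * k)) by move=> rn; field.
      by apply: key; rewrite gt_eqF.
    rewrite -[leLHS]mul1r ler_wpM2r ?mulr_ge0 ?nrm_ge0//.
    by have h2 := mulfV (_ : (2 : R) != 0); lra.
  have cE t y : cv t (dil rho a) (partial i g) y = cv (rho * t) a (partial i g) y.
    by apply: cv_dil_l => //; exact: Ccoo_Cc.
  pose J l := \int[mu]_x (cv (rho * (hf ^+ l * th)) a (partial i g) ((1 + hf ^+ l * th) *: x + 0) * h x).
  have EJ l : \int[mu]_x (cv (hf ^+ l * th) (dil rho a) (partial i g) ((1 + hf ^+ l * th) *: x + 0) * h x) = J l.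
    by apply: eq_Rintegral => x _; rewrite cE.
  rewrite (eq_bigr (fun l : 'I_N => hf ^+ l * ((1 + hf ^+ l * th) ^+ n * J l))); last by move=> l _; rewrite EJ.
  have nE (S : R) : rho * th * `|S| = `|rho * th * S| by rewrite normrM (gtr0_norm rth).
  rewrite nE mulr_sumr; apply: le_trans HH.
  rewrite le_eqVlt; apply/orP; left; apply/eqP; congr (`|_|); apply: eq_bigr => l _.
  rewrite -/(J l); move: (J l) (hf ^+ l) => u v.
  by rewrite !mulrA [rho * th * v]mulrAC.
- by move=> t _; apply: young1.
Qed.

End chart_bounds.

(** * Estimates on second derivatives *)

Section balance.
Variable R : realType.
Local Notation hf := (2^-1 : R).
Local Notation q := (Num.sqrt 2 : R).

Definition loggrowth (n : nat) (K : R) : R :=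
  1 + K `^ ((n%:R - 2) / (2 * (n%:R - 1))) * (ln K) `^ (n%:R / (2 * (n%:R - 1))).

(** At [t] of order [2 ^ -l] the first Young inequality costs [t ^ (-n/2)]; beyond level [L] the
    other one costs the square root of the volume ratio [K]. The factors [2 ^ -l] are the lengths of
    the dyadic intervals. *)
Definition dyadic_cost (n L : nat) (K : R) : R :=
  \sum_(l < L) hf ^+ l * Num.sqrt (2 ^+ (l * n)) + hf ^+ L * Num.sqrt K.

Let q2 : q ^+ 2 = 2. Proof. by rewrite sqr_sqrtr. Qed.

Let q0 : 0 < q. Proof. by rewrite sqrtr_gt0. Qed.

Let q43 : 4 / 3 <= q.
Proof.
rewrite -(@ler_pXn2r _ 2)// ?nnegrE ?(ltW q0)// q2; lra.
Qed.

Let q1 : 1 <= q. Proof. by apply: le_trans q43; lra. Qed.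

Let sqrtX k : Num.sqrt (2 ^+ k) = q ^+ k.
Proof. by rewrite -[in LHS]q2 -exprM mulnC exprM sqrtr_sqr ger0_norm// exprn_ge0// ltW. Qed.

Let hfq l k : hf ^+ l * q ^+ (l * k.+2) = q ^+ (l * k).
Proof.
rewrite -[k.+2]addn2 mulnDr exprD mulrCA [(l * 2)%N]mulnC (exprM q 2) q2 -exprMn.
by rewrite mulVf// expr1n mulr1.
Qed.

Let exists_level (m : nat) (K : R) : (0 < m)%N -> 1 <= K ->
  exists L, K <= 2 ^+ (L * m) /\ (L = 0%N \/ exists2 k, L = k.+1 & 2 ^+ (k * m) < K).
Proof.
move=> m0 K1; have ex : exists L, K <= 2 ^+ (L * m).
  exists (Num.trunc K).+1; apply/ltW; apply: lt_le_trans (truncnS_gt K) _.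
  rewrite -natrX ler_nat; apply: leq_trans (ltnW (ltn_expl _ (ltnSn 1))) _.
  by rewrite leq_pexp2l// leq_pmulr.
have [L hL minL] := ex_minnP ex; exists L; split => //.
case: L hL minL => [|k] hL minL; [by left|right; exists k => //].
rewrite ltNge; apply/negP => h; have := minL _ h; by rewrite ltnn.
Qed.

(** [3] is [1 / (4/3 - 1)]; the ratios to come are powers of the square root of [2], which is above
    [4/3]. *)
Let geom_growth (r : R) L : 4 / 3 <= r -> \sum_(l < L) r ^+ l <= 3 * r ^+ L.
Proof.
move=> r43; have r0 : 0 <= r by lra.
elim: L => [|L IH]; first by rewrite big_ord0 expr0; lra.
rewrite big_ord_recr/= exprS; have := exprn_ge0 L r0; move: (r ^+ L) IH => u; nra.
Qed.

(* [L] is the least level with [K <= 2 ^ (L * m)]. *)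
Lemma dyadic_balance (m : nat) : (0 < m)%N -> exists2 C : R, 0 < C &
  forall K : R, 1 <= K -> exists L, dyadic_cost m.+1 L K <= C * loggrowth m.+1 K.
Proof.
case: m => [//|[_|p _]].
(* For [n = 2] every term of the sum equals [1], so the cost is the number of levels, at most [1]
   plus the base two logarithm of [K]: the logarithm originates here. *)
- have ln2 : 0 < ln (2 : R) by rewrite ln_gt0// ltr1n.
  exists (2 + (ln (2 : R))^-1); first by rewrite addr_gt0 ?invr_gt0.
  move=> K K1; have [L [hL L']] := exists_level (ltnSn 0) K1; exists L.
  have lK : 0 <= ln K by exact: ln_ge0.
  have -> : loggrowth 2 K = 1 + ln K.
    rewrite /loggrowth (_ : 2%:R - 2 = 0); last by rewrite subrr.
    rewrite mul0r powRr0 mul1r (_ : 2%:R / (2 * (2%:R - 1)) = 1); last by field.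
    by rewrite powRr1.
  have -> : dyadic_cost 2 L K = L%:R + hf ^+ L * Num.sqrt K.
    rewrite /dyadic_cost; congr (_ + _); rewrite -[in RHS](card_ord L) -sumr_const.
    by apply: eq_bigr => l _; rewrite sqrtX (hfq l 0) muln0 expr0.
  have h1 : hf ^+ L * Num.sqrt K <= 1.
    rewrite exprVn ler_pdivrMl ?exprn_gt0// mulr1; apply: le_trans (_ : K <= _).
      rewrite -[leRHS](@sqr_sqrtr _ K) ?(le_trans _ K1)// expr2 ler_peMl ?sqrtr_ge0//.
      by rewrite -sqrtr1 ler_wsqrtr.
    by rewrite muln1 in hL.
  have h2 : L%:R <= 1 + (ln 2)^-1 * ln K.
    case: L' => [->|[k -> hk]]; first by rewrite addr_ge0// mulr_ge0// invr_ge0 ltW.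
    rewrite -natr1 addrC lerD2l ler_pdivlMl//; rewrite muln1 in hk.
    rewrite mulrC mulr_natl -lnXn// ler_ln ?posrE ?exprn_gt0 ?ltW//.
    exact: lt_le_trans K1.
  have h3 : 0 <= (ln (2 : R))^-1 by rewrite invr_ge0 ltW.
  have h4 := mulr_ge0 h3 lK; rewrite mulrDr mulr1 mulrDl; lra.
(* For [n >= 3] the sum is geometric with ratio a positive power of the square root of [2], and its
   last term decides. *)
pose m := p.+2; pose n := m.+1.
pose ee : R := expR 1 + 1.
have ee1 : 1 <= ee by rewrite lerDr expR_ge0.
have ee0 : 0 < ee by exact: lt_le_trans ee1.
exists (4 * (2 ^+ m * ee)); first by apply: mulr_gt0 => //; apply: mulr_gt0 => //; exact: exprn_gt0.
move=> K K1; have [L [hL L']] := exists_level (isT : (0 < m)%N) K1; exists L.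
have K0 : 0 < K by exact: lt_le_trans K1.
pose e : R := (n%:R - 2) / (2 * (n%:R - 1)).
pose s := K `^ e.
have m0 : (m%:R : R) != 0 by rewrite pnatr_eq0.
have nE : (n%:R : R) = m%:R + 1 by rewrite /n -natr1.
have e0 : 0 <= e.
  rewrite /e nE addrK divr_ge0// ?mulr_ge0//.
  by rewrite /m -natr1 -natr1; have := ler0n R p; lra.
have s1 : 1 <= s by rewrite /s -(powRr0 K) ler_powR.
(* By minimality level [L - 1] fails, so [2 ^ ((L - 1) m) < K]; comparing powers of order [2 m]
   turns this into the exponent [(n - 2) / (2 (n - 1))], and the one missing level costs at most
   [2 ^+ m]. *)
have rL : q ^+ (L * p.+1) <= 2 ^+ m * s.
  case: L' => [->|[k -> hk]].
    by rewrite mul0n expr0 -[leLHS]mulr1 ler_pM// exprn_ege1// ler1n.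
  rewrite mulSn exprD ler_pM ?exprn_ge0 ?(ltW q0)//.
    apply: (@le_trans _ _ (2 ^+ p.+1)); last by rewrite ler_weXn2l// ler1n.
    by rewrite lerXn2r ?nnegrE ?(ltW q0)// -[leRHS]q2 expr2 ler_peMl ?(ltW q0).
  rewrite -(@ler_pXn2r _ (2 * m)) ?nnegrE ?exprn_ge0 ?powR_ge0 ?(ltW q0)//.
  have -> : s ^+ (2 * m) = K ^+ p.+1.
    rewrite -powR_mulrn ?powR_ge0// /s -powRrM (_ : e * _ = p.+1%:R).
      by rewrite powR_mulrn// ltW.
    rewrite /e nE addrK natrM; have -> : m%:R + 1 - 2 = p.+1%:R :> R by rewrite /m -natr1; ring.
    by field.
  rewrite -exprM mulnA [(_ * 2)%N]mulnC -mulnA exprM q2 mulnAC exprM.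
  by rewrite lerXn2r ?nnegrE ?exprn_ge0// ltW.
have cost : dyadic_cost n L K <= 4 * q ^+ (L * p.+1).
  rewrite /dyadic_cost (_ : 4 = 3 + 1); last by ring.
  rewrite mulrDl mul1r; apply: lerD.
    rewrite mulnC exprM; apply: le_trans (geom_growth (r := q ^+ p.+1) _ _).
      apply: ler_sum => l _; rewrite sqrtX (hfq l p.+1) mulnC exprM//.
    by apply: le_trans q43 _; rewrite -[leLHS]expr1 ler_weXn2l.
  apply: (@le_trans _ _ (hf ^+ L * q ^+ (L * m))).
    by rewrite ler_wpM2l ?exprn_ge0// -sqrtX ler_wsqrtr.
  by rewrite (hfq L p) ler_weXn2l// leq_mul.
(* The logarithmic factor can be small when [K] is close to [1]. From [K >= e] on it is at least
   [1]; below, [s <= K] is bounded by [e] and the summand [1] of [loggrowth] suffices. *)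
have G1 : s <= ee * loggrowth n K.
  apply: (@le_trans _ _ (ee * (1 + s * (ln K) `^ (n%:R / (2 * (n%:R - 1)))))); last by [].
  set w := (ln K) `^ _; have w0 : 0 <= w by exact: powR_ge0.
  have [h|h] := leP (expR 1) K.
    have w1 : 1 <= w.
      rewrite (_ : 1 = 1 `^ (n%:R / (2 * (n%:R - 1)))); last by rewrite powR1.
      apply: ge0_ler_powR => //.
      + by rewrite nE divr_ge0// ?addr_ge0// mulr_ge0// addrK.
      + by rewrite nnegrE.
      + by rewrite nnegrE ln_ge0.
      + by rewrite -(expRK 1) ler_ln// posrE expR_gt0.
    have : s * 1 <= s * w by rewrite ler_wpM2l// (le_trans _ s1).
    rewrite mulr1 => h1; have h2 : 0 <= (ee - 1) * (1 + s * w) by rewrite mulr_ge0 ?subr_ge0// addr_ge0// mulr_ge0// (le_trans _ s1).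
    lra.
  have s3 : s <= ee.
    apply: (@le_trans _ _ K); last by apply: le_trans (ltW h) _; rewrite lerDl.
    rewrite /s -[leRHS]powRr1 ?(ltW K0)// ler_powR// /e nE addrK ler_pdivrMr ?mulr_gt0 ?ltr0n//.
    by have := ler0n R m; lra.
  have h2 : 0 <= ee * (s * w) by rewrite mulr_ge0 ?(ltW ee0)// mulr_ge0// (le_trans _ s1).
  by rewrite mulrDr mulr1; lra.
apply: le_trans cost _; apply: (@le_trans _ _ (4 * (2 ^+ m * s))).
  by rewrite ler_wpM2l.
have e2 : 0 <= (2 : R) ^+ m by exact: exprn_ge0.
by move: e2 G1; move: (2 ^+ m) => u u0 G1; rewrite -!mulrA !ler_wpM2l.
Qed.

End balance.

(** * Bumps, kernels and the level estimate for a smooth second argument *)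

Section kernel.
Variables (R : realType) (n : nat).
Local Notation V := 'rV[R]_n.
Local Notation mu := (lebesgueV R n).
Local Notation lam := (@lebesgue_measure R).
Local Notation hf := (2^-1 : R).
Implicit Types (a b f g h : V -> R) (x y z : V) (t rho : R).

Definition flat1 : R -> R := flat 1.

Lemma flat1_gt0 s : 0 < s -> 0 < flat1 s.
Proof. by move=> s0; rewrite /flat1 /flat s0 hornerC mul1r expR_gt0. Qed.

Lemma flat1_le0 s : s <= 0 -> flat1 s = 0.
Proof. by move=> s0; rewrite /flat1 /flat ltNge s0. Qed.

Lemma flat1_ge0 s : 0 <= flat1 s.
Proof. by have [/flat1_le0->//|/flat1_gt0/ltW] := leP s 0. Qed.

Lemma flat1_le1 s : flat1 s <= 1.
Proof.
have [/flat1_le0->//|s0] := leP s 0.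
by rewrite /flat1 /flat s0 hornerC mul1r -expR0 ler_expR oppr_le0 invr_ge0 ltW.
Qed.

(** Positive exactly on the open cube of centre [c] and half-side [d]. The parameter [k] is a
    steepness: one value serves for the mollifier, and letting it grow gives the indicator of the
    cube. *)
Definition box_bump (c : V) (d k : R) x : R :=
  \prod_(i < n) (flat1 (k * x ord0 i + k * (d - c ord0 i)) * flat1 (- k * x ord0 i + k * (d + c ord0 i))).

Lemma box_bump_smooth c d k : smooth (box_bump c d k).
Proof. by apply: smooth_prod => i; apply: smoothM; exact: flat_smooth. Qed.

Let box_bumpE c d k x : box_bump c d k x =
  \prod_(i < n) (flat1 (k * (d + (x ord0 i - c ord0 i))) * flat1 (k * (d - (x ord0 i - c ord0 i)))).
Proof. by apply: eq_bigr => i _; congr (flat1 _ * flat1 _); ring. Qed.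

Lemma box_bump_gt0 c d k x : 0 < k -> cube c d x -> 0 < box_bump c d k x.
Proof.
move=> k0 xc; rewrite box_bumpE; apply: prodr_gt0 => i _.
by have := xc i; rewrite ltr_norml => /andP[h1 h2]; rewrite mulr_gt0// flat1_gt0// mulr_gt0//; lra.
Qed.

Lemma box_bump_ge0 c d k x : 0 <= box_bump c d k x.
Proof. by apply: prodr_ge0 => i _; rewrite mulr_ge0 ?flat1_ge0. Qed.

Lemma box_bump_le1 c d k x : box_bump c d k x <= 1.
Proof.
rewrite /box_bump; apply: prodr_ile1 => i _; rewrite mulr_ge0 ?flat1_ge0//=.
by rewrite mulr_ile1 ?flat1_ge0 ?flat1_le1.
Qed.

Lemma box_bump_eq0 c d k x : 0 < k -> ~ cube c d x -> box_bump c d k x = 0.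
Proof.
move=> k0 /existsNP[i /negP]; rewrite -leNgt => hi.
rewrite box_bumpE; apply/eqP/prodf_eq0; exists i => //.
rewrite mulf_eq0; apply/orP; move: hi; rewrite ler_normr => /orP[] hi.
  by right; rewrite flat1_le0// pmulr_rle0//; lra.
by left; rewrite flat1_le0// pmulr_rle0//; lra.
Qed.

Lemma Rint_gt0 f x : Cc f -> (forall x, 0 <= f x) -> 0 < f x -> 0 < \int[mu]_x f x.
Proof.
move=> hf f0 fx; have [r r0 hr] : exists2 r : R, 0 < r & cube x r `<=` [set y | f x / 2 < f y].
  apply: nbhs_cube; have := hf.1 x; move=> /cvgrPdist_lt/(_ (f x / 2)) h.
  have := h (divr_gt0 fx (ltr0n R 2)); apply: filterS => y /=.
  by rewrite ltr_norml => /andP[_ h2]; lra.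
have mc := @measurable_cube R n x r.
have cfin : (mu (cube x r) < +oo)%E by rewrite lebesgueV_cube// ltry.
have rI : rint mu (fun y => f x / 2 * \1_(cube x r) y).
  apply: rintZ; apply: (rint_bounded mc cfin (C := 1)) => //.
    by move=> z; rewrite indicE; case: (_ \in _); rewrite ?normr0 ?normr1.
  by move=> z Az; rewrite indicE memNset.
apply: (@lt_le_trans _ _ (\int[mu]_y (f x / 2 * \1_(cube x r) y))); last first.
  apply: Rint_le => //; first exact: Cc_rint.
  move=> y; rewrite indicE; have [/set_mem/hr/= h|_] := boolP (y \in _); last by rewrite mulr0.
  by rewrite mulr1 ltW.
rewrite RintZ; last first.
  apply: (rint_bounded mc cfin (C := 1)) => //.
    by move=> z; rewrite indicE; case: (_ \in _); rewrite ?normr0 ?normr1.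
  by move=> z Az; rewrite indicE memNset.
have -> : \int[mu]_y \1_(cube x r) y = (2 * r) ^+ n.
  by rewrite /Rintegral integral_indic// setIT; have /= -> := lebesgueV_cube x r0.
by apply: mulr_gt0; [exact: divr_gt0|rewrite exprn_gt0// mulr_gt0].
Qed.

Lemma kernel_exists (d : R) : 0 < d ->
  exists eta, [/\ Ccoo eta, forall x, d <= `|x| -> eta x = 0 & \int[mu]_x eta x = 1].
Proof.
move=> d0; pose b := box_bump 0 d 1.
have b0 x : d <= `|x| -> b x = 0.
  move=> dx; apply: box_bump_eq0 => // xc; move: dx; rewrite leNgt => /negP; apply.
  by apply: rV_norm_lt => // i; have := xc i; rewrite mxE subr0.
have hb : Ccoo b by split; [exact: box_bump_smooth|exists d].
have ib : 0 < \int[mu]_x b x.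
  apply: (@Rint_gt0 _ 0) (Ccoo_Cc hb) _ _; first by move=> x; exact: box_bump_ge0.
  by apply: box_bump_gt0 => // i; rewrite !mxE subrr normr0.
exists (fun x => (\int[mu]_x b x)^-1 * b x); split.
- exact: CcooZ.
- by move=> x /b0->; rewrite mulr0.
- by rewrite RintZ ?mulVf ?gt_eqF//; exact/Cc_rint/Ccoo_Cc.
Qed.

Lemma enorm_lt x (r : R) : 0 < r -> `|x| * n.+1%:R < r -> enorm x < r.
Proof.
move=> r0 h; rewrite /enorm -(ger0_norm (ltW r0)) -sqrtr_sqr ltr_sqrt ?exprn_gt0//.
have s2 : (`|x| * n.+1%:R) ^+ 2 < r ^+ 2 by rewrite ltrXn2r// nnegrE ?mulr_ge0// ltW.
apply: le_lt_trans s2; apply: (@le_trans _ _ (\sum_(i < n) `|x| ^+ 2)).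
  by apply: ler_sum => i _; rewrite -real_normK ?num_real// lerXn2r ?nnegrE// rV_coord_le.
rewrite sumr_const card_ord exprMn -[leLHS]mulr_natr ler_wpM2l ?sqr_ge0//.
by rewrite -natrX ler_nat expnS expn1 mulSn (leq_trans (leqnSn n))// leq_addr.
Qed.

Lemma coord_le_enorm x i : `|x ord0 i| <= enorm x.
Proof.
rewrite /enorm -sqrtr_sqr ler_wsqrtr// (bigD1 i)//= lerDl.
by apply: sumr_ge0 => j _; exact: sqr_ge0.
Qed.

Lemma cvZl t (c : R) a f x : Cc a -> Cc f -> cv t (fun y => c * a y) f x = c * cv t a f x.
Proof.
move=> ha hcf; rewrite -[RHS]RintZ; last exact: rint_cv.
by apply: eq_Rintegral => z _; rewrite mulrA.
Qed.

Lemma cvDl t a b f x : Cc a -> Cc b -> Cc f ->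
  cv t (fun y => a y + b y) f x = cv t a f x + cv t b f x.
Proof.
move=> ha hb hf; rewrite -[RHS]RintD; [|exact: rint_cv|exact: rint_cv].
by apply: eq_Rintegral => z _; rewrite mulrDl.
Qed.

Lemma cvDr t a f g x : Cc a -> Cc f -> Cc g ->
  cv t a (fun y => f y + g y) x = cv t a f x + cv t a g x.
Proof.
move=> ha hf hg; rewrite -[RHS]RintD; [|exact: rint_cv|exact: rint_cv].
by apply: eq_Rintegral => z _; rewrite mulrDr.
Qed.

Local Opaque cv.

Lemma EZl m (c : R) a f : Cc a -> Cc f -> E m (fun y => c * a y) f = fun x => c * E m a f x.
Proof.
move=> ha hf; apply/funext => x; rewrite -[RHS](RintZ c (rint_E m x ha hf)).
by apply: eq_Rintegral => t _; rewrite cvZl// mulrCA.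
Qed.

Lemma EZr m (c : R) a f : Cc a -> Cc f -> E m a (fun y => c * f y) = fun x => c * E m a f x.
Proof.
move=> ha hf; apply/funext => x; rewrite -[RHS](RintZ c (rint_E m x ha hf)).
by apply: eq_Rintegral => t _; rewrite cvZr// mulrCA.
Qed.

Lemma EDl m a b f : Cc a -> Cc b -> Cc f ->
  E m (fun y => a y + b y) f = fun x => E m a f x + E m b f x.
Proof.
move=> ha hb hf; apply/funext => x; rewrite -[RHS](RintD (rint_E m x ha hf) (rint_E m x hb hf)).
by apply: eq_Rintegral => t _; rewrite cvDl// mulrDr.
Qed.

Lemma EDr m a f g : Cc a -> Cc f -> Cc g ->
  E m a (fun y => f y + g y) = fun x => E m a f x + E m a g x.
Proof.
move=> ha hf hg; apply/funext => x; rewrite -[RHS](RintD (rint_E m x ha hf) (rint_E m x ha hg)).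
by apply: eq_Rintegral => t _; rewrite cvDr// mulrDr.
Qed.

Lemma L1_le_nrm (Omega : set V) a : measurable Omega -> (mu Omega < +oo)%E -> Cc a ->
  (forall x, ~ Omega x -> a x = 0) -> L1 a <= Num.sqrt (vol Omega) * nrm a.
Proof.
move=> mO fO ha a0.
have i0 x : `|\1_Omega x : R| <= 1 by rewrite indicE; case: (_ \in _); rewrite ?normr0 ?normr1.
have i1 x : ~ Omega x -> \1_Omega x = 0 :> R by move=> h; rewrite indicE memNset.
have rI : rint mu (\1_Omega : V -> R) by apply: (rint_bounded mO fO _ i0 i1).
have E2 x : (\1_Omega x : R) ^+ 2 = \1_Omega x.
  by rewrite indicE; case: (_ \in _); rewrite ?expr1n ?expr0n.
have E1 x : `|a x| = `|a x| * \1_Omega x.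
  rewrite indicE; have [_|/negP h] := boolP (x \in Omega); first by rewrite mulr1.
  by rewrite a0 ?normr0 ?mul0r// => Ox; apply: h; exact: mem_set.
have := @Rint_CS _ _ _ mu (fun x => `|a x|) (\1_Omega : V -> R).
have r2 : rint mu (fun x => `|a x| ^+ 2) by exact: Cc_rint (Cc_sqr (Cc_abs ha)).
have r3 : rint mu (fun x => (\1_Omega x : R) ^+ 2) by under eq_fun do rewrite E2.
have r4 : rint mu (fun x => `|a x| * \1_Omega x) by under eq_fun do rewrite -E1; exact: Cc_rint (Cc_abs ha).
move=> /(_ r2 r3 r4) H.
rewrite -(@ler_pXn2r _ 2)// ?nnegrE ?L1_ge0 ?mulr_ge0 ?nrm_ge0 ?sqrtr_ge0//.
rewrite exprMn sqr_sqrtr ?fine_ge0// nrm_sqr mulrC.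
have -> : L1 a = \int[mu]_x (`|a x| * \1_Omega x) by apply: eq_Rintegral => x _; rewrite -E1.
apply: le_trans H _; rewrite le_eqVlt; apply/orP; left; apply/eqP; congr (_ * _).
  by apply: eq_Rintegral => x _; rewrite real_normK// num_real.
transitivity (\int[mu]_x (\1_Omega x : R)); first by apply: eq_Rintegral => x _; exact: E2.
by rewrite /Rintegral integral_indic// setIT.
Qed.

Local Opaque nrm L1.

(** One factor [2 ^+ n] of the constant bounds [(1 + t) ^ n]. The other is the square root of
    [4 ^+ n] in [t ^- n <= 4 ^+ n * 2 ^+ (l * n)], valid since [t > 2 ^ -(l + 1)] at level [l]. *)
Lemma E_bound_levels a b (L : nat) (A B : R) : Cc a -> Ccoo b -> 0 <= A -> 0 <= B ->
  (forall t, 0 < t -> nrm (cv t a b) ^+ 2 <= t ^- n * A ^+ 2) ->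
  (forall t, nrm (cv t a b) <= B) ->
  nrm (E n a b) <= 4 ^+ n * (A * \sum_(l < L) hf ^+ l * Num.sqrt (2 ^+ (l * n)) + hf ^+ L * B).
Proof.
move=> ha hb A0 B0 hA hB.
have h2n : (1 : R) <= 2 ^+ n by rewrite exprn_ege1// ler1n.
have h4 : (4 : R) ^+ n = 2 ^+ n * 2 ^+ n by rewrite -exprMn; congr (_ ^+ _); ring.
pose Sg := \sum_(l < L) hf ^+ l * (Num.sqrt (2 ^+ (l * n)) : R).
have Sg0 : 0 <= Sg by apply: sumr_ge0 => l _; rewrite mulr_ge0 ?exprn_ge0 ?sqrtr_ge0.
apply: (@le_trans _ _ (4 ^+ n * (A * Sg) + hf ^+ L * (2 ^+ n * B))); last first.
  rewrite mulrDr lerD2l mulrCA; rewrite ler_wpM2r ?mulr_ge0 ?exprn_ge0//.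
  by rewrite h4 ler_peMl// exprn_ge0.
apply: E_dyadic => //; first by rewrite !mulr_ge0 ?exprn_ge0.
move=> h th hh /andP[th0 th1]; have thp : 0 < th by apply: lt_trans th0; rewrite invr_gt0.
apply: le_trans (ler_norm_sum _ _ _) _; rewrite /Sg !mulr_sumr mulr_suml; apply: ler_sum => l _.
pose t := hf ^+ l * th; have t0 : 0 < t by rewrite mulr_gt0// exprn_gt0 ?invr_gt0.
have t1 : t <= 1.
  by rewrite /t -[leRHS]mulr1 ler_pM ?exprn_ge0 ?(ltW thp)// exprn_ile1// invf_le1// ler1n.
have r1 : 1 <= 1 + t by rewrite lerDl ltW.
have rn : 1 + t != 0 by rewrite gt_eqF// addr_gt0.
have hc := cv_Ccoo t ha hb.
have b1 : `|\int[mu]_x (cv t a b ((1 + t) *: x + 0) * h x)| <= nrm (cv t a b) * nrm h.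
  apply: le_trans (Cc_CS (Cc_affine 0 rn (Ccoo_Cc hc)) (Ccoo_Cc hh)) _.
  apply: ler_wpM2r; [exact: nrm_ge0|exact: nrm_dil_le r1 (Ccoo_Cc hc)].
have b2 : nrm (cv t a b) <= 2 ^+ n * (Num.sqrt (2 ^+ (l * n)) * A).
  rewrite -(@ler_pXn2r _ 2)// ?nnegrE ?nrm_ge0 ?mulr_ge0 ?exprn_ge0 ?sqrtr_ge0//.
  have t2 : t^-1 <= 4 * 2 ^+ l.
    rewrite /t invfM exprVn invrK mulrC ler_wpM2r ?exprn_ge0//.
    apply: (@le_trans _ _ 2); last by lra.
    by rewrite -[leRHS]invrK lef_pV2 ?posrE ?invr_gt0// ltW.
  have b0 : t ^- n <= (2 ^+ n) ^+ 2 * 2 ^+ (l * n).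
    have -> : (2 ^+ n) ^+ 2 * 2 ^+ (l * n) = (4 * 2 ^+ l) ^+ n :> R.
      by rewrite exprMn h4 expr2 -exprM.
    by rewrite -exprVn lerXn2r ?nnegrE ?mulr_ge0 ?exprn_ge0// invr_ge0 ltW.
  apply: le_trans (hA t t0) _; rewrite [in leRHS]exprMn [in leRHS]exprMn sqr_sqrtr ?exprn_ge0//.
  by rewrite mulrA ler_wpM2r ?sqr_ge0.
rewrite normrM ger0_norm ?exprn_ge0// -!mulrA mulrCA [X in _ <= X](_ : _ =
  hf ^+ l * (4 ^+ n * (A * (Num.sqrt (2 ^+ (l * n)) * nrm h)))); last by ring.
rewrite ler_wpM2l ?exprn_ge0// normrM h4 -mulrA ger0_norm ?exprn_ge0 ?addr_ge0 ?(ltW t0)//.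
apply: ler_pM => //; first by rewrite exprn_ge0// addr_ge0// ltW.
  have t3 : (1 + t) ^+ n <= 2 ^+ n by rewrite lerXn2r ?nnegrE ?addr_ge0 ?(ltW t0)//; lra.
  exact: t3.
apply: le_trans b1 _; have := ler_wpM2r (nrm_ge0 h) b2.
by rewrite -!mulrA [A * (_ * _)]mulrCA.
Qed.

End kernel.

Section eballs.
Variables (R : realType) (n : nat).
Local Notation V := 'rV[R]_n.
Local Notation mu := (lebesgueV R n).
Implicit Types (x y z : V) (t rho : R).

Lemma enormZ (c : R) x : enorm (c *: x) = `|c| * enorm x.
Proof.
rewrite /enorm -[in RHS]sqrtr_sqr -sqrtrM ?sqr_ge0//; congr (Num.sqrt _).
by rewrite mulr_sumr; apply: eq_bigr => i _; rewrite mxE exprMn.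
Qed.

Lemma enorm_continuous : continuous (@enorm R n).
Proof.
move=> x; apply: (@continuous_comp _ _ _ (fun x : V => \sum_(i < n) x ord0 i ^+ 2)).
  by apply: cf_sum => i; under eq_fun do rewrite expr2; apply: cfM; exact: coord_continuous.
exact: sqrt_continuous.
Qed.

Lemma measurable_eball x r : measurable (eball x r).
Proof.
have -> : eball x r = (fun y : V => enorm (1 *: y + - x)) @^-1` `]-oo, r[.
  by apply/seteqP; split => y /=; rewrite /eball/= in_itv/= scale1r.
rewrite -[X in measurable X]setTI.
have c : continuous (fun y : V => enorm (1 *: y + - x)).
  move=> y; apply: (@continuous_comp _ _ _ (fun y : V => 1 *: y + - x)); first exact: continuous_affine.
  exact: enorm_continuous.
exact: (measurable_rV_continuous c).
Qed.

Lemma vol_eball x rho : 0 < rho -> vol (eball x rho) = rho ^+ n * vol (eball (0 : V) 1).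
Proof.
move=> r0; rewrite /vol (@lebesgueV_affine R n rho x) ?gt_eqF//; last exact: measurable_eball.
rewrite (_ : mkset _ = eball 0 1); last first.
  by apply/funext => y; apply/propext; rewrite /eball/= addrK enormZ subr0 gtr0_norm// -[X in _ < X <-> _]mulr1 ltr_pM2l.
rewrite gtr0_norm// fineM// ge0_fin_numE//.
apply: (@lebesgueV_bounded _ _ _ 2); first exact: measurable_eball.
move=> y; rewrite /eball /= subr0 => h; apply: rV_norm_lt => // i.
by apply: le_lt_trans (coord_le_enorm y i) (lt_trans h _); rewrite ltr1n.
Qed.

Lemma vol_eball1_gt0 : 0 < vol (eball (0 : V) 1).
Proof.
pose r : R := (n.+2%:R)^-1; have r0 : 0 < r by rewrite invr_gt0.
have sub : cube (0 : V) r `<=` eball 0 1.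
  move=> x xr; rewrite /eball /= subr0; apply: enorm_lt => //.
  have xr' : `|x| < r by apply: rV_norm_lt => // i; have := xr i; rewrite mxE subr0.
  rewrite -ltr_pdivlMr// mul1r; apply: lt_le_trans xr' _.
  by rewrite lef_pV2 ?posrE// ler_nat.
have fin : (mu (eball (0 : V) 1) < +oo)%E.
  apply: (@lebesgueV_bounded _ _ _ 2); first exact: measurable_eball.
  move=> y; rewrite /eball /= subr0 => h; apply: rV_norm_lt => // i.
  by apply: le_lt_trans (coord_le_enorm y i) (lt_trans h _); rewrite ltr1n.
rewrite fine_gt0// fin andbT.
have := @le_measure _ _ _ mu (cube (0 : V) r) (eball 0 1).
rewrite !inE => /(_ (@measurable_cube _ _ _ _) (@measurable_eball _ _) sub).
apply: lt_le_trans; have /= -> := lebesgueV_cube (0 : V) r0.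
by rewrite lte_fin exprn_gt0// mulr_gt0.
Qed.

End eballs.

(** * Bogovskii's formula and its second derivatives *)

Section core.
Variables (R : realType) (n : nat).
Local Notation V := 'rV[R]_n.
Local Notation mu := (lebesgueV R n).
Local Notation lam := (@lebesgue_measure R).
Local Notation hf := (2^-1 : R).
Implicit Types (a b f g h : V -> R) (x y z : V) (t rho : R) (i j k : 'I_n).

Local Opaque nrm L1 cv E.

(** For the tail, [young1] brings [L1 a <= sqrt |Omega| * nrm a] and
    [nrm (dil rho b0) = rho ^ (-n/2) * nrm b0]; the product sees [Omega] and [rho] only through the
    volume ratio. For the first levels [young2] uses the L1 norm of the dilate, which does not
    depend on [rho]. The levels are then chosen by [dyadic_balance]. *)
Lemma E_smoothing_bound m b0 : n = m.+1 -> (0 < m)%N -> Ccoo b0 ->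
  exists2 C : R, 0 <= C & forall rho (Omega : set V) a, 0 < rho ->
    measurable Omega -> (mu Omega < +oo)%E -> Cc a -> (forall x, ~ Omega x -> a x = 0) ->
    1 <= vol Omega / vol (eball (0 : V) rho) ->
    nrm (E n a (dil rho b0)) <= C * (loggrowth n (vol Omega / vol (eball (0 : V) rho)) * nrm a).
Proof.
move=> nm m0 hb0; have [C0 C0gt HC] := dyadic_balance R m0.
pose v := vol (eball (0 : V) 1).
pose C1 := L1 b0 + Num.sqrt v * nrm b0.
have C10 : 0 <= C1 by rewrite addr_ge0 ?L1_ge0// mulr_ge0 ?sqrtr_ge0 ?nrm_ge0.
exists (4 ^+ n * (C1 * C0)); first by rewrite !mulr_ge0 ?exprn_ge0// ltW.
move=> rho Omega a r0 mO fO ha a0; set K := _ / _ => K1.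
have hb := Ccoo_dil r0 hb0; have cb := Ccoo_Cc hb; have cb0 := Ccoo_Cc hb0.
have v0 : 0 < v by exact: vol_eball1_gt0.
have volE : vol Omega = K * (rho ^+ n * v).
  by rewrite /K vol_eball// divfK// gt_eqF// mulr_gt0// exprn_gt0.
pose A := L1 b0 * nrm a.
pose B := Num.sqrt v * nrm b0 * nrm a * Num.sqrt K.
have A0 : 0 <= A by rewrite mulr_ge0 ?L1_ge0 ?nrm_ge0.
have B0 : 0 <= B by rewrite !mulr_ge0 ?sqrtr_ge0 ?nrm_ge0.
have K0 : 0 <= K by exact: le_trans K1.
have hA t : 0 < t -> nrm (cv t a (dil rho b0)) ^+ 2 <= t ^- n * A ^+ 2.
  move=> t0; have := young2 t0 ha hb; rewrite L1_dil//.
  by move=> h; rewrite /A [(L1 b0 * _) ^+ 2]exprMn mulrA.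
have hB t : nrm (cv t a (dil rho b0)) <= B.
  apply: le_trans (young1 t ha hb) _.
  have l1 := L1_le_nrm mO fO ha a0.
  apply: le_trans (ler_wpM2r (nrm_ge0 _) l1) _.
  rewrite (_ : B = Num.sqrt (vol Omega) * nrm a * nrm (dil rho b0))//.
  have -> : nrm (dil rho b0) = Num.sqrt (rho ^- n) * nrm b0.
    rewrite -[LHS]ger0_norm ?nrm_ge0// -sqrtr_sqr nrm_dil_sqr// sqrtrM ?invr_ge0 ?exprn_ge0 ?(ltW r0)//.
    by rewrite sqrtr_sqr ger0_norm ?nrm_ge0.
  have rn0 : 0 <= rho ^+ n by rewrite exprn_ge0 ?ltW.
  rewrite volE (sqrtrM _ K0) (sqrtrM _ rn0).
  have e : Num.sqrt (rho ^+ n) * Num.sqrt (rho ^- n) = 1.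
    by rewrite -sqrtrM ?exprn_ge0 ?(ltW r0)// mulfV ?sqrtr1// expf_neq0// gt_eqF.
  rewrite /B; move: e; move: (Num.sqrt (rho ^+ n)) (Num.sqrt (rho ^- n)) => p q e.
  transitivity (Num.sqrt v * nrm b0 * nrm a * Num.sqrt K * (p * q)); first by rewrite e mulr1.
  by move: (Num.sqrt v) (nrm b0) (nrm a) (Num.sqrt K) => *; ring.
have [L HL] := HC K K1; rewrite -nm in HL.
apply: le_trans (E_bound_levels L ha hb A0 B0 hA hB) _.
rewrite -!mulrA ler_wpM2l ?exprn_ge0//.
apply: (@le_trans _ _ (C1 * (dyadic_cost n L K * nrm a))); last first.
  by rewrite ler_wpM2l// [leRHS]mulrA ler_wpM2r ?nrm_ge0.
rewrite /dyadic_cost /A /B /C1; set S := \sum_(_ < _) _.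
have S0 : 0 <= S by apply: sumr_ge0 => l _; rewrite mulr_ge0 ?exprn_ge0 ?sqrtr_ge0.
set W := hf ^+ L * Num.sqrt K; have W0 : 0 <= W by rewrite mulr_ge0 ?exprn_ge0 ?sqrtr_ge0.
rewrite [hf ^+ L * _](_ : _ = Num.sqrt v * nrm b0 * nrm a * W); last by rewrite /W; ring.
have := L1_ge0 b0; have := nrm_ge0 a; have : 0 <= Num.sqrt v * nrm b0 by rewrite mulr_ge0 ?sqrtr_ge0 ?nrm_ge0.
move: (L1 b0) (nrm a) (Num.sqrt v * nrm b0) S0 W0 => l u w S0 W0 w0 u0 l0.
have -> : (l + w) * ((S + W) * u) = l * u * S + w * u * W + (l * (W * u) + w * (S * u)) by ring.
by rewrite [l * (u * S)]mulrA lerDl addr_ge0// !mulr_ge0.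
Qed.

Definition mc i f : V -> R := fun x => x ord0 i * f x.

Lemma Ccoo_mc i f : Ccoo f -> Ccoo (mc i f).
Proof. by move=> hf; apply: CcooMr => //; exact: smooth_coord. Qed.

Lemma mc_dil i rho a : 0 < rho -> mc i (dil rho a) = fun x => rho * dil rho (mc i a) x.
Proof.
move=> r0; apply/funext => x; rewrite /mc /dil mulrCA [RHS]mulrCA; congr (_ * _).
by rewrite addr0 mxE !mulrA mulfV ?mul1r// gt_eqF.
Qed.

(** Split the coordinate of [x] as that of [z] plus that of [x - z]. This product rule keeps [x_i w]
    a sum of convolutions of two bumps, the shape to which the singular estimate applies. *)
Lemma mc_cv i a b : Ccoo a -> Ccoo b ->
  mc i (cv 1 a b) = fun x => cv 1 (mc i a) b x + cv 1 a (mc i b) x.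
Proof.
Local Transparent cv.
move=> ha hb; apply/funext => x; have := Ccoo_Cc (Ccoo_mc i ha); have := Ccoo_Cc (Ccoo_mc i hb).
move=> h1 h2; have h3 := Ccoo_Cc ha; have h4 := Ccoo_Cc hb.
rewrite /mc /cv -RintZ; last exact: rint_cv.
rewrite -[RHS]RintD; [|exact: (rint_cv 1 x h2 h4)|exact: (rint_cv 1 x h3 h1)].
by apply: eq_Rintegral => z _; rewrite scale1r !mxE; ring.
Local Opaque cv.
Qed.

Lemma partial_mc i j f : smooth f -> partial j (mc i f) = fun x => (j == i)%:R * f x + mc i (partial j f) x.
Proof.
move=> sf; rewrite (partialM j (smooth_coord R i) sf); apply/funext => x.
by rewrite partial_coord addrC [f x * _]mulrC.
Qed.

(* The half of Bogovskii's integral near the support of [f], then the half near that of [w]. *)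
Definition bogovskii (w : V -> R) i f : V -> R := fun x =>
  E n.-2 (mc i w) f x - E n.-2 w (mc i f) x + (E n.-2 f (mc i w) x - E n.-2 (mc i f) w x).

Lemma bogovskii_smooth w i f : Ccoo w -> Ccoo f -> smooth (bogovskii w i f).
Proof.
move=> hw hf; have hmw := Ccoo_mc i hw; have hmf := Ccoo_mc i hf.
apply: smoothD; apply: smoothB; (apply: E_smooth; [exact: Ccoo_Cc|by []]).
Qed.

(** A derivative falls on second arguments only, so these are left arbitrary: the lemma can then be
    applied to its own result. *)
Lemma partial_bogovskiiE w i j f m : Ccoo w -> Ccoo f -> Ccoo (mc i w) -> Ccoo (mc i f) ->
  forall mw w' mf f', Ccoo mw -> Ccoo w' -> Ccoo mf -> Ccoo f' ->
  partial j (fun x => E m (mc i w) f' x - E m w mf x + (E m f mw x - E m (mc i f) w' x)) =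
  fun x => E m.+1 (mc i w) (partial j f') x - E m.+1 w (partial j mf) x +
    (E m.+1 f (partial j mw) x - E m.+1 (mc i f) (partial j w') x).
Proof.
move=> hw hf hmw hmf mw w' mf f' h1 h2 h3 h4.
have [[[cw cf] cmw] cmf] := (Ccoo_Cc hw, Ccoo_Cc hf, Ccoo_Cc hmw, Ccoo_Cc hmf).
have s1 := E_smooth m cmw h4; have s2 := E_smooth m cw h3.
have s3 := E_smooth m cf h1; have s4 := E_smooth m cmf h2.
rewrite (partialD j (smoothB s1 s2) (smoothB s3 s4)) (partialB j s1 s2) (partialB j s3 s4).
by rewrite (E_partial m j cmw h4) (E_partial m j cw h3) (E_partial m j cf h1) (E_partial m j cmf h2).
Qed.

(** Each half contributes by [E_div] its values at [t = 0] and [t = 1]. The values at [t = 1], where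
    the halves meet at the midpoint, cancel under [z |-> 2 x - z]; those at [t = 0] leave [f x]
    times the integral of [w] minus [w x] times the integral of [f]. *)
Lemma bogovskii_div w f x : (2 <= n)%N -> Ccoo w -> Ccoo f ->
  \int[mu]_x w x = 1 -> \int[mu]_x f x = 0 -> \sum_i partial i (bogovskii w i f) x = f x.
Proof.
move=> n2 hw hf iw iff'; have [cw cf] := (Ccoo_Cc hw, Ccoo_Cc hf).
have nE : n = n.-2.+2 by case: (n) n2 => [|[]].
have nE' : n = n.-2.+1.+1 by exact: nE.
have P i : partial i (bogovskii w i f) x = - (E n.-2.+1 w (partial i (mc i f)) x - E n.-2.+1 (mc i w) (partial i f) x) +
    (E n.-2.+1 f (partial i (mc i w)) x - E n.-2.+1 (mc i f) (partial i w) x).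
  rewrite /bogovskii (partial_bogovskiiE i n.-2 hw hf (Ccoo_mc i hw) (Ccoo_mc i hf) (Ccoo_mc i hw) hw (Ccoo_mc i hf) hf).
  by rewrite opprB.
rewrite (eq_bigr _ (fun i _ => P i)) big_split/= sumrN.
have D1 : \sum_i (E n.-2.+1 w (partial i (mc i f)) x - E n.-2.+1 (mc i w) (partial i f) x) =
    \int[mu]_z (w z * (2 ^+ n * f (2 *: x - z) - f x)) := E_div x nE' cw hf.
have D2 : \sum_i (E n.-2.+1 f (partial i (mc i w)) x - E n.-2.+1 (mc i f) (partial i w) x) =
    \int[mu]_z (f z * (2 ^+ n * w (2 *: x - z) - w x)) := E_div x nE' cf hw.
have comb (S1 S2 I1 I2 : R) : S1 = I1 -> S2 = I2 -> - I1 + I2 = f x -> - S1 + S2 = f x by move=> -> ->.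
apply: (comb _ _ _ _ D1 D2).
Local Transparent cv.
have split_int a b : Ccoo a -> Ccoo b -> \int[mu]_z (a z * (2 ^+ n * b (2 *: x - z) - b x)) =
    2 ^+ n * cv 1 a b (2 *: x) - b x * \int[mu]_z a z.
  move=> ha hb; have r1 := rint_cv 1 (2 *: x) (Ccoo_Cc ha) (Ccoo_Cc hb).
  rewrite -(RintZ _ r1) -(RintZ _ (Cc_rint (Ccoo_Cc ha))) -RintB.
  - by apply: eq_Rintegral => z _; rewrite scale1r; ring.
  - exact: rintZ.
  - exact/rintZ/Cc_rint/Ccoo_Cc.
rewrite (split_int w f hw hf) (split_int f w hf hw) iw iff' mulr0 subr0 mulr1.
suff -> : cv 1 f w (2 *: x) = cv 1 w f (2 *: x) by ring.
rewrite /cv (Rint_affine (2 *: x) (_ : (-1 : R) != 0)) ?oppr_eq0 ?oner_eq0//; last exact: rint_cv.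
rewrite normrN normr1 expr1n mul1r; apply: eq_Rintegral => z _.
by rewrite !scale1r scaleN1r opprD opprK addrCA subrr addr0 mulrC [- z + _]addrC.
Local Opaque cv.
Qed.

End core.

Lemma finite_unif (R : realType) (T : finType) (P : T -> R -> Prop) :
  (forall i, exists2 C : R, 0 <= C & P i C) -> (forall i C C', C <= C' -> P i C -> P i C') ->
  exists2 C : R, 0 <= C & forall i, P i C.
Proof.
move=> h mono; have /choice[F hF] : forall i, exists C : R, 0 <= C /\ P i C.
  by move=> i; have [C] := h i; exists C.
exists (\sum_i F i); first by apply: sumr_ge0 => i _; have [] := hF i.
move=> i; have [Fi PF] := hF i; apply: mono PF; rewrite (bigD1 i)//= lerDl.
by apply: sumr_ge0 => j _; have [] := hF j.
Qed.

Section core_bound.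
Variables (R : realType) (n : nat).
Local Notation V := 'rV[R]_n.
Local Notation mu := (lebesgueV R n).
Implicit Types (a b f g h : V -> R) (x y z : V) (t rho : R) (i j k : 'I_n).

Lemma nrm_mc i f (D : R) : 0 <= D -> Ccoo f -> (forall x, f x != 0 -> `|x ord0 i| <= D) ->
  nrm (mc i f) <= D * nrm f.
Proof.
move=> D0 hf hD; rewrite -(@ler_pXn2r _ 2)// ?nnegrE ?mulr_ge0 ?nrm_ge0//.
rewrite exprMn !nrm_sqr -RintZ; last exact/Cc_rint/Cc_sqr/Ccoo_Cc.
apply: Rint_le; [exact/Cc_rint/Cc_sqr/Ccoo_Cc/Ccoo_mc|exact/rintZ/Cc_rint/Cc_sqr/Ccoo_Cc|].
move=> x; rewrite /mc exprMn; have [->|fx] := eqVneq (f x) 0; first by rewrite expr0n !mulr0.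
by rewrite ler_wpM2r ?sqr_ge0// -real_normK ?num_real// lerXn2r ?nnegrE// hD.
Qed.

Local Opaque nrm L1 cv E.

Lemma nrm_addB_le a b c d : Cc a -> Cc b -> Cc c -> Cc d ->
  nrm (fun x => a x - b x + (c x - d x)) <= nrm a + nrm b + (nrm c + nrm d).
Proof.
move=> ha hb hc hd.
have nrmB f g : Cc f -> Cc g -> nrm (fun x => f x - g x) <= nrm f + nrm g.
  move=> hf hg; have := nrmD hf (CcZ (-1) hg); rewrite nrmZ// normrN1 mul1r.
  by under eq_fun do rewrite mulN1r.
apply: le_trans (nrmD (CcB ha hb) (CcB hc hd)) _.
by apply: lerD; exact: nrmB.
Qed.

Lemma partial2_bogovskii w i j k f : (2 <= n)%N -> Ccoo w -> Ccoo f ->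
  partial k (partial j (bogovskii w i f)) =
  fun x => E n (mc i w) (partial k (partial j f)) x - E n w (partial k (partial j (mc i f))) x +
    (E n f (partial k (partial j (mc i w))) x - E n (mc i f) (partial k (partial j w)) x).
Proof.
move=> n2 hw hf; have nE : n = n.-2.+2 by case: (n) n2 => [|[]].
have [hmw hmf] := (Ccoo_mc i hw, Ccoo_mc i hf).
rewrite /bogovskii (partial_bogovskiiE j n.-2 hw hf hmw hmf hmw hw hmf hf).
rewrite (partial_bogovskiiE k n.-2.+1 hw hf hmw hmf (Ccoo_partial j hmw) (Ccoo_partial j hw)
  (Ccoo_partial j hmf) (Ccoo_partial j hf)).
by rewrite -nE.
Qed.

Lemma Ccoo_partial2_bog w i j k f : (2 <= n)%N -> Ccoo w -> Ccoo f -> Ccoo (partial k (partial j (bogovskii w i f))).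
Proof.
move=> n2 hw hf; have [hmw hmf] := (Ccoo_mc i hw, Ccoo_mc i hf).
have [[[cw cf] cmw] cmf] := (Ccoo_Cc hw, Ccoo_Cc hf, Ccoo_Cc hmw, Ccoo_Cc hmf).
rewrite partial2_bogovskii//; apply: CcooD; apply: CcooB; (apply: E_Ccoo; [by []|exact/Ccoo_partial/Ccoo_partial]).
Qed.

(** The ball is centred at the origin and [D] bounds a coordinate on [Omega]; it will be the
    diameter. Everything that varies with the domain is quantified after [C]. *)
Definition bogovskii_estimate (eta : V -> R) i j k (C : R) :=
  forall rho (D : R) (Omega : set V) f, 0 < rho -> rho <= D ->
    measurable Omega -> (mu Omega < +oo)%E -> Ccoo f -> (forall x, ~ Omega x -> f x = 0) ->
    (forall x, Omega x -> `|x ord0 i| <= D) ->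
    1 <= vol Omega / vol (eball (0 : V) rho) ->
    nrm (partial k (partial j (bogovskii (dil rho (cv 1 eta eta)) i f))) <=
    C * (D / rho ^+ 2 * loggrowth n (vol Omega / vol (eball (0 : V) rho)) * nrm f + D / rho * nrm (partial j f)).

(** [1 <= D / rho] and [1 <= G] bring the four bounds under two common terms; [C3] occurs twice
    because the derivative of [x_i f] has two terms. *)
Lemma bogovskii_arith (rho D G C1 C2 C3 C4 C5 u v : R) : 0 < rho -> rho <= D -> 1 <= G ->
  0 <= C1 -> 0 <= C2 -> 0 <= C3 -> 0 <= C4 -> 0 <= C5 -> 0 <= u -> 0 <= v ->
  (C1 + C2) * v + C3 / rho * (u + D * v) + (C4 / rho * (G * u) + C5 / rho ^+ 2 * (G * (D * u))) <=
  (C1 + C2 + 2 * C3 + C4 + C5) * (D / rho ^+ 2 * G * u + D / rho * v).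
Proof.
move=> r0 rD G1 C10 C20 C30 C40 C50 u0 v0; have D0 : 0 <= D by exact: le_trans (ltW r0) rD.
pose P := D / rho ^+ 2 * G * u; pose Q := D / rho * v.
have r1 : 0 < rho^-1 by rewrite invr_gt0.
have Dr : 1 <= D / rho by rewrite ler_pdivlMr// mul1r.
have q1 : v <= Q by rewrite /Q -[leLHS]mul1r ler_wpM2r.
have q2 : D / rho * v = Q by [].
have p1 : rho^-1 * (G * u) <= P.
  rewrite /P -mulrA ler_wpM2r ?mulr_ge0 ?(le_trans _ G1)//.
  by rewrite expr2 invfM mulrA -[leLHS]mul1r ler_wpM2r// ltW.
have p2 : rho^-1 * u <= P.
  by apply: le_trans p1; rewrite ler_wpM2l ?(ltW r1)// -[leLHS]mul1r ler_wpM2r.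
have P0 : 0 <= P by apply: le_trans p2; rewrite mulr_ge0// ltW.
have Q0 : 0 <= Q by exact: le_trans q1.
have -> : (C1 + C2) * v + C3 / rho * (u + D * v) + (C4 / rho * (G * u) + C5 / rho ^+ 2 * (G * (D * u))) =
  (C1 + C2) * v + C3 * (rho^-1 * u) + C3 * Q + C4 * (rho^-1 * (G * u)) + C5 * P.
  by rewrite /P /Q; field; rewrite gt_eqF.
have l1 : (C1 + C2) * v <= (C1 + C2) * Q by rewrite ler_wpM2l// addr_ge0.
have l2 : C3 * (rho^-1 * u) <= C3 * P by rewrite ler_wpM2l.
have l3 : C4 * (rho^-1 * (G * u)) <= C4 * P by rewrite ler_wpM2l.
rewrite -/P -/Q; have m1 := mulr_ge0 C10 P0; have m2 := mulr_ge0 C20 P0.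
have m3 := mulr_ge0 C30 P0; have m4 := mulr_ge0 C30 Q0; have m5 := mulr_ge0 C40 Q0.
have m6 := mulr_ge0 C50 Q0.
rewrite (_ : (C1 + C2 + 2 * C3 + C4 + C5) * (P + Q) = (C1 + C2) * Q + C3 * P + C3 * Q + C4 * P + C5 * P +
  (C1 * P + C2 * P + C3 * P + C3 * Q + C4 * Q + C5 * Q)); last by ring.
by lra.
Qed.

(** Powers of [rho] in the four terms: [x_i w] is [rho] times a dilate, which cancels the [1 / rho]
    of the singular bound in [T1]; [T2] keeps [1 / rho] and pays [D] for the coordinate multiplying
    the derivative of [f]. In [T3] and [T4] both derivatives hit the dilate, giving [rho * rho ^- 2]
    and [rho ^- 2], the latter with [D] from [x_i f]. *)
Lemma bogovskii_estimate_exists eta i j k : (2 <= n)%N -> Ccoo eta ->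
  exists2 C : R, 0 <= C & bogovskii_estimate eta i j k C.
Proof.
move=> n2 heta; have nE : n = n.-1.+1 by case: (n) n2.
have m0 : (0 < n.-1)%N by case: (n) n2 => [|[]].
pose om := cv 1 eta eta; have hom : Ccoo om by apply: cv_Ccoo => //; exact: Ccoo_Cc.
have hmeta := Ccoo_mc i heta; have hmom := Ccoo_mc i hom.
have [C1 C10 H1] := E_singular_bound k hmeta heta.
have [C2 C20 H2] := E_singular_bound k heta hmeta.
have [C3 C30 H3] := E_singular_bound k heta heta.
have [C4 C40 H4] := E_smoothing_bound nE m0 (Ccoo_partial k (Ccoo_partial j hmom)).
have [C5 C50 H5] := E_smoothing_bound nE m0 (Ccoo_partial k (Ccoo_partial j hom)).
exists (C1 + C2 + 2 * C3 + C4 + C5); first by rewrite !addr_ge0 ?mulr_ge0.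
move=> rho D Omega f r0 rD mO fO hf f0 hD; set K := _ / _ => K1.
have D0 : 0 <= D by exact: le_trans (ltW r0) rD.
set w := dil rho om; have hw : Ccoo w by exact: Ccoo_dil.
set G := loggrowth n K.
have G1 : 1 <= G by rewrite /G /loggrowth lerDl mulr_ge0 ?powR_ge0.
have [hmw hmf] := (Ccoo_mc i hw, Ccoo_mc i hf).
have [[[cw cf] cmw] cmf] := (Ccoo_Cc hw, Ccoo_Cc hf, Ccoo_Cc hmw, Ccoo_Cc hmf).
have hjf := Ccoo_partial j hf; have hkjf := Ccoo_partial k hjf.
have hjmf := Ccoo_partial j hmf; have hkjmf := Ccoo_partial k hjmf.
have f0' x : f x != 0 -> `|x ord0 i| <= D.
  by move=> fx; apply: hD; apply: contrapT => Ox; move: fx; rewrite f0// eqxx.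
(* Where the coordinate exceeds [D] it does so in a neighbourhood, on which [f] vanishes; hence so
   does its derivative. *)
have pf0 x : partial j f x != 0 -> `|x ord0 i| <= D.
  apply: contraNT; rewrite -ltNge => xD; apply/eqP; apply: partial0_near.
  apply/nbhs_ballP; exists (`|x ord0 i| - D); first by rewrite /= subr_gt0.
  move=> y; rewrite -ball_normE /= => xy; apply/eqP; apply/negPn/negP => /f0' yD.
  move: xy; rewrite ltNge => /negP; apply; apply: le_trans (rV_coord_le (x - y) i).
  rewrite !mxE; apply: le_trans (lerB_dist _ _); by rewrite lerB.
have nm := nrm_mc D0 hf f0'; have nmj := nrm_mc D0 hjf pf0.
have hmwE : mc i w = fun x => rho * dil rho (mc i om) x by exact: mc_dil.
have hdmom := Ccoo_dil r0 hmom.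
have T1 : nrm (E n (mc i w) (partial k (partial j f))) <= (C1 + C2) * nrm (partial j f).
  have e1 : dil rho (mc i om) = fun x => dil rho (cv 1 (mc i eta) eta) x + dil rho (cv 1 eta (mc i eta)) x.
    by rewrite /om mc_cv//; apply/funext => x; rewrite /dil mulrDr.
  have hA : Ccoo (dil rho (cv 1 (mc i eta) eta)) by apply: Ccoo_dil => //; apply: cv_Ccoo => //; exact: Ccoo_Cc.
  have hB : Ccoo (dil rho (cv 1 eta (mc i eta))) by apply: Ccoo_dil => //; apply: cv_Ccoo => //; exact: Ccoo_Cc.
  have [[cA cB] ckjf] := (Ccoo_Cc hA, Ccoo_Cc hB, Ccoo_Cc hkjf).
  rewrite hmwE EZl//; last exact: Ccoo_Cc.
  rewrite nrmZ; last by apply: Ccoo_Cc; apply: E_Ccoo => //; exact: Ccoo_Cc.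
  rewrite (gtr0_norm r0) e1 EDl//.
  have q := nrmD (Ccoo_Cc (E_Ccoo n cA hkjf)) (Ccoo_Cc (E_Ccoo n cB hkjf)).
  have h1 := H1 rho _ r0 hjf; have h2 := H2 rho _ r0 hjf.
  apply: le_trans (ler_wpM2l (ltW r0) q) _.
  apply: le_trans (ler_wpM2l (ltW r0) (lerD h1 h2)) _.
  rewrite le_eqVlt; apply/orP; left; apply/eqP.
  by move: (nrm _) => u; field; rewrite gt_eqF.
have T2 : nrm (E n w (partial k (partial j (mc i f)))) <= C3 / rho * (nrm f + D * nrm (partial j f)).
  apply: le_trans (H3 rho _ r0 hjmf) _; rewrite ler_wpM2l ?divr_ge0 ?(ltW r0)//.
  rewrite (partial_mc i j hf.1).
  apply: le_trans (nrmD (CcZ _ cf) (Ccoo_Cc (Ccoo_mc i hjf))) _.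
  apply: lerD => //; rewrite nrmZ//; case: (j == i); rewrite ?normr1 ?normr0 ?mul1r ?mul0r//.
  exact: nrm_ge0.
have T3 : nrm (E n f (partial k (partial j (mc i w)))) <= C4 / rho * (G * nrm f).
  have e : partial k (partial j (mc i w)) = fun x => rho^-1 * dil rho (partial k (partial j (mc i om))) x.
    have [s1 _] := hdmom; have [s2 _] := Ccoo_dil r0 (Ccoo_partial j hmom).
    rewrite hmwE (partialZ _ _ s1) (partial_dil rho j hmom).
    rewrite (_ : (fun x => rho * _) = dil rho (partial j (mc i om))).
      by rewrite (partial_dil rho k (Ccoo_partial j hmom)).
    by apply/funext => x; rewrite mulrA mulfV ?mul1r// gt_eqF.
  have hB := Ccoo_dil r0 (Ccoo_partial k (Ccoo_partial j hmom)).
  rewrite e EZr//; last exact: Ccoo_Cc.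
  rewrite nrmZ; last by apply: Ccoo_Cc; exact: E_Ccoo.
  rewrite gtr0_norm ?invr_gt0// [C4 / rho]mulrC -mulrA ler_wpM2l ?invr_ge0 ?(ltW r0)//.
  exact: (H4 rho Omega f r0 mO fO cf f0 K1).
have T4 : nrm (E n (mc i f) (partial k (partial j w))) <= C5 / rho ^+ 2 * (G * (D * nrm f)).
  have e : partial k (partial j w) = fun x => rho ^- 2 * dil rho (partial k (partial j om)) x.
    have [s2 _] := Ccoo_dil r0 (Ccoo_partial j hom).
    rewrite (partial_dil rho j hom) (partialZ _ _ s2) (partial_dil rho k (Ccoo_partial j hom)).
    by apply/funext => x; rewrite mulrA -invfM -expr2.
  have hB := Ccoo_dil r0 (Ccoo_partial k (Ccoo_partial j hom)).
  have r2 : 0 < rho ^- 2 by rewrite invr_gt0 exprn_gt0.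
  rewrite e EZr//; last exact: Ccoo_Cc.
  rewrite nrmZ; last by apply: Ccoo_Cc; exact: E_Ccoo.
  rewrite gtr0_norm// [C5 / _]mulrC -mulrA ler_wpM2l ?(ltW r2)//.
  have mf0 x : ~ Omega x -> mc i f x = 0 by move=> h; rewrite /mc f0// mulr0.
  apply: le_trans (H5 rho Omega (mc i f) r0 mO fO cmf mf0 K1) _.
  by rewrite ler_wpM2l// ler_wpM2l// (le_trans _ G1).
have hjmw := Ccoo_partial j hmw; have hjw := Ccoo_partial j hw.
have k1 := Ccoo_Cc (E_Ccoo n cmw hkjf); have k2 := Ccoo_Cc (E_Ccoo n cw hkjmf).
have k3 := Ccoo_Cc (E_Ccoo n cf (Ccoo_partial k hjmw)).
have k4 := Ccoo_Cc (E_Ccoo n cmf (Ccoo_partial k hjw)).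
rewrite (partial2_bogovskii i j k n2 hw hf).
apply: le_trans (nrm_addB_le k1 k2 k3 k4) _.
apply: le_trans (lerD (lerD T1 T2) (lerD T3 T4)) _.
exact: (bogovskii_arith r0 rD G1 C10 C20 C30 C40 C50 (nrm_ge0 f) (nrm_ge0 (partial j f))).
Qed.

Lemma bogovskii_estimate_unif eta : (2 <= n)%N -> Ccoo eta ->
  exists2 C : R, 0 <= C & forall i j k, bogovskii_estimate eta i j k C.
Proof.
move=> n2 heta.
have [|p C C' CC' h|C C0 HC] := @finite_unif R ('I_n * 'I_n * 'I_n)%type
   (fun p C => bogovskii_estimate eta p.1.1 p.1.2 p.2 C).
- by move=> p; exact: bogovskii_estimate_exists.
- move=> rho D Omega f r0 rD mO fO hf f0 hD K1; apply: le_trans (h rho D Omega f r0 rD mO fO hf f0 hD K1) _.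
  have D0 : 0 <= D by exact: le_trans (ltW r0) rD.
  apply: ler_wpM2r CC'; rewrite addr_ge0// !mulr_ge0 ?nrm_ge0 ?invr_ge0 ?exprn_ge0 ?(ltW r0)//.
  by rewrite addr_ge0// mulr_ge0 ?powR_ge0.
by exists C => // i j k; exact: (HC (i, j, k)).
Qed.

End core_bound.

Lemma continuous_comb (R : realType) (W : normedModType R) :
  continuous (fun p : R * (W * W) => (1 - p.1) *: p.2.1 + p.1 *: p.2.2).
Proof.
move=> p; apply: cvgD; apply: cvgZ.
- by apply: cvgB; [exact: cvg_cst|exact: cvg_fst].
- by apply: (@cvg_comp _ _ _ snd fst); [exact: cvg_snd|exact: cvg_fst].
- exact: cvg_fst.
- by apply: (@cvg_comp _ _ _ snd snd); [exact: cvg_snd|exact: cvg_snd].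
Qed.

(** * Solutions on star-shaped domains *)

Section support.
Variables (R : realType) (n : nat).
Local Notation V := 'rV[R]_n.
Local Notation mu := (lebesgueV R n).
Implicit Types (a c x y z : V) (f g w : V -> R) (t rho : R) (i j k : 'I_n) (Omega K : set V).

Lemma test_functionI Omega K f : smooth f -> compact K -> K `<=` Omega ->
  (forall x, ~ K x -> f x = 0) -> test_function Omega f.
Proof.
move=> sf cK KO f0; have clK : closed K by apply: compact_closed => //; exact: norm_hausdorff.
have sub : closure [set x | f x != 0] `<=` K.
  rewrite closureE; apply: smallest_sub => // x /= fx; apply: contrapT => Kx.
  by move: fx; rewrite f0// eqxx.
split => //; first exact: subclosed_compact (@closed_closure _ _) cK sub.
exact: subset_trans sub KO.
Qed.

Lemma test_functionE Omega f : test_function Omega f ->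
  smooth f /\ exists K, [/\ compact K, K `<=` Omega & forall x, ~ K x -> f x = 0].
Proof.
move=> [sf cK KO]; split => //; exists (closure [set x | f x != 0]); split => // x Kx.
apply/eqP/negPn/negP => fx; apply: Kx; exact: subset_closure.
Qed.

Lemma test_function_off Omega f x : test_function Omega f -> ~ Omega x -> f x = 0.
Proof. by move=> /test_functionE[_ [K [_ KO f0]]] Ox; apply: f0 => /KO. Qed.

Lemma test_function_Ccoo Omega f : test_function Omega f -> Ccoo f.
Proof.
move=> /test_functionE[sf [K [cK _ f0]]]; split => //.
have [M [_ hM]] := compact_bounded cK; exists (M + 2) => x hx; apply: f0 => Kx.
have := hM (M + 1) _ x Kx; rewrite ltrDl ltr01 => /(_ isT) /= h; lra.
Qed.

Lemma test_functionB Omega f g : test_function Omega f -> test_function Omega g ->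
  test_function Omega (fun x => f x - g x).
Proof.
move=> /test_functionE[sf [K [cK KO f0]]] /test_functionE[sg [L [cL LO g0]]].
apply: (@test_functionI _ (K `|` L)); first exact: smoothB.
- exact: compactU.
- by move=> x [/KO|/LO].
- by move=> x /not_orP[Kx Lx]; rewrite f0// g0// subr0.
Qed.

Lemma test_functionZ Omega (c : R) f : test_function Omega f -> test_function Omega (fun x => c * f x).
Proof.
move=> /test_functionE[sf [K [cK KO f0]]].
apply: (test_functionI (smoothZ c sf) cK KO).
by move=> x Kx; rewrite f0// mulr0.
Qed.

Lemma test_functionS Omega Omega' f : Omega `<=` Omega' -> test_function Omega f -> test_function Omega' f.
Proof. by move=> OO [sf cK KO]; split => //; exact: subset_trans KO OO. Qed.

Lemma compact_box c r : compact [set x : V | forall i, `|x ord0 i - c ord0 i| <= r].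
Proof.
have := @rV_compact R n (fun i => `[c ord0 i - r, c ord0 i + r]%classic) (fun i => @segment_compact R _ _).
congr compact; apply/seteqP; split => x /= h i; have := h i; rewrite /= in_itv/= ler_norml => /andP[h1 h2].
  by apply/andP; split; lra.
by apply/andP; split; lra.
Qed.

(** The factor [1] makes it literally an affine change of variables, so that the results on those
    apply. *)
Definition shift_fun c f : V -> R := fun x => f (1 *: x + c).

Lemma shift_funE c f x : shift_fun c f x = f (x + c).
Proof. by rewrite /shift_fun scale1r. Qed.

Lemma shift_eval c f g x : f = shift_fun c g -> f x = g (x + c).
Proof. by move=> ->; exact: shift_funE. Qed.

Lemma Ccoo_shift c f : Ccoo f -> Ccoo (shift_fun c f).
Proof. by move=> hf; apply: Ccoo_affine => //; exact: oner_neq0. Qed.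

Lemma partial_shift i c f : smooth f -> partial i (shift_fun c f) = shift_fun c (partial i f).
Proof. by move=> sf; rewrite /shift_fun partial_affine//; apply/funext => x; rewrite mul1r. Qed.

Lemma Rint_shift c f : rint mu f -> \int[mu]_x shift_fun c f x = \int[mu]_x f x.
Proof. by move=> rf; rewrite [RHS](Rint_affine c (oner_neq0 R) rf) normr1 expr1n mul1r. Qed.

Lemma nrm_shift c f : Cc f -> nrm (shift_fun c f) = nrm f.
Proof.
move=> hf; apply/eqP; rewrite -(@eqrXn2 _ 2)// ?nrm_ge0//; apply/eqP.
by rewrite [RHS](nrm_affine c (oner_neq0 R) hf) normr1 expr1n mul1r.
Qed.

Definition solve w a i f : V -> R := shift_fun (- a) (bogovskii w i (shift_fun a f)).

(** A value can be nonzero only at points [(y + t *: z) / (1 + t)] with one of [y], [z] in the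
    support of [w] and the other in that of [f]; multiplying by a coordinate does not enlarge
    supports. *)
Lemma bogovskii_neq0 w i f x (P : Prop) :
  (forall t y z, 0 < t <= 1 -> w z != 0 -> f y != 0 -> (1 + t) *: x = y + t *: z -> P) ->
  (forall t y z, 0 < t <= 1 -> f z != 0 -> w y != 0 -> (1 + t) *: x = y + t *: z -> P) ->
  ~ P -> bogovskii w i f x = 0.
Proof.
move=> H1 H2 Px.
have case1 (u v : V -> R) : (forall x, w x = 0 -> u x = 0) -> (forall x, f x = 0 -> v x = 0) ->
    E n.-2 u v x = 0.
  move=> u0 v0; apply: E_supp => t z t1.
  have [wz|wz] := eqVneq (w z) 0; [by left; exact: u0|right].
  have [fy|fy] := eqVneq (f ((1 + t) *: x - t *: z)) 0; first exact: v0.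
  by exfalso; apply/Px/(H1 t _ z t1 wz fy); rewrite subrK.
have case2 (u v : V -> R) : (forall x, f x = 0 -> u x = 0) -> (forall x, w x = 0 -> v x = 0) ->
    E n.-2 u v x = 0.
  move=> u0 v0; apply: E_supp => t z t1.
  have [fz|fz] := eqVneq (f z) 0; [by left; exact: u0|right].
  have [wy|wy] := eqVneq (w ((1 + t) *: x - t *: z)) 0; first exact: v0.
  by exfalso; apply/Px/(H2 t _ z t1 fz wy); rewrite subrK.
have mc0 (u : V -> R) y : u y = 0 -> mc i u y = 0 by rewrite /mc => ->; rewrite mulr0.
have q1 : E n.-2 (mc i w) f x = 0 by apply: case1 => // y; exact: mc0.
have q2 : E n.-2 w (mc i f) x = 0 by apply: case1 => // y; exact: mc0.
have q3 : E n.-2 f (mc i w) x = 0 by apply: case2 => // y; exact: mc0.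
have q4 : E n.-2 (mc i f) w x = 0 by apply: case2 => // y; exact: mc0.
by rewrite /bogovskii q1 q2 q3 q4 subrr addr0.
Qed.

(** The set of segments from [K], a compact set carrying [f], to a closed box inside the ball is
    compact as a continuous image, and lies in [Omega] by star-shapedness. The parameter on the
    segment is [t / (1 + t)] for one half of the operator and [1 / (1 + t)] for the other. *)
Lemma solve_test Omega a rho (r : R) w i f : star_shaped Omega (eball a rho) -> Ccoo w ->
  0 < rho -> 0 <= r -> r * n.+1%:R < rho -> (forall z, w z != 0 -> `|z| <= r) ->
  test_function Omega f -> test_function Omega (solve w a i f).
Proof.
move=> star hw rho0 r0 rrho wr tf; have hf := test_function_Ccoo tf.
have [sf [K [cK KO f0]]] := test_functionE tf.
pose B := [set x : V | forall i, `|x ord0 i - a ord0 i| <= r].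
pose comb (p : R * (V * V)) : V := (1 - p.1) *: p.2.1 + p.1 *: p.2.2.
pose L := comb @` (`[0, 1]%classic `*` (K `*` B)).
have Bball : B `<=` eball a rho.
  move=> x Bx; rewrite /eball /=; apply: enorm_lt => //.
  apply: le_lt_trans rrho; rewrite ler_wpM2r//.
  by apply: rV_norm_le => // k; have := Bx k; rewrite !mxE.
apply: (@test_functionI _ L).
- exact: smooth_affine (bogovskii_smooth i hw (Ccoo_shift a hf)).
- apply: continuous_compact; first by apply: continuous_subspaceT; exact: continuous_comb.
  by apply: compact_setX; [exact: segment_compact|apply: compact_setX => //; exact: compact_box].
- move=> x [[t [y z]] [/= + [Ky Bz]] <-]; rewrite in_itv/= => t01.
  by apply: star => //; [exact: KO|exact: Bball].
- move=> x Lx; rewrite /solve /shift_fun.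
  have fK y : f (1 *: y + a) != 0 -> K (y + a).
    by rewrite scale1r => fy; apply: contrapT => Ky; move: fy; rewrite f0// eqxx.
  have wB z : w z != 0 -> B (z + a).
    move=> wz k; rewrite mxE addrK; exact: le_trans (rV_coord_le z k) (wr z wz).
  have key (s : R) y z : 0 <= s <= 1 -> K (y + a) -> B (z + a) ->
      1 *: x - a = (1 - s) *: y + s *: z -> L x.
    move=> s01 Ky Bz e; exists (s, (y + a, z + a)); first by split => //=; rewrite in_itv.
    rewrite /comb /= !scalerDr addrACA -e -scalerDl subrK scale1r.
    by rewrite scale1r subrK.
  apply: (@bogovskii_neq0 _ _ _ _ (L x)) => // t y z /andP[t0 t1] h1 h2 e.
  + apply: (key (t / (1 + t)) y z) => //.
    * have t2 : 0 < 1 + t by rewrite addr_gt0.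
      by rewrite divr_ge0 ?(ltW t0) ?(ltW t2)//= ler_pdivrMr// mul1r lerDr.
    * exact: fK.
    * exact: wB.
    * have t2 : 1 + t != 0 by rewrite gt_eqF// addr_gt0.
      by rewrite -[LHS](scalerK t2) e scalerDr scalerA; congr (_ *: _ + _ *: _); field.
  + apply: (key (1 + t)^-1 z y) => //.
    * have t2 : 0 < 1 + t by rewrite addr_gt0.
      by rewrite invr_ge0 (ltW t2)/= invf_le1// lerDl ltW.
    * exact: fK.
    * exact: wB.
    * have t2 : 1 + t != 0 by rewrite gt_eqF// addr_gt0.
      by rewrite -[LHS](scalerK t2) e scalerDr scalerA addrC; congr (_ *: _ + _ *: _); field.
Qed.

Local Opaque E cv nrm.

Lemma bogovskiiB w i f g : Ccoo w -> Ccoo f -> Ccoo g ->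
  bogovskii w i (fun x => f x - g x) = fun x => bogovskii w i f x - bogovskii w i g x.
Proof.
move=> hw hf hg; have [[cw cf] cg] := (Ccoo_Cc hw, Ccoo_Cc hf, Ccoo_Cc hg).
have [[cmw cmf] cmg] := (Ccoo_Cc (Ccoo_mc i hw), Ccoo_Cc (Ccoo_mc i hf), Ccoo_Cc (Ccoo_mc i hg)).
have mcB : mc i (fun x => f x - g x) = fun x => mc i f x - mc i g x.
  by apply/funext => x; rewrite /mc mulrBr.
have EBr (b u v : V -> R) : Cc b -> Cc u -> Cc v -> E n.-2 b (fun x => u x - v x) = fun x => E n.-2 b u x - E n.-2 b v x.
  move=> ha hu hv; have := EDr n.-2 ha hu (CcZ (-1) hv); rewrite EZr// => e.
  rewrite (_ : (fun x => u x - v x) = fun x => u x + -1 * v x).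
    by rewrite e; apply/funext => x; rewrite mulN1r.
  by apply/funext => x; rewrite mulN1r.
have EBl (b u v : V -> R) : Cc b -> Cc u -> Cc v -> E n.-2 (fun x => u x - v x) b = fun x => E n.-2 u b x - E n.-2 v b x.
  move=> ha hu hv; have := EDl n.-2 hu (CcZ (-1) hv) ha; rewrite EZl// => e.
  rewrite (_ : (fun x => u x - v x) = fun x => u x + -1 * v x).
    by rewrite e; apply/funext => x; rewrite mulN1r.
  by apply/funext => x; rewrite mulN1r.
rewrite /bogovskii mcB (EBr _ _ _ cmw cf cg) (EBr _ _ _ cw cmf cmg) (EBl _ _ _ cmw cf cg) (EBl _ _ _ cw cmf cmg).
apply/funext => x.
have key (p q r s p' q' r' s' : R) : p - p' - (q - q') + (r - r' - (s - s')) =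
  p - q + (r - s) - (p' - q' + (r' - s')) by ring.
exact: key.
Qed.

Lemma solveB w a i f g : Ccoo w -> Ccoo f -> Ccoo g ->
  solve w a i (fun x => f x - g x) = fun x => solve w a i f x - solve w a i g x.
Proof.
move=> hw hf hg; rewrite /solve.
have := bogovskiiB i hw (Ccoo_shift a hf) (Ccoo_shift a hg).
by rewrite /shift_fun => ->.
Qed.

Lemma partial_solve w a i j f : Ccoo w -> Ccoo f ->
  partial j (solve w a i f) = shift_fun (- a) (partial j (bogovskii w i (shift_fun a f))).
Proof. by move=> hw hf; exact: partial_shift (bogovskii_smooth i hw (Ccoo_shift a hf)). Qed.

Local Opaque partial bogovskii solve shift_fun.

Lemma solve_div w a f x : (2 <= n)%N -> Ccoo w -> Ccoo f ->
  \int[mu]_x w x = 1 -> \int[mu]_x f x = 0 -> \sum_i partial i (solve w a i f) x = f x.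
Proof.
move=> n2 hw hf iw f0; have hs := Ccoo_shift a hf.
have PS (i : 'I_n) := shift_eval x (partial_solve a i i hw hf).
rewrite (eq_bigr _ (fun i _ => PS i)).
have is0 : \int[mu]_x shift_fun a f x = 0 by rewrite Rint_shift//; exact/Cc_rint/Ccoo_Cc.
by rewrite (bogovskii_div (x - a) n2 hw hs iw is0) shift_funE subrK.
Qed.

Local Transparent solve.

End support.

(** * Diameter, volume ratio and the choice of the mollifier *)

Section geometry.
Variables (R : realType) (n : nat).
Local Notation V := 'rV[R]_n.
Local Notation mu := (lebesgueV R n).
Implicit Types (a c x y z : V) (f g w : V -> R) (t rho D : R) (i j k : 'I_n) (Omega K : set V).

Lemma star_ball Omega a rho : Omega !=set0 -> star_shaped Omega (eball a rho) -> eball a rho `<=` Omega.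
Proof.
move=> [x Ox] star y By; have := star x y Ox By 1; rewrite subrr scale0r add0r scale1r; apply.
by rewrite ler01 lexx.
Qed.

Lemma center_ball a rho : 0 < rho -> eball a rho a.
Proof.
move=> r0; rewrite /eball /= subrr /enorm big1 ?sqrtr0// => i _.
by rewrite mxE expr0n.
Qed.

Lemma enorm_le_ediam Omega (diam : R) x y : ediam Omega = diam%:E -> Omega x -> Omega y -> enorm (x - y) <= diam.
Proof.
move=> hd Ox Oy; rewrite -lee_fin -hd; apply: ereal_sup_ubound => /=.
by exists x => //; exists y.
Qed.

Lemma norm_le_enorm x : `|x| <= enorm x.
Proof. by apply: rV_norm_le => [|i]; [exact: sqrtr_ge0|exact: coord_le_enorm]. Qed.

Lemma ediam_bounded Omega (diam : R) a : ediam Omega = diam%:E -> Omega a ->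
  forall x, Omega x -> `|x| < `|a| + diam + 1.
Proof.
move=> hd Oa x Ox; have h1 := enorm_le_ediam hd Ox Oa; have h2 := norm_le_enorm (x - a).
have h3 : `|x| <= `|a| + `|x - a| by rewrite -{1}(subrK a x) addrC ler_normD.
lra.
Qed.

Lemma radius_le_ediam Omega (diam rho : R) a (i : 'I_n) : ediam Omega = diam%:E -> 0 < rho ->
  eball a rho `<=` Omega -> rho <= diam.
Proof.
move=> hd r0 BO; rewrite leNgt; apply/negP => dr.
(* A distance strictly between [diam] and [rho], realised along a coordinate axis; the maximum is
   there because [diam] is not yet known to be nonnegative. *)
pose s := (Num.max diam 0 + rho) / 2.
have m0 : 0 <= Num.max diam 0 by rewrite le_max lexx orbT.
have mr : Num.max diam 0 < rho by rewrite gt_max dr.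
have s0 : 0 < s by rewrite divr_gt0// ltr_wpDl.
have en : enorm (s *: ei R i : V) = s.
  rewrite enormZ gtr0_norm// /enorm (bigD1 i)//= big1 ?addr0; last first.
    by move=> j ji; rewrite mxE (negbTE ji) andbF expr0n.
  by rewrite mxE !eqxx expr1n sqrtr1 mulr1.
have := @enorm_le_ediam Omega diam (a + s *: ei R i) a hd.
have e : a + s *: ei R i - a = s *: ei R i by rewrite addrC addKr.
rewrite e en => h; have : s <= diam.
  apply: h; apply: BO; last exact: center_ball.
  by rewrite /eball /= e en /s; lra.
have : diam <= Num.max diam 0 by rewrite le_max lexx.
rewrite /s; lra.
Qed.

Lemma vol_ratio_ge1 Omega a rho : 0 < rho -> measurable Omega -> (mu Omega < +oo)%E ->
  eball a rho `<=` Omega -> 1 <= vol Omega / vol (eball a rho).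
Proof.
move=> r0 mO fO BO; rewrite ler_pdivlMr; last first.
  by rewrite vol_eball// mulr_gt0 ?exprn_gt0 ?vol_eball1_gt0.
rewrite mul1r /vol fine_le ?ge0_fin_numE//; last first.
  by apply: le_measure => //; rewrite inE//; exact: measurable_eball.
by apply: le_lt_trans fO; apply: le_measure => //; rewrite inE//; exact: measurable_eball.
Qed.

Lemma Rint_cv t f g : Cc f -> Cc g -> \int[mu]_x cv t f g x = (\int[mu]_x f x) * (\int[mu]_x g x).
Proof.
move=> hf hg; rewrite /cv.
have T := tame3 (- t) 0 hf hg (oner_neq0 R).
have e x z : f z * g (x - t *: z) = f z * g (1 *: x + - t *: z + 0).
  by rewrite scale1r scaleNr addr0.
transitivity (\int[mu]_x \int[mu]_z (f z * g (1 *: x + - t *: z + 0))).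
  by apply: eq_Rintegral => x _; apply: eq_Rintegral => z _.
rewrite (VFubini T) /= mulrC -RintZ; last exact: Cc_rint.
apply: eq_Rintegral => z _.
have gE : \int[mu]_x g x = \int[mu]_x g (1 *: x + (- t *: z + 0)).
  by rewrite [LHS](Rint_affine (- t *: z + 0) (oner_neq0 R) (Cc_rint hg)) normr1 expr1n mul1r.
rewrite gE [RHS]mulrC -RintZ; last exact/Cc_rint/Cc_affine/hg/oner_neq0.
by apply: eq_Rintegral => x _; rewrite addrA.
Qed.

Lemma Rint_dil rho f : 0 < rho -> Cc f -> \int[mu]_x dil rho f x = \int[mu]_x f x.
Proof.
move=> r0 ha; have rn : rho^-1 != 0 by rewrite invr_eq0 gt_eqF.
rewrite [RHS](Rint_affine 0 rn (Cc_rint ha)) -(RintZ _ (rint_affine 0 rn (Cc_rint ha))).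
by apply: eq_Rintegral => x _; rewrite /dil gtr0_norm ?invr_gt0// exprVn.
Qed.

Lemma mu_shift Omega c : measurable Omega -> mu [set x | Omega (1 *: x + c)] = mu Omega.
Proof.
move=> mO; have := @lebesgueV_affine R n 1 c Omega (oner_neq0 R) mO.
by rewrite normr1 expr1n mul1e => ->.
Qed.

(** Convolving doubles the support, so [eta] gets half the radius. The radius [1 / (n + 2)] in the
    sup norm is small enough that, scaled by [rho], the support lies in the Euclidean ball by
    [enorm_lt], which loses a factor [n + 1]. *)
Lemma mollifier : exists2 eta, Ccoo eta &
  let om := cv 1 eta eta in
  [/\ Ccoo om, \int[mu]_x om x = 1 & forall x, om x != 0 -> `|x| <= (n.+2%:R)^-1].
Proof.
pose d : R := (n.+2%:R)^-1 / 2; have d0 : 0 < d by rewrite divr_gt0.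
have [eta [heta eta0 ieta]] := kernel_exists n d0; exists eta => //=.
have ceta := Ccoo_Cc heta; split.
- exact: cv_Ccoo.
- by rewrite Rint_cv// ieta mulr1.
- move=> x; apply: contraNT; rewrite -ltNge => xd.
  rewrite /cv -(Rintegral_zero mu); apply/eqP; apply: eq_Rintegral => z _.
  have [zd|zd] := leP d `|z|; first by rewrite eta0// mul0r.
  rewrite [eta (x - _)]eta0 ?mulr0// scale1r; apply: le_trans (lerB_dist _ _).
  rewrite lerBrDr; apply: le_trans (ltW xd); rewrite (_ : n.+2%:R^-1 = d + d); first by rewrite lerD2l ltW.
  by rewrite /d; field.
Qed.

Local Opaque E cv nrm partial.

(** After translating the centre [a] to the origin, a coordinate on the domain is at most a distance
    to [a], hence at most the diameter. *)
Lemma solve_bound eta (C D : R) rho Omega a i j k f : (2 <= n)%N -> Ccoo eta ->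
  (forall i j k, bogovskii_estimate eta i j k C) ->
  0 < rho -> measurable Omega -> (mu Omega < +oo)%E -> ediam Omega = D%:E ->
  eball a rho `<=` Omega -> test_function Omega f ->
  nrm (partial k (partial j (solve (dil rho (cv 1 eta eta)) a i f))) <=
  C * (D / rho ^+ 2 * loggrowth n (vol Omega / vol (eball a rho)) * nrm f + D / rho * nrm (partial j f)).
Proof.
move=> n2 heta HC r0 mO fO hd BO tf; have hf := test_function_Ccoo tf.
have hw : Ccoo (dil rho (cv 1 eta eta)).
  by apply: Ccoo_dil => //; apply: cv_Ccoo => //; exact: Ccoo_Cc.
have hs := Ccoo_shift a hf; have hpf := Ccoo_partial j hf.
have e1 : partial j (solve (dil rho (cv 1 eta eta)) a i f) =
    shift_fun (- a) (partial j (bogovskii (dil rho (cv 1 eta eta)) i (shift_fun a f))).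
  exact: partial_solve.
rewrite e1 (partial_shift k (- a) (smooth_partial j (bogovskii_smooth i hw hs))).
rewrite (nrm_shift _ (Ccoo_Cc (Ccoo_partial2_bog i j k n2 hw hs))).
pose O' : set V := [set x | Omega (1 *: x + a)].
have mO' : measurable O'.
  by have := @measurable_affine R n 1 a measurableT Omega mO; rewrite setTI.
have volO' : mu O' = mu Omega.
  exact: mu_shift.
have Oa : Omega a by apply: BO; exact: center_ball.
have rD : rho <= D by apply: (radius_le_ediam (Ordinal (ltnW n2)) hd r0 BO).
have vE : vol O' / vol (eball (0 : V) rho) = vol Omega / vol (eball a rho).
  have v1 : vol O' = vol Omega by rewrite /vol volO'.
  have v2 : vol (eball (0 : V) rho) = vol (eball a rho) by rewrite (vol_eball 0 r0) (vol_eball a r0).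
  by rewrite v1 v2.
have := HC i j k rho D O' (shift_fun a f) r0 rD mO'; rewrite volO' vE => /(_ fO hs).
rewrite (partial_shift j a hf.1) (nrm_shift _ (Ccoo_Cc hf)) (nrm_shift _ (Ccoo_Cc hpf)); apply.
- move=> x /= Ox; exact: (test_function_off tf Ox).
- move=> x /= Ox; have := enorm_le_ediam hd Ox Oa; apply: le_trans.
  by rewrite scale1r addrK coord_le_enorm.
- exact: vol_ratio_ge1.
Qed.

End geometry.

Lemma cvg_eps (R : realType) (u : nat -> R) (l : R) :
  (forall e : R, 0 < e -> exists N, forall k, (N <= k)%N -> `|l - u k| <= e) -> u @ \oo --> l.
Proof. by move=> h; apply/cvgrPdist_le => e /h[N hN]; exists N. Qed.

(** * Separation by test functions *)

Section dct.
Context d (T : measurableType d) (R : realType) (mu : {measure set T -> \bar R}).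

Lemma Rint_dct0 (F : nat -> T -> R) (F0 g : T -> R) :
  (forall k, rint mu (F k)) -> rint mu F0 -> rint mu g -> (forall k x, `|F k x| <= g x) ->
  (forall x, (fun k => F k x) @ \oo --> F0 x) ->
  (forall k, \int[mu]_x F k x = 0) -> \int[mu]_x F0 x = 0.
Proof.
move=> rF rF0 rg Fg FF F00.
have h : (fun k => \int[mu]_(x in setT) (F k x)%:E)%E @ \oo --> (\int[mu]_(x in setT) (F0 x)%:E)%E.
  have [] // := @dominated_convergence _ T R mu setT measurableT (fun k => EFin \o F k) (EFin \o F0) (EFin \o g).
  - by move=> k; exact: measurable_int (rF k).
  - exact: measurable_int rF0.
  - by apply: aeW => x _; apply/fine_cvgP; split; [exact: nearW|exact: FF].
  - by apply: aeW => x k _; rewrite /= lee_fin.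
have h0 : (fun k => \int[mu]_(x in setT) (F k x)%:E)%E = fun=> 0%E.
  apply/funext => k; have := F00 k; rewrite /Rintegral.
  by have := integrable_fin_num measurableT (rF k); case: (\int[mu]_x _)%E => //= r _ ->.
rewrite h0 in h; have := cvg_unique _ h (@cvg_cst _ _ _ _ _); rewrite /Rintegral => -> //.
Qed.

End dct.

Section approximation.
Variables (R : realType) (n : nat).
Local Notation V := 'rV[R]_n.
Local Notation mu := (lebesgueV R n).
Implicit Types (c x y z : V) (f g : V -> R) (U Omega : set V).

Lemma measurable_rV_opens : @measurable _ V = <<s (@open V) >>.
Proof.
apply/seteqP; split; last first.
  apply: smallest_sub; first exact: sigma_algebra_measurable.
  by move=> A; exact: measurable_rV_open.
move=> A mA; pose T := g_sigma_algebraType (@open V).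
have : measurable_fun setT (fun x : T => (x : V)).
  apply: measurable_fun_coordP => i.
  apply: (measurability _ (RGenOpens.measurableE R)).
  move=> _ [_ [a [b ->] <-]]; rewrite setTI; apply: sub_sigma_algebra.
  have /continuousP := @coord_continuous R 1 n ord0 i; apply; exact: interval_open.
by move=> /(_ measurableT A mA); rewrite setTI.
Qed.

Lemma flat1_ge (s : R) : 0 < s -> 1 - s^-1 <= flat1 s.
Proof.
by move=> s0; rewrite /flat1 /flat s0 hornerC mul1r; have := expR_ge1Dx (- s^-1).
Qed.

(** Bernoulli's inequality for a product of factors close to [1]. *)
Lemma prod_ge1B (I : Type) (s : seq I) (f : I -> R) (e : R) : 0 <= e -> (forall i, 0 <= f i <= 1) ->
  (forall i, 1 - e <= f i) -> 1 - (size s)%:R * e <= \prod_(i <- s) f i.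
Proof.
move=> e0 f01 fe; elim: s => [|i s IH]; first by rewrite big_nil mul0r subr0.
rewrite big_cons -[size _]/((size s).+1) -natr1.
have p1 : \prod_(j <- s) f j <= 1 by apply: prodr_ile1 => j _; exact: f01.
have p0 : 0 <= \prod_(j <- s) f j by apply: prodr_ge0 => j _; have /andP[] := f01 j.
have /andP[f0 f1] := f01 i; have := fe i; move: IH p1 p0; set P := \prod_(_ <- _) _ => IH p1 p0 h.
have : 0 <= (1 - f i) * (1 - P) by rewrite mulr_ge0// subr_ge0.
lra.
Qed.

Lemma box_bump_ge c (d e k : R) x : 0 < k -> 0 < e -> (forall i, `|x ord0 i - c ord0 i| <= d - e) ->
  1 - n%:R * (2 * (k * e)^-1) <= box_bump c d k x.
Proof.
move=> k0 e0 h; rewrite /box_bump -[in X in 1 - X * _](size_enum_ord n) -big_enum /=.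
have ke : 0 < (k * e)^-1 by rewrite invr_gt0 mulr_gt0.
apply: prod_ge1B => [|i|i]; first by rewrite mulr_ge0// ltW.
  by rewrite mulr_ge0 ?flat1_ge0//= mulr_ile1 ?flat1_ge0 ?flat1_le1.
have := h i; rewrite ler_norml => /andP[h1 h2].
have fl u : e <= u -> 1 - (k * e)^-1 <= flat1 (k * u).
  move=> eu; have u0 : 0 < u by exact: lt_le_trans eu.
  apply: le_trans (flat1_ge (mulr_gt0 k0 u0)); rewrite lerD2l lerN2.
  by rewrite lef_pV2 ?posrE ?mulr_gt0// ler_wpM2l// ltW.
have f1 : 1 - (k * e)^-1 <= flat1 (k * x ord0 i + k * (d - c ord0 i)).
  by rewrite -mulrDr; apply: fl; lra.
have f2 : 1 - (k * e)^-1 <= flat1 (- k * x ord0 i + k * (d + c ord0 i)).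
  by rewrite mulNr -mulrN -mulrDr; apply: fl; lra.
have := flat1_le1 (k * x ord0 i + k * (d - c ord0 i)); have := flat1_le1 (- k * x ord0 i + k * (d + c ord0 i)).
move: (flat1 _) (flat1 _) f1 f2 => u v f1 f2 u1 v1.
have : 0 <= (1 - u) * (1 - v) by rewrite mulr_ge0// subr_ge0.
lra.
Qed.

(** [j] encodes a rational cube, discarded unless contained in [U]. Shrinking it by
    [1 - 1 / (k + 2)] keeps the support compact in [U], while the growing steepness makes the bump
    tend to [1] inside the cube. *)
Definition cutoff1 U (j k : nat) x : R :=
  match @unpickle ('rV[rat]_n * nat)%type j with
  | Some cm => if `[< cube (map_mx ratr cm.1 : V) cm.2.+1%:R^-1 `<=` U >] then
       box_bump (map_mx ratr cm.1) (cm.2.+1%:R^-1 * (1 - k.+2%:R^-1)) k.+1%:R x else 0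
  | None => 0
  end.

Lemma cutoff1_01 U j k x : 0 <= cutoff1 U j k x <= 1.
Proof.
rewrite /cutoff1; case: unpickle => [cm|]; last by rewrite lexx ler01.
by case: ifP => _; [rewrite box_bump_ge0 box_bump_le1|rewrite lexx ler01].
Qed.

Lemma test_function0 U : test_function U (fun _ : V => 0 : R).
Proof.
by apply: (@test_functionI _ _ _ set0) => //; [exact: smooth_cst|exact: compact0].
Qed.

Lemma cutoff1_test U j k : test_function U (cutoff1 U j k).
Proof.
rewrite /cutoff1; case: unpickle => [cm|]; last exact: test_function0.
have [sub|nsub] := pselect (cube (map_mx ratr cm.1 : V) cm.2.+1%:R^-1 `<=` U); last first.
  by rewrite (asboolF nsub); exact: test_function0.
rewrite (asboolT sub).
set c := map_mx _ _ in sub *; set r : R := _^-1 in sub *; set d := r * _.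
have r0 : 0 < r by rewrite invr_gt0.
have dr : d < r.
  by rewrite /d -[ltRHS]mulr1 ltr_pM2l// gtrBl invr_gt0.
apply: (@test_functionI _ _ _ [set x | forall i, `|x ord0 i - c ord0 i| <= d]).
- exact: box_bump_smooth.
- exact: compact_box.
- by move=> x h; apply: sub => i; exact: le_lt_trans (h i) dr.
- move=> x h; apply: box_bump_eq0 => // xc; apply: h => i; exact/ltW/xc.
Qed.

Lemma cutoff1_cvg U x : open U -> U x -> exists j, forall e : R, 0 < e -> exists N, forall k, (N <= k)%N ->
  1 - e <= cutoff1 U j k x.
Proof.
move=> oU Ux; move: (Ux); rewrite {1}(open_bigcup_cube oU) => -[cm /= sub xc].
exists (pickle cm) => e e0; rewrite /cutoff1.
set c := map_mx _ _ in sub xc; set r : R := _^-1 in sub xc.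
have r0 : 0 < r by rewrite invr_gt0.
have nx : `|x - c| < r by apply: rV_norm_lt => // i; have := xc i; rewrite !mxE.
(* Half the margin of [x] inside its cube: one [m] absorbs the shrinking of the cube, the other is
   the distance that the steepness turns into closeness to [1]. *)
pose m := (r - `|x - c|) / 2; have m0 : 0 < m by rewrite divr_gt0// subr_gt0.
exists (Num.trunc (Num.max (r / m) (n%:R * 2 / (m * e)))).+1 => k kN.
have hk : Num.max (r / m) (n%:R * 2 / (m * e)) <= k%:R.
  by apply: le_trans (ltW (truncnS_gt _)) _; rewrite ler_nat.
move: hk; rewrite ge_max => /andP[hk1 hk2].
rewrite pickleK; case: asboolP => // _.
have k1 : (k%:R : R) <= k.+1%:R by rewrite ler_nat.
have k2 : (k%:R : R) <= k.+2%:R by rewrite ler_nat -addn2 leq_addr.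
apply: le_trans (box_bump_ge (e := m) _ m0 _) => //.
  have km : 0 < k.+1%:R * m by exact: mulr_gt0.
  rewrite lerD2l lerN2 mulrA (ler_pdivrMr _ _ km).
  have := le_trans hk2 k1; rewrite ler_pdivrMr; last exact: mulr_gt0.
  by have -> : e * (k.+1%:R * m) = k.+1%:R * (m * e) by ring.
move=> i; have := rV_coord_le (x - c) i; rewrite !mxE => h; apply: le_trans h _.
rewrite -/r -/c mulrBr mulr1; have : r * k.+2%:R^-1 <= m.
  rewrite ler_pdivrMr// mulrC -ler_pdivrMr//; exact: le_trans hk1 k2.
have mE : r - `|x - c| = 2 * m by rewrite /m mulrCA mulfV// mulr1.
have fin (q m' y r' : R) : r' - y = 2 * m' -> q <= m' -> y <= r' - q - m' by lra.
exact: fin.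
Qed.

(** A smooth substitute for the maximum of the bumps: it stays in [[0, 1]] and dominates each of
    them. *)
Definition cutoff U k x : R := 1 - \prod_(j < k) (1 - cutoff1 U j k x).

Lemma test_functionD U f g : test_function U f -> test_function U g ->
  test_function U (fun x => f x + g x).
Proof.
move=> hf hg; have := test_functionB hf (test_functionZ (-1) hg).
rewrite (_ : (fun x => f x + g x) = fun x => f x - -1 * g x)//.
by apply/funext => x; rewrite mulN1r opprK.
Qed.

Lemma test_functionM U f g : test_function U f -> smooth g -> test_function U (fun x => f x * g x).
Proof.
move=> /test_functionE[sf [K [cK KU f0]]] sg; apply: (test_functionI (smoothM sf sg) cK KU).
by move=> x Kx; rewrite f0// mul0r.
Qed.

Lemma cutoff_test U k : test_function U (cutoff U k).
Proof.
suff H l : test_function U (fun x => 1 - \prod_(j < l) (1 - cutoff1 U j k x)) by exact: H.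
elim: l => [|l IH].
  rewrite (_ : (fun x => _) = fun=> 0); first exact: test_function0.
  by apply/funext => x; rewrite big_ord0 subrr.
rewrite (_ : (fun x => _) = fun x => (1 - \prod_(j < l) (1 - cutoff1 U j k x)) + cutoff1 U l k x *
   (1 - (1 - \prod_(j < l) (1 - cutoff1 U j k x)))); last first.
  by apply/funext => x; rewrite big_ord_recr/=; move: (\prod_(_ < _) _) => P; ring.
apply: test_functionD => //; apply: test_functionM; first exact: cutoff1_test.
by apply: smoothB; [exact: smooth_cst|case: IH].
Qed.

Lemma cutoff_prod01 U k x : 0 <= \prod_(j < k) (1 - cutoff1 U j k x) <= 1.
Proof.
have h (j : 'I_k) : 0 <= 1 - cutoff1 U j k x <= 1.
  by have /andP[h1 h2] := cutoff1_01 U j k x; rewrite subr_ge0 h2 lerBlDr lerDl.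
by rewrite prodr_ge0 ?prodr_ile1// => j _; have /andP[] := h j.
Qed.

Lemma cutoff_01 U k x : 0 <= cutoff U k x <= 1.
Proof. by have /andP[h1 h2] := cutoff_prod01 U k x; rewrite /cutoff subr_ge0 h2 lerBlDr lerDl. Qed.

Lemma cutoff_cvg U x : open U -> (fun k => cutoff U k x) @ \oo --> (\1_U x : R).
Proof.
move=> oU; have [Ux|Ux] := pselect (U x); last first.
  rewrite indicE memNset// (_ : (fun k => _) = fun=> 0); first exact: cvg_cst.
  by apply/funext => k; exact: test_function_off (cutoff_test U k) Ux.
rewrite indicE mem_set//; have [j hj] := cutoff1_cvg oU Ux.
apply: cvg_eps => e e0; have [N hN] := hj e e0; exists (maxn N j.+1) => k; rewrite geq_max => /andP[Nk jk].
have /andP[P0 P1] := cutoff_prod01 U k x.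
rewrite /cutoff opprB addrCA subrr addr0 ger0_norm//.
rewrite (bigD1 (Ordinal jk))//=; apply: (@le_trans _ _ (1 - cutoff1 U j k x)); last by have := hN k Nk; lra.
have h (l : 'I_k) : 0 <= 1 - cutoff1 U l k x <= 1.
  by have /andP[h1 h2] := cutoff1_01 U l k x; rewrite subr_ge0 h2 lerBlDr lerDl.
rewrite -[leRHS]mulr1 ler_wpM2l//; first by have /andP[] := h (Ordinal jk).
by apply: prodr_ile1 => l _; exact: h.
Qed.

(** Cutoffs and dominated convergence give integral zero over open sets. Since these are stable
    under intersection and generate the sigma-algebra, [dynkin_induction] extends this to all
    measurable sets, so [d] vanishes almost everywhere. *)
Theorem test_separate Omega (d : V -> R) : open Omega -> rint mu d -> (forall x, ~ Omega x -> d x = 0) ->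
  (forall phi, test_function Omega phi -> \int[mu]_x (d x * phi x) = 0) ->
  {ae mu, forall x, d x = 0}.
Proof.
move=> oO rd d0 hd.
have r1 (f : V -> R) : measurable_fun setT f -> (forall x, `|f x| <= 1) -> rint mu (fun x => d x * f x).
  move=> mf f1; apply: (rint_le _ _ (rint_norm rd)); first exact: measurable_funM (rint_measurable rd) mf.
  by move=> x; rewrite normrM -[leRHS]mulr1 ler_wpM2l.
have rI A : measurable A -> rint mu (fun x => d x * \1_A x).
  by move=> mA; apply: r1 => // x; rewrite indicE; case: (_ \in _); rewrite ?normr0 ?normr1.
have opn U : open U -> \int[mu]_x (d x * \1_U x) = 0.
  move=> oU; have oUO : open (U `&` Omega) by exact: openI.
  have -> : \int[mu]_x (d x * \1_U x) = \int[mu]_x (d x * \1_(U `&` Omega) x).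
    apply: eq_Rintegral => x _; rewrite !indicE in_setI.
    have [Ox|Ox] := pselect (Omega x); first by rewrite (mem_set Ox) andbT.
    by rewrite d0// !mul0r.
  apply: (@Rint_dct0 _ _ _ _ (fun k x => d x * cutoff (U `&` Omega) k x) _ (fun x => `|d x|)).
  - move=> k; apply: r1 => [|x].
      exact: Cc_measurable (Ccoo_Cc (test_function_Ccoo (cutoff_test (U `&` Omega) k))).
    by have /andP[h1 h2] := cutoff_01 (U `&` Omega) k x; rewrite ger0_norm.
  - by apply: rI; exact: measurable_rV_open.
  - exact: rint_norm.
  - move=> k x; have /andP[h1 h2] := cutoff_01 (U `&` Omega) k x.
    by rewrite normrM -[leRHS]mulr1 ler_wpM2l// ger0_norm.
  - by move=> x; apply: cvgMr; exact: cutoff_cvg.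
  - move=> k; apply: hd; apply: test_functionS (cutoff_test (U `&` Omega) k); exact: subIsetr.
have all A : measurable A -> \int[mu]_x (d x * \1_A x) = 0.
  move=> mA; have : <<s (@open V) >> A by rewrite -measurable_rV_opens.
  apply: (@dynkin_induction _ V (@open V) (fun A => \int[mu]_x (d x * \1_A x) = 0) measurable_rV_opens (@openI V)).
  - by apply: opn; exact: openT.
  - by move=> U; exact: opn.
  - move=> S mS hS; have e x : d x * \1_(~` S) x = d x * \1_setT x - d x * \1_S x.
      rewrite !indicE in_setC in_setT; case: (_ \in _); rewrite ?mulr0 ?mulr1 ?subrr ?subr0//.
    under eq_Rintegral do rewrite e.
    by rewrite RintB ?hS ?opn ?subrr//; [exact: openT|exact: rI|exact: rI].
  - move=> F mF tF hF.
    apply: (@Rint_dct0 _ _ _ _ (fun k x => d x * \1_(\bigcup_(i < k) F i) x) _ (fun x => `|d x|)).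
    + by move=> k; apply: rI; exact: bigcup_measurable.
    + by apply: rI; exact: bigcup_measurable.
    + exact: rint_norm.
    + by move=> k x; rewrite normrM -[leRHS]mulr1 ler_wpM2l// indicE; case: (_ \in _); rewrite ?normr0 ?normr1.
    + move=> x; apply: cvgMr; apply: cvg_eps => e e0.
      have [[i _ Fix]|nF] := pselect ((\bigcup_k F k) x).
        exists i.+1 => k ik; rewrite !indicE !mem_set ?subrr ?normr0 ?ltW//; first by exists i.
        by exists i.
      exists 0%N => k _; rewrite !indicE !memNset ?subrr ?normr0 ?ltW//.
      by move=> [i _ Fix]; apply: nF; exists i.
    + elim=> [|k IH].
        rewrite -(Rintegral_zero mu); apply: eq_Rintegral => x _.
        by rewrite II0 bigcup_set0 indicE memNset// mulr0.
      have e x : d x * \1_(\bigcup_(i < k.+1) F i) x = d x * \1_(\bigcup_(i < k) F i) x + d x * \1_(F k) x.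
        rewrite -mulrDr; congr (_ * _); rewrite !indicE.
        have [Fk|nFk] := pselect (F k x).
          rewrite (mem_set Fk) mem_set; last by exists k => //=.
          rewrite memNset ?add0r// => -[i /= ik Fi].
          have ki : i = k by apply: (tF i k I I); exists x; split.
          by rewrite ki ltnn in ik.
        rewrite (memNset nFk) addr0.
        have [[i /= ik Fi]|nU] := pselect ((\bigcup_(i < k) F i) x).
          by rewrite !mem_set//; exists i => //=; exact: ltnW.
        rewrite !memNset// => -[i /= ik Fi]; move: ik; rewrite ltnS leq_eqVlt => /orP[/eqP ik|ik].
          by apply: nFk; rewrite -ik.
        by apply: nU; exists i.
      under eq_Rintegral do rewrite e.
      by rewrite RintD ?IH ?hF ?addr0//; [apply: rI; exact: bigcup_measurable|exact: rI].
have ae0 : ae_eq mu setT (EFin \o d) (cst 0%E).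
  apply: integral_ae_eq => // E _ mE.
  rewrite integral0 integral_mkcond.
  have := all E mE; have := integrable_fin_num measurableT (rI E mE).
  rewrite /Rintegral; have -> : (\int[mu]_x (d x * \1_E x)%:E = \int[mu]_x ((EFin \o d) \_ E) x)%E.
    apply: eq_integral => x _; rewrite /patch indicE; case: (_ \in _); by rewrite ?mulr1 ?mulr0.
  by case: (\int[mu]_x _)%E => //= r _ ->.
by apply: filterS ae0 => x /(_ I) [].
Qed.

End approximation.

(** * Square-integrable functions and weak derivatives *)

Section L2.
Variables (R : realType) (n : nat).
Local Notation V := 'rV[R]_n.
Local Notation mu := (lebesgueV R n).
Local Notation hf := (2^-1 : R).
Implicit Types (x y z : V) (f g h : V -> R) (Omega : set V).

Definition L2f f := measurable_fun setT f /\ rint mu (fun x => f x ^+ 2).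

Lemma Cc_L2f f : Cc f -> L2f f.
Proof. by move=> hf; split; [exact: Cc_measurable|exact/Cc_rint/Cc_sqr]. Qed.

Lemma rint_L2M f g : L2f f -> L2f g -> rint mu (fun x => f x * g x).
Proof.
move=> [mf rf] [mg rg]; apply: (rint_le _ _ (rintD rf rg)); first exact: measurable_funM.
move=> x; rewrite normrM; have : 0 <= (`|f x| - `|g x|) ^+ 2 by exact: sqr_ge0.
have := sqr_ge0 (f x); have := sqr_ge0 (g x).
rewrite -[f x ^+ 2]real_normK ?num_real// -[g x ^+ 2]real_normK ?num_real//.
by move: `|f x| `|g x| => u v; rewrite !expr2; nra.
Qed.

Lemma L2fZ (c : R) f : L2f f -> L2f (fun x => c * f x).
Proof.
move=> [mf rf]; split; first exact: measurable_funM.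
by apply: eq_integrable (rintZ (c ^+ 2) rf) => // x _ /=; rewrite exprMn.
Qed.

Lemma L2fD f g : L2f f -> L2f g -> L2f (fun x => f x + g x).
Proof.
move=> hf hg; split; first by apply: measurable_funD; [exact: hf.1|exact: hg.1].
have := rintD (rintD hf.2 (rintZ 2 (rint_L2M hf hg))) hg.2.
by apply: eq_integrable => // x _ /=; congr EFin; ring.
Qed.

Lemma L2fB f g : L2f f -> L2f g -> L2f (fun x => f x - g x).
Proof.
move=> hf hg; rewrite (_ : (fun x => _) = fun x => f x + -1 * g x); last first.
  by apply/funext => x; rewrite mulN1r.
by apply: L2fD => //; exact: L2fZ.
Qed.

Lemma L2f_CS f g : L2f f -> L2f g -> `|\int[mu]_x (f x * g x)| <= nrm f * nrm g.
Proof.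
move=> hf hg; rewrite -(@ler_pXn2r _ 2)// ?nnegrE ?mulr_ge0 ?nrm_ge0//.
rewrite exprMn !nrm_sqr real_normK ?num_real//; apply: Rint_CS; [exact: hf.2|exact: hg.2|exact: rint_L2M].
Qed.

Lemma L2nrmZ (c : R) f : L2f f -> nrm (fun x => c * f x) = `|c| * nrm f.
Proof.
move=> hf; rewrite /nrm -sqrtr_sqr -sqrtrM ?sqr_ge0// -RintZ; last exact: hf.2.
by congr Num.sqrt; apply: eq_Rintegral => x _; rewrite exprMn.
Qed.

Lemma L2nrmD f g : L2f f -> L2f g -> nrm (fun x => f x + g x) <= nrm f + nrm g.
Proof.
move=> hf hg; have cs := L2f_CS hf hg; have rfg := rint_L2M hf hg.
rewrite -(@ler_pXn2r _ 2)// ?nnegrE ?addr_ge0 ?nrm_ge0// sqrrD !nrm_sqr.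
have -> : \int[mu]_x (f x + g x) ^+ 2 = \int[mu]_x (f x ^+ 2) + 2 * \int[mu]_x (f x * g x) + \int[mu]_x (g x ^+ 2).
  rewrite -RintZ// -RintD; [|exact: hf.2|exact: rintZ].
  rewrite -RintD; [|exact: rintD hf.2 (rintZ 2 rfg)|exact: hg.2].
  by apply: eq_Rintegral => x _; ring.
rewrite -[nrm f * nrm g *+ 2]mulr_natl !lerD2r lerD2l ler_wpM2l//; exact: le_trans (ler_norm _) cs.
Qed.

Lemma L2nrmB f g : L2f f -> L2f g -> nrm (fun x => f x - g x) <= nrm f + nrm g.
Proof.
move=> hf hg; have := L2nrmD hf (L2fZ (-1) hg); rewrite L2nrmZ// normrN1 mul1r.
by rewrite (_ : (fun x => f x + -1 * g x) = fun x => f x - g x)//; apply/funext => x; rewrite mulN1r.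
Qed.

Lemma nrm_subC f g : nrm (fun x => f x - g x) = nrm (fun x => g x - f x).
Proof. by congr Num.sqrt; apply: eq_Rintegral => x _; rewrite -sqrrN opprB. Qed.

Lemma L2nrm_tri f g h : L2f f -> L2f g -> L2f h ->
  nrm (fun x => f x - h x) <= nrm (fun x => f x - g x) + nrm (fun x => g x - h x).
Proof.
move=> hf hg hh; have := L2nrmD (L2fB hf hg) (L2fB hg hh).
by rewrite (_ : (fun x => f x - g x + (g x - h x)) = fun x => f x - h x)//; apply/funext => x; rewrite addrA subrK.
Qed.

Lemma L2nrm_le_add f g : L2f f -> L2f g -> nrm f <= nrm g + nrm (fun x => f x - g x).
Proof.
move=> hf hg; have := L2nrmD hg (L2fB hf hg).
by rewrite (_ : (fun x => g x + (f x - g x)) = f)//; apply/funext => x; rewrite addrC subrK.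
Qed.

Lemma ae_nrm f g : L2f f -> L2f g -> {ae mu, forall x, f x = g x} -> nrm f = nrm g.
Proof.
move=> hf hg fg; rewrite /nrm; congr Num.sqrt; rewrite /Rintegral; congr fine.
apply: ae_eq_integral => //; [exact: measurable_int hf.2|exact: measurable_int hg.2|].
by apply: filterS fg => x /= -> _.
Qed.

Lemma EFin_Rint f : rint mu f -> (\int[mu]_x (f x)%:E = (\int[mu]_x f x)%:E)%E.
Proof. by move=> rf; rewrite /Rintegral fineK//; exact: integrable_fin_num rf. Qed.

(** The increments have norm at most [4 ^ -j], so the sum of [4 ^ j] times their squares has finite
    integral and is finite almost everywhere. At such a point the increments are of order [2 ^ -j],
    hence summable. *)
Lemma L2_summable_cvg (p : nat -> V -> R) : (forall j, L2f (p j)) ->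
  (forall j, nrm (fun x => p j.+1 x - p j x) <= (2^-1 ^+ 2) ^+ j) ->
  {ae mu, forall x, cvgn (fun j => p j x)}.
Proof.
move=> hp hD; pose D j x := p j.+1 x - p j x.
have hDj j : L2f (D j) by exact: L2fB.
pose T j x : \bar R := (4 ^+ j * D j x ^+ 2)%:E.
have rT j : rint mu (fun x => 4 ^+ j * D j x ^+ 2) by apply: rintZ; exact: (hDj j).2.
have T0 j x : (0 <= T j x)%E by rewrite lee_fin; apply: mulr_ge0; [exact: exprn_ge0|exact: sqr_ge0].
have mT j : measurable_fun setT (T j) by exact: measurable_int (rT j).
have iT j : (\int[mu]_x T j x <= (hf ^+ j)%:E)%E.
  rewrite (EFin_Rint (rT j)) lee_fin RintZ; last exact: (hDj j).2.
  rewrite -nrm_sqr; have h1 : nrm (D j) ^+ 2 <= ((2^-1 ^+ 2) ^+ j) ^+ 2.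
    by rewrite lerXn2r ?nnegrE ?nrm_ge0 ?exprn_ge0// hD.
  apply: le_trans (ler_wpM2l _ h1) _; first by rewrite exprn_ge0.
  rewrite -exprM mulnC exprM -exprMn lerXn2r ?nnegrE ?mulr_ge0//.
  by rewrite !exprVn; lra.
pose S x := (\sum_(0 <= j <oo) T j x)%E.
have mS : measurable_fun setT S by apply: ge0_emeasurable_sum.
have S0 x : (0 <= S x)%E by apply: nneseries_ge0.
have iS : (\int[mu]_x S x <= 2%:E)%E.
  rewrite /S integral_nneseries//.
  apply: lime_le.
    by apply: is_cvg_nneseries => j _ _; exact: integral_ge0.
  apply: nearW => N; rewrite big_mkord.
  apply: (@le_trans _ _ (\sum_(j < N) (hf ^+ j)%:E)%E); first by apply: lee_sum => j _.
  by rewrite sumEFin lee_fin geom_half.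
have IS : mu.-integrable setT S.
  apply/integrableP; split => //; under eq_integral do rewrite gee0_abs//.
  by apply: le_lt_trans iS _; rewrite ltry.
have := integrable_ae measurableT IS; apply: filterS => x /(_ Logic.I) Sfin.
pose M := fine (S x).
have TM j : 4 ^+ j * D j x ^+ 2 <= M.
  rewrite -lee_fin /M fineK//; apply: le_trans (nneseries_lim_ge j.+1 _) => [|k _ _]; last exact: T0.
  by rewrite big_nat_recr//= leeDr//; apply: sume_ge0 => k _; exact: T0.
have M0 : 0 <= M by rewrite /M fine_ge0.
have DM j : `|D j x| <= Num.sqrt M * hf ^+ j.
  rewrite -(@ler_pXn2r _ 2)// ?nnegrE ?mulr_ge0 ?sqrtr_ge0 ?exprn_ge0//.
  rewrite real_normK ?num_real// exprMn sqr_sqrtr// -exprM mulnC exprM.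
  have -> : hf ^+ 2 = 4^-1 by rewrite exprVn; congr (_^-1); ring.
  by rewrite exprVn ler_pdivlMr ?exprn_gt0// mulrC.
have cD : cvgn (series (fun j => D j x)).
  apply: normed_cvg; apply: (@series_le_cvg _ _ (geometric (Num.sqrt M) hf)) => //.
  - by move=> j /=; exact: normr_ge0.
  - by move=> j; rewrite /geometric /= mulr_ge0 ?sqrtr_ge0 ?exprn_ge0.
  - by apply: is_cvg_geometric_series; rewrite ger0_norm// invf_lt1// ltr1n.
rewrite (_ : (fun j => p j x) = fun j => p 0%N x + series (fun j => D j x) j).
  by apply: is_cvgD => //; exact: is_cvg_cst.
by apply/funext => j; rewrite [LHS](eq_sum_telescope (fun j => p j x)).
Qed.

(** Riesz-Fischer: a fast subsequence converges almost everywhere, and Fatou bounds the distance of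
    its limit to each [h k], which proves both square integrability and convergence of the full
    sequence. *)
Theorem L2_complete (h : nat -> V -> R) : (forall k, L2f (h k)) ->
  (forall e : R, 0 < e -> exists N, forall k l, (N <= k)%N -> (N <= l)%N -> nrm (fun x => h k x - h l x) <= e) ->
  exists2 g, L2f g & forall e : R, 0 < e -> exists N, forall k, (N <= k)%N -> nrm (fun x => h k x - g x) <= e.
Proof.
move=> hh Cau.
have /choice[N hN] : forall j : nat, exists N, forall k l, (N <= k)%N -> (N <= l)%N ->
    nrm (fun x => h k x - h l x) <= (2^-1 ^+ 2) ^+ j.
  by move=> j; apply: Cau; rewrite !exprn_gt0.
pose q j := (\sum_(i < j.+1) (N i).+1)%N; pose p j := h (q j).
have qN j : (N j <= q j)%N by rewrite /q big_ord_recr/= addnS ltnW// ltnS leq_addl.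
have qS j : (q j <= q j.+1)%N by rewrite /q [X in (_ <= X)%N]big_ord_recr/= leq_addr.
have qmono i j : (i <= j)%N -> (q i <= q j)%N.
  by move=> ij; rewrite -(subnK ij); elim: (j - i)%N => [//|k IH]; rewrite addSn (leq_trans IH).
have cp := L2_summable_cvg (p := p) (fun j => hh (q j)) (fun j => hN j _ _ (leq_trans (qN j) (qS j)) (qN j)).
(* The upper limit is defined and measurable everywhere and is the limit wherever that exists. *)
pose g x := fine (limn_esup (fun j => (p j x)%:E)).
have mp j : measurable_fun setT (p j) by exact: (hh _).1.
have mg : measurable_fun setT g.
  apply: measurableT_comp; first exact: fine_measurable.
  by apply: measurable_fun_limn_esup => j; apply/measurable_EFinP.
have gE x : cvgn (fun j => p j x) -> (fun j => p j x) @ \oo --> g x.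
  move=> cx; have c2 : (fun j => (p j x)%:E) @ \oo --> (limn (fun j => p j x))%:E.
    by apply/fine_cvgP; split; [exact: nearW|exact: cx].
  by rewrite /g; have [_ ->] := cvg_limn_einf_sup c2.
have bound k (e : R) : 0 <= e -> (exists J, forall j, (J <= j)%N -> nrm (fun x => p j x - h k x) <= e) ->
    (\int[mu]_x ((g x - h k x) ^+ 2)%:E <= (e ^+ 2)%:E)%E.
  move=> e0 [J hJ]; pose F j x : \bar R := ((p j x - h k x) ^+ 2)%:E.
  have rF j : rint mu (fun x => (p j x - h k x) ^+ 2) by exact: (L2fB (hh (q j)) (hh k)).2.
  have mF j : measurable_fun setT (F j) by exact: measurable_int (rF j).
  have F0 j x : setT x -> (0 <= F j x)%E by rewrite lee_fin sqr_ge0.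
  have fat := fatou mu measurableT mF F0.
  have mgk : measurable_fun setT (fun x => ((g x - h k x) ^+ 2)%:E).
    apply/measurable_EFinP; apply: measurable_funX; apply: measurable_funB => //; exact: (hh k).1.
  have mlim : measurable_fun setT (fun x => limn_einf (F^~ x)).
    rewrite (_ : (fun x => _) = fun x => (- limn_esup (fun j => - F j x))%E).
      apply: measurableT_comp => //; apply: measurable_fun_limn_esup => j.
      exact: measurableT_comp.
    by apply/funext => x; rewrite limn_esupN oppeK.
  have -> : (\int[mu]_x ((g x - h k x) ^+ 2)%:E = \int[mu]_x limn_einf (F^~ x))%E.
    apply: ae_eq_integral => //; apply: filterS cp => x cx _.
    have c2 : (fun j => F j x) @ \oo --> ((g x - h k x) ^+ 2)%:E.
      apply/fine_cvgP; split; first exact: nearW.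
      have c3 : (fun j => p j x - h k x) @ \oo --> g x - h k x.
        by apply: cvgB; [exact: gE|exact: cvg_cst].
      by rewrite (_ : _ \o _ = fun j => (p j x - h k x) * (p j x - h k x)); [rewrite expr2; exact: cvgM|apply/funext => j /=; rewrite expr2].
    by have [-> _] := cvg_limn_einf_sup c2.
  apply: le_trans fat _; rewrite limn_einf_lim; apply: lime_le; first exact: is_cvg_einfs.
  apply: nearW => m; apply: ge_ereal_inf; exists (\int[mu]_x F (maxn m J) x)%E => //=.
    by exists (maxn m J) => //=; rewrite leq_maxl.
  rewrite (EFin_Rint (rF _)) lee_fin -nrm_sqr lerXn2r ?nnegrE ?nrm_ge0// hJ// leq_maxr//.
have sub k (e : R) : 0 <= e -> (exists J, forall j, (J <= j)%N -> nrm (fun x => p j x - h k x) <= e) ->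
    L2f (fun x => g x - h k x) /\ nrm (fun x => g x - h k x) <= e.
  move=> e0 hJ; have b := bound k e e0 hJ.
  have m1 : measurable_fun setT (fun x => g x - h k x) by apply: measurable_funB => //; exact: (hh k).1.
  have r : rint mu (fun x => (g x - h k x) ^+ 2).
    apply/integrableP; split; first by apply/measurable_EFinP; exact: measurable_funX.
    under eq_integral do rewrite /= ger0_norm ?sqr_ge0//.
    by apply: le_lt_trans b _; rewrite ltry.
  split => //; rewrite -(@ler_pXn2r _ 2)// ?nnegrE ?nrm_ge0// nrm_sqr -lee_fin.
  by rewrite -EFin_Rint.
have qid j : (j <= q j)%N.
  elim: j => // j IH; apply: leq_ltn_trans IH _.
  by rewrite /q [X in (_ < X)%N]big_ord_recr/= addnS ltnS leq_addr.
have lim (e : R) : 0 < e -> exists K, forall k, (K <= k)%N ->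
    L2f (fun x => g x - h k x) /\ nrm (fun x => g x - h k x) <= e.
  move=> e0; have [K hK] := Cau e e0; exists K => k Kk; apply: sub; first exact: ltW.
  by exists K => j Kj; apply: hK => //; exact: leq_trans Kj (qid j).
have L2g : L2f g.
  have [K hK] := lim 1 ltr01; have := L2fD (hK K (leqnn K)).1 (hh K).
  by rewrite (_ : (fun x => _) = g)//; apply/funext => x; rewrite subrK.
exists g => // e e0; have [K hK] := lim e e0; exists K => k Kk.
by rewrite nrm_subC; exact: (hK k Kk).2.
Qed.

End L2.

(** * Weak derivatives *)

Section weak.
Variables (R : realType) (n : nat).
Local Notation V := 'rV[R]_n.
Local Notation mu := (lebesgueV R n).
Implicit Types (x y z : V) (f g h phi : V -> R) (Omega : set V) (alpha : 'I_n -> nat).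

Lemma Lnorm2E f : measurable_fun setT f ->
  ('N[mu]_2%:E [EFin \o f] = (\int[mu]_x (f x ^+ 2)%:E) `^ 2^-1)%E.
Proof.
move=> mf; rewrite unlock; congr (_ `^ _)%E; apply: eq_integral => x _ /=.
by rewrite powR_mulrn// real_normK ?num_real.
Qed.

Lemma in_L2E Omega f : in_L2 Omega f <-> L2f (f \_ Omega).
Proof.
rewrite /in_L2; move: (f \_ Omega) => {}f; split.
  move=> /andP[]; rewrite !inE /= /finite_norm => mf; rewrite Lnorm2E// => fin.
  split=> //; apply/integrableP; split; first by apply/measurable_EFinP; exact: measurable_funX.
  under eq_integral do rewrite /= ger0_norm ?sqr_ge0//.
  have [//|/= inf] := boolP (_ < +oo)%E; move: fin.
  by rewrite -leNgt leye_eq in inf; rewrite (eqP inf) poweRyr// invr_eq0.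
move=> [mf rf]; apply/andP; split; rewrite !inE//= /finite_norm Lnorm2E//.
by rewrite (EFin_Rint rf) poweR_EFin ltry.
Qed.

Lemma L2normE Omega f : L2f (f \_ Omega) -> L2norm Omega f = nrm (f \_ Omega).
Proof.
move=> [mf rf]; rewrite /L2norm Lnorm2E// (EFin_Rint rf) poweR_EFin/= powR12_sqrt//.
by apply: Rint_ge0 => x; exact: sqr_ge0.
Qed.

Lemma restrict_off Omega f : (forall x, ~ Omega x -> f x = 0) -> f \_ Omega = f.
Proof.
by move=> f0; apply/funext => x; rewrite patchE; case: ifPn => // /negP xO; rewrite f0// => Ox; apply: xO; exact/mem_set.
Qed.

Lemma restrict_idem Omega f : (f \_ Omega) \_ Omega = f \_ Omega.
Proof. by apply/funext => x; rewrite !patchE; case: (x \in Omega). Qed.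

Lemma restrictB Omega f g : (fun x => f x - g x) \_ Omega = fun x => (f \_ Omega) x - (g \_ Omega) x.
Proof. by apply/funext => x; rewrite !patchE; case: ifP => // _; rewrite subr0. Qed.

Lemma restrictM Omega f g : (fun x => f x * g x) \_ Omega = fun x => (f \_ Omega) x * g x.
Proof. by apply/funext => x; rewrite !patchE; case: ifP => // _; rewrite mul0r. Qed.

Lemma L2f_restrict Omega f : measurable Omega -> L2f f -> L2f (f \_ Omega).
Proof.
move=> mO [mf rf]; have mg : measurable_fun setT (f \_ Omega).
  by apply/(measurable_restrictT _ mO); exact: measurable_funTS.
split=> //; apply: (rint_le _ _ rf); first exact: measurable_funX.
move=> x; rewrite normrX real_normK ?num_real// patchE; case: ifP => // _; rewrite expr0n; exact: sqr_ge0.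
Qed.

Lemma nrm_le f g : L2f f -> L2f g -> (forall x, `|f x| <= `|g x|) -> nrm f <= nrm g.
Proof.
move=> hf hg fg; rewrite -(@ler_pXn2r _ 2)// ?nnegrE ?nrm_ge0// !nrm_sqr.
apply: Rint_le; [exact: hf.2|exact: hg.2|move=> x].
by rewrite -[f x ^+ 2]real_normK ?num_real// -[g x ^+ 2]real_normK ?num_real// lerXn2r ?nnegrE.
Qed.

Lemma nrm_eq0 f : L2f f -> nrm f = 0 -> {ae mu, forall x, f x = 0}.
Proof.
move=> hf f0; have := nrm_sqr f; rewrite f0 expr0n/= => /esym i0.
have i2 : (\int[mu]_x `|(f x ^+ 2)%:E| = 0)%E.
  under eq_integral do rewrite /= ger0_norm ?sqr_ge0//.
  by rewrite (EFin_Rint hf.2) i0.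
have := (ae_eq_integral_abs mu measurableT (measurable_int _ hf.2)).1 i2.
by apply: filterS => x /= /(_ Logic.I) [] /eqP; rewrite sqrf_eq0 => /eqP.
Qed.

(** A multi-index spelled out as a word of directions, so that repeated integration by parts is an
    induction on a list. *)
Definition mseq alpha : seq 'I_n := flatten [seq nseq (alpha i) i | i <- enum 'I_n].

Lemma mpartialE alpha f : mpartial alpha f = foldr (@partial R n) f (mseq alpha).
Proof.
rewrite /mpartial /mseq; elim: (enum _) => //= i s ->.
by rewrite foldr_cat; elim: (alpha i) => //= k ->.
Qed.

Lemma size_mseq alpha : size (mseq alpha) = mdeg alpha.
Proof.
rewrite /mseq /mdeg size_flatten /shape -map_comp sumnE big_map enumT.
by apply: eq_bigr => i _ /=; rewrite size_nseq.
Qed.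

Lemma mem_mseq alpha i : (i \in mseq alpha) = (0 < alpha i)%N.
Proof.
apply/flattenP/idP => [[s /mapP[j _ ->]]|ai].
  by rewrite mem_nseq => /andP[? /eqP->].
by exists (nseq (alpha i) i); [apply: map_f; rewrite mem_enum|rewrite mem_nseq eqxx ai].
Qed.

Lemma smooth_foldr f (s : seq 'I_n) : smooth f -> smooth (foldr (@partial R n) f s).
Proof. by move=> hf; elim: s => [|i s IH]; [exact: hf|exact: (smooth_partial i IH)]. Qed.

Lemma IBP_foldr (s : seq 'I_n) f phi : Ccoo f -> Ccoo phi ->
  \int[mu]_x (f x * foldr (@partial R n) phi s x) =
  (-1) ^+ size s * \int[mu]_x (foldr (@partial R n) f (rev s) x * phi x).
Proof.
elim: s f => [f|i s IH f] hf hp; first by rewrite expr0 mul1r.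
rewrite rev_cons -cats1 foldr_cat/= exprS -mulrA -IH//; last exact: Ccoo_partial.
rewrite mulN1r IBP//; first by rewrite opprK.
by apply: smooth_foldr; exact: hp.1.
Qed.

Lemma test_partial Omega i phi : test_function Omega phi -> test_function Omega (partial i phi).
Proof.
move=> tp; have [sp cp pO] := tp.
apply: (test_functionI (smooth_partial i sp) cp pO).
move=> x xK; apply: partial0_near.
have : nbhs x (~` closure [set x | phi x != 0]) by apply: open_nbhs_nbhs; split => //; rewrite openC; exact: closed_closure.
apply: filterS => y yK; apply/eqP/negPn/negP => py; apply: yK; exact: subset_closure.
Qed.

Lemma test_foldr Omega phi (s : seq 'I_n) : test_function Omega phi ->
  test_function Omega (foldr (@partial R n) phi s).
Proof. by move=> tp; elim: s => [|i s IH]; [exact: tp|exact: (test_partial i IH)]. Qed.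

Lemma test_L2f Omega phi : test_function Omega phi -> L2f phi.
Proof. by move=> /test_function_Ccoo/Ccoo_Cc/Cc_L2f. Qed.

Lemma restrict_test Omega phi : test_function Omega phi -> phi \_ Omega = phi.
Proof. by move=> tp; apply: restrict_off => x; exact: test_function_off. Qed.

Lemma is_wpartialE Omega alpha f g : is_wpartial Omega alpha f g <->
  L2f (g \_ Omega) /\ forall phi, test_function Omega phi ->
    \int[mu]_x ((f \_ Omega) x * foldr (@partial R n) phi (mseq alpha) x) =
    (-1) ^+ mdeg alpha * \int[mu]_x ((g \_ Omega) x * phi x).
Proof.
rewrite /is_wpartial in_L2E.
have E phi : (\int[mu]_(x in Omega) (f x * mpartial alpha phi x) =
    (-1) ^+ mdeg alpha * \int[mu]_(x in Omega) (g x * phi x)) =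
  (\int[mu]_x ((f \_ Omega) x * foldr (@partial R n) phi (mseq alpha) x) =
    (-1) ^+ mdeg alpha * \int[mu]_x ((g \_ Omega) x * phi x)).
  by rewrite Rintegral_mkcond [in X in _ * X]Rintegral_mkcond mpartialE !restrictM.
by split=> -[gL H]; split=> // phi tp; have := H phi tp; rewrite E.
Qed.

(* Integration by parts reverses the order of the derivatives, so that their symmetry is not needed. *)
Lemma is_wpartial_test Omega alpha phi : test_function Omega phi ->
  is_wpartial Omega alpha phi (foldr (@partial R n) phi (rev (mseq alpha))).
Proof.
move=> tp; have td := test_foldr (rev (mseq alpha)) tp.
apply/is_wpartialE; rewrite !restrict_test//; split; first exact: test_L2f td.
move=> psi tpsi; rewrite -size_mseq; exact: (IBP_foldr _ (test_function_Ccoo tp) (test_function_Ccoo tpsi)).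
Qed.

Lemma is_wpartial0 Omega alpha f : in_L2 Omega f -> mdeg alpha = 0%N -> is_wpartial Omega alpha f f.
Proof.
move=> /in_L2E hf a0; apply/is_wpartialE; split=> // phi tp.
by have := size_mseq alpha; rewrite a0 => /size0nil ->; rewrite expr0 mul1r.
Qed.

Lemma is_wpartialB Omega alpha f f' g g' : in_L2 Omega f -> in_L2 Omega f' ->
  is_wpartial Omega alpha f g -> is_wpartial Omega alpha f' g' ->
  is_wpartial Omega alpha (f \- f') (fun x => g x - g' x).
Proof.
move=> /in_L2E hf /in_L2E hf' /is_wpartialE[hg H] /is_wpartialE[hg' H']; apply/is_wpartialE.
rewrite !restrictB; split; first exact: L2fB.
move=> phi tp; have hp := test_L2f tp; have hq := test_L2f (test_foldr (mseq alpha) tp).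
under eq_Rintegral do rewrite mulrBl.
rewrite RintB; [|exact: rint_L2M|exact: rint_L2M].
under [in RHS]eq_Rintegral do rewrite mulrBl.
rewrite RintB; [|exact: rint_L2M|exact: rint_L2M].
by rewrite mulrBr H// H'.
Qed.

Definition nrm_cvg (h : nat -> V -> R) g :=
  forall e : R, 0 < e -> exists N, forall k, (N <= k)%N -> nrm (fun x => h k x - g x) <= e.

Lemma Rint_nrm_cvg (h : nat -> V -> R) g phi : (forall k, L2f (h k)) -> L2f g -> L2f phi -> nrm_cvg h g ->
  (fun k => \int[mu]_x (h k x * phi x)) @ \oo --> \int[mu]_x (g x * phi x).
Proof.
move=> hh hg hp hc; apply: cvg_eps => e e0.
have p0 : 0 < nrm phi + 1 by rewrite ltr_wpDl ?nrm_ge0.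
have [N hN] := hc _ (divr_gt0 e0 p0); exists N => k Nk.
rewrite distrC -RintB; [|exact: rint_L2M|exact: rint_L2M].
rewrite (eq_Rintegral mu (g := fun x => (h k x - g x) * phi x)); last by move=> x _; rewrite mulrBl.
apply: le_trans (L2f_CS (L2fB (hh k) hg) hp) _.
apply: (@le_trans _ _ (e / (nrm phi + 1) * (nrm phi + 1))); last by rewrite divfK ?gt_eqF.
by apply: ler_pM; rewrite ?nrm_ge0 ?hN// lerDl.
Qed.

Lemma is_wpartial_lim Omega alpha (h h' : nat -> V -> R) f g :
  (forall k, L2f (h k \_ Omega)) -> L2f (f \_ Omega) -> L2f (g \_ Omega) ->
  (forall k, is_wpartial Omega alpha (h k) (h' k)) ->
  nrm_cvg (fun k => h k \_ Omega) (f \_ Omega) -> nrm_cvg (fun k => h' k \_ Omega) (g \_ Omega) ->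
  is_wpartial Omega alpha f g.
Proof.
move=> hh hf hg hw c1 c2; apply/is_wpartialE; split=> // phi tp.
have hw2 k := (is_wpartialE Omega alpha (h k) (h' k)).1 (hw k).
have l1 := Rint_nrm_cvg hh hf (test_L2f (test_foldr (mseq alpha) tp)) c1.
have l2 := Rint_nrm_cvg (fun k => (hw2 k).1) hg (test_L2f tp) c2.
have l3 : (fun k => (-1) ^+ mdeg alpha * \int[mu]_x ((h' k \_ Omega) x * phi x)) @ \oo -->
    (-1) ^+ mdeg alpha * \int[mu]_x ((g \_ Omega) x * phi x).
  by apply: cvgM; [exact: cvg_cst|exact: l2].
rewrite (_ : (fun k => _) = fun k => \int[mu]_x ((h k \_ Omega) x * foldr (@partial R n) phi (mseq alpha) x)) in l3.
  exact: (cvg_unique (@Rhausdorff R) l1 l3).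
by apply/funext => k; rewrite (hw2 k).2.
Qed.

Lemma L2f_rint Omega f : measurable Omega -> (mu Omega < +oo)%E -> L2f f ->
  (forall x, ~ Omega x -> f x = 0) -> rint mu f.
Proof.
move=> mO fO [mf rf] f0.
have r1 : rint mu (\1_Omega : V -> R).
  apply: (rint_bounded (A := Omega) (C := 1)) => //= x; rewrite indicE; first by case: (x \in _); rewrite ?normr1 ?normr0.
  by move=> nx; rewrite memNset.
apply: (rint_le mf _ (rintD rf r1)) => x; rewrite indicE.
case: (pselect (Omega x)) => [Ox|nOx]; last by rewrite f0// normr0 addr_ge0 ?sqr_ge0.
by rewrite mem_set//= -[f x ^+ 2]real_normK ?num_real//; move: `|f x| => t; nra.
Qed.

(** Two candidates have the same pairings with all test functions. Finite volume makes their
    difference integrable, so that [test_separate] applies. *)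
Lemma is_wpartial_unique Omega alpha f g g' : open Omega -> measurable Omega -> (mu Omega < +oo)%E ->
  is_wpartial Omega alpha f g -> is_wpartial Omega alpha f g' ->
  {ae mu, forall x, (g \_ Omega) x = (g' \_ Omega) x}.
Proof.
move=> oO mO fO /is_wpartialE[hg H] /is_wpartialE[hg' H'].
have off (h : V -> R) x : ~ Omega x -> (h \_ Omega) x = 0.
  by move=> nx; rewrite patchE memNset.
have d0 x : ~ Omega x -> (g \_ Omega) x - (g' \_ Omega) x = 0 by move=> nx; rewrite !off// subr0.
have := test_separate oO (L2f_rint mO fO (L2fB hg hg') d0) d0 _.
move=> /(_ _)/wrap[]; last by apply: filterS => x /eqP; rewrite subr_eq0 => /eqP.
move=> phi tp; have hp := test_L2f tp.
under eq_Rintegral do rewrite mulrBl.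
rewrite RintB; [|exact: rint_L2M|exact: rint_L2M].
have := H phi tp; rewrite H'// => /(mulfI _) ->; first by rewrite subrr.
by rewrite signr_eq0.
Qed.

Lemma wpartialP Omega alpha f g : is_wpartial Omega alpha f g ->
  is_wpartial Omega alpha f (wpartial Omega alpha f).
Proof. by move=> w; have := @xgetPex _ (cst 0) [set g | is_wpartial Omega alpha f g]; apply; exists g. Qed.

Lemma wpartial_ae Omega alpha f g : open Omega -> measurable Omega -> (mu Omega < +oo)%E ->
  is_wpartial Omega alpha f g ->
  {ae mu, forall x, (wpartial Omega alpha f \_ Omega) x = (g \_ Omega) x}.
Proof. by move=> oO mO fO w; apply: is_wpartial_unique (wpartialP w) w. Qed.

Lemma L2norm_wpartial Omega alpha f g : open Omega -> measurable Omega -> (mu Omega < +oo)%E ->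
  is_wpartial Omega alpha f g -> L2norm Omega (wpartial Omega alpha f) = nrm (g \_ Omega).
Proof.
move=> oO mO fO w; have w' := wpartialP w.
have [[h _] [h' _]] := ((is_wpartialE _ _ _ _).1 w, (is_wpartialE _ _ _ _).1 w').
by rewrite L2normE//; apply: ae_nrm => //; exact: wpartial_ae w.
Qed.

End weak.

(** * Limits of test functions in Sobolev spaces *)

Section sobolev_limits.
Variables (R : realType) (n : nat).
Local Notation V := 'rV[R]_n.
Local Notation mu := (lebesgueV R n).
Implicit Types (x y z : V) (f g h phi : V -> R) (Omega : set V) (alpha : 'I_n -> nat).

Lemma L2norm_ge0 Omega f : 0 <= L2norm Omega f.
Proof. by rewrite /L2norm fine_ge0// Lnorm_ge0. Qed.

Definition multi_index_count k : R :=
  \sum_(alpha : {ffun 'I_n -> 'I_k.+1} | mdeg (fun i => alpha i) == k) 1.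

Lemma multi_index_count_ge0 k : 0 <= multi_index_count k.
Proof. by apply: sumr_ge0. Qed.

Lemma Hseminorm_sqr_le k Omega f (B : R) : 0 <= B ->
  (forall alpha, mdeg alpha = k -> L2norm Omega (wpartial Omega alpha f) <= B) ->
  Hseminorm k Omega f ^+ 2 <= multi_index_count k * B ^+ 2.
Proof.
move=> B0 H; rewrite sqr_sqrtr; last by apply: sumr_ge0 => alpha _; exact: sqr_ge0.
rewrite mulr_suml; apply: ler_sum => alpha /eqP ak.
by rewrite mul1r lerXn2r ?nnegrE ?L2norm_ge0// H.
Qed.

Lemma Hseminorm_ge k Omega f (alpha : {ffun 'I_n -> 'I_k.+1}) : mdeg (fun i => alpha i) = k ->
  L2norm Omega (wpartial Omega (fun i => alpha i) f) <= Hseminorm k Omega f.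
Proof.
move=> ak; rewrite -[leLHS]ger0_norm ?L2norm_ge0// -sqrtr_sqr ler_sqrt.
  rewrite (bigD1 alpha) ?ak//= lerDl; apply: sumr_ge0 => *; exact: sqr_ge0.
by apply: sumr_ge0 => *; exact: sqr_ge0.
Qed.

Lemma Hnorm_le m Omega f (B : R) : 0 <= B ->
  (forall alpha, (mdeg alpha <= m)%N -> L2norm Omega (wpartial Omega alpha f) <= B) ->
  Hnorm m Omega f <= Num.sqrt (\sum_(k < m.+1) multi_index_count k) * B.
Proof.
move=> B0 H; rewrite -[X in _ * X]ger0_norm// -sqrtr_sqr -sqrtrM; last first.
  by apply: sumr_ge0 => *; exact: multi_index_count_ge0.
rewrite /Hnorm ler_wsqrtr// mulr_suml; apply: ler_sum => k _.
by apply: Hseminorm_sqr_le => // alpha ak; apply: H; rewrite ak -ltnS.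
Qed.

Lemma Hnorm_ge m Omega f (k : 'I_m.+1) : Hseminorm k Omega f <= Hnorm m Omega f.
Proof.
rewrite -[leLHS]ger0_norm ?sqrtr_ge0// -sqrtr_sqr ler_wsqrtr// (bigD1 k)//= lerDl.
by apply: sumr_ge0 => *; exact: sqr_ge0.
Qed.

Lemma HseminormV_le k Omega (u : V -> V) (B : R) : 0 <= B ->
  (forall i alpha, mdeg alpha = k -> L2norm Omega (wpartial Omega alpha (component u i)) <= B) ->
  HseminormV k Omega u <= Num.sqrt (n%:R * multi_index_count k) * B.
Proof.
move=> B0 H; rewrite -[X in _ * X]ger0_norm// -sqrtr_sqr -sqrtrM; last first.
  by rewrite mulr_ge0 ?multi_index_count_ge0.
rewrite /HseminormV ler_wsqrtr// (@le_trans _ _ (\sum_(i < n) (multi_index_count k * B ^+ 2)))//.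
  by apply: ler_sum => i _; apply: Hseminorm_sqr_le => // alpha ak; exact: H.
by rewrite sumr_const card_ord -mulrA mulr_natl.
Qed.

Definition nrm_cauchy (h : nat -> V -> R) := forall e : R, 0 < e ->
  exists N, forall k l, (N <= k)%N -> (N <= l)%N -> nrm (fun x => h k x - h l x) <= e.

Lemma nrm_cvg_cauchy (h : nat -> V -> R) g : (forall k, L2f (h k)) -> L2f g ->
  nrm_cvg h g -> nrm_cauchy h.
Proof.
move=> hh hg hc e e0; have [|N hN] := hc (e / 2); first by rewrite divr_gt0.
exists N => k l Nk Nl; apply: le_trans (L2nrm_tri (hh k) hg (hh l)) _.
have := hN k Nk; have := hN l Nl; rewrite [in X in X -> _]nrm_subC; lra.
Qed.

Lemma nrm_cauchy_le (h h' : nat -> V -> R) (K : R) : 0 <= K ->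
  (forall k l, nrm (fun x => h k x - h l x) <= K * nrm (fun x => h' k x - h' l x)) ->
  nrm_cauchy h' -> nrm_cauchy h.
Proof.
move=> K0 H hc e e0; have K1 : 0 < K + 1 by rewrite ltr_wpDl.
have [N hN] := hc _ (divr_gt0 e0 K1); exists N => k l Nk Nl.
apply: le_trans (H k l) _; apply: (@le_trans _ _ ((K + 1) * (e / (K + 1)))).
  by apply: ler_pM; rewrite ?nrm_ge0 ?hN// lerDl.
by rewrite mulrC divfK ?gt_eqF.
Qed.

(* [G s] stands for the [L^2] limit of the derivatives along the directions in [s]. *)
Definition test_limit Omega m (v : nat -> V -> R) (G : seq 'I_n -> V -> R) :=
  [/\ forall k, test_function Omega (v k), forall s, (size s <= m)%N -> L2f (G s),
      forall s, (size s <= m)%N -> G s \_ Omega = G s &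
      forall s, (size s <= m)%N -> nrm_cvg (fun k => foldr (@partial R n) (v k) s) (G s)].

Lemma cauchy_test_limit Omega m v : measurable Omega -> (forall k, test_function Omega (v k)) ->
  (forall s, (size s <= m)%N -> nrm_cauchy (fun k => foldr (@partial R n) (v k) s)) ->
  exists G, test_limit Omega m v G.
Proof.
move=> mO tv hc.
have /choice[G hG] : forall s, exists g : V -> R, (size s <= m)%N ->
    [/\ L2f g, g \_ Omega = g & nrm_cvg (fun k => foldr (@partial R n) (v k) s) g].
  move=> s; have [sm|sm] := leqP (size s) m; last by exists (cst 0).
  have tvs k := test_foldr s (tv k).
  have [g hg gc] := L2_complete (fun k => test_L2f (tvs k)) (hc s sm).
  (* Test functions vanish off [Omega], so cutting the limit off there does not increase its
     distance to them. *)
  exists (g \_ Omega) => _; split; [exact: L2f_restrict|exact: restrict_idem|].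
  move=> e e0; have [N hN] := gc e e0; exists N => k Nk; apply: le_trans (hN k Nk).
  apply: nrm_le; [exact: L2fB (test_L2f (tvs k)) (L2f_restrict mO hg)|exact: L2fB (test_L2f (tvs k)) hg|].
  move=> x; rewrite patchE; case: ifPn => // /negP nx; rewrite (test_function_off (tvs k)) ?subrr ?normr0//.
  by move=> Ox; apply: nx; exact/mem_set.
by exists G; split=> // s /hG[].
Qed.

Lemma test_limit_wpartial Omega m v G alpha : test_limit Omega m v G -> (mdeg alpha <= m)%N ->
  is_wpartial Omega alpha (G [::]) (G (rev (mseq alpha))).
Proof.
move=> [tv hG GO Gc] am.
have sm : (size (rev (mseq alpha)) <= m)%N by rewrite size_rev size_mseq.
apply: (is_wpartial_lim (h := v) (h' := fun k => foldr (@partial R n) (v k) (rev (mseq alpha)))).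
- by move=> k; rewrite restrict_test//; exact: test_L2f.
- by rewrite GO//; exact: hG.
- by rewrite GO//; exact: hG.
- by move=> k; exact: is_wpartial_test.
- rewrite GO// (_ : (fun k => _) = v); first exact: (Gc [::]).
  by apply/funext => k; rewrite restrict_test.
- rewrite GO// (_ : (fun k => _) = fun k => foldr (@partial R n) (v k) (rev (mseq alpha))); first exact: Gc.
  by apply/funext => k; rewrite restrict_test//; exact: test_foldr.
Qed.

Lemma finite_nrm_cvg (J : finType) (h : J -> nat -> V -> R) (g : J -> V -> R) (P : pred J) :
  (forall j, P j -> nrm_cvg (h j) (g j)) ->
  forall e : R, 0 < e -> exists N, forall j k, P j -> (N <= k)%N -> nrm (fun x => h j k x - g j x) <= e.
Proof.
move=> H e e0.
have /choice[N hN] : forall j, exists N, P j -> forall k, (N <= k)%N -> nrm (fun x => h j k x - g j x) <= e.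
  move=> j; have [Pj|_] := boolP (P j); last by exists 0%N.
  by have [N hN] := H j Pj e e0; exists N.
exists (\max_j N j)%N => j k Pj Nk; apply: hN => //; apply: leq_trans Nk; exact: leq_bigmax.
Qed.

Lemma test_limit_in_H0 Omega m v G : open Omega -> measurable Omega -> (mu Omega < +oo)%E ->
  test_limit Omega m v G -> in_H0 m Omega (G [::]).
Proof.
move=> oO mO fO TL; have [tv hG GO Gc] := TL.
have L2u : in_L2 Omega (G [::]) by apply/in_L2E; rewrite GO//; exact: hG.
split.
  by split=> // alpha am; exists (G (rev (mseq alpha))); exact: test_limit_wpartial TL am.
move=> e e0; pose K : R := Num.sqrt (\sum_(k < m.+1) multi_index_count k).
have K0 : 0 < K + 1 by rewrite ltr_wpDl// sqrtr_ge0.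
(* The words of length at most [m] are put in a finite type, to obtain one rank of approximation
   valid for all of them. *)
have Hs (p : {k : 'I_m.+1 & k.-tuple 'I_n}) : (size (tagged p) <= m)%N by rewrite size_tuple -ltnS.
have [N hN] := @finite_nrm_cvg {k : 'I_m.+1 & k.-tuple 'I_n}
  (fun p k => foldr (@partial R n) (v k) (tagged p)) (fun p => G (tagged p)) xpredT
  (fun p _ => Gc _ (Hs p)) _ (divr_gt0 e0 K0).
exists (v N) => //.
apply: le_lt_trans (Hnorm_le (B := e / (K + 1)) _ _) _; first by rewrite divr_ge0// ltW.
  move=> alpha am; have tN := test_foldr (rev (mseq alpha)) (tv N).
  have sm : (size (rev (mseq alpha)) <= m)%N by rewrite size_rev size_mseq.
  have w := is_wpartialB L2u ((in_L2E Omega (v N)).2 _) (test_limit_wpartial TL am) (is_wpartial_test alpha (tv N)).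
  rewrite (L2norm_wpartial oO mO fO (w _)); last by rewrite restrict_test//; exact: test_L2f.
  rewrite restrictB GO// (restrict_test tN) nrm_subC.
  have sm' : (size (rev (mseq alpha)) < m.+1)%N by [].
  exact: (hN (Tagged (fun k : 'I_m.+1 => k.-tuple 'I_n) (in_tuple (rev (mseq alpha)) : (Ordinal sm').-tuple 'I_n)) N isT (leqnn N)).
rewrite -/K mulrCA gtr_pMr// ltr_pdivrMr// mul1r ltrDl//.
Qed.

Definition unit_index (j : 'I_n) : 'I_n -> nat := fun i => nat_of_bool (i == j).

Lemma mdeg_unit_index j : mdeg (unit_index j) = 1%N.
Proof. by rewrite /mdeg (bigD1 j)//= big1 /unit_index ?eqxx// => i /negbTE ->. Qed.

Lemma mseq_unit_index j : mseq (unit_index j) = [:: j].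
Proof.
have := size_mseq (unit_index j); have := mem_mseq (unit_index j) j.
rewrite mdeg_unit_index /unit_index eqxx; case: (mseq _) => [//|i [|//]].
by rewrite inE => /eqP ->.
Qed.

Lemma L2norm_unit_index_le Omega f j :
  L2norm Omega (wpartial Omega (unit_index j) f) <= Hseminorm 1 Omega f.
Proof.
have E : (fun i => [ffun i : 'I_n => inord (i == j) : 'I_2] i : nat) = unit_index j.
  by apply/funext => i; rewrite ffunE /unit_index; case: (i == j); rewrite inordK.
rewrite -E; apply: Hseminorm_ge; rewrite E; exact: mdeg_unit_index.
Qed.

Lemma H01_approx Omega f : open Omega -> measurable Omega -> (mu Omega < +oo)%E -> in_H0 1 Omega f ->
  forall e : R, 0 < e -> exists phi, [/\ test_function Omega phi,
    nrm (fun x => phi x - (f \_ Omega) x) <= e &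
    forall j, nrm (fun x => partial j phi x - (wpartial Omega (unit_index j) f \_ Omega) x) <= e].
Proof.
move=> oO mO fO [[f2 fH] H] e e0; have [phi tp he] := H e e0; exists phi.
have p2 : in_L2 Omega phi by apply/in_L2E; rewrite restrict_test//; exact: test_L2f tp.
split=> // [|j].
  rewrite -(restrict_test tp) nrm_subC -restrictB.
  have w := is_wpartial0 (alpha := fun=> 0%N) ((in_L2E Omega (f \- phi)).2 _) _.
  rewrite -(L2norm_wpartial oO mO fO (w _ _)); last 2 first.
  - by rewrite restrictB; apply: L2fB; exact/in_L2E.
  - by rewrite /mdeg big1.
  apply: le_trans (ltW he); apply: le_trans (Hnorm_ge _ _ (ord0 : 'I_2)).
  have E : (fun i => [ffun i : 'I_n => ord0 : 'I_1] i : nat) = fun=> 0%N by apply/funext => i; rewrite ffunE.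
  by rewrite -E; apply: Hseminorm_ge; rewrite E /mdeg big1.
have [g wg] := fH (unit_index j) ltac:(by rewrite mdeg_unit_index).
have w := is_wpartialB f2 p2 (wpartialP wg) (is_wpartial_test (unit_index j) tp).
have tj := test_foldr (rev (mseq (unit_index j))) tp.
have := L2norm_wpartial oO mO fO w; rewrite restrictB (restrict_test tj) mseq_unit_index/= nrm_subC => <-.
apply: le_trans (L2norm_unit_index_le _ _ _) _; apply: le_trans (ltW he).
exact: (Hnorm_ge _ _ (lift ord0 ord0 : 'I_2)).
Qed.

(* From [\int v ^ 2 = - 2 \int x_i v (partial i v)]. *)
Lemma poincare Omega (M : R) i v : 0 <= M -> (forall x, Omega x -> `|x ord0 i| <= M) ->
  test_function Omega v -> nrm v <= 2 * M * nrm (partial i v).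
Proof.
move=> M0 hM tv; have tp := test_partial i tv; have cv := test_function_Ccoo tv.
have tx : test_function Omega (fun x => v x * x ord0 i) by apply: test_functionM; [|exact: smooth_coord].
have [hv hp hx] := And3 (test_L2f tv) (test_L2f tp) (test_L2f tx).
have := IBP i cv (test_function_Ccoo tx).1.
have [->|v0] := eqVneq (nrm v) 0; first by move=> _; rewrite !mulr_ge0 ?nrm_ge0.
have r1 : rint mu (fun x => v x ^+ 2) by exact: hv.2.
have r2 := rint_L2M hp hx.
rewrite (_ : (fun x => v x * partial i (fun x => v x * x ord0 i) x) = fun x => v x ^+ 2 + partial i v x * (v x * x ord0 i)); last first.
  apply/funext => x; rewrite partialM; [|exact: cv.1|exact: smooth_coord].
  by rewrite partial_coord eqxx mulr1; ring.
rewrite RintD// -nrm_sqr => E.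
have E2 : nrm v ^+ 2 = - 2 * \int[mu]_x (partial i v x * (v x * x ord0 i)) by lra.
have E3 : nrm (fun x => v x * x ord0 i) <= M * nrm v.
  rewrite -[M]ger0_norm// -(L2nrmZ M hv); apply: nrm_le => //; first exact: L2fZ.
  move=> x; rewrite !normrM mulrC; case: (pselect (Omega x)) => Ox.
    by rewrite ler_wpM2r// (ger0_norm M0) hM.
  by rewrite (test_function_off tv Ox) normr0 !mulr0.
have E4 := le_trans (ler_norm _) (L2f_CS (L2fZ (-1) hp) hx).
move: E4; rewrite L2nrmZ// normrN1 mul1r => E4.
have E5 : \int[mu]_x (-1 * partial i v x * (v x * x ord0 i)) = - \int[mu]_x (partial i v x * (v x * x ord0 i)).
  by rewrite -[RHS]mulN1r -RintZ//; apply: eq_Rintegral => x _; rewrite mulrA.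
rewrite E5 in E4.
have v1 : 0 < nrm v by rewrite lt_neqAle eq_sym v0 nrm_ge0.
rewrite -(ler_pM2l v1) -expr2 E2.
have := ler_wpM2l (nrm_ge0 (partial i v)) E3; nra.
Qed.

End sobolev_limits.

Section convergence.
Variables (R : realType) (n : nat).
Local Notation V := 'rV[R]_n.
Local Notation mu := (lebesgueV R n).
Implicit Types (x y z : V) (f g : V -> R) (Omega : set V).

Lemma nrm_cvg_harmonic (h : nat -> V -> R) g (K : R) : 0 <= K ->
  (forall k, nrm (fun x => h k x - g x) <= K * k.+1%:R^-1) -> nrm_cvg h g.
Proof.
move=> K0 H e e0; have [N hN] : exists N, K / e < N%:R.
  by exists (Num.Def.archi_bound (K / e)); apply: archi_boundP; rewrite divr_ge0// ltW.
exists N => k Nk; apply: le_trans (H k) _; rewrite ler_pdivrMr//.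
rewrite -ler_pdivrMl// mulrC (le_trans (ltW hN))// ler_nat; exact: leqW.
Qed.

Lemma nrm_cvgD (h h' : nat -> V -> R) g g' : (forall k, L2f (h k)) -> (forall k, L2f (h' k)) ->
  L2f g -> L2f g' -> nrm_cvg h g -> nrm_cvg h' g' ->
  nrm_cvg (fun k x => h k x + h' k x) (fun x => g x + g' x).
Proof.
move=> hh hh' hg hg' hc hc' e e0.
have [|N hN] := hc (e / 2); first by rewrite divr_gt0.
have [|N' hN'] := hc' (e / 2); first by rewrite divr_gt0.
exists (maxn N N') => k; rewrite geq_max => /andP[Nk Nk'].
have := L2nrmD (L2fB (hh k) hg) (L2fB (hh' k) hg').
rewrite (_ : (fun x => h k x - g x + (h' k x - g' x)) = fun x => h k x + h' k x - (g x + g' x)); last first.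
  by apply/funext => x; rewrite opprD addrACA.
by have := hN k Nk; have := hN' k Nk'; lra.
Qed.

Lemma L2f0 : L2f (fun _ : V => 0 : R).
Proof. by apply: Cc_L2f; exact: Cc0. Qed.

Lemma L2f_sum (J : Type) (s : seq J) (g : J -> V -> R) : (forall j, L2f (g j)) ->
  L2f (fun x => \sum_(j <- s) g j x).
Proof.
move=> hg; elim: s => [|j s IH].
  by rewrite (_ : (fun x => _) = fun=> 0); [exact: L2f0|apply/funext => x; rewrite big_nil].
rewrite (_ : (fun x => _) = fun x => g j x + \sum_(j <- s) g j x); first exact: L2fD.
by apply/funext => x; rewrite big_cons.
Qed.

Lemma nrm0 : nrm (fun _ : V => 0 : R) = 0.
Proof.
by rewrite /nrm -[RHS](sqrtr0 R) -[in RHS](Rintegral_zero mu); congr Num.sqrt; apply: eq_Rintegral => x _; rewrite expr0n.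
Qed.

Lemma nrm_cvg_sum (J : Type) (s : seq J) (h : J -> nat -> V -> R) (g : J -> V -> R) :
  (forall j k, L2f (h j k)) -> (forall j, L2f (g j)) -> (forall j, nrm_cvg (h j) (g j)) ->
  nrm_cvg (fun k x => \sum_(j <- s) h j k x) (fun x => \sum_(j <- s) g j x).
Proof.
move=> hh hg hc; elim: s => [|j s IH].
  move=> e e0; exists 0%N => k _; rewrite (_ : (fun x => _) = fun=> 0) ?nrm0 ?ltW//.
  by apply/funext => x; rewrite !big_nil subrr.
rewrite (_ : (fun x => _) = fun x => g j x + \sum_(j <- s) g j x); last by apply/funext => x; rewrite big_cons.
rewrite (_ : (fun k => _) = fun k x => h j k x + \sum_(j <- s) h j k x); last first.
  by apply/funext => k; apply/funext => x; rewrite big_cons.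
by apply: nrm_cvgD => // [k|]; exact: L2f_sum.
Qed.

Lemma nrm_cvg_unique (h : nat -> V -> R) g g' : (forall k, L2f (h k)) -> L2f g -> L2f g' ->
  nrm_cvg h g -> nrm_cvg h g' -> {ae mu, forall x, g x = g' x}.
Proof.
move=> hh hg hg' hc hc'.
have g0 : nrm (fun x => g x - g' x) = 0.
  apply/eqP; rewrite eq_le nrm_ge0 andbT; apply/ler_addgt0Pr => e e0; rewrite add0r.
  have [|N hN] := hc (e / 2); first by rewrite divr_gt0.
  have [|N' hN'] := hc' (e / 2); first by rewrite divr_gt0.
  apply: le_trans (L2nrm_tri hg (hh (maxn N N')) hg') _; rewrite [X in X + _]nrm_subC.
  by have := hN _ (leq_maxl N N'); have := hN' _ (leq_maxr N N'); lra.
by apply: filterS (nrm_eq0 (L2fB hg hg') g0) => x /eqP; rewrite subr_eq0 => /eqP.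
Qed.

Lemma ae_forall_ord (P : 'I_n -> V -> Prop) : (forall i, {ae mu, forall x, P i x}) ->
  {ae mu, forall x i, P i x}.
Proof.
move=> H; have : {ae mu, forall x k, forall kn : (k < n)%N, P (Ordinal kn) x}.
  apply: ae_foralln => k; case: (pselect (is_true (k < n)%N)) => kn; last exact: filterE.
  by apply: filterS (H (Ordinal kn)) => x Px kn'; rewrite (_ : Ordinal kn' = Ordinal kn)//; exact: val_inj.
apply: filterS => x Hx i; have := Hx i (ltn_ord i).
by rewrite (_ : Ordinal (ltn_ord i) = i)//; exact: val_inj.
Qed.

Lemma Rint_L2_le Omega f : measurable Omega -> (mu Omega < +oo)%E -> L2f f ->
  (forall x, ~ Omega x -> f x = 0) ->
  `|\int[mu]_x f x| <= nrm (\1_Omega : V -> R) * nrm f.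
Proof.
move=> mO fO hf f0.
have h1 : L2f (\1_Omega : V -> R).
  split; first exact: measurable_indic.
  apply: (rint_bounded (A := Omega) (C := 1)) => //=.
  - exact: measurable_funX.
  - by move=> x; rewrite indicE; case: (x \in _); rewrite ?expr0n ?expr1n ?normr1 ?normr0.
  - by move=> x nx; rewrite indicE memNset// expr0n.
rewrite (eq_Rintegral mu (g := fun x => \1_Omega x * f x)); first exact: L2f_CS.
move=> x _; rewrite indicE; case: (pselect (Omega x)) => Ox; first by rewrite mem_set// mul1r.
by rewrite f0// mulr0.
Qed.

End convergence.

(** * Existence of the solution *)

Section existence.
Local Opaque cv nrm L1 E bogovskii partial solve.
Variables (R : realType) (n : nat).
Local Notation V := 'rV[R]_n.
Local Notation mu := (lebesgueV R n).
Implicit Types (x y z : V) (f g : V -> R) (Omega : set V).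

Lemma shift_kernel_test Omega a (rho r : R) w : 0 < rho -> 0 <= r -> r * n.+1%:R < rho -> Ccoo w ->
  (forall z, w z != 0 -> `|z| <= r) -> eball a rho `<=` Omega ->
  test_function Omega (shift_fun (- a) w).
Proof.
move=> rho0 r0 rrho hw wr BO.
apply: (@test_functionI _ _ _ [set x : V | forall i, `|x ord0 i - a ord0 i| <= r]).
- exact: (Ccoo_shift (- a) hw).1.
- exact: compact_box.
- move=> x Bx; apply: BO; rewrite /eball /=; apply: enorm_lt => //; apply: le_lt_trans rrho.
  rewrite ler_wpM2r//.
  by apply: rV_norm_le => // k; have := Bx k; rewrite !mxE.
- move=> x Bx; rewrite shift_funE; apply/eqP; apply: contrapT => /negP wx; apply: Bx => i.
  by apply: le_trans (wr _ wx); have := rV_coord_le (x - a) i; rewrite !mxE.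
Qed.

(** Since [F] has mean zero, the mean of [phi k] is at most [nrm (\1_Omega)] times the distance from
    [phi k] to [F]. The correction is thus of order [1 / (k + 1)], as are its derivatives, which
    only see the fixed function [W]. *)
Lemma solve_correction Omega W (F : V -> R) (phi : nat -> V -> R) :
  measurable Omega -> (mu Omega < +oo)%E -> test_function Omega W -> \int[mu]_x W x = 1 ->
  L2f F -> (forall x, ~ Omega x -> F x = 0) -> \int[mu]_x F x = 0 ->
  (forall k, test_function Omega (phi k)) ->
  (forall k, nrm (fun x => phi k x - F x) <= k.+1%:R^-1) ->
  let f k x := phi k x - (\int[mu]_x phi k x) * W x in
  [/\ forall k, test_function Omega (f k), forall k, \int[mu]_x f k x = 0, nrm_cvg f F &
   forall j g, L2f g -> (forall k, nrm (fun x => partial j (phi k) x - g x) <= k.+1%:R^-1) ->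
     nrm_cvg (fun k => partial j (f k)) g].
Proof.
move=> mO fO tW iW hF F0 iF tphi hphi f.
have rphi k : rint mu (phi k) := Cc_rint (Ccoo_Cc (test_function_Ccoo (tphi k))).
have rW : rint mu W := Cc_rint (Ccoo_Cc (test_function_Ccoo tW)).
pose K := nrm (\1_Omega : V -> R); have K0 : 0 <= K := nrm_ge0 _.
have mle k : `|\int[mu]_x phi k x| <= K * k.+1%:R^-1.
  have rF := L2f_rint mO fO hF F0.
  have -> : \int[mu]_x phi k x = \int[mu]_x (phi k x - F x) by rewrite RintB// iF subr0.
  apply: le_trans (ler_wpM2l K0 (hphi k)); apply: Rint_L2_le => //; first exact: L2fB (test_L2f (tphi k)) hF.
  by move=> x nx; rewrite F0// (test_function_off (tphi k) nx) subrr.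
have gen (p : nat -> V -> R) (g W' : V -> R) : (forall k, L2f (p k)) -> L2f g -> L2f W' ->
    (forall k, nrm (fun x => p k x - g x) <= k.+1%:R^-1) ->
    nrm_cvg (fun k x => p k x - (\int[mu]_x phi k x) * W' x) g.
  move=> hp hg hW' pg; apply: (@nrm_cvg_harmonic _ _ _ _ (1 + K * nrm W')).
    by rewrite addr_ge0// mulr_ge0// nrm_ge0.
  move=> k; rewrite (_ : (fun x => _) = fun x => (p k x - g x) - (\int[mu]_x phi k x) * W' x); last first.
    by apply/funext => x; rewrite addrAC.
  apply: le_trans (L2nrmB (L2fB (hp k) hg) (L2fZ _ hW')) _; rewrite L2nrmZ// mulrDl mul1r lerD//.
  by rewrite mulrAC ler_wpM2r ?nrm_ge0.
split.
- by move=> k; apply: test_functionB => //; exact: test_functionZ.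
- by move=> k; rewrite RintB//; [rewrite RintZ// iW mulr1 subrr|exact: rintZ].
- exact: (gen _ _ _ (fun k => test_L2f (tphi k)) hF (test_L2f tW) hphi).
move=> j g hg pg; rewrite (_ : (fun k => _) = fun k x => partial j (phi k) x - (\int[mu]_x phi k x) * partial j W x).
  exact: (gen _ _ _ (fun k => test_L2f (test_partial j (tphi k))) hg (test_L2f (test_partial j tW)) pg).
have sW := (test_function_Ccoo tW).1.
apply/funext => k; have sp := (test_function_Ccoo (tphi k)).1.
by rewrite /f (partialB j sp (smoothZ _ sW)) (partialZ _ j sW).
Qed.

(** Poincare's inequality in the direction [i0] bounds the derivative along a word [s] by that along
    [i0 :: s]; two applications descend from order two to order zero. *)
Lemma second_order_cauchy Omega (M : R) i0 (v : nat -> V -> R) : 0 <= M ->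
  (forall x, Omega x -> `|x ord0 i0| <= M) -> (forall k, test_function Omega (v k)) ->
  (forall j k, nrm_cauchy (fun l => partial k (partial j (v l)))) ->
  forall s, (size s <= 2)%N -> nrm_cauchy (fun l => foldr (@partial R n) (v l) s).
Proof.
move=> M0 hM tv H.
have P s : nrm_cauchy (fun l => foldr (@partial R n) (v l) (i0 :: s)) ->
    nrm_cauchy (fun l => foldr (@partial R n) (v l) s).
  apply: (nrm_cauchy_le (K := 2 * M)); first by rewrite mulr_ge0.
  move=> k l; have tk := test_foldr s (tv k); have tl := test_foldr s (tv l).
  have := poincare M0 hM (test_functionB tk tl).
  by rewrite (partialB i0 (test_function_Ccoo tk).1 (test_function_Ccoo tl).1).
have P2 s : size s = 2%N -> nrm_cauchy (fun l => foldr (@partial R n) (v l) s).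
  by case: s => [//|k [//|j [|//]]] _; exact: H.
have P1 s : size s = 1%N -> nrm_cauchy (fun l => foldr (@partial R n) (v l) s).
  by move=> s1; apply: P; apply: P2; rewrite /= s1.
move=> s; rewrite leq_eqVlt => /orP[/eqP|]; first exact: P2.
rewrite ltnS leq_eqVlt => /orP[/eqP|]; first exact: P1.
by rewrite ltnS leqn0 => /eqP s0; apply: P; apply: P1; rewrite /= s0.
Qed.

(** Each approximant is solved exactly, so the divergence equation passes to the limit by uniqueness
    of L2 limits, and the estimate by convergence of the norms on both sides. *)
Lemma solution_exists eta (C D rho : R) Omega a f : (2 <= n)%N -> 0 <= C -> Ccoo eta ->
  Ccoo (cv 1 eta eta) -> \int[mu]_x cv 1 eta eta x = 1 ->
  (forall x, cv 1 eta eta x != 0 -> `|x| <= n.+2%:R^-1) ->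
  (forall i j k, bogovskii_estimate eta i j k C) ->
  domain Omega -> ediam Omega = D%:E -> 0 < rho -> star_shaped Omega (eball a rho) ->
  in_H0 1 Omega f -> in_L20 Omega f ->
  exists u : V -> V, [/\ in_H0V 2 Omega u,
    {ae mu, forall x, Omega x -> wdiv Omega u x = f x} &
    HseminormV 2 Omega u <= Num.sqrt (n%:R * multi_index_count R n 2) *
      (C * (D / rho ^+ 2 * loggrowth n (vol Omega / vol (eball a rho)) * L2norm Omega f +
            D / rho * Hseminorm 1 Omega f))].
Proof.
move=> n2 C0 heta hom iom som HC [oO _ neO] dO rho0 star H0f [L2F0 iF].
have BO := star_ball neO star; have Oa := BO _ (center_ball a rho0).
have n0 : (0 < n)%N by apply: leq_trans n2.
pose i0 : 'I_n := Ordinal n0.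
have bO := ediam_bounded dO Oa.
have mO : measurable Omega by rewrite measurable_rV_opens; exact: sub_sigma_algebra.
have fO : (mu Omega < +oo)%E.
  apply: (le_lt_trans _ (nball_fin n (`|a| + D + 1))); apply: le_measure; rewrite ?inE//.
  exact: measurable_nball.
have D0 : 0 <= D by apply: le_trans (radius_le_ediam i0 dO rho0 BO); exact: ltW.
set B1 := D / rho ^+ 2 * _; set B2 := D / rho.
have B10 : 0 <= B1.
  rewrite /B1; apply: mulr_ge0; first by apply: divr_ge0 => //; exact/exprn_ge0/ltW.
  by rewrite /loggrowth addr_ge0// mulr_ge0 ?powR_ge0.
have B20 : 0 <= B2 by apply: divr_ge0 => //; exact: ltW.
pose om := cv 1 eta eta; pose w := dil rho om.
have hw : Ccoo w := Ccoo_dil rho0 hom.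
have iw : \int[mu]_x w x = 1 by rewrite /w Rint_dil//; exact: Ccoo_Cc.
pose r := rho / n.+2%:R; have r0 : 0 <= r by rewrite divr_ge0 ?(ltW rho0).
have rrho : r * n.+1%:R < rho by rewrite /r mulrAC ltr_pdivrMr// ltr_pM2l// ltr_nat.
have wr z : w z != 0 -> `|z| <= r.
  rewrite /w /dil addr0 mulf_eq0 negb_or => /andP[_ /som].
  rewrite normrZ gtr0_norm ?invr_gt0// /r => h.
  by rewrite -ler_pdivrMl.
pose W := shift_fun (- a) w.
have tW : test_function Omega W := shift_kernel_test rho0 r0 rrho hw wr BO.
have iW : \int[mu]_x W x = 1 by rewrite /W Rint_shift//; exact: Cc_rint (Ccoo_Cc hw).
pose F := f \_ Omega; pose gj j := wpartial Omega (unit_index j) f \_ Omega.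
have hF : L2f F := (in_L2E Omega f).1 L2F0.
have F0 x : ~ Omega x -> F x = 0 by move=> nx; rewrite /F patchE memNset.
have iF0 : \int[mu]_x F x = 0 by rewrite /F -Rintegral_mkcond.
have hgj j : L2f (gj j).
  have [g wg] := H0f.1.2 (unit_index j) ltac:(by rewrite mdeg_unit_index).
  exact: ((is_wpartialE _ _ _ _).1 (wpartialP wg)).1.
have /choice[phi hphi] : forall k : nat, exists phi, [/\ test_function Omega phi,
    nrm (fun x => phi x - F x) <= k.+1%:R^-1 &
    forall j, nrm (fun x => partial j phi x - gj j x) <= k.+1%:R^-1].
  by move=> k; apply: H01_approx => //; rewrite invr_gt0.
have tphi k : test_function Omega (phi k) by have [] := hphi k.
have [|] := solve_correction mO fO tW iW hF F0 iF0 tphi.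
  by move=> k; have [] := hphi k.
set fk := fun k x => phi k x - _; move=> tf if0 fF fg.
have {}fg j : nrm_cvg (fun k => partial j (fk k)) (gj j).
  by apply: fg => // k; have [_ _] := hphi k; apply.
have cf k := test_function_Ccoo (tf k).
pose u k i := solve w a i (fk k).
have tu k i : test_function Omega (u k i) by exact: solve_test star hw rho0 r0 rrho wr (tf k).
have su k i := (test_function_Ccoo (tu k i)).1.
have est i j l (h : V -> R) : test_function Omega h ->
    nrm (partial l (partial j (solve w a i h))) <= C * (B1 * nrm h + B2 * nrm (partial j h)).
  by move=> th; exact: solve_bound n2 heta HC rho0 mO fO dO BO th.
have cauf := nrm_cvg_cauchy (fun k => test_L2f (tf k)) hF fF.
have caug j := nrm_cvg_cauchy (fun k => test_L2f (test_partial j (tf k))) (hgj j) (fg j).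
(* [solve] is linear, so the difference of two approximate solutions solves for the difference of
   the data, and the same estimate applies to it. *)
have cau2 i j l : nrm_cauchy (fun k => partial l (partial j (u k i))).
  move=> e e0; pose K := C * (B1 + B2) + 1.
  have K0 : 0 < K by rewrite ltr_wpDl// mulr_ge0// addr_ge0.
  have [N1 hN1] := cauf _ (divr_gt0 e0 K0); have [N2 hN2] := caug j _ (divr_gt0 e0 K0).
  exists (maxn N1 N2) => k m; rewrite !geq_max => /andP[k1 k2] /andP[m1 m2].
  have -> : (fun x => partial l (partial j (u k i)) x - partial l (partial j (u m i)) x) =
      partial l (partial j (solve w a i (fun x => fk k x - fk m x))).
    rewrite (solveB a i hw (cf k) (cf m)) (partialB j (su k i) (su m i)).
    by rewrite (partialB l (smooth_partial j (su k i)) (smooth_partial j (su m i))).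
  apply: le_trans (est i j l _ (test_functionB (tf k) (tf m))) _.
  rewrite (partialB j (cf k).1 (cf m).1).
  apply: (@le_trans _ _ (C * (B1 * (e / K) + B2 * (e / K)))).
    exact: (ler_wpM2l C0 (lerD (ler_wpM2l B10 (hN1 k m k1 m1)) (ler_wpM2l B20 (hN2 k m k2 m2)))).
  rewrite -mulrDl mulrA mulrCA ler_piMr ?(ltW e0)// ler_pdivrMr// mul1r /K lerDl//.
have hM x : Omega x -> `|x ord0 i0| <= `|a| + D + 1.
  by move=> Ox; apply: le_trans (ltW (bO x Ox)); exact: rV_coord_le.
have M0 : 0 <= `|a| + D + 1 by rewrite !addr_ge0.
have /choice[G hG] : forall i, exists G, test_limit Omega 2 (fun k => u k i) G.
  move=> i; apply: cauchy_test_limit => // s s2.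
  exact: second_order_cauchy M0 hM (fun k => tu k i) (fun j l => cau2 i j l) s s2.
pose U x : V := \row_i G i [::] x.
have compU i : component U i = G i [::] by apply/funext => x; rewrite /component mxE.
exists U; split.
- by move=> i; rewrite compU; exact: test_limit_in_H0 oO mO fO (hG i).
- have hGi i : L2f (G i [:: i]) by have [_ h _ _] := hG i; exact: h.
  have cG i : nrm_cvg (fun k => partial i (u k i)) (G i [:: i]).
    by have [_ _ _ h] := hG i; exact: (h [:: i]).
  have hui i k : L2f (partial i (u k i)) := test_L2f (test_partial i (tu k i)).
  have cS := nrm_cvg_sum (index_enum 'I_n) hui hGi cG.
  rewrite (_ : (fun k x => _) = fk) in cS; last first.
    by apply/funext => k; apply/funext => x; exact: solve_div n2 hw (cf k) iw (if0 k).
  have ae1 := nrm_cvg_unique (fun k => test_L2f (tf k)) (L2f_sum _ hGi) hF cS fF.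
  have ae2 : {ae mu, forall x i, (wpartial Omega (unit_index i) (component U i) \_ Omega) x =
      (G i [:: i] \_ Omega) x}.
    apply: ae_forall_ord => i; rewrite compU; apply: wpartial_ae => //.
    have := test_limit_wpartial (alpha := unit_index i) (hG i) ltac:(by rewrite mdeg_unit_index).
    by rewrite mseq_unit_index.
  apply: filterS2 ae1 ae2 => x e1 e2 Ox; have xO : x \in Omega by exact/mem_set.
  have -> : f x = F x by rewrite /F patchE xO.
  rewrite -e1 /wdiv; apply: eq_bigr => i _; have := e2 i; rewrite !patchE xO; exact.
have nF : L2norm Omega f = nrm F by exact: L2normE.
have ng j : nrm (gj j) <= Hseminorm 1 Omega f.
  by rewrite -(L2normE (hgj j)); exact: L2norm_unit_index_le.
set T := C * _; have T0 : 0 <= T.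
  rewrite /T nF; apply: mulr_ge0 => //; apply: addr_ge0; apply: mulr_ge0 => //; [exact: nrm_ge0|exact: sqrtr_ge0].
apply: HseminormV_le => // i alpha a2; rewrite compU.
rewrite (L2norm_wpartial oO mO fO (test_limit_wpartial (hG i) _)); last by rewrite a2.
have [_ hGs GO Gc] := hG i.
have s2 : size (rev (mseq alpha)) = 2%N by rewrite size_rev size_mseq.
move: (rev (mseq alpha)) s2 => s s2.
have s2' : (size s <= 2)%N by rewrite s2.
(* An error [e / K] is allowed in the data, in its derivative and in the second derivative of the
   solution; [K] is the sum of their coefficients in the final bound. *)
rewrite GO//; apply/ler_addgt0Pr => e e0; pose K := C * (B1 + B2) + 1.
have K0 : 0 < K by rewrite ltr_wpDl// mulr_ge0// addr_ge0.
have e1 : 0 < e / K by rewrite divr_gt0.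
move: s s2 s2' => [//|l [//|j [|//]]] _ s2'.
have [N1 hN1] := Gc _ s2' _ e1; have [N2 hN2] := fF _ e1; have [N3 hN3] := fg j _ e1.
pose k := maxn N1 (maxn N2 N3).
have k1 : (N1 <= k)%N by exact: leq_maxl.
have k2 : (N2 <= k)%N by apply: leq_trans (leq_maxr _ _); exact: leq_maxl.
have k3 : (N3 <= k)%N by apply: leq_trans (leq_maxr _ _); exact: leq_maxr.
have hd := test_L2f (test_partial l (test_partial j (tu k i))).
have q1 := L2nrm_le_add (hGs _ s2') hd; have q1' := hN1 k k1; rewrite nrm_subC in q1'.
have q2 := le_trans (L2nrm_le_add (test_L2f (tf k)) hF) (lerD (lexx _) (hN2 k k2)).
have q3 := le_trans (L2nrm_le_add (test_L2f (test_partial j (tf k))) (hgj j)) (lerD (ng j) (hN3 k k3)).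
have q4 := est i j l _ (tf k).
apply: le_trans q1 _; apply: le_trans (lerD q4 q1') _.
rewrite /T nF; move: q2 q3; move: (nrm (fk k)) (nrm (partial j (fk k))) (nrm F) (Hseminorm 1 Omega f) => p q P Q q2 q3.
apply: (@le_trans _ _ (C * (B1 * (P + e / K) + B2 * (Q + e / K)) + e / K)).
  by rewrite lerD2r ler_wpM2l// lerD// ler_wpM2l.
have key (c b b' s s' t : R) : c * (b * (s + t) + b' * (s' + t)) + t = c * (b * s + b' * s') + t * (c * (b + b') + 1) by ring.
by rewrite key -/K divfK ?gt_eqF.
Qed.

End existence.

Theorem theorem1p2 (R : realType) (n : nat) (hn : (2 <= n)%N) :
  exists2 c : R, 0 < c &
  forall (Omega : set 'rV[R]_n) (diam rho : R) (a : 'rV[R]_n),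
    domain Omega ->
    ediam Omega = diam%:E ->
    0 < rho ->
    star_shaped Omega (eball a rho) ->
    exists CA CB : R,
      [/\ 0 < CA,
          0 < CB,
          CA <= c * (diam / rho ^+ 2) *
            (1 + (vol Omega / vol (eball a rho))
                   `^ ((n%:R - 2) / (2 * (n%:R - 1))) *
                 (ln (vol Omega / vol (eball a rho)))
                   `^ (n%:R / (2 * (n%:R - 1)))),
          CB <= c * (diam / rho) &
          forall f : 'rV[R]_n -> R,
            in_H0 1 Omega f -> in_L20 Omega f ->
            exists u : 'rV[R]_n -> 'rV[R]_n,
              [/\ in_H0V 2 Omega u,
                  {ae lebesgueV R n,
                    forall x, Omega x -> wdiv Omega u x = f x} &
                  HseminormV 2 Omega u <=
                    CA * L2norm Omega f + CB * Hseminorm 1 Omega f]].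
Proof.
have [eta heta [hom iom som]] := mollifier R n.
have [C C0 HC] := bogovskii_estimate_unif hn heta.
pose N : R := Num.sqrt (n%:R * multi_index_count R n 2).
have N0 : 0 <= N by exact: sqrtr_ge0.
(* [N] counts components and second-order multi-indices, each obeying the same bound; [+ 1] secures
   positivity. *)
pose c := N * C + 1; have c0 : 0 < c by rewrite ltr_wpDl// mulr_ge0.
exists c => // Omega D rho a domO dO rho0 star.
have [_ _ neO] := domO; have BO := star_ball neO star.
have D0 : 0 < D by apply: lt_le_trans (radius_le_ediam (Ordinal (leq_trans (ltn0Sn 1) hn)) dO rho0 BO).
pose L := loggrowth n (vol Omega / vol (eball a rho)).
have L1 : 1 <= L by rewrite /L /loggrowth lerDl mulr_ge0 ?powR_ge0.
have L0 : 0 < L by apply: lt_le_trans L1.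
have d2 : 0 < D / rho ^+ 2 by rewrite divr_gt0 ?exprn_gt0.
have d1 : 0 < D / rho by rewrite divr_gt0.
(* The constants are taken equal to their admissible upper bounds. *)
exists (c * (D / rho ^+ 2) * L), (c * (D / rho)); split=> //.
- by apply: mulr_gt0 => //; exact: mulr_gt0.
- by rewrite mulr_gt0.
move=> f H0f L20f.
have [u [uH ud ub]] := solution_exists hn C0 heta hom iom som HC domO dO rho0 star H0f L20f.
exists u; split=> //; apply: le_trans ub _; rewrite -/N -/L.
have s0 : 0 <= Hseminorm 1 Omega f by exact: sqrtr_ge0.
have := L2norm_ge0 Omega f; move: (L2norm _ _) (Hseminorm _ _ _) s0 => P Q Q0 P0.
have t0 : 0 <= D / rho ^+ 2 * L * P + D / rho * Q.
  by apply: addr_ge0; apply: mulr_ge0 => //; [apply: mulr_ge0|]; exact: ltW.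
have E : c * (D / rho ^+ 2) * L * P + c * (D / rho) * Q = c * (D / rho ^+ 2 * L * P + D / rho * Q).
  by move: (D / rho ^+ 2) (D / rho) (c) (L) => *; ring.
by rewrite E mulrA ler_wpM2r// /c lerDl.
Qed.
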